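(* Let $d\ge 1$, let $F\subset\mathbb{R}^d$ be a compact set with $\lambda_{d-1}[\partial F]<\infty$, and let $G:F\to\mathbb{R}$ be a random Gaussian field with $G\in\mathcal{C}^1(F)$ almost surely. Put $m(x)=\mathbf{E}\,G(x)$ and $\sigma^2(x)=\mathrm{Var}\,G(x)$ with $\sigma(x)\ge 0$, and suppose that (a') $\mathbf{E}\,\lambda_{d-1}\big[\{x\in F : \nabla(G/\sigma)(x)=0\}\big]<\infty$; (b') $\sigma(x)>0$ for all $x\in F$. Then, with $G^{-1}(0)=\{x\in F : G(x)=0\}$, $$\mathbf{E}\,\lambda_{d-1}[G^{-1}(0)]=\frac{1}{\sqrt{2\pi}}\int_F\exp\left\{-\frac{m^2(x)}{2\sigma^2(x)}\right\}\mathbf{E}\left\|\nabla\frac{G(x)}{\sigma(x)}\right\|\,dx .$$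
   Context: $\mathcal{C}^1(F)$ is the class of continuously differentiable real functions on $F$; $\nabla$ is the gradient and $\|\cdot\|$ the Euclidean norm. (Under the assumptions $m,\sigma\in\mathcal{C}^1(F)$.) The field need not be centered. Area: $\lambda_{d-1}$ denotes the $(d-1)$-dimensional Favard measure, defined for $A\subset\mathbb{R}^d$ by $$\lambda_{d-1}[A]=\frac{\Gamma(\frac{d+1}{2})}{2\pi^{(d-1)/2}}\int_{\mathbb{S}^{d-1}}\mu_{d-1}(ds)\int_{s^\perp}\lambda_0\big[\{y+ts : t\in\mathbb{R}\}\cap A\big]\,dy,$$ where $\mathbb{S}^{d-1}$ is the unit sphere of $\mathbb{R}^d$ with its Lebesgue (surface) measure $\mu_{d-1}$, $s^\perp$ is the linear hyperplane orthogonal to $s$ (with Lebesgue measure $dy$), and $\lambda_0[B]$ is the cardinality of a set $B$ (possibly infinite). For $d=1$, $\lambda_0$ is the cardinality. *)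

(* Defs.v *)
From HB Require Import structures.
From mathcomp Require Import all_boot all_order all_algebra.
From mathcomp Require Import all_classical all_reals all_analysis.
From mathcomp Require Import measurable_realfun.

Set Implicit Arguments.
Unset Strict Implicit.
Unset Printing Implicit Defensive.

Import Order.TTheory GRing.Theory Num.Theory.
Import numFieldNormedType.Exports.

Local Open Scope classical_set_scope.
Local Open Scope ring_scope.

(* R^n is 'rV[R]_n. Its topology is the library's (the product topology), but
   the library norm `|v| is the sup norm, whence enorm. *)
Definition dotp (R : realType) (n : nat) (u v : 'rV[R]_n) : R :=
  \sum_(i < n) u ord0 i * v ord0 i.

Definition enorm (R : realType) (n : nat) (v : 'rV[R]_n) : R :=
  Num.sqrt (dotp v v).

Section measurable_rV.
Context (R : realType) (n : nat).

Let coors : 'I_n -> 'rV[R]_n -> R := fun i v => v ord0 i.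

Let rV_set0 : g_sigma_preimage coors set0.
Proof. exact: sigma_algebra0. Qed.

Let rV_setC A : g_sigma_preimage coors A -> g_sigma_preimage coors (~` A).
Proof. exact: sigma_algebraC. Qed.

Let rV_bigcup (A : (set 'rV[R]_n)^nat) :
  (forall i, g_sigma_preimage coors (A i)) ->
  g_sigma_preimage coors (\bigcup_i (A i)).
Proof. exact: sigma_algebra_bigcup. Qed.

Definition rV_display : measure_display. Proof. exact. Qed.

(* The sigma-algebra generated by the coordinates, i.e. the Borel one. *)
HB.instance Definition _ := @isMeasurable.Build rV_display
  'rV[R]_n (g_sigma_preimage coors) rV_set0 rV_setC rV_bigcup.

End measurable_rV.

Section measurable_fun_rV.
Context (R : realType).

Lemma measurable_coord n (i : 'I_n) :
  measurable_fun [set: 'rV[R]_n] (fun v : 'rV[R]_n => v ord0 i).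
Proof.
move=> _ Y mY; rewrite setTI; apply: sub_sigma_algebra => /=.
rewrite -bigcup_seq/=; exists i => /=; first by rewrite mem_index_enum.
by exists Y => //; rewrite setTI.
Qed.

Lemma measurable_fun_rV d (T : measurableType d) n (f : T -> 'rV[R]_n) :
  (forall i, measurable_fun [set: T] (fun x => f x ord0 i)) ->
  measurable_fun [set: T] f.
Proof.
move=> mf _ A mA; rewrite setTI.
have {mA} : (g_sigma_preimage (fun (i : 'I_n) (v : 'rV[R]_n) => v ord0 i)) A
  by [].
move: A; apply: smallest_sub.
  split => /=.
  - by rewrite preimage_set0.
  - by move=> A mA; rewrite setTD preimage_setC; exact: measurableC.
  - by move=> A mA; rewrite preimage_bigcup; exact: bigcupT_measurable.
rewrite -bigcup_seq => A [i _ [B mB <-]] /=.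
by rewrite setTI; have := mf i measurableT _ mB; rewrite setTI.
Qed.

End measurable_fun_rV.

Section lebesgue_rV.
Context (R : realType).

Definition cons_rV n (p : measurableTypeR R * 'rV[R]_n) : 'rV[R]_n.+1 :=
  \row_(i < n.+1) if unlift ord0 i is Some j then p.2 ord0 j else p.1.

Definition uncons_rV n (v : 'rV[R]_n.+1) : measurableTypeR R * 'rV[R]_n :=
  (v ord0 ord0, \row_(j < n) v ord0 (lift ord0 j)).

Lemma cons_rVK n : cancel (@cons_rV n) (@uncons_rV n).
Proof.
move=> [x v]; rewrite /uncons_rV /cons_rV mxE unlift_none /=; congr pair.
by apply/rowP => j; rewrite !mxE liftK.
Qed.

Lemma measurable_cons_rV n : measurable_fun setT (@cons_rV n).
Proof.
apply: measurable_fun_rV => i; rewrite /cons_rV.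
under eq_fun do rewrite mxE.
case: (unlift ord0 i) => [j|]; last exact: measurable_fst.
exact: (measurableT_comp (measurable_coord j) measurable_snd).
Qed.

Lemma measurable_uncons_rV n : measurable_fun setT (@uncons_rV n).
Proof.
apply/measurable_fun_pairP; split; first exact: (measurable_coord ord0).
apply: measurable_fun_rV => j /=.
by under eq_fun do rewrite mxE; exact: measurable_coord.
Qed.

Section step.
Context (n : nat) (mu : {sigma_finite_measure set 'rV[R]_n -> \bar R}).

Definition lebesgue_rV_step : set 'rV[R]_n.+1 -> \bar R :=
  pushforward (lebesgue_measure \x mu)%E (@cons_rV n).

Let push : {measure set 'rV[R]_n.+1 -> \bar R} :=
  measure_function_pushforward__canonical__measure_function_Measure
    (lebesgue_measure \x mu)%E (@measurable_cons_rV n).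

Let step0 : lebesgue_rV_step set0 = 0%E.
Proof. exact: (measure0 push). Qed.

Let step_ge0 A : (0 <= lebesgue_rV_step A)%E.
Proof. exact: (measure_ge0 push). Qed.

Let step_sigma_additive : semi_sigma_additive lebesgue_rV_step.
Proof. exact: (@measure_semi_sigma_additive _ _ _ push). Qed.

HB.instance Definition _ := isMeasure.Build _ _ _ lebesgue_rV_step
  step0 step_ge0 step_sigma_additive.

Let step_sigma_finite : sigma_finite setT lebesgue_rV_step.
Proof.
have /sigma_finiteP[A [AT ndA Afin]] :=
  @sigma_finiteT _ _ _ (@lebesgue_measure R).
have /sigma_finiteP[B [BT ndB Bfin]] := sigma_finiteT mu.
exists (fun k => @uncons_rV n @^-1` (A k `*` B k)).
  rewrite -preimage_bigcup (_ : \bigcup_k _ = setT) ?preimage_setT//.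
  apply/seteqP; split => // -[x v] _.
  have [i _ Aix] : (\bigcup_i A i) x by rewrite -AT.
  have [j _ Bjv] : (\bigcup_i B i) v by rewrite -BT.
  exists (maxn i j) => //; split => /=.
    by move: x Aix; exact/subsetPset/ndA/leq_maxl.
  by move: v Bjv; exact/subsetPset/ndB/leq_maxr.
move=> k; have [mA Ak] := Afin k; have [mB Bk] := Bfin k; split.
  rewrite -[X in measurable X]setTI; apply: measurable_uncons_rV => //.
  exact: measurableX.
rewrite /lebesgue_rV_step /pushforward.
rewrite (_ : _ @^-1` _ = A k `*` B k).
  rewrite product_measure1E// lte_mul_pinfty//.
  by rewrite ge0_fin_numE.
by rewrite -comp_preimage (_ : _ \o _ = id) //; apply/funext/cons_rVK.
Qed.

HB.instance Definition _ := Measure_isSigmaFinite.Build _ _ _ lebesgue_rV_step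
  step_sigma_finite.

End step.

(* Lebesgue measure on R^n, as an iterated product; on the one-point space R^0
   it is the unit mass. *)
Fixpoint lebesgue_rV (n : nat) : {sigma_finite_measure set 'rV[R]_n -> \bar R} :=
  if n is m.+1 then @lebesgue_rV_step m (lebesgue_rV m)
  else \d_(0 : 'rV[R]_0).

End lebesgue_rV.
Arguments lebesgue_rV R n : clear implicits.

Section surface_measure.
Context (R : realType) (n : nat).

Definition sphere : set 'rV[R]_n := [set s | enorm s = 1].

Definition enormalize (v : 'rV[R]_n) : 'rV[R]_n := (enorm v)^-1 *: v.

Lemma measurable_enorm : measurable_fun [set: 'rV[R]_n] (@enorm R n).
Proof.
apply: (measurableT_comp (f := @Num.sqrt R)).
  exact: (continuous_measurable_fun (@sqrt_continuous R)).
apply: measurable_sum => i.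
by apply: measurable_funM; exact: measurable_coord.
Qed.

Lemma measurable_enormalize : measurable_fun setT enormalize.
Proof.
apply: measurable_fun_rV => i; rewrite /enormalize.
under eq_fun do rewrite mxE.
apply: measurable_funM; last exact: measurable_coord.
rewrite (_ : (fun _ => _) = (@powR R ^~ (-1)) \o @enorm R n).
  by apply: measurableT_comp; [exact: measurable_powR|exact: measurable_enorm].
by apply/funext => v /=; rewrite powR_inv1// sqrtr_ge0.
Qed.

Definition unit_ball : set 'rV[R]_n := [set v | enorm v <= 1].

Lemma measurable_unit_ball : measurable unit_ball.
Proof.
have := measurable_enorm measurableT (@measurable_itv R `]-oo, 1]).
by rewrite setTI.
Qed.

(* Surface measure of the unit sphere of R^n, in the cone form
     surface_measure B = n * Leb {r s : 0 < r <= 1, s in B}   (n >= 1),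
   so that dx = r^(n-1) dr ds. For n = 1 it is the counting measure of
   {-1, 1}. The origin, which enormalize sends to itself, is negligible. *)
Definition surface_measure : {measure set 'rV[R]_n -> \bar R} :=
  mscale (n%:R%:nng : {nonneg R})
    (measure_function_pushforward__canonical__measure_function_Measure
      (mrestr (lebesgue_rV R n) measurable_unit_ball) measurable_enormalize).

End surface_measure.
Arguments sphere {R n}.
Arguments surface_measure R n : clear implicits.

Section favard.
Context (R : realType) (n : nat).

Definition hyperplane (s : 'rV[R]_n.+1) : set 'rV[R]_n.+1 :=
  [set y | dotp y s = 0].

(* The rows of Q are an orthonormal basis of the hyperplane. *)
Definition is_frame (s : 'rV[R]_n.+1) (Q : 'M[R]_(n, n.+1)) : Prop :=
  Q *m Q^T = 1%:M /\ Q *m s^T = 0.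

Definition frame (s : 'rV[R]_n.+1) : 'M[R]_(n, n.+1) := xget 0 (is_frame s).

Lemma measurable_mulmx_frame (s : 'rV[R]_n.+1) :
  measurable_fun setT (fun v : 'rV[R]_n => v *m frame s).
Proof.
apply: measurable_fun_rV => i; under eq_fun do rewrite mxE.
apply: measurable_sum => j.
by apply: measurable_funM; [exact: measurable_coord|exact: measurable_cst].
Qed.

(* Lebesgue measure on the hyperplane, transported from R^n by the isometry
   v |-> v *m frame s; it does not depend on the frame chosen. *)
Definition lebesgue_hyperplane (s : 'rV[R]_n.+1) :
    {measure set 'rV[R]_n.+1 -> \bar R} :=
  measure_function_pushforward__canonical__measure_function_Measure
    (lebesgue_rV R n) (measurable_mulmx_frame s).

Definition line (y s : 'rV[R]_n.+1) : set 'rV[R]_n.+1 :=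
  [set y + t *: s | t in [set: R]].

Definition Gamma (x : R) : R :=
  \int[lebesgue_measure]_(t in `]0%R, +oo[) (t `^ (x - 1) * expR (- t)).

(* The dimension of the ambient space is d = n.+1. *)
Definition favard_cst : R :=
  Gamma (n.+2%:R / 2) / (2 * pi `^ (n%:R / 2)).

Definition favard (A : set 'rV[R]_n.+1) : \bar R :=
  if n == 0%N then counting A
  else (favard_cst%:E * \int[surface_measure R n.+1]_(s in sphere)
          \int[lebesgue_hyperplane s]_(y in hyperplane s)
            counting (line y s `&` A))%E.

End favard.

Section C1.
Context (R : realType) (n : nat).

Definition boundary (A : set 'rV[R]_n.+1) : set 'rV[R]_n.+1 :=
  closure A `\` A°.

Definition grad (f : 'rV[R]_n.+1 -> R) (x : 'rV[R]_n.+1) : 'rV[R]_n.+1 :=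
  \row_(i < n.+1) 'D_(delta_mx ord0 i) (f : 'rV[R]_n.+1 -> R^o) x.

(* For a compact F: f is continuous on F, differentiable in the interior of F,
   and its gradient there extends to a continuous map on F. The values of f
   off F are irrelevant. *)
Definition C1_on (F : set 'rV[R]_n.+1) (f : 'rV[R]_n.+1 -> R) : Prop :=
  [/\ {within F, continuous f},
      forall x, F° x -> differentiable (f : 'rV[R]_n.+1 -> R^o) x &
      exists g : 'rV[R]_n.+1 -> 'rV[R]_n.+1,
        {within F, continuous g} /\ forall x, F° x -> g x = grad f x].

(* The gradient on F: the usual one in the interior, its limit from the
   interior at boundary points. *)
Definition grad_on (F : set 'rV[R]_n.+1) (f : 'rV[R]_n.+1 -> R)
    (x : 'rV[R]_n.+1) : 'rV[R]_n.+1 :=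
  if `[< F° x >] then grad f x else lim (grad f @ within F° (nbhs x)).

End C1.

Section gaussian.
Context d (T : measurableType d) (R : realType) (P : probability T R).

(* normal_prob m s is the normal law of standard deviation s only for s != 0,
   so that the degenerate normal laws are listed apart. *)
Definition gaussian_rv (X : T -> R) : Prop :=
  measurable_fun setT X /\
  exists (m s : R), 0 <= s /\
    forall A : set R, measurable A ->
      P (X @^-1` A) = if s == 0 then \d_m A else normal_prob m s A.

(* All finite-dimensional marginals over F are (possibly degenerate)
   multivariate normal, i.e. all linear combinations are normal. *)
Definition gaussian_field (I : Type) (F : set I) (G : T -> I -> R) : Prop :=
  forall (k : nat) (x : 'I_k -> I) (a : 'I_k -> R),
    (forall i, F (x i)) ->
    gaussian_rv (fun w => \sum_(i < k) a i * G w (x i)).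

Definition field_mean (I : Type) (G : T -> I -> R) (x : I) : R :=
  fine ('E_P[fun w => G w x])%E.

Definition field_sd (I : Type) (G : T -> I -> R) (x : I) : R :=
  Num.sqrt (fine ('V_P[fun w => G w x])%E).

End gaussian.

(* Main.v *)
(* The Favard measure of a set is a constant times the average, over directions
   [s] and over base points [x] in the slab [0 <= <x, s> < 1], of the number of
   points of the set on the line [x + R s]; so everything reduces to lines.

   On a line, let [X = G / sigma], of unit variance. Then [(X_t + X_{t+h}) / 2]
   and [(X_{t+h} - X_t) / h] are uncorrelated, hence independent, and a sign
   change of [X] between [t] and [t + h] is the event that the first one is
   smaller in absolute value than [h / 2] times the second. Its probability is
   therefore equivalent to [h phi(E X_t) E |X'_t|], with [phi] the standard
   normal density, and is dominated by a multiple of [h]. On the other hand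
   [1/h] times the Lebesgue measure of the [t] with a sign change between [t]
   and [t + h] never exceeds the number of zeros, and converges to it when
   there is no zero with zero derivative, which is almost sure by a small ball
   estimate. Dominated convergence gives the one-dimensional formula.

   Almost every line meets the boundary of [F] in finitely many points, at each
   of which [G] is almost surely nonzero, so that [F] may be replaced by its
   interior. By translation invariance, integrating a function along the lines
   through the points of a slab amounts to integrating it over the whole space,
   so what remains is the average over [s] of [|<v, s>|] with [v = grad X], and
   the Favard constant makes it [enorm v]. *)
From HB Require Import structures.
From mathcomp Require Import all_boot all_order all_algebra.
From mathcomp Require Import finmap.
From mathcomp Require Import all_classical all_reals all_analysis.
From mathcomp Require Import measurable_realfun.
From mathcomp Require Import ring lra.
Require Import Defs.

Set Implicit Arguments.
Unset Strict Implicit.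
Unset Printing Implicit Defensive.

Import Order.TTheory GRing.Theory Num.Theory.
Import numFieldNormedType.Exports.

Local Open Scope classical_set_scope.
Local Open Scope ring_scope.

(** * Integration and counting on the line *)

(** Two obstacles shape the details. The paths are smooth only off a null set, so the zero count of
    the given field need not be measurable; since the integral of a nonnegative function is a
    supremum over simple functions, it does not see a measurable null set, and the field is replaced
    by one all of whose paths are smooth. Moreover nothing is assumed on the joint law of the field
    and its gradient, nor on the smoothness of [sigma]. Both come from one fact: pointwise limits of
    Gaussian variables are limits in [L^2], because a normal law that gives mass 3/4 to [[-c, c]]
    has second moment at most [20 c^2]. This makes the variance differentiable along lines, and
    turns bounds that hold path by path into the uniform mean square bounds that the domination
    needs. Independence of uncorrelated variables, rotation invariance of Lebesgue measure and the
    Favard constant rest on Tonelli's theorem for nonnegative integrands, rather than on Fourier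
    inversion, determinants or polar coordinates. *)

Section nonmeasurable_integrand.
Context d (T : measurableType d) (R : realType).
Variable mu : {measure set T -> \bar R}.
Local Open Scope ereal_scope.
Import HBNNSimple.

(* The integral of a nonnegative function is the supremum of the integrals of
   the simple functions below it, so that no measurability is needed here. *)
Lemma le_integral_off_null (N : set T) (f g : T -> \bar R) :
  measurable N -> mu N = 0 -> (forall x, 0 <= f x) -> (forall x, 0 <= g x) ->
  (forall x, ~ N x -> f x <= g x) ->
  \int[mu]_x f x <= \int[mu]_x g x.
Proof.
move=> mN N0 f0 g0 fg; rewrite ge0_integralTE// [leRHS]ge0_integralTE//.
apply: ge_ereal_sup => _ /= [h hf <-].
apply: ereal_sup_ubound => /=; exists (proj_nnsfun h (measurableC mN)).
  move=> x; rewrite [X in X%:E <= _](_ : _ = h x * \1_(~` N) x)%R// indicE.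
  case: (boolP (x \in ~` N)) => [|].
    by rewrite inE /= mulr1 => Nx; exact: (le_trans (hf x) (fg _ Nx)).
  by rewrite mulr0 g0.
rewrite -!integralT_nnsfun; apply: ge0_ae_eq_integral => //.
- by apply/measurable_EFinP.
- by apply/measurable_EFinP.
- by move=> x _; rewrite lee_fin.
- by move=> x _; rewrite lee_fin.
exists N; split => // x /=; apply: contra_notP => Nx _.
by rewrite [RHS](_ : _ = (h x * \1_(~` N) x)%:E)// indicE mem_set// mulr1.
Qed.

Lemma eq_integral_off_null (N : set T) (f g : T -> \bar R) :
  measurable N -> mu N = 0 -> (forall x, 0 <= f x) -> (forall x, 0 <= g x) ->
  (forall x, ~ N x -> f x = g x) ->
  \int[mu]_x f x = \int[mu]_x g x.
Proof.
by move=> mN N0 f0 g0 fg; apply/eqP; rewrite eq_le;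
  apply/andP; split; apply: (le_integral_off_null mN N0) => // x /fg ->.
Qed.

End nonmeasurable_integrand.

Section lebesgue_line.
Context (R : realType).
Local Notation leb := (@lebesgue_measure R).
Local Open Scope ereal_scope.

(** The translated measure gives every half-open interval its length, hence is Lebesgue measure by
    uniqueness. *)
Lemma integral_lebesgue_shift (f : R -> \bar R) (a : R) :
  measurable_fun [set: measurableTypeR R] f -> (forall x, 0 <= f x) ->
  \int[leb]_x f (x + a)%R = \int[leb]_x f x.
Proof.
move=> mf f0.
have ms : measurable_fun [set: measurableTypeR R]
    (fun x => (x + a)%R : measurableTypeR R).
  by apply: measurable_funD => //; exact: measurable_cst.
transitivity (\int[pushforward leb (fun x => (x + a)%R : measurableTypeR R)]_x f x).
  by rewrite (ge0_integral_pushforward ms)// preimage_setT.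
apply: eq_measure_integral => A mA _; apply/esym.
apply: (@lebesgue_measure_unique R
  (measure_function_pushforward__canonical__measure_function_Measure leb ms)) => //.
move=> _ [[x y] /= _ <-].
rewrite /= /pushforward (_ : _ @^-1` _ = `]x - a, y - a]%classic)%R; last first.
  by apply/seteqP; split => z /=; rewrite !in_itv/= ltrBlDr lerBrDr.
rewrite !lebesgue_measure_itv/= !lte_fin ltrD2r.
by case: ifPn => // _; rewrite -!EFinB; congr EFin; ring.
Qed.

Lemma integral_lebesgue_scale (f : R -> \bar R) (a : R) : (0 < a)%R ->
  measurable_fun [set: measurableTypeR R] f -> (forall x, 0 <= f x) ->
  \int[leb]_x f (a * x)%R = (a^-1)%:E * \int[leb]_x f x.
Proof.
move=> a0 mf f0.
have ms : measurable_fun [set: measurableTypeR R]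
    (fun x => (a * x)%R : measurableTypeR R).
  by apply: measurable_funM => //; exact: measurable_cst.
have a0' : (0 <= a)%R by exact: ltW.
transitivity (\int[pushforward leb (fun x => (a * x)%R : measurableTypeR R)]_x f x).
  by rewrite (ge0_integral_pushforward ms)// preimage_setT.
have k : (0 <= a^-1)%R by rewrite invr_ge0.
rewrite -[X in X%:E * _]/((NngNum k)%:num) -(@ge0_integral_mscale _ _ _ leb setT _ (NngNum k))//.
apply: eq_measure_integral => A mA _; rewrite /= /mscale /=.
(* The preimage of an interval under [x -> a * x] is shorter by the factor [a], so [a] times the
   pushforward is Lebesgue measure by uniqueness. *)
transitivity ((a^-1)%:E * (a%:E * (pushforward leb (fun x => (a * x)%R : measurableTypeR R)) A)).
  by rewrite muleA -EFinM mulVf ?mul1e// gt_eqF.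
congr (_ * _); apply/esym.
apply: (@lebesgue_measure_unique R (mscale (NngNum a0')
  (measure_function_pushforward__canonical__measure_function_Measure leb ms))) => //.
move=> _ [[x y] /= _ <-].
rewrite /= /mscale/= /pushforward (_ : _ @^-1` _ = `](x / a)%R, (y / a)%R]%classic); last first.
  by apply/seteqP; split => z /=; rewrite !in_itv/= ltr_pdivrMr// ler_pdivlMr// ![(z * a)%R]mulrC.
rewrite !lebesgue_measure_itv/= !lte_fin ltr_pM2r ?invr_gt0//.
case: ifPn => // _; rewrite ?mule0// -!EFinB -EFinM; congr EFin.
by rewrite -mulrBl mulrCA divff ?mulr1// gt_eqF.
Qed.

End lebesgue_line.

(** * Counting points through the length of shrinking windows *)

Section window.
Context (R : realType).
Local Notation leb := (@lebesgue_measure R).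
Local Open Scope ereal_scope.

Lemma counting_fset (S : {fset R}) : counting [set` S] = (#|` S|%:R)%:E :> \bar R.
Proof. by rewrite /counting asboolT// set_fsetK. Qed.

Lemma leb_bigsetU_le (I : Type) (s : seq I) (F : I -> set R) :
  (forall i, measurable (F i : set (measurableTypeR R))) ->
  leb (\big[setU/set0]_(i <- s) F i) <= \sum_(i <- s) leb (F i).
Proof.
move=> mF; elim: s => [|z s IH]; first by rewrite !big_nil measure0.
rewrite !big_cons; apply: le_trans (leeD2l _ IH).
by apply: measureU2 => //; exact: bigsetU_measurable.
Qed.

Lemma leb_window_le (S : {fset R}) (h : R) (E : set R) : (0 <= h)%R ->
  measurable (E : set (measurableTypeR R)) ->
  (E `<=` [set t | exists2 z, z \in S & (t <= z <= t + h)%R]) ->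
  leb E <= (h * #|` S|%:R)%:E.
Proof.
move=> h0 mE sub.
apply: (@le_trans _ _ (leb (\big[setU/set0]_(z <- S) [set` `[z - h, z]%R]))).
  apply: le_measure; rewrite ?inE//.
    by apply: bigsetU_measurable => z _; exact: measurable_itv.
  move=> t /sub[z zS /andP[tz zt]].
  rewrite -bigcup_seq; exists z => //=; rewrite in_itv/= tz andbT.
  by rewrite lerBlDr.
apply: (@le_trans _ _ (\sum_(z <- S) leb [set` `[z - h, z]%R])).
  by apply: leb_bigsetU_le => z; exact: measurable_itv.
rewrite (eq_bigr (fun=> h%:E)); last first.
  move=> z _; rewrite lebesgue_measure_itv/= lte_fin.
  case: ifPn => [_|]; first by rewrite -EFinB; congr EFin; ring.
  by rewrite ltrBlDr ltrDl -leNgt => h0'; congr EFin; apply/eqP; rewrite eq_le h0 h0'.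
by rewrite sumEFin big_const_seq iter_addr addr0 count_predT mulr_natr.
Qed.

Lemma leb_disjoint_windows (s : seq R) (h : R) : (0 <= h)%R -> uniq s ->
  (forall z z', z \in s -> z' \in s -> z != z' -> (h < `|z - z'|)%R) ->
  leb (\big[setU/set0]_(z <- s) [set` `]z - h, z[%R]) = (h * (size s)%:R)%:E.
Proof.
move=> h0; elim: s => [|z s IH]; first by rewrite big_nil measure0 mulr0.
move=> /= /andP[zs us] sep; rewrite big_cons.
transitivity (leb [set` `]z - h, z[%R] +
    leb (\big[setU/set0]_(z <- s) [set` `]z - h, z[%R])).
  apply: measureU => //; first by apply: bigsetU_measurable => y _; exact: measurable_itv.
  rewrite -subset0 => t [] /=; rewrite -bigcup_seq in_itv/= => /andP[t1 t2] [y /= ys].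
  rewrite in_itv/= => /andP[t3 t4].
  have /sep : z \in z :: s by rewrite mem_head.
  have ys' : y \in z :: s by rewrite in_cons ys orbT.
  move=> /(_ _ ys'); have zy : z != y by apply: contraNneq zs => ->.
  by move=> /(_ zy); rewrite ltNge => /negP; apply; rewrite ler_norml; lra.
rewrite IH//; last first.
  by move=> y y' ys ys'; apply: sep; rewrite in_cons ?ys ?ys' orbT.
rewrite lebesgue_measure_itv/= lte_fin.
rewrite (_ : (if _ then _ else _) = h%:E).
  by rewrite -EFinD -natr1 mulrDr mulr1 addrC.
case: ifPn => [_|]; first by rewrite -EFinB; congr EFin; ring.
by rewrite ltrBlDr ltrDl -leNgt => h0'; congr EFin; apply/eqP; rewrite eq_le h0 h0'.
Qed.

Lemma near_all_seq (T : eqType) (s : seq T) (Q : T -> nat -> Prop) :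
  (forall x, x \in s -> \forall k \near \oo, Q x k) ->
  \forall k \near \oo, forall x, x \in s -> Q x k.
Proof.
elim: s => [|x s IH] H; first by near=> k.
have H1 := H x (mem_head _ _).
have H2 : \forall k \near \oo, forall y, y \in s -> Q y k.
  by apply: IH => y ys; apply: H; rewrite in_cons ys orbT.
near=> k => y; rewrite in_cons => /orP[/eqP ->|ys]; first by near: k.
by move: y ys; near: k.
Unshelve. all: by end_near. Qed.

Variables (Z : set R) (E : nat -> set R).
Hypothesis mE : forall k, measurable (E k : set (measurableTypeR R)).
Hypothesis E_near_Z : forall k t, E k t ->
  exists2 z, Z z & (t <= z <= t + k.+1%:R^-1)%R.

(** [E k] is covered by the intervals [[z - 1/(k+1), z]], one for each point [z] of [Z]; the bound
    thus holds for every [k], not only in the limit. *)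
Lemma window_le_counting k : k.+1%:R%:E * leb (E k) <= counting Z.
Proof.
have [finZ|infZ] := pselect (finite_set Z); last first.
  by rewrite /counting asboolF// leey.
rewrite -(fset_setK finZ) counting_fset.
have /le_trans -> // : k.+1%:R%:E * leb (E k) <= k.+1%:R%:E * (k.+1%:R^-1 * #|` fset_set Z|%:R)%:E.
  rewrite lee_pmul2l// ?lte_fin//; apply: leb_window_le => //.
  by move=> t /E_near_Z[z Zz tz]; exists z => //; rewrite in_fset_set// inE.
by rewrite -EFinM mulrA divff// mul1r.
Qed.

Hypothesis windows_in_E : forall z, Z z ->
  \forall k \near \oo, ([set` `]z - k.+1%:R^-1, z[%R] `<=` E k).

(** Once [1/(k+1)] is below all gaps between points of [s], the intervals to their left are
    disjoint, and eventually they lie in [E k]. *)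
Lemma card_le_window (s : seq R) : uniq s -> (forall z, z \in s -> Z z) ->
  \forall k \near \oo, ((size s)%:R)%:E <= k.+1%:R%:E * leb (E k).
Proof.
move=> us sZ.
have H1 : \forall k \near \oo, forall z, z \in s -> ([set` `]z - k.+1%:R^-1, z[%R] `<=` E k).
  by apply: near_all_seq => z /sZ; exact: windows_in_E.
have H2 : \forall k \near \oo, forall z, z \in s -> forall z', z' \in s -> z != z' ->
    (k.+1%:R^-1 < `|z - z'|)%R.
  apply: near_all_seq => z zs; apply: near_all_seq => z' zs'.
  have [->|zz'] := eqVneq z z'; first by near=> k.
  have e0 : (0 < `|z - z'|)%R by rewrite normr_gt0 subr_eq0.
  near=> k => _; near: k; exact: (near_infty_natSinv_lt (PosNum e0)).
near=> k.
have -> : (size s)%:R%:E = k.+1%:R%:E * (k.+1%:R^-1 * (size s)%:R)%:E :> \bar R.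
  by rewrite -EFinM mulrA divff// mul1r.
rewrite lee_pmul2l// ?lte_fin// -(leb_disjoint_windows _ us)//; last first.
  by move=> z z' zs zs'; move: z zs z' zs'; near: k.
apply: le_measure; rewrite ?inE//.
  by apply: bigsetU_measurable => z _; exact: measurable_itv.
rewrite -bigcup_seq; apply: bigcup_sub => z /=; move: z; near: k; exact: H1.
Unshelve. all: by end_near. Qed.

(** For finite [Z] the two bounds agree from some [k] on; for infinite [Z] the lower bound applies
    to finite subsets of any size. This serves twice: for sign changes along a path, and for the
    measurability of the number of zeros on a line. *)
Lemma window_cvg_counting :
  (fun k => k.+1%:R%:E * leb (E k)) @ \oo --> (counting Z : \bar R).
Proof.
have [finZ|infZ] := pselect (finite_set Z).
  have eZ : counting Z = (#|` fset_set Z|%:R)%:E :> \bar R.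
    by rewrite -{1}(fset_setK finZ) counting_fset.
  apply: cvg_near_cst; rewrite eZ.
  have := @card_le_window (fset_set Z) (fset_uniq _).
  have sZ : forall z, z \in enum_fset (fset_set Z) -> Z z.
    by move=> z zs; move: (zs : z \in fset_set Z); rewrite in_fset_set// inE.
  move=> /(_ sZ) H; near=> k.
  apply/eqP; rewrite eq_le -{1}eZ window_le_counting/=.
  by near: k; exact: H.
rewrite /counting asboolF//; apply/cvgeyPge => M.
have [S SZ cS] := infinite_set_fset (Num.truncn M).+1 infZ.
have := @card_le_window S (fset_uniq _) (fun z zS => SZ _ zS).
apply: filterS => k; apply: le_trans; rewrite lee_fin.
apply: (@le_trans _ _ ((Num.truncn M).+1%:R)); first exact/ltW/truncnS_gt.
by rewrite ler_nat.
Unshelve. all: by end_near. Qed.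

End window.

(** * Lebesgue measure on row vectors *)

Section rV_topology.
Context (R : realType) (n : nat).
Implicit Types (v x : 'rV[R]_n) (C : set 'rV[R]_n).

Lemma coord_le_norm v i : `|v ord0 i| <= `|v|.
Proof.
rewrite [leRHS]mx_normrE.
by apply: (le_trans _ (@le_bigmax _ _ _ 0 (fun ij => `|v ij.1 ij.2|) (ord0, i))).
Qed.

Lemma norm_lt_coord v e : 0 < e -> (forall i, `|v ord0 i| < e) -> `|v| < e.
Proof.
move=> e0 ve; rewrite [ltLHS]mx_normrE; apply/bigmax_ltP; split => // -[i j] _ /=.
by rewrite ord1.
Qed.

(** To each rational vector and each [m] one attaches a point of [C] within [1/(m+1)] of the vector
    if there is one, and [c] otherwise; [pickle] enumerates the pairs. *)
Lemma dense_seq C : C !=set0 -> exists q : nat -> 'rV[R]_n,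
  (forall j, C (q j)) /\ (forall x e, C x -> 0 < e -> exists j, `|x - q j| < e).
Proof.
move=> [c Cc].
pose Q (rm : 'rV[rat]_n * nat) y := C y /\ `|y - map_mx ratr rm.1| < rm.2.+1%:R^-1.
pose q k := if choice.unpickle k is Some rm then xget c (Q rm) else c.
exists q; split => [j|x e Cx e0].
  rewrite /q; case: (choice.unpickle j) => // rm.
  by case: xgetP => // y -> [].
have [m me] : exists m, m.+1%:R^-1 < e / 2.
  have e2 : 0 < e / 2 by rewrite divr_gt0.
  have [m _ /(_ m (leqnn m))/= H] := near_infty_natSinv_lt (PosNum e2).
  by exists m.
have m0 : 0 < m.+1%:R^-1 :> R by rewrite invr_gt0.
have /choice[r rP] : forall i, exists r : rat, `|x ord0 i - ratr r| < m.+1%:R^-1.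
  move=> i; have /rat_in_itvoo[r] : x ord0 i - m.+1%:R^-1 < x ord0 i by rewrite ltrBlDr ltrDl.
  rewrite in_itv/= => /andP[r1 r2]; exists r.
  by rewrite gtr0_norm ?subr_gt0// ltrBlDr -ltrBlDl.
exists (choice.pickle (\row_i r i, m)); rewrite /q choice.pickleK.
have Qx : Q (\row_i r i, m) x.
  split => //=; apply: norm_lt_coord => // i; rewrite !mxE; exact: rP.
have [_ H] := xgetPex c (ex_intro _ x Qx).
have [_ H'] := Qx.
rewrite -(subrKA (map_mx ratr (\row_i r i))); apply: le_lt_trans (ler_normD _ _) _.
rewrite [ltRHS](splitr e) ltrD//; first exact: lt_trans me.
by rewrite distrC; exact: lt_trans me.
Qed.

Lemma measurable_normrV : measurable_fun [set: 'rV[R]_n] (fun v => `|v|).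
Proof.
rewrite (_ : (fun v => _) = fun v => \big[Num.max/0]_ij `|v ij.1 ij.2|); last first.
  by apply/funext => v; rewrite [LHS]mx_normrE.
elim: (index_enum _) => [|[i j] s IH].
  by under eq_fun do rewrite big_nil; exact: measurable_cst.
under eq_fun do rewrite big_cons.
apply: measurable_maxr => //=.
rewrite ord1; apply: measurableT_comp => //; exact: measurable_coord.
Qed.

Lemma measurable_addrV (a : 'rV[R]_n) :
  measurable_fun setT (fun x : 'rV[R]_n => x + a).
Proof.
apply: measurable_fun_rV => i; under eq_fun do rewrite mxE.
by apply: measurable_funD; [exact: measurable_coord|exact: measurable_cst].
Qed.

Lemma measurable_distrV (a : 'rV[R]_n) :
  measurable_fun [set: 'rV[R]_n] (fun x => `|x - a|).
Proof. exact: (measurableT_comp measurable_normrV (measurable_addrV (- a))). Qed.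

(** The sigma-algebra is generated by the coordinates, so the topology enters through separability:
    a closed set is the intersection over [k] of the unions of the balls of radius [1/(k+1)] about a
    dense sequence of its points. *)
Lemma closed_measurable_rV C : closed C -> measurable C.
Proof.
move=> cC; have [->|/set0P/dense_seq[q [Cq dq]]] := eqVneq C set0; first by [].
have -> : C = \bigcap_k \bigcup_j [set x | `|x - q j| < k.+1%:R^-1].
  apply/seteqP; split => [x Cx k _|x Hx].
    have [j xj] := dq x k.+1%:R^-1 Cx ltac:(by rewrite invr_gt0).
    by exists j.
  apply: cC => U /nbhs_ballP[e /= e0 eU].
  have [m _ /(_ m (leqnn m))/= me] := near_infty_natSinv_lt (PosNum e0).
  have [j _ /= xj] := Hx m I.
  exists (q j); split => //; apply: eU; rewrite -ball_normE/=.
  exact: lt_trans me.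
apply: bigcapT_measurable => k; apply: bigcupT_measurable => j.
have := measurable_distrV (q j) measurableT (@measurable_itv R `]-oo, k.+1%:R^-1[).
by rewrite setTI set_itvE.
Qed.

Lemma open_measurable_rV C : open C -> measurable C.
Proof.
move=> oC; rewrite -(setCK C); apply: measurableC; apply: closed_measurable_rV.
exact: open_closedC.
Qed.

End rV_topology.

Section lebesgue_rV_integral.
Context (R : realType).
Local Notation leb := (@lebesgue_measure R).
Local Notation lebn := (lebesgue_rV R).
Local Open Scope ereal_scope.

Lemma integral_lebesgue_rVS n (f : 'rV[R]_n.+1 -> \bar R) :
  measurable_fun setT f -> (forall x, 0 <= f x) ->
  \int[lebn n.+1]_x f x = \int[leb]_t \int[lebn n]_v f (cons_rV (t, v)).
Proof.
move=> mf f0.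
transitivity (\int[pushforward (leb \x lebn n) (@cons_rV R n)]_x f x).
  by [].
rewrite (ge0_integral_pushforward (@measurable_cons_rV R n))// preimage_setT.
rewrite fubini_tonelli1//=.
exact: measurableT_comp (@measurable_cons_rV R n).
Qed.

Lemma measurable_cons_rV_snd n (t : R) :
  measurable_fun setT (fun v : 'rV[R]_n => cons_rV (t : measurableTypeR R, v)).
Proof. exact: measurableT_comp (@measurable_cons_rV R n) (@measurable_pair1 _ _ _ _ t). Qed.

Lemma measurable_int_cons n (f : 'rV[R]_n.+1 -> \bar R) :
  measurable_fun setT f -> (forall x, 0 <= f x) ->
  measurable_fun [set: measurableTypeR R] (fun t => \int[lebn n]_v f (cons_rV (t, v))).
Proof.
move=> mf f0; apply: (measurable_fun_fubini_tonelli_F (fun tv => f (cons_rV tv))) => //.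
exact: measurableT_comp (@measurable_cons_rV R n).
Qed.

Lemma cons_rVD n (t u : R) (v w : 'rV[R]_n) :
  (cons_rV (t : measurableTypeR R, v) + cons_rV (u : measurableTypeR R, w))%R =
  cons_rV ((t + u)%R : measurableTypeR R, (v + w)%R).
Proof.
apply/rowP => i; rewrite !mxE; case: (unlift ord0 i) => [j|] //=.
by rewrite mxE.
Qed.

Lemma cons_rVZ n (a t : R) (v : 'rV[R]_n) :
  (a *: cons_rV (t : measurableTypeR R, v))%R =
  cons_rV ((a * t)%R : measurableTypeR R, (a *: v)%R).
Proof.
apply/rowP => i; rewrite !mxE; case: (unlift ord0 i) => [j|] //=.
by rewrite mxE.
Qed.

Lemma uncons_rVK n : cancel (@uncons_rV R n) (@cons_rV R n).
Proof.
move=> v; apply/rowP => i; rewrite mxE; case: unliftP => [j|] -> //=.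
by rewrite mxE.
Qed.

Lemma integral_rV_shift n (f : 'rV[R]_n -> \bar R) (a : 'rV[R]_n) :
  measurable_fun setT f -> (forall x, 0 <= f x) ->
  \int[lebn n]_x f (x + a)%R = \int[lebn n]_x f x.
Proof.
elim: n f a => [|n IH] f a mf f0.
  by apply: eq_integral => x _; congr f; apply/rowP => -[].
have mfa : measurable_fun setT (fun x : 'rV[R]_n.+1 => f (x + a)%R).
  exact: measurableT_comp (measurable_addrV a).
rewrite [LHS]integral_lebesgue_rVS// [RHS]integral_lebesgue_rVS//.
rewrite -[RHS](@integral_lebesgue_shift R _ (uncons_rV a).1); last 2 first.
- exact: measurable_int_cons.
- by move=> t; exact: integral_ge0.
apply: eq_integral => t _; rewrite -[RHS](IH _ (uncons_rV a).2)//; last first.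
  exact: measurableT_comp (measurable_cons_rV_snd _).
apply: eq_integral => v _.
by rewrite -cons_rVD -surjective_pairing uncons_rVK.
Qed.

Lemma measurable_scale_rV n (a : R) :
  measurable_fun setT (fun x : 'rV[R]_n => a *: x)%R.
Proof.
apply: measurable_fun_rV => i; under eq_fun do rewrite mxE.
by apply: measurable_funM; [exact: measurable_cst|exact: measurable_coord].
Qed.

Lemma integral_rV_scale n (f : 'rV[R]_n -> \bar R) (a : R) : (0 < a)%R ->
  measurable_fun setT f -> (forall x, 0 <= f x) ->
  \int[lebn n]_x f (a *: x)%R = (a ^- n)%:E * \int[lebn n]_x f x.
Proof.
move=> a0; elim: n f => [|n IH] f mf f0.
  rewrite expr0 invr1 mul1e.
  by apply: eq_integral => x _; congr f; apply/rowP => -[].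
have mfa : measurable_fun setT (fun x : 'rV[R]_n.+1 => f (a *: x)%R).
  exact: measurableT_comp (@measurable_scale_rV _ a).
rewrite integral_lebesgue_rVS// [in RHS]integral_lebesgue_rVS//.
rewrite exprS invfM mulrC EFinM -muleA -(@integral_lebesgue_scale R _ a)//; last 2 first.
- exact: measurable_int_cons.
- by move=> t; exact: integral_ge0.
rewrite -ge0_integralZl//; last 3 first.
- have := measurable_int_cons mf f0.
  move=> /measurableT_comp; apply; apply: measurable_funM => //; exact: measurable_cst.
- by move=> t _; exact: integral_ge0.
- by rewrite lee_fin invr_ge0 exprn_ge0// ltW.
apply: eq_integral => t _; rewrite -IH//; last first.
  exact: measurableT_comp (measurable_cons_rV_snd _).
by apply: eq_integral => v _; rewrite cons_rVZ.
Qed.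

End lebesgue_rV_integral.

Section measurable_rV_ops.
Context d (T : measurableType d) (R : realType) (n : nat).
Implicit Types f g : T -> 'rV[R]_n.

Lemma measurable_rV_coord f i : measurable_fun setT f ->
  measurable_fun setT (fun x => f x ord0 i).
Proof. by move=> mf; exact: measurableT_comp (measurable_coord i) mf. Qed.

Lemma measurable_rVD f g : measurable_fun setT f -> measurable_fun setT g ->
  measurable_fun setT (fun x => f x + g x).
Proof.
move=> mf mg; apply: measurable_fun_rV => i; under eq_fun do rewrite mxE.
by apply: measurable_funD; exact: measurable_rV_coord.
Qed.

Lemma measurable_rVZ (a : T -> R) f : measurable_fun setT a ->
  measurable_fun setT f -> measurable_fun setT (fun x => a x *: f x).
Proof.
move=> ma mf; apply: measurable_fun_rV => i; under eq_fun do rewrite mxE.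
by apply: measurable_funM => //; exact: measurable_rV_coord.
Qed.

Lemma measurable_rVM m (Q : 'M[R]_(n, m)) f : measurable_fun setT f ->
  measurable_fun setT (fun x => f x *m Q).
Proof.
move=> mf; apply: measurable_fun_rV => i; under eq_fun do rewrite mxE.
apply: measurable_sum => j; apply: measurable_funM; last exact: measurable_cst.
exact: measurable_rV_coord.
Qed.

Lemma measurable_dotp f g : measurable_fun setT f -> measurable_fun setT g ->
  measurable_fun setT (fun x => dotp (f x) (g x)).
Proof.
move=> mf mg; apply: measurable_sum => j.
by apply: measurable_funM; exact: measurable_rV_coord.
Qed.

End measurable_rV_ops.

Section dotp_theory.
Context (R : realType) (n : nat).
Implicit Types (u v w : 'rV[R]_n) (a : R).

Lemma dotpE u v : dotp u v = (u *m v^T) ord0 ord0.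
Proof. by rewrite mxE; apply: eq_bigr => i _; rewrite mxE. Qed.

Lemma dotpC u v : dotp u v = dotp v u.
Proof. by apply: eq_bigr => i _; rewrite mulrC. Qed.

Lemma dotpDl u v w : dotp (u + v) w = dotp u w + dotp v w.
Proof. by rewrite !dotpE mulmxDl mxE. Qed.

Lemma dotpZl a u v : dotp (a *: u) v = a * dotp u v.
Proof. by rewrite !dotpE -scalemxAl mxE. Qed.

Lemma dotpZr a u v : dotp u (a *: v) = a * dotp u v.
Proof. by rewrite dotpC dotpZl dotpC. Qed.

Lemma dotpDr u v w : dotp u (v + w) = dotp u v + dotp u w.
Proof. by rewrite dotpC dotpDl !(dotpC u). Qed.

Lemma dotpNl u v : dotp (- u) v = - dotp u v.
Proof. by rewrite -scaleN1r dotpZl mulN1r. Qed.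

Lemma dotpNr u v : dotp u (- v) = - dotp u v.
Proof. by rewrite dotpC dotpNl dotpC. Qed.

Lemma dotp_ge0 v : 0 <= dotp v v.
Proof. by apply: sumr_ge0 => i _; rewrite -expr2 sqr_ge0. Qed.

Lemma dotp_eq0 v : (dotp v v == 0) = (v == 0).
Proof.
apply/idP/eqP => [|->]; last by rewrite /dotp big1// => i _; rewrite mxE mul0r.
rewrite psumr_eq0 => [/allP H|i _]; last by rewrite -expr2 sqr_ge0.
apply/rowP => i; rewrite mxE; have /implyP/(_ isT) := H i (mem_index_enum _).
by rewrite mulf_eq0 orbb => /eqP.
Qed.

Lemma sqr_enorm v : enorm v ^+ 2 = dotp v v.
Proof. by rewrite sqr_sqrtr// dotp_ge0. Qed.

Lemma enorm_ge0 v : 0 <= enorm v. Proof. exact: sqrtr_ge0. Qed.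

Lemma enorm_eq0 v : (enorm v == 0) = (v == 0).
Proof. by rewrite -dotp_eq0 -sqr_enorm sqrf_eq0. Qed.

Lemma enorm0 : enorm (0 : 'rV[R]_n) = 0.
Proof. by apply/eqP; rewrite enorm_eq0. Qed.

Lemma enormZ a v : enorm (a *: v) = `|a| * enorm v.
Proof.
by rewrite /enorm dotpZl dotpZr mulrA -expr2 sqrtrM ?sqr_ge0// sqrtr_sqr.
Qed.

Lemma enormalize_sphere v : v != 0 -> enorm (enormalize v) = 1.
Proof.
move=> v0; rewrite enormZ ger0_norm ?invr_ge0 ?enorm_ge0//.
by rewrite mulVf// enorm_eq0.
Qed.

End dotp_theory.

Lemma dotp_orth (R : realType) n m (Q : 'M[R]_(n, m)) (u v : 'rV[R]_n) : Q *m Q^T = 1%:M ->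
  dotp (u *m Q) (v *m Q) = dotp u v.
Proof. by move=> QQ; rewrite !dotpE trmx_mul mulmxA -(mulmxA u) QQ mulmx1. Qed.

Lemma enorm_orth (R : realType) n m (Q : 'M[R]_(n, m)) (v : 'rV[R]_n) : Q *m Q^T = 1%:M ->
  enorm (v *m Q) = enorm v.
Proof. by move=> QQ; rewrite /enorm dotp_orth. Qed.

Lemma dotp_cons (R : realType) n (t u : R) (v w : 'rV[R]_n) :
  dotp (cons_rV (t : measurableTypeR R, v)) (cons_rV (u : measurableTypeR R, w)) =
  t * u + dotp v w.
Proof.
rewrite /dotp big_ord_recl !mxE unlift_none/=; congr (_ + _).
by apply: eq_bigr => i _; rewrite !mxE liftK.
Qed.

(* Householder reflection exchanging [s] and the first basis vector. *)
Lemma orth_first_row (R : realType) n (s : 'rV[R]_n.+1) : enorm s = 1 ->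
  exists H : 'M[R]_n.+1, [/\ H *m H^T = 1%:M & row ord0 H = s].
Proof.
move=> s1; pose e : 'rV[R]_n.+1 := delta_mx ord0 ord0.
have ss : dotp s s = 1 by rewrite -sqr_enorm s1 expr1n.
have ee : dotp e e = 1.
  rewrite /dotp (bigD1 ord0)//= !mxE eqxx/= mulr1 big1 ?addr0// => i i0.
  by rewrite !mxE (negbTE i0) andbF mul0r.
have [se|se] := eqVneq s e.
  by exists 1%:M; split; [rewrite trmx1 mulmx1|rewrite rowE mulmx1].
pose u := s - e; have u0 : dotp u u != 0 by rewrite dotp_eq0 subr_eq0.
pose c := 2 / dotp u u.
pose H : 'M[R]_n.+1 := 1%:M - c *: (u^T *m u).
have uu : u *m u^T = (dotp u u)%:M by apply/rowP => i; rewrite ord1 -dotpE mxE eqxx mulr1n.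
have HT : H^T = H by rewrite /H linearB/= trmx1 linearZ/= trmx_mul trmxK.
exists H; split.
  rewrite HT {2}/H mulmxBr mulmx1 -scalemxAr {2}/H mulmxBl mul1mx -scalemxAl.
  rewrite mulmxA -(mulmxA u^T) uu -mulmxA mul_scalar_mx -scalemxAr scalerA.
  rewrite (_ : c * dotp u u = 2); last by rewrite /c mulfVK.
  by rewrite (scaler_nat 2) mulr2n opprD addNKr scalerN opprK /H subrK.
rewrite rowE -/e /H mulmxBr mulmx1 -scalemxAr mulmxA.
have -> : e *m u^T = (dotp e u)%:M by apply/rowP => i; rewrite ord1 -dotpE mxE eqxx mulr1n.
rewrite mul_scalar_mx scalerA.
have eu : dotp u u = - 2 * dotp e u.
  by rewrite /u !(dotpDl, dotpDr, dotpNl, dotpNr) ss ee (dotpC s e); ring.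
have eu0 : dotp e u != 0 by apply: contraNneq u0 => eu0; rewrite eu eu0 mulr0.
rewrite (_ : c * dotp e u = -1); last by rewrite /c eu; field.
by rewrite scaleN1r opprK /u addrC subrK.
Qed.

(** * Orthogonal invariance of Lebesgue measure *)

Section orthogonal_invariance.
Context (R : realType).
Local Notation leb := (@lebesgue_measure R).
Local Notation lebn := (lebesgue_rV R).
Local Open Scope ereal_scope.

Definition gauss_rV n (x : 'rV[R]_n) : R := expR (- dotp x x).

Lemma measurable_gauss_rV n : measurable_fun setT (@gauss_rV n).
Proof.
apply: measurableT_comp => //; apply: measurableT_comp => //.
exact: measurable_dotp.
Qed.

Lemma integral_gauss_rV n :
  \int[lebn n]_x (gauss_rV x)%:E = (Num.sqrt pi ^+ n)%:E.
Proof.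
elim: n => [|n IH].
  rewrite (eq_integral (cst 1)); last first.
    by move=> x _; rewrite /gauss_rV /dotp big_ord0 oppr0 expR0.
  rewrite integral_cst// mul1e.
  by rewrite /= diracT.
rewrite integral_lebesgue_rVS//; last 2 first.
- by apply/measurable_EFinP; exact: measurable_gauss_rV.
- by move=> x; rewrite lee_fin expR_ge0.
transitivity (\int[leb]_t ((Num.sqrt pi ^+ n)%:E * (gauss_fun t)%:E)).
  apply: eq_integral => t _; rewrite -IH muleC -ge0_integralZl_EFin//.
  - apply: eq_integral => v _.
    by rewrite -EFinM /gauss_rV dotp_cons opprD expRD /gauss_fun expr2.
  - by move=> x _; rewrite lee_fin expR_ge0.
  - by apply/measurable_EFinP; exact: measurable_gauss_rV.
  - exact: gauss_fun_ge0.
rewrite ge0_integralZl_EFin//.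
- by rewrite integralT_gauss -EFinM exprSr.
- by move=> x _; rewrite lee_fin gauss_fun_ge0.
- by apply/measurable_EFinP; exact: measurable_gauss_fun.
Qed.

(** Only translations and Tonelli's theorem are used. With a rotation-invariant weight [g], the
    double integral of [f (x P) g (y + x P)] is computed in two ways. Integrating over [y] first
    leaves [f (x P)]. Integrating over [x] first, the shift of [x] by [- y P^T] gives
    [f (x P - y) g (x)], and a second exchange leaves [f (- y)]. The case [P = 1] removes the
    sign. *)
Lemma integral_orth n (Q : 'M[R]_n) (f : 'rV[R]_n -> \bar R) :
  Q *m Q^T = 1%:M -> measurable_fun setT f -> (forall x, 0 <= f x) ->
  \int[lebn n]_x f (x *m Q) = \int[lebn n]_x f x.
Proof.
move=> QQ mf f0.
suff H (P : 'M[R]_n) : P *m P^T = 1%:M ->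
    \int[lebn n]_x f (x *m P) = \int[lebn n]_x f (- x)%R.
  rewrite H//; have := H 1%:M; rewrite trmx1 mulmx1 => /(_ erefl) <-.
  by apply: eq_integral => x _; rewrite mulmx1.
move=> {Q QQ} PP; have PP' := mulmx1C PP.
pose g (x : 'rV[R]_n) := (gauss_rV x)%:E.
have mg : measurable_fun setT g by apply/measurable_EFinP; exact: measurable_gauss_rV.
have g0 x : 0 <= g x by rewrite lee_fin expR_ge0.
have gP x : g (x *m P) = g x by rewrite /g /gauss_rV dotp_orth.
have mfN : measurable_fun setT (fun x : 'rV[R]_n => f (- x)%R).
  apply: (measurableT_comp mf); apply: measurable_fun_rV => i.
  by under eq_fun do rewrite mxE; apply: measurableT_comp => //; exact: measurable_coord.
have G : \int[lebn n]_x g x = (Num.sqrt pi ^+ n)%:E by exact: integral_gauss_rV.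
have Gn0 : (Num.sqrt pi ^+ n != 0 :> R)%R by rewrite expf_neq0// sqrtr_eq0 -ltNge pi_gt0.
have mP : measurable_fun setT (fun x : 'rV[R]_n => x *m P) by exact: measurable_rVM.
have m1 : measurable_fun setT (fun z : 'rV[R]_n * 'rV[R]_n => z.1 *m P).
  by apply: measurable_rVM; exact: measurable_fst.
have H1 : \int[lebn n]_x \int[lebn n]_y (f (x *m P) * g (y + x *m P)%R) =
    (\int[lebn n]_x f (x *m P)) * (Num.sqrt pi ^+ n)%:E.
  rewrite -ge0_integralZr//; last exact: measurableT_comp mP.
  apply: eq_integral => x _; rewrite ge0_integralZl//; last first.
    exact: measurableT_comp (measurable_addrV _).
  by rewrite integral_rV_shift// G.
have H2 : \int[lebn n]_x \int[lebn n]_y (f (x *m P) * g (y + x *m P)%R) =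
    (\int[lebn n]_x f (- x)%R) * (Num.sqrt pi ^+ n)%:E.
  rewrite (fubini_tonelli (fun z : 'rV[R]_n * 'rV[R]_n => f (z.1 *m P) * g (z.2 + z.1 *m P)%R))/=; last 2 first.
  - apply: emeasurable_funM; first exact: measurableT_comp m1.
    apply: (measurableT_comp mg); apply: measurable_rVD => //; exact: measurable_snd.
  - by move=> z; rewrite mule_ge0.
  transitivity (\int[lebn n]_y \int[lebn n]_x (f (x *m P - y)%R * g x)).
    apply: eq_integral => y _; rewrite -[LHS](integral_rV_shift (- y *m P^T)); last 2 first.
    - apply: emeasurable_funM; first exact: measurableT_comp mP.
      by apply: (measurableT_comp mg); apply: measurable_rVD => //; exact: measurable_cst.
    - by move=> x; rewrite mule_ge0.
    apply: eq_integral => x _.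
    by rewrite mulmxDl -mulmxA PP' mulmx1 [(y + _)%R]addrC subrK gP.
  rewrite (fubini_tonelli (fun z : 'rV[R]_n * 'rV[R]_n => f (z.2 *m P - z.1)%R * g z.2))/=; last 2 first.
  - apply: emeasurable_funM; last exact: measurableT_comp measurable_snd.
    apply: (measurableT_comp mf).
    rewrite (_ : (fun x => _) = (fun x : 'rV[R]_n * 'rV[R]_n => x.2 *m P + (-1) *: x.1))%R; last first.
      by apply/funext => z; rewrite scaleN1r.
    apply: measurable_rVD; first by apply: measurable_rVM; exact: measurable_snd.
    by apply: measurable_rVZ => //; exact: measurable_fst.
  - by move=> z; rewrite mule_ge0.
  rewrite -[in RHS]G -ge0_integralZl//; last exact: integral_ge0.
  apply: eq_integral => x _; rewrite ge0_integralZr//.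
  - congr (_ * _); rewrite -[RHS](integral_rV_shift (- (x *m P)) mfN)//.
    by apply: eq_integral => y _; rewrite opprD opprK addrC.
  - apply: (measurableT_comp mf); rewrite (_ : (fun y => _) = (fun y : 'rV[R]_n => (-1) *: y + x *m P))%R.
      by apply: measurable_rVD => //; apply: measurable_rVZ.
    by apply/funext => y; rewrite scaleN1r addrC.
have := etrans (esym H1) H2 => /(congr1 (fun z => z * (Num.sqrt pi ^+ n)^-1%:E)).
by rewrite -!muleA -!EFinM divff// !mule1.
Qed.

End orthogonal_invariance.

Section indicators.
Context d (T : measurableType d) (R : realType).

Lemma measurable_natr_bool (D : set T) (b : T -> bool) :
  measurable_fun D b -> measurable_fun D (fun x => (b x)%:R : R).
Proof.
move=> mb; apply: (@measurableT_comp _ _ _ _ _ _ (fun c : bool => c%:R : R)) => //.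
Qed.

Lemma measurable_ind_le (f g : T -> R) : measurable_fun setT f ->
  measurable_fun setT g -> measurable_fun setT (fun x => ((f x <= g x)%R)%:R : R).
Proof. by move=> mf mg; apply: measurable_natr_bool; exact: measurable_fun_ler. Qed.

Lemma measurable_ind_lt (f g : T -> R) : measurable_fun setT f ->
  measurable_fun setT g -> measurable_fun setT (fun x => ((f x < g x)%R)%:R : R).
Proof. by move=> mf mg; apply: measurable_natr_bool; exact: measurable_fun_ltr. Qed.

Lemma integral_ind (mu : {measure set T -> \bar R}) (f : T -> \bar R) (b : T -> bool) :
  (\int[mu]_x (f x * (b x)%:R%:E) = \int[mu]_(x in [set x | b x]) f x)%E.
Proof.
rewrite [RHS]integral_mkcond; apply: eq_integral => x _.
rewrite patchE; case: ifPn; rewrite ?inE/=; first by move=> ->; rewrite mule1.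
by move=> /negP; rewrite inE/= => /negP/negbTE ->; rewrite mule0.
Qed.

End indicators.

Lemma integral_mrestr d (T : measurableType d) (R : realType)
    (mu : {measure set T -> \bar R}) (D : set T) (mD : measurable D)
    (f : T -> \bar R) :
  measurable_fun setT f -> (forall x, 0 <= f x)%E ->
  (\int[mrestr mu mD]_x f x = \int[mu]_(x in D) f x)%E.
Proof.
move=> mf f0.
rewrite (@ge0_negligible_integral _ _ _ (mrestr mu mD) setT (~` D))//=; last 2 first.
- exact: measurableC.
- by rewrite /mrestr setICl measure0.
rewrite setTD setCK; apply: eq_measure_integral => A mA AD.
by rewrite /= /mrestr; congr (mu _); apply/setIidPl.
Qed.

Lemma muleVK (R : realType) (a : R) (x : \bar R) : a != 0 ->
  (a%:E * ((a^-1)%:E * x) = x)%E.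
Proof. by move=> a0; rewrite muleA -EFinM divff// mul1e. Qed.

Section line_integrals.
Context (R : realType).
Local Notation leb := (@lebesgue_measure R).
Local Open Scope ereal_scope.

Lemma is_derive_expRN (x : R) :
  is_derive x 1%R (fun u : R => - expR (- u))%R (expR (- x)).
Proof.
have h := is_deriveN (is_derive1_comp (is_derive_expR (- x)%R) (is_deriveNid x 1%R)).
by apply: is_derive_eq h _; rewrite mulrN1 opprK.
Qed.

Lemma is_derive_expow (n : nat) (x : R) :
  is_derive x 1%R (fun u : R => n.+1%:R^-1 * u ^+ n.+1)%R (x ^+ n)%R.
Proof.
have h := is_deriveZ n.+1%:R^-1%R (is_deriveX n.+1 (is_derive_id x (1%R : R))).
have -> : (fun u : R => n.+1%:R^-1 * u ^+ n.+1)%R = (n.+1%:R^-1 \*: (@idfun R ^+ n.+1))%R.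
  by apply/funext => u; rewrite /= exprfctE.
by apply: is_derive_eq h _; rewrite /GRing.scale/= mulr1 mulrA mulVf ?mul1r.
Qed.

Lemma integral_exp_tail (v : R) :
  \int[leb]_u ((expR (- u))%:E * (v <= u)%R%:R%:E) = (expR (- v))%:E.
Proof.
have dF := is_derive_expRN.
rewrite integral_ind -set_itvcy.
rewrite (@ge0_continuous_FTC2y _ _ (fun u => - expR (- u))%R _ 0%R).
- by rewrite EFinN oppeK add0e.
- by move=> x _; exact: expR_ge0.
- apply: continuous_subspaceT => x; apply: continuous_comp; first exact: opp_continuous.
  exact: continuous_expR.
- by rewrite -oppr0; apply: cvgN; exact: cvgr_expR.
- by move=> x _; apply: ex_derive.
- apply: cvgN; apply: cvg_at_right_filter; apply: continuous_comp; first exact: opp_continuous.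
  exact: continuous_expR.
- by move=> x _; rewrite derive1E; exact: derive_val.
Qed.

Lemma integral_expow (n : nat) :
  \int[leb]_(r in `[0%R, 1%R]) (r ^+ n)%:E = (n.+1%:R^-1)%:E.
Proof.
have dF := is_derive_expow n.
rewrite (@continuous_FTC2 _ _ (fun r => n.+1%:R^-1 * r ^+ n.+1)%R)//.
- by rewrite expr1n mulr1 exprS mul0r mulr0 sube0.
- apply: continuous_subspaceT => x; exact: exprn_continuous.
- split.
  + by move=> x _; apply: ex_derive.
  + apply: cvg_at_right_filter; apply: cvgM; first exact: cvg_cst.
    exact: exprn_continuous.
  + apply: cvg_at_left_filter; apply: cvgM; first exact: cvg_cst.
    exact: exprn_continuous.
- by move=> x _; rewrite derive1E; exact: derive_val.
Qed.

Lemma powR_half (u : R) (n : nat) : (0 <= u)%R -> (u `^ (n%:R / 2) = Num.sqrt u ^+ n)%R.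
Proof. by move=> u0; rewrite mulrC powRrM powR12_sqrt// powR_mulrn// sqrtr_ge0. Qed.

Lemma continuous_sqrt_pow k : continuous (fun v : R => Num.sqrt v ^+ k)%R.
Proof.
move=> x; apply: (@continuous_comp _ _ _ (@Num.sqrt R) (fun v : R => v ^+ k)%R).
  exact: sqrt_continuous.
exact: exprn_continuous.
Qed.

Lemma is_derive_sqrt_pow n (x : R) : (0 < x)%R ->
  is_derive x 1%R (fun v : R => Num.sqrt v ^+ n.+2)%R (n.+2%:R / 2 * Num.sqrt x ^+ n)%R.
Proof.
move=> x0; have x0' : x \in `]0%R, +oo[ by rewrite in_itv/= x0.
apply: (@near_eq_is_derive _ _ _ (fun v => powR v (n.+2%:R / 2))).
  near=> v; apply: powR_half; apply: ltW; near: v; exact: lt_nbhsr.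
apply: DeriveDef; first exact: (derivable_powR x0').
rewrite -derive1E powR_derive1//; congr (_ * _)%R.
by rewrite -powR_half ?ltW//; congr powR; rewrite -natr1 -natr1; field.
Unshelve. all: by end_near. Qed.

Lemma integral_sqrt_pow (n : nat) :
  \int[leb]_(v in `[0%R, 1%R]) (Num.sqrt v ^+ n)%:E = (2 / n.+2%:R)%:E.
Proof.
rewrite (@continuous_FTC2 _ _ (fun v => (2 / n.+2%:R) * Num.sqrt v ^+ n.+2)%R)//.
- by rewrite sqrtr1 sqrtr0 expr1n mulr1 exprS mul0r mulr0 sube0.
- apply: continuous_subspaceT => x; exact: continuous_sqrt_pow.
- split.
  + move=> x; rewrite in_itv/= => /andP[x0 _]; apply: derivableM => //.
    by have := is_derive_sqrt_pow n x0 => -[].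
  + apply: cvg_at_right_filter; apply: cvgM; first exact: cvg_cst.
    exact: continuous_sqrt_pow.
  + apply: cvg_at_left_filter; apply: cvgM; first exact: cvg_cst.
    exact: continuous_sqrt_pow.
- move=> x; rewrite in_itv/= => /andP[x0 _].
  have [d1 d2] := is_derive_sqrt_pow n x0.
  rewrite derive1E deriveM// derive_cst scaler0 addr0 d2 /GRing.scale/=; field.
  by rewrite -natrD pnatr_eq0.
Qed.

(* Recursion for the Gamma function at half-integers, with [e^-v] written as
   the integral of [e^-u] over [u >= v]. *)
Lemma integral_Gamma_half_rec (n : nat) :
  \int[leb]_(u in `]0%R, +oo[) (Num.sqrt u ^+ n.+2 * expR (- u))%:E =
  (n.+2%:R / 2)%:E * \int[leb]_(u in `]0%R, +oo[) (Num.sqrt u ^+ n * expR (- u))%:E.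
Proof.
have m1 k : measurable_fun [set: R] (fun v : R => Num.sqrt v ^+ k)%R.
  exact: continuous_measurable_fun (@continuous_sqrt_pow k).
have mexpN : measurable_fun [set: R] (fun u : R => expR (- u)).
  by apply: continuous_measurable_fun => x; apply: continuous_comp;
    [exact: opp_continuous|exact: continuous_expR].
(* Integrated over [v], [w] gives [u^(n/2 + 1) * 2 / (n + 2)] by scaling; integrated over [u]
   against [e^-u], it gives [v^(n/2) e^-v]. The recursion compares the two orders of integration. *)
pose w (v u : R) : R := (Num.sqrt v ^+ n * (0 < v)%R%:R * (v <= u)%R%:R)%R.
have w0 v u : (0 <= w v u)%R by rewrite !mulr_ge0// exprn_ge0// sqrtr_ge0.
have mw : measurable_fun setT (fun z : measurableTypeR R * measurableTypeR R => w z.1 z.2).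
  apply: measurable_funM; last by apply: measurable_ind_le; [exact: measurable_fst|exact: measurable_snd].
  apply: measurable_funM; first exact: measurableT_comp (m1 n) measurable_fst.
  by apply: measurable_ind_lt; [exact: measurable_cst|exact: measurable_fst].
have mwu u : measurable_fun [set: R] (w ^~ u).
  exact: (measurableT_comp mw (@measurable_pair2 _ _ (measurableTypeR R) (measurableTypeR R) u)).
have w1 : \int[leb]_v (w v 1%R)%:E = (2 / n.+2%:R)%:E.
  rewrite -integral_sqrt_pow -integral_itv_obnd_cbnd; last first.
    by apply/measurable_EFinP; exact: measurable_funTS.
  rewrite [RHS]integral_mkcond; apply: eq_integral => v _.
  rewrite patchE mem_setE in_itv/= /w.
  by case: (0 < v)%R; case: (v <= 1)%R; rewrite ?(mulr0,mulr1).
have wu (u : R) : (0 < u)%R ->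
    \int[leb]_v (w v u)%:E = (Num.sqrt u ^+ n.+2 * (2 / n.+2%:R))%:E.
  move=> u0.
  have mwe : measurable_fun [set: R] (fun v => (w v u)%:E) by apply/measurable_EFinP; exact: mwu.
  have := @integral_lebesgue_scale R (fun v => (w v u)%:E) u u0 mwe (fun v => w0 v u).
  have ws (v : R) : w (u * v)%R u = (Num.sqrt u ^+ n * w v 1)%R.
    rewrite /w (sqrtrM v (ltW u0)) exprMn pmulr_rgt0//.
    by rewrite -[X in (_ <= X)%R](mulr1 u) ler_pM2l// !mulrA.
  have -> : \int[leb]_v (w (u * v) u)%:E = (Num.sqrt u ^+ n)%:E * \int[leb]_v (w v 1%R)%:E.
    rewrite -ge0_integralZl_EFin//; last 2 first.
    - by move=> v _; rewrite lee_fin.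
    - by apply/measurable_EFinP; exact: mwu.
    by apply: eq_integral => v _; rewrite ws.
  rewrite w1 => /(congr1 (fun z => u%:E * z)).
  rewrite muleVK ?gt_eqF// => <-.
  rewrite -!EFinM; congr EFin; rewrite mulrA; congr (_ * _)%R.
  by rewrite -addn2 exprD sqr_sqrtr ?ltW// mulrC.
have wu0 (u : R) : (u <= 0)%R -> \int[leb]_v (w v u)%:E = 0.
  move=> u0; apply: integral0_eq => v _; rewrite /w.
  have [v0|] := ltP 0%R v; last by rewrite mulr0 mul0r.
  by rewrite leNgt (le_lt_trans u0 v0) mulr0.
transitivity (\int[leb]_u ((n.+2%:R / 2)%:E * ((expR (- u))%:E * \int[leb]_v (w v u)%:E))).
  rewrite integral_mkcond; apply: eq_integral => u _.
  rewrite patchE mem_setE in_itv/= andbT; case: ltP => u0.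
    rewrite wu// -!EFinM; congr EFin.
    by field; rewrite -natrD pnatr_eq0.
  by rewrite wu0// !mule0.
have mI : measurable_fun [set: measurableTypeR R] (fun u => (expR (- u))%:E * \int[leb]_v (w v u)%:E).
  apply: emeasurable_funM; first exact/measurable_EFinP.
  apply: (measurable_fun_fubini_tonelli_G (fun z : measurableTypeR R * measurableTypeR R => (w z.1 z.2)%:E)) => //.
    exact/measurable_EFinP.
  by move=> z; rewrite lee_fin.
have mH : measurable_fun setT (fun z : measurableTypeR R * measurableTypeR R => (expR (- z.2) * w z.1 z.2)%:E).
  apply/measurable_EFinP; apply: measurable_funM => //.
  exact: measurableT_comp mexpN measurable_snd.
rewrite ge0_integralZl_EFin//; last first.
  by move=> u _; rewrite mule_ge0// ?lee_fin ?expR_ge0//; apply: integral_ge0 => v _; rewrite lee_fin.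
congr (_ * _).
transitivity (\int[leb]_u \int[leb]_v (expR (- u) * w v u)%:E).
  apply: eq_integral => u _; rewrite -ge0_integralZl_EFin//.
  - by move=> v _; rewrite lee_fin.
  - by apply/measurable_EFinP; exact: mwu.
rewrite -(fubini_tonelli (fun z : measurableTypeR R * measurableTypeR R => (expR (- z.2) * w z.1 z.2)%:E))//=; last first.
  by move=> z; rewrite lee_fin mulr_ge0// expR_ge0.
rewrite [RHS]integral_mkcond; apply: eq_integral => v _.
transitivity ((Num.sqrt v ^+ n * (0 < v)%R%:R)%:E * \int[leb]_u ((expR (- u))%:E * (v <= u)%R%:R%:E)).
  rewrite -ge0_integralZl_EFin//.
  - by apply: eq_integral => u _; rewrite -!EFinM; congr EFin; rewrite /w mulrCA.
  - apply: emeasurable_funM; first exact/measurable_EFinP.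
    apply/measurable_EFinP; apply: measurable_ind_le => //; exact: measurable_cst.
rewrite integral_exp_tail patchE mem_setE in_itv/= andbT -EFinM.
by case: ifPn => _; rewrite ?mulr1// mulr0 mul0r.
Qed.

Lemma integral_norm_gauss : \int[leb]_t (`|t| * gauss_fun t)%:E = 1.
Proof.
have cg : continuous (@gauss_fun R) by exact: continuous_gauss_fun.
have cn : continuous (fun t : R => `|t| * gauss_fun t)%R.
  move=> t; apply: cvgM; [exact: norm_continuous|exact: cg].
rewrite ge0_symfun_integralT//; last 2 first.
- by move=> t; rewrite mulr_ge0// gauss_fun_ge0.
- by move=> t /=; rewrite normrN /gauss_fun sqrrN.
have dF (x : R) : is_derive x 1%R (fun t : R => - (2^-1) * gauss_fun t)%R (x * gauss_fun x)%R.
  have h := is_deriveZ (- 2^-1)%R (@is_derive1_comp _ expR (fun t : R => - (t * t))%R x _ _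
    (is_derive_expR _) (is_deriveN (is_deriveM (is_derive_id x (1%R : R)) (is_derive_id x (1%R : R))))).
  apply: is_derive_eq h _; rewrite /GRing.scale/= /gauss_fun expr2; by field.
rewrite -set_itvcy (@ge0_continuous_FTC2y _ _ (fun t => - (2^-1) * gauss_fun t)%R _ 0%R).
- by rewrite /gauss_fun expr0n oppr0 expR0 mulr1 EFinN oppeK add0e -EFinM divff.
- by move=> t _; rewrite mulr_ge0// gauss_fun_ge0.
- exact: continuous_subspaceT.
- by rewrite -(mulr0 (- 2^-1)%R); apply: cvgM; [exact: cvg_cst|exact: cvg_gauss_fun].
- by move=> x _; apply: ex_derive.
- by apply: cvg_at_right_filter; apply: cvgM; [exact: cvg_cst|exact: cg].
- move=> x; rewrite in_itv/= andbT => x0.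
  by rewrite derive1E ger0_norm ?ltW//; exact: derive_val.
Qed.

End line_integrals.

(** * The Favard constant *)

Section polar.
Context (R : realType).
Local Notation leb := (@lebesgue_measure R).
Local Notation lebn := (lebesgue_rV R).
Local Open Scope ereal_scope.

Definition ball_integral n (f : 'rV[R]_n -> R) : \bar R :=
  \int[lebn n]_x (f x * (enorm x <= 1)%R%:R)%:E.

Lemma measurable_ball_ind n (f : 'rV[R]_n -> R) (a : R) : measurable_fun setT f ->
  measurable_fun setT (fun x => f x * (enorm x <= a)%R%:R)%R.
Proof.
move=> mf; apply: measurable_funM => //; apply: measurable_ind_le.
  exact: measurable_enorm.
exact: measurable_cst.
Qed.

Lemma homogeneous_ball_integral n p (f : 'rV[R]_n -> R) (a : R) :
  measurable_fun setT f -> (forall x, (0 <= f x)%R) -> (0 < a)%R ->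
  (forall x, f (a *: x) = a ^+ p * f x)%R ->
  \int[lebn n]_x (f x * (enorm x <= a)%R%:R)%:E = (a ^+ (n + p))%:E * ball_integral f.
Proof.
move=> mf f0 a0 fa.
have mI b : measurable_fun setT (fun x => (f x * (enorm x <= b)%R%:R)%:E).
  by apply/measurable_EFinP; exact: measurable_ball_ind.
have I0 b x : 0 <= (f x * (enorm x <= b)%R%:R)%:E by rewrite lee_fin mulr_ge0.
have := integral_rV_scale a0 (mI a) (I0 a).
have -> : \int[lebn n]_x (f (a *: x)%R * (enorm (a *: x)%R <= a)%R%:R)%:E =
    (a ^+ p)%:E * ball_integral f.
  rewrite /ball_integral -ge0_integralZl_EFin// ?exprn_ge0 ?ltW//.
  apply: eq_integral => x _; rewrite fa enormZ gtr0_norm// -EFinM -mulrA.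
  by rewrite -[X in (_ <= X)%R]mulr1 ler_pM2l.
move=> /(congr1 (fun z => (a ^+ n)%:E * z)).
rewrite muleVK ?gt_eqF ?exprn_gt0// => <-.
by rewrite muleA -EFinM -exprD.
Qed.

Definition norm_coord0 n (x : 'rV[R]_n.+1) : R := `|x ord0 ord0|.

Lemma norm_coord0_ge0 n (x : 'rV[R]_n.+1) : (0 <= norm_coord0 x)%R.
Proof. exact: normr_ge0. Qed.

Lemma gauss_rV_ge0 n (x : 'rV[R]_n) : (0 <= gauss_rV x)%R.
Proof. exact: expR_ge0. Qed.

Hint Resolve norm_coord0_ge0 gauss_rV_ge0 : core.

Lemma measurable_norm_coord0 n : measurable_fun setT (@norm_coord0 n).
Proof. by apply: measurableT_comp => //; exact: measurable_coord. Qed.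

Lemma integral_norm_coord0_gauss n :
  \int[lebn n.+1]_x (norm_coord0 x * gauss_rV x)%:E = (Num.sqrt pi ^+ n)%:E.
Proof.
rewrite integral_lebesgue_rVS//; last 2 first.
- apply/measurable_EFinP; apply: measurable_funM; first exact: measurable_norm_coord0.
  exact: measurable_gauss_rV.
- by move=> x; rewrite lee_fin mulr_ge0.
transitivity (\int[leb]_t ((Num.sqrt pi ^+ n)%:E * (`|t| * gauss_fun t)%:E)).
  apply: eq_integral => t _; rewrite -integral_gauss_rV muleC -ge0_integralZl_EFin//.
  - apply: eq_integral => v _; rewrite -EFinM /gauss_rV dotp_cons opprD expRD mulrA.
    by rewrite /norm_coord0 mxE unlift_none /gauss_fun expr2.
  - by move=> x _; rewrite lee_fin expR_ge0.
  - by apply/measurable_EFinP; exact: measurable_gauss_rV.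
  - by rewrite mulr_ge0// gauss_fun_ge0.
rewrite ge0_integralZl_EFin//.
- by rewrite integral_norm_gauss mule1.
- by move=> x _; rewrite lee_fin mulr_ge0// gauss_fun_ge0.
- apply/measurable_EFinP; apply: measurable_funM; last exact: measurable_gauss_fun.
  exact: (@normr_measurable R setT).
Qed.

(* [e^-|x|^2] is the integral of [e^-u] over [u >= |x|^2]. *)
Lemma ball_integral_norm_coord0 n :
  ball_integral (@norm_coord0 n) *
    \int[leb]_(u in `]0%R, +oo[) (Num.sqrt u ^+ n.+2 * expR (- u))%:E =
  (Num.sqrt pi ^+ n)%:E.
Proof.
have mexpN : measurable_fun [set: R] (fun u : R => expR (- u)).
  by apply: continuous_measurable_fun => x; apply: continuous_comp;
    [exact: opp_continuous|exact: continuous_expR].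
have mD : measurable_fun setT (fun z : 'rV[R]_n.+1 * R => dotp z.1 z.1).
  by apply: measurable_dotp; exact: measurable_fst.
have mN : measurable_fun setT (fun z : 'rV[R]_n.+1 * R => norm_coord0 z.1).
  exact: measurableT_comp (@measurable_norm_coord0 n) measurable_fst.
have mF : measurable_fun setT (fun z : 'rV[R]_n.+1 * R =>
    (expR (- z.2) * (norm_coord0 z.1 * (dotp z.1 z.1 <= z.2)%R%:R))%:E).
  apply/measurable_EFinP; apply: measurable_funM.
    exact: measurableT_comp mexpN measurable_snd.
  by apply: measurable_funM => //; apply: measurable_ind_le => //; exact: measurable_snd.
have F0 (z : 'rV[R]_n.+1 * R) :
    0 <= (expR (- z.2) * (norm_coord0 z.1 * (dotp z.1 z.1 <= z.2)%R%:R))%:E.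
  by rewrite lee_fin mulr_ge0 ?expR_ge0// mulr_ge0.
transitivity (\int[lebn n.+1]_x \int[leb]_u
    (expR (- u) * (norm_coord0 x * (dotp x x <= u)%R%:R))%:E); last first.
  rewrite -integral_norm_coord0_gauss; apply: eq_integral => x _.
  rewrite /gauss_rV EFinM -integral_exp_tail -ge0_integralZl_EFin//.
  - by apply: eq_integral => u _; rewrite -!EFinM mulrCA.
  - apply: emeasurable_funM; first exact/measurable_EFinP.
    apply/measurable_EFinP; apply: measurable_ind_le => //; exact: measurable_cst.
rewrite (fubini_tonelli (fun z : 'rV[R]_n.+1 * measurableTypeR R =>
  (expR (- z.2) * (norm_coord0 z.1 * (dotp z.1 z.1 <= z.2)%R%:R))%:E))//=.
have K0 : 0 <= ball_integral (@norm_coord0 n).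
  by apply: integral_ge0 => x _; rewrite lee_fin mulr_ge0.
have mG : measurable_fun (`]0%R, +oo[%classic : set R)
    (fun u : R => (Num.sqrt u ^+ n.+2 * expR (- u))%:E).
  apply/measurable_EFinP/measurable_funTS; apply: measurable_funM => //.
  exact: continuous_measurable_fun (@continuous_sqrt_pow _ _).
have G0 (u : R) : `]0%R, +oo[%classic u -> 0 <= (Num.sqrt u ^+ n.+2 * expR (- u))%:E.
  by move=> _; rewrite lee_fin mulr_ge0 ?expR_ge0// exprn_ge0// sqrtr_ge0.
rewrite muleC -ge0_integralZr//.
rewrite integral_mkcond; apply: eq_integral => u _.
rewrite patchE mem_setE in_itv/= andbT.
transitivity ((expR (- u))%:E * \int[lebn n.+1]_x (norm_coord0 x * (dotp x x <= u)%R%:R)%:E); last first.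
  rewrite -ge0_integralZl_EFin//.
  - by move=> x _; rewrite lee_fin mulr_ge0.
  - apply/measurable_EFinP; apply: measurable_funM; first exact: measurable_norm_coord0.
    by apply: measurable_ind_le; [exact: measurable_dotp|exact: measurable_cst].
case: ltP => u0; last first.
  rewrite integral0_eq ?mule0// => x _; congr EFin.
  have [xu|_] := leP (dotp x x) u; last by rewrite mulr0.
  have /eqP : dotp x x = 0%R by apply/eqP; rewrite eq_le dotp_ge0 (le_trans xu).
  by rewrite dotp_eq0 => /eqP ->; rewrite /norm_coord0 mxE normr0 mul0r.
rewrite EFinM muleAC [LHS]muleC; congr (_ * _).
rewrite -[n.+2]addn1 -homogeneous_ball_integral ?sqrtr_gt0//; last 2 first.
- exact: measurable_norm_coord0.
- by move=> x; rewrite expr1 /norm_coord0 mxE normrM ger0_norm// sqrtr_ge0.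
apply: eq_integral => x _; congr (_ * _%:R)%:E.
by rewrite /enorm ler_sqrt// ltW.
Qed.

(** The absolute value of the cosine of the angle with the first axis, set to 0 at the origin. In
    the cone form of [surface_measure], its integral over the unit ball times the dimension is the
    integral of [|s_0|] over the sphere. *)
Definition norm_cos n (x : 'rV[R]_n.+1) : R := (norm_coord0 x * (enorm x)^-1)%R.

Lemma measurable_inv_enorm n : measurable_fun setT (fun x : 'rV[R]_n => (enorm x)^-1)%R.
Proof.
rewrite (_ : (fun _ => _) = (@powR R ^~ (-1)) \o @enorm R n)%R.
  by apply: measurableT_comp; [exact: measurable_powR|exact: measurable_enorm].
by apply/funext => v /=; rewrite powR_inv1// enorm_ge0.
Qed.

Lemma measurable_norm_cos n : measurable_fun setT (@norm_cos n).
Proof.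
apply: measurable_funM; first exact: measurable_norm_coord0.
exact: measurable_inv_enorm.
Qed.

Lemma coord_le_enorm n (x : 'rV[R]_n) i : (`|x ord0 i| <= enorm x)%R.
Proof.
rewrite -sqrtr_sqr; apply: ler_wsqrtr.
rewrite /dotp (bigD1 i)//= -expr2 lerDl; apply: sumr_ge0 => j _.
by rewrite -expr2 sqr_ge0.
Qed.

Lemma norm_cos_ge0 n (x : 'rV[R]_n.+1) : (0 <= norm_cos x)%R.
Proof. by rewrite mulr_ge0// invr_ge0 enorm_ge0. Qed.

Lemma norm_cos_le1 n (x : 'rV[R]_n.+1) : (norm_cos x <= 1)%R.
Proof.
have [->|x0] := eqVneq x 0%R; first by rewrite /norm_cos enorm0 invr0 mulr0.
rewrite ler_pdivrMr ?mul1r; first exact: coord_le_enorm.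
by rewrite lt_neqAle enorm_ge0 eq_sym enorm_eq0 x0.
Qed.

Lemma ball_integral_norm_cos_fin n : ball_integral (@norm_cos n) \is a fin_num.
Proof.
rewrite ge0_fin_numE; last first.
  by apply: integral_ge0 => x _; rewrite lee_fin mulr_ge0// norm_cos_ge0.
(* On the unit ball [1 <= e^(1 - |x|^2)], so a Gaussian weight dominates the indicator of the
   ball. *)
apply: (@le_lt_trans _ _ (\int[lebn n.+1]_x ((expR 1)%:E * (gauss_rV x)%:E))).
  apply: ge0_le_integral => //.
  - by move=> x _; rewrite lee_fin mulr_ge0// norm_cos_ge0.
  - by apply/measurable_EFinP; apply: measurable_ball_ind; exact: measurable_norm_cos.
  - apply/measurable_EFinP; apply: measurable_funM; first exact: measurable_cst.
    exact: measurable_gauss_rV.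
  move=> x _; rewrite -EFinM lee_fin /gauss_rV -expRD.
  have [x1|_] := leP (enorm x) 1%R; last by rewrite mulr0 expR_ge0.
  rewrite mulr1 (le_trans (norm_cos_le1 _))// -[leLHS]expR0 ler_expR subr_ge0.
  by rewrite -sqr_enorm expr_le1// enorm_ge0.
rewrite ge0_integralZl_EFin ?expR_ge0//; last 2 first.
- by move=> x _; rewrite lee_fin expR_ge0.
- by apply/measurable_EFinP; exact: measurable_gauss_rV.
by rewrite integral_gauss_rV -EFinM ltry.
Qed.

(** This stands for polar coordinates. In the ball, [|x_0| / |x|] is the sum of [|x_0|] and of
    [(1 - |x|) |x_0| / |x|]; writing [1 - |x|] as the integral over [r] in [[0, 1]] of the indicator
    of [|x| <= r], homogeneity of degree 0 produces the integral of [r^(n+1)], that is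
    [1 / (n+2)]. *)
Lemma ball_integral_norm_cosE n :
  ball_integral (@norm_cos n) =
  (n.+2%:R^-1)%:E * ball_integral (@norm_cos n) + ball_integral (@norm_coord0 n).
Proof.
have mcos := @measurable_norm_cos n.
pose F (x : 'rV[R]_n.+1) (r : R) : \bar R := (norm_cos x * (enorm x <= r)%R%:R * ((0 <= r) && (r <= 1))%R%:R)%:E.
have mF : measurable_fun setT (fun z : 'rV[R]_n.+1 * measurableTypeR R => F z.1 z.2).
  apply/measurable_EFinP; apply: measurable_funM; first apply: measurable_funM.
  - exact: measurableT_comp mcos measurable_fst.
  - apply: measurable_ind_le; last exact: measurable_snd.
    exact: measurableT_comp (@measurable_enorm R n.+1) measurable_fst.
  - apply: measurable_natr_bool; apply: measurable_and; apply: measurable_fun_ler => //; exact: measurable_snd.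
have F0 x r : 0 <= F x r by rewrite lee_fin mulr_ge0// mulr_ge0// norm_cos_ge0.
have -> : (n.+2%:R^-1)%:E * ball_integral (@norm_cos n) = \int[lebn n.+1]_x \int[leb]_r F x r.
  rewrite (fubini_tonelli (fun z : 'rV[R]_n.+1 * measurableTypeR R => F z.1 z.2))//=.
  have K0 : 0 <= ball_integral (@norm_cos n).
    by apply: integral_ge0 => x _; rewrite lee_fin mulr_ge0// norm_cos_ge0.
  have mG : measurable_fun (`[0%R, 1%R]%classic : set R) (fun r : R => (r ^+ n.+1)%:E).
    apply/measurable_EFinP/measurable_funTS.
    exact: (continuous_measurable_fun (@exprn_continuous _ n.+1)).
  have G0 (r : R) : `[0%R, 1%R]%classic r -> 0 <= (r ^+ n.+1)%:E.
    by rewrite /= in_itv/= => /andP[r0 _]; rewrite lee_fin exprn_ge0.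
  rewrite -integral_expow -ge0_integralZr//.
  rewrite integral_mkcond; apply: eq_integral => r _.
  rewrite patchE mem_setE in_itv/=.
  case: ifPn => [/andP[r0 r1]|r01]; last first.
    by rewrite integral0_eq// => x _; rewrite /F (negbTE r01) mulr0.
  rewrite /F r0 r1/=; under eq_integral do rewrite mulr1.
  have [{}r0|r0'] := ltP 0%R r.
    rewrite (@homogeneous_ball_integral _ 0)// ?addn0//; first exact: norm_cos_ge0.
    move=> x; rewrite expr0 mul1r /norm_cos enormZ /norm_coord0 mxE normrM.
    by rewrite gtr0_norm// invfM mulrACA divff ?mul1r// gt_eqF.
  have -> : r = 0%R by apply/eqP; rewrite eq_le r0 r0'.
  rewrite expr0n mul0e; apply/esym; apply: integral0_eq => x _; congr EFin.
  have [x0|_] := leP (enorm x) 0%R; last by rewrite mulr0.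
  have /eqP : enorm x = 0%R by apply/eqP; rewrite eq_le enorm_ge0 x0.
  by rewrite /norm_cos => /eqP ->; rewrite invr0 mulr0 mul0r.
rewrite -ge0_integralD//; last 4 first.
- by move=> x _; apply: integral_ge0.
- exact: (measurable_fun_fubini_tonelli_F (fun z : 'rV[R]_n.+1 * measurableTypeR R => F z.1 z.2)).
- by move=> x _; rewrite lee_fin mulr_ge0.
- by apply/measurable_EFinP; apply: measurable_ball_ind; exact: measurable_norm_coord0.
apply: eq_integral => x _.
have [x1|x1] := leP (enorm x) 1%R; last first.
  rewrite mulr0 integral0_eq ?add0e ?mulr0// => r _; rewrite /F.
  case: (leP (enorm x) r) => xr; last by rewrite mulr0 mul0r.
  by rewrite [(r <= 1)%R]leNgt (lt_le_trans x1 xr) andbF mulr0.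
have -> : \int[leb]_r F x r = (norm_cos x * (1 - enorm x))%:E.
  transitivity (\int[leb]_(r in `[enorm x, 1%R]) (norm_cos x)%:E).
    rewrite [RHS]integral_mkcond; apply: eq_integral => r _.
    rewrite patchE mem_setE in_itv/= /F.
    case: (leP (enorm x) r) => xr /=; last by rewrite mulr0 mul0r.
    by rewrite (le_trans (enorm_ge0 _) xr)/=; case: (r <= 1)%R; rewrite !(mulr1,mulr0).
  transitivity ((norm_cos x)%:E * leb [set` `[enorm x, 1%R]]); first exact: integral_cst.
  rewrite lebesgue_measure_itv/= lte_fin [RHS]EFinM; congr (_ * _).
  case: ltP => // x1'; have -> : enorm x = 1%R by apply/eqP; rewrite eq_le x1 x1'.
  by rewrite subrr.
rewrite -EFinD !mulr1; congr EFin; rewrite mulrBr mulr1.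
have [->|x0] := eqVneq x 0%R.
  by rewrite /norm_cos enorm0 invr0 !mulr0 /norm_coord0 mxE normr0 subr0 addr0.
by rewrite {3}/norm_cos divfK ?enorm_eq0// subrK.
Qed.

End polar.

(** * Favard measure as an average over lines *)

Section surface.
Context (R : realType).
Local Notation leb := (@lebesgue_measure R).
Local Notation lebn := (lebesgue_rV R).
Local Open Scope ereal_scope.

Lemma measurable_sphere n : measurable (@sphere R n).
Proof.
have := @measurable_enorm R n measurableT [set 1%R] (measurable_set1 _).
by rewrite setTI.
Qed.

(** The factor [0 < enorm x] removes the origin, whose image under [enormalize] is off the sphere.
    It is in this form, with Lebesgue measure on a ball, that Tonelli's theorem reaches the
    sphere. *)
Lemma integral_sphere n (f : 'rV[R]_n -> \bar R) :
  measurable_fun setT f -> (forall x, 0 <= f x) ->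
  \int[surface_measure R n]_(s in sphere) f s =
  n%:R%:E * \int[lebn n]_x (f (enormalize x) * ((0 < enorm x) && (enorm x <= 1))%R%:R%:E).
Proof.
move=> mf f0; rewrite integral_mkcond.
have mfs : measurable_fun setT (f \_ sphere).
  by apply/(measurable_restrictT _ (@measurable_sphere n)); exact: measurable_funTS.
have fs0 x : 0 <= (f \_ sphere) x by rewrite patchE; case: ifPn.
rewrite /surface_measure ge0_integral_mscale//; congr (_ * _).
rewrite (ge0_integral_pushforward (@measurable_enormalize R n))// preimage_setT.
rewrite integral_mrestr; [|exact: measurableT_comp mfs (@measurable_enormalize R n)|by move=> x /=].
rewrite integral_mkcond; apply: eq_integral => x _ /=.
rewrite patchE /= patchE.
have [->|x0] := eqVneq x 0%R.
  rewrite enorm0 ltxx mule0 /enormalize scaler0.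
  case: ifPn => // _; rewrite ifF//; apply/negP; rewrite inE /sphere/= enorm0.
  by move=> /eqP; rewrite eq_sym oner_eq0.
have xs : enormalize x \in @sphere R n by rewrite inE /sphere/= enormalize_sphere.
have x0' : (0 < enorm x)%R by rewrite lt_neqAle enorm_ge0 eq_sym enorm_eq0 x0.
rewrite xs x0'/=; have [x1|x1] := leP (enorm x) 1%R.
  by rewrite mem_set// mule1.
by rewrite memNset ?mule0// /unit_ball/=; apply/negP; rewrite -ltNge.
Qed.

(** Let [H] and [K] be the ball integrals of [|x_0| / |x|] and of [|x_0|], and
    [G = Gamma (n/2 + 1)]. Then [(n+1) H = (n+2) K] and [K G (n+2) / 2 = pi^(n/2)], while the
    constant is [G / (2 pi^(n/2))]. *)
Lemma favard_cst_ball n :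
  (favard_cst R n)%:E * (n.+1%:R%:E * ball_integral (@norm_cos R n)) = 1.
Proof.
have KG := @ball_integral_norm_coord0 R n.
have HK := @ball_integral_norm_cosE R n.
have Hfin := @ball_integral_norm_cos_fin R n.
rewrite integral_Gamma_half_rec in KG.
set K := ball_integral (@norm_coord0 R n) in KG HK.
set H := ball_integral (@norm_cos R n) in HK Hfin *.
set G := \int[leb]_(u in `]0%R, +oo[) (Num.sqrt u ^+ n * expR (- u))%:E in KG.
have GE : Gamma (n.+2%:R / 2) = fine G.
  rewrite /Gamma /Rintegral; congr fine; apply: eq_integral => u.
  rewrite inE/= in_itv/= andbT => u0; congr (_ * _)%:E.
  rewrite -(powR_half n (ltW u0)); congr powR; rewrite -natr1 -natr1; by field.
have H0 : 0 <= H by apply: integral_ge0 => x _; rewrite lee_fin mulr_ge0// norm_cos_ge0.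
have K0 : 0 <= K by apply: integral_ge0 => x _; rewrite lee_fin mulr_ge0// norm_coord0_ge0.
have G0 : 0 <= G.
  by apply: integral_ge0 => x _; rewrite lee_fin mulr_ge0 ?expR_ge0// exprn_ge0// sqrtr_ge0.
(* Cancelling in the extended reals requires finiteness: [K] is at most the finite [H], and [G] is
   finite because its product with the positive [K] is. *)
have Kfin : K \is a fin_num.
  rewrite ge0_fin_numE// (@le_lt_trans _ _ H)//; last by rewrite -ge0_fin_numE.
  by rewrite HK leeDr// mule_ge0.
have p0 : (0 < Num.sqrt pi ^+ n :> R)%R by rewrite exprn_gt0// sqrtr_gt0 pi_gt0.
have Kn0 : K != 0 by apply: contraTneq p0 => K0'; move: KG; rewrite K0' mul0e => -[<-]; rewrite ltxx.
have Gfin : G \is a fin_num.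
  rewrite ge0_fin_numE// ltNge leye_eq; apply/eqP => Gy; move: KG.
  rewrite Gy gt0_muley ?lte_fin ?divr_gt0// gt0_muley//.
  by rewrite lt_neqAle eq_sym Kn0.
rewrite /favard_cst GE.
move: KG HK; rewrite -(fineK Kfin) -(fineK Gfin) -(fineK Hfin) /=.
rewrite -!EFinM -EFinD => -[KG] [HK]; congr EFin.
have piE : (pi `^ (n%:R / 2) = Num.sqrt pi ^+ n :> R)%R by rewrite powR_half// pi_ge0.
have n2 : (n.+2%:R != 0 :> R)%R by rewrite pnatr_eq0.
have HK' : (n.+1%:R * fine H = n.+2%:R * fine K)%R.
  have : (n.+2%:R * fine H = fine H + n.+2%:R * fine K)%R.
    by rewrite {1}HK mulrDr mulrA divff// mul1r.
  by rewrite -natr1 mulrDl mul1r addrC => /addrI.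
rewrite piE HK' -KG.
have g0 : (fine G != 0)%R by apply: contraTneq p0 => g0; rewrite -KG g0 !mulr0 ltxx.
have k0 : (fine K != 0)%R by apply: contraTneq p0 => k0; rewrite -KG k0 mul0r ltxx.
by field; rewrite g0 k0/= -natrD pnatr_eq0.
Qed.

(** An orthogonal change of variables carries [v / |v|] to the first axis, and the integrand on the
    ball becomes [|v|] times [norm_cos]. This is the identity that turns averages of [|<v, s>|] into
    Euclidean norms. *)
Lemma favard_cst_sphere n (v : 'rV[R]_n.+1) :
  (favard_cst R n)%:E *
    \int[surface_measure R n.+1]_(s in sphere) (`|dotp v s|)%:E = (enorm v)%:E.
Proof.
have mv : measurable_fun setT (fun s : 'rV[R]_n.+1 => (`|dotp v s|)%:E).
  apply/measurable_EFinP; apply: measurableT_comp => //.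
  by apply: measurable_dotp => //; exact: measurable_cst.
rewrite integral_sphere//.
have [->|v0] := eqVneq v 0%R.
  rewrite enorm0 (_ : \int[_]_x _ = 0) ?mule0//; apply: integral0_eq => x _.
  by rewrite -(scale0r (0%R : 'rV[R]_n.+1)) dotpZl mul0r normr0 mul0e.
have [H [HH Hs]] := orth_first_row (enormalize_sphere v0).
have vE : v = (enorm v *: (delta_mx ord0 ord0 *m H))%R.
  by rewrite -rowE Hs scalerA divff ?scale1r// enorm_eq0.
have vx x : (dotp v x = enorm v * (x *m H^T) ord0 ord0)%R.
  rewrite {1}vE dotpZl; congr (_ * _)%R; rewrite dotpE -mulmxA -{1}(trmxK H) -trmx_mul.
  by rewrite -rowE !mxE.
rewrite (_ : \int[_]_x _ = (enorm v)%:E * ball_integral (@norm_cos R n)).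
  by rewrite (muleCA n.+1%:R%:E) (muleCA (favard_cst R n)%:E) favard_cst_ball mule1.
have HH' : (H^T *m H^T^T = 1%:M)%R by rewrite trmxK; exact: mulmx1C.
have mB : measurable_fun setT (fun x : 'rV[R]_n.+1 => (norm_cos x * (enorm x <= 1)%R%:R)%:E).
  by apply/measurable_EFinP; apply: measurable_ball_ind; exact: measurable_norm_cos.
have B0 (x : 'rV[R]_n.+1) : 0 <= (norm_cos x * (enorm x <= 1)%R%:R)%:E.
  by rewrite lee_fin mulr_ge0// norm_cos_ge0.
rewrite /ball_integral -(integral_orth HH' mB B0) -ge0_integralZl_EFin//; last 2 first.
- exact: (measurableT_comp mB (measurable_rVM _ (@measurable_id _ _ _))).
- exact: enorm_ge0.
apply: eq_integral => x _; rewrite /norm_cos /norm_coord0 enorm_orth// -!EFinM; congr EFin.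
rewrite /enormalize dotpZr normrM ger0_norm ?invr_ge0 ?enorm_ge0// vx normrM ger0_norm ?enorm_ge0//.
have [->|x0] := eqVneq x 0%R; first by rewrite enorm0 invr0 !(mul0r,mulr0).
have -> : (0 < enorm x)%R by rewrite lt_neqAle enorm_ge0 eq_sym enorm_eq0 x0.
by rewrite /=; ring.
Qed.

End surface.

(** * From hyperplanes to slabs *)

Section hyperplanes.
Context (R : realType).
Local Notation leb := (@lebesgue_measure R).
Local Notation lebn := (lebesgue_rV R).
Local Open Scope ereal_scope.

Lemma frameP n (s : 'rV[R]_n.+1) : enorm s = 1%R -> is_frame s (frame s).
Proof.
move=> s1; apply: xgetPex; have [H [HH Hs]] := orth_first_row s1.
have HE i j : (\sum_k H i k * H j k = (i == j)%:R)%R.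
  by move: HH => /matrixP/(_ i j); rewrite !mxE => <-; apply: eq_bigr => k _; rewrite mxE.
exists (rowsub (lift ord0) H); split; apply/matrixP => i j; rewrite !mxE.
  rewrite -(inj_eq (@lift_inj _ ord0)) -HE; apply: eq_bigr => k _; by rewrite !mxE.
have := HE (lift ord0 i) ord0; rewrite eq_sym (negbTE (neq_lift _ _)) => H0.
by rewrite -[RHS]H0 ord1; apply: eq_bigr => k _; rewrite !mxE -Hs mxE.
Qed.

(** The orthogonal matrix that turns the splitting [(t, v)] of [cons_rV] into the component along
    [s] and the one in the hyperplane. *)
Definition full_frame n (s : 'rV[R]_n.+1) : 'M[R]_n.+1 :=
  \matrix_(i, j) if unlift ord0 i is Some k then frame s k j else s ord0 j.

Lemma full_frame_orth n (s : 'rV[R]_n.+1) : enorm s = 1%R ->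
  (full_frame s *m (full_frame s)^T = 1%:M)%R.
Proof.
move=> s1; have [QQ Qs] := frameP s1.
have ss : (dotp s s = 1)%R by rewrite -sqr_enorm s1 expr1n.
have QsE k : (\sum_j frame s k j * s ord0 j = 0)%R.
  have /matrixP/(_ k ord0) := Qs; rewrite !mxE => Q0.
  by rewrite -[RHS]Q0; apply: eq_bigr => j _; rewrite mxE.
apply/matrixP => i j; rewrite !mxE.
under eq_bigr do rewrite !mxE.
case: (unliftP ord0 i) => [i' ->|->]; case: (unliftP ord0 j) => [j' ->|->].
- rewrite (inj_eq (@lift_inj _ ord0)).
  by move: QQ => /matrixP/(_ i' j'); rewrite !mxE => <-; apply: eq_bigr => k _; rewrite mxE.
- by rewrite QsE eq_sym (negbTE (neq_lift _ _)).
- by under eq_bigr do rewrite mulrC; rewrite QsE (negbTE (neq_lift _ _)).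
- by rewrite eqxx -ss.
Qed.

Lemma cons_full_frame n (s : 'rV[R]_n.+1) (t : R) (v : 'rV[R]_n) :
  (cons_rV (t : measurableTypeR R, v) *m full_frame s = t *: s + v *m frame s)%R.
Proof.
apply/rowP => j; rewrite !mxE big_ord_recl !mxE unlift_none; congr (_ + _)%R.
by apply: eq_bigr => k _; rewrite !mxE liftK.
Qed.

Lemma dotp_frame n (s : 'rV[R]_n.+1) (v : 'rV[R]_n) : enorm s = 1%R ->
  (dotp (v *m frame s) s = 0)%R.
Proof. by move=> /frameP[_ Qs]; rewrite dotpE -mulmxA Qs mulmx0 mxE. Qed.

(** The matrix [frame s] is picked by choice, so nothing ensures that it is measurable in [s]. The
    slab of unit thickness replaces the hyperplane by an indicator that is measurable in [x] and [s]
    jointly. *)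
Definition slab n (s x : 'rV[R]_n.+1) : bool := (0 <= dotp x s < 1)%R.

Lemma measurable_slab d (T : measurableType d) n (f g : T -> 'rV[R]_n.+1) :
  measurable_fun setT f -> measurable_fun setT g ->
  measurable_fun setT (fun x => (slab (f x) (g x))%:R%:E : \bar R).
Proof.
move=> mf mg; apply/measurable_EFinP; apply: measurable_natr_bool.
apply: measurable_and.
  by apply: measurable_fun_ler; [exact: measurable_cst|exact: measurable_dotp].
by apply: measurable_fun_ltr; [exact: measurable_dotp|exact: measurable_cst].
Qed.

(** In the coordinates of [full_frame s], the slab is [0 <= t < 1] and [g] does not depend on [t],
    so the integral over [t] contributes the factor 1. *)
Lemma integral_hyperplane n (s : 'rV[R]_n.+1) (g : 'rV[R]_n.+1 -> \bar R) :
  enorm s = 1%R -> measurable_fun setT g -> (forall x, 0 <= g x) ->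
  (forall x t, g (x + t *: s)%R = g x) ->
  \int[lebesgue_hyperplane s]_(y in hyperplane s) g y =
  \int[lebn n.+1]_x (g x * (slab s x)%:R%:E).
Proof.
move=> s1 mg g0 gs.
have mh : measurable (hyperplane s).
  have := (measurable_dotp (@measurable_id _ _ setT) (measurable_cst s)) measurableT [set 0%R] (measurable_set1 _).
  by rewrite setTI.
have mgs : measurable_fun setT (fun x => g x * (slab s x)%:R%:E).
  by apply: emeasurable_funM => //; apply: measurable_slab => //; exact: measurable_cst.
have gs0 x : 0 <= g x * (slab s x)%:R%:E by rewrite mule_ge0// lee_fin.
transitivity (\int[lebn n]_v g (v *m frame s)%R).
  rewrite /lebesgue_hyperplane (ge0_integral_pushforward (measurable_mulmx_frame s))//; last exact: measurable_funTS.
  rewrite (_ : _ @^-1` _ = setT)//; apply/seteqP; split => // v _ /=.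
  exact: dotp_frame.
rewrite -(integral_orth (full_frame_orth s1) mgs gs0) integral_lebesgue_rVS//; last first.
  exact: (measurableT_comp mgs (measurable_rVM _ (@measurable_id _ _ _))).
transitivity (\int[leb]_t (((0 <= t < 1)%R)%:R%:E * \int[lebn n]_v g (v *m frame s)%R)).
  rewrite ge0_integralZr//.
  - rewrite (_ : \int[leb]_x _ = 1) ?mul1e//.
    transitivity (\int[leb]_(t in [set` `[0%R, 1%R[]) (cst 1 t)).
      rewrite [RHS]integral_mkcond; apply: eq_integral => t _.
      by rewrite patchE mem_setE in_itv/=; case: ifP.
    transitivity (1 * leb [set` `[0%R, 1%R[]); first exact: integral_cst.
    by rewrite mul1e lebesgue_measure_itv/= lte_fin ltr01 oppr0 adde0.
  - apply/measurable_EFinP; apply: measurable_natr_bool; apply: measurable_and.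
      by apply: measurable_fun_ler => //; exact: measurable_cst.
    by apply: measurable_fun_ltr => //; exact: measurable_cst.
  - exact: integral_ge0.
apply: eq_integral => t _; rewrite muleC -ge0_integralZr//.
- apply: eq_integral => v _; rewrite cons_full_frame addrC gs /slab.
  by rewrite dotpDl dotp_frame// dotpZl -sqr_enorm s1 expr1n mulr1 add0r.
- exact: measurableT_comp mg (measurable_mulmx_frame s).
Qed.

End hyperplanes.

Section counting_lines.
Context (R : realType).
Local Notation lebn := (lebesgue_rV R).
Local Open Scope ereal_scope.

Lemma counting_image_inj (S U : choiceType) (f : S -> U) (A : set S) :
  injective f -> counting (f @` A) = counting A :> \bar R.
Proof.
move=> fi; have cA : (f @` A #= A)%card by apply: inj_card_eq => x y _ _; exact: fi.
have [fA|iA] := pselect (finite_set A); last first.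
  by rewrite /counting !asboolF// (eq_finite_set cA).
have fA' : finite_set (f @` A) by exact: finite_image.
by rewrite /counting !asboolT//; move: cA => /(fcard_eq fA' fA) ->.
Qed.

Definition line_count n (A : set 'rV[R]_n) (x s : 'rV[R]_n) : \bar R :=
  counting [set t : R | A (x + t *: s)%R].

Lemma line_count_ge0 n (A : set 'rV[R]_n) x s : 0 <= line_count A x s.
Proof. by rewrite /line_count /counting; case: ifPn => // _; rewrite lee_fin. Qed.

Lemma line_count_shift n (A : set 'rV[R]_n) x s t :
  line_count A (x + t *: s)%R s = line_count A x s.
Proof.
rewrite /line_count -[RHS](@counting_image_inj _ _ (fun u => u - t)%R); last exact: addIr.
congr counting; apply/seteqP; split => u /=.
  by move=> Au; exists (t + u)%R; [rewrite scalerDl addrA|rewrite addrC addKr].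
by move=> [v Av <-]; rewrite -addrA -scalerDl [(t + _)%R]addrC subrK.
Qed.

Lemma counting_line n (A : set 'rV[R]_n.+1) (y s : 'rV[R]_n.+1) : s != 0%R ->
  counting (line y s `&` A) = line_count A y s.
Proof.
move=> s0; rewrite /line_count -[RHS](@counting_image_inj _ _ (fun t => y + t *: s)%R).
  congr counting; apply/seteqP; split => x /=.
    by move=> [[t _ <-] Ax]; exists t.
  by move=> [t At <-]; split => //; exists t.
move=> t u /addrI /eqP; rewrite -subr_eq0 -scalerBl scaler_eq0 (negbTE s0) orbF subr_eq0.
by move=> /eqP.
Qed.

Lemma sphere_neq0 n (s : 'rV[R]_n) : enorm s = 1%R -> s != 0%R.
Proof. by move=> s1; rewrite -enorm_eq0 s1 oner_eq0. Qed.

(** For [n > 0] this is [integral_hyperplane] applied to the line count, which is constant along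
    [s]. For [n = 0], where [favard] is the cardinality, the same formula has to be verified. *)
Lemma favardE n (A : set 'rV[R]_n.+1) :
  measurable_fun setT (fun z : 'rV[R]_n.+1 * 'rV[R]_n.+1 => line_count A z.1 z.2) ->
  favard A = (favard_cst R n)%:E * \int[surface_measure R n.+1]_(s in sphere)
    \int[lebn n.+1]_x (line_count A x s * (slab s x)%:R%:E).
Proof.
move=> mA.
have mAs s : measurable_fun setT (fun x => line_count A x s).
  exact: measurableT_comp mA (@measurable_pair2 _ _ _ _ s).
rewrite /favard; case: ifPn => [/eqP n0|_]; last first.
  congr (_ * _); apply: eq_integral => s; rewrite inE /sphere/= => s1.
  rewrite -integral_hyperplane//; last by move=> x t; exact: line_count_shift.
  by apply: eq_integral => y _; rewrite counting_line// sphere_neq0.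
(* On the line, every [line y s] is the whole space, so the count is that of [A] for each direction;
   the total weight of the average is 1, by [favard_cst_sphere] for the vector with coordinate 1. *)
subst n.
have lcE x s : enorm s = 1%R -> line_count A x s = counting A.
  move=> s1; rewrite -counting_line ?sphere_neq0//.
  congr counting; apply/seteqP; split => [y []//|y Ay]; split => //.
  have s0 : (s ord0 ord0 != 0)%R.
    apply: contra_eq_neq s1 => s0; rewrite (_ : s = 0%R) ?enorm0 1?eq_sym ?oner_eq0//.
    by apply/rowP => i; rewrite !ord1 mxE.
  exists ((y ord0 ord0 - x ord0 ord0) / s ord0 ord0)%R => //.
  by apply/rowP => i; rewrite !ord1 !mxE divfK// addrC subrK.
have c0 : 0 <= counting A :> \bar R by rewrite /counting; case: ifPn => // _; rewrite lee_fin.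
transitivity ((favard_cst R 0)%:E * \int[surface_measure R 1]_(s in sphere)
    (counting A * (`|dotp (const_mx 1 : 'rV[R]_1) s|)%:E)).
  rewrite ge0_integralZl//; last 2 first.
  - exact: measurable_sphere.
  - apply/measurable_EFinP/measurable_funTS; apply: measurableT_comp => //.
    by apply: measurable_dotp => //; exact: measurable_cst.
  rewrite muleCA favard_cst_sphere /enorm /dotp big_ord1 !mxE mulr1 sqrtr1 mule1//.
congr (_ * _); apply: eq_integral => s; rewrite inE /sphere/= => s1.
rewrite (eq_integral (fun x => counting A * (slab s x)%:R%:E)); last first.
  by move=> x _; rewrite lcE.
rewrite ge0_integralZl//; last first.
  by apply: measurable_slab => //; exact: measurable_cst.
congr (_ * _); transitivity (1 : \bar R).
  move: s1; rewrite /enorm /dotp !big_ord1 mxE mul1r -expr2 sqrtr_sqr => -> //.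
transitivity (\int[lebn 1]_x (1 * (slab s x)%:R%:E)); last first.
  by apply: eq_integral => x _; rewrite mul1e.
rewrite -(@integral_hyperplane _ _ s (cst 1))//.
rewrite integral_cst//; last first.
  have := (measurable_dotp (@measurable_id _ _ setT) (measurable_cst s)) measurableT [set 0%R] (measurable_set1 _).
  by rewrite setTI.
rewrite mul1e /lebesgue_hyperplane /= /pushforward (_ : _ @^-1` _ = setT) ?diracT//.
by apply/seteqP; split => // v _ /=; exact: dotp_frame.
Qed.

End counting_lines.

(** * Independence of uncorrelated Gaussian variables *)

Section cosine_kernel.
Context (R : realType).
Local Notation leb := (@lebesgue_measure R).
Local Open Scope ereal_scope.

Lemma abs_sin_le (x : R) : (`|sin x| <= `|x|)%R.
Proof.
wlog x0 : x / (0 < x)%R => [H|].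
  have [->|] := eqVneq x 0%R; first by rewrite sin0 normr0.
  rewrite neq_lt => /orP[xn|xp]; last exact: H.
  by rewrite -normrN -sinN -(normrN x); apply: H; rewrite oppr_gt0.
have [] := @MVT R (@sin R) (@cos R) 0%R x x0.
- by apply: continuous_subspaceT; exact: continuous_sin.
move=> c _; rewrite sin0 !subr0 => ->; rewrite normrM -[leRHS]mul1r.
by rewrite ler_wpM2r// cos_max.
Qed.

Lemma cos_le_sqr (x : R) : (1 - cos x <= x ^+ 2 / 2)%R.
Proof.
have -> : (x = (x / 2) *+ 2)%R by rewrite -mulr_natr divfK.
rewrite cos_mulr2n cos2sin2.
have : (sin (x / 2) ^+ 2 <= (x / 2) ^+ 2)%R.
  by rewrite -[leLHS]real_normK ?num_real// -[leRHS]real_normK ?num_real// lerXn2r ?nnegrE ?abs_sin_le.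
rewrite [X in _ -> (_ <= X)%R](_ : _ = 2 * (x / 2) ^+ 2)%R; last by field.
rewrite -mulr_natl; lra.
Qed.

Definition cos_kernel (p : R) : R := ((1 - cos p) / p ^+ 2)%R.

Lemma cos_kernel_ge0 p : (0 <= cos_kernel p)%R.
Proof. by rewrite divr_ge0 ?sqr_ge0// subr_ge0 cos_le1. Qed.

Lemma measurable_inv_sqr : measurable_fun [set: R] (fun x : R => x ^- 2)%R.
Proof.
rewrite (_ : (fun _ => _) = (@powR R ^~ (-1)%R) \o (fun x : R => x ^+ 2)%R).
  apply: measurableT_comp; first exact: measurable_powR.
  exact: (continuous_measurable_fun (@exprn_continuous _ 2)).
by apply/funext => v /=; rewrite powR_inv1// sqr_ge0.
Qed.

Lemma measurable_cos_kernel : measurable_fun setT cos_kernel.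
Proof.
apply: measurable_funM.
  by apply: measurable_funB => //; exact: continuous_measurable_fun (@continuous_cos R).
exact: measurable_inv_sqr.
Qed.

(** Its value is [pi / 2]; it is later cancelled from both sides of an equality, which takes only
    [0 < cos_kernel_cst < +oo]. *)
Definition cos_kernel_cst : \bar R := \int[leb]_(p in `]0%R, +oo[) (cos_kernel p)%:E.

Lemma integral_inv_sqr : \int[leb]_(p in `[1%R, +oo[) (p ^- 2)%:E = 1.
Proof.
rewrite (@ge0_continuous_FTC2y _ _ (fun p => - p^-1)%R _ 0%R).
- by rewrite invr1 EFinN oppeK add0e.
- by move=> x _; rewrite invr_ge0 sqr_ge0.
- apply/continuous_within_itvcyP; split.
    move=> x; rewrite in_itv/= andbT => x1; apply: cvgV.
      by rewrite gt_eqF// exprn_gt0// (lt_trans _ x1).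
    exact: exprn_continuous.
  apply: cvg_at_right_filter; apply: cvgV; first by rewrite expr1n oner_eq0.
  exact: exprn_continuous.
- rewrite -oppr0; apply: cvgN; apply/gtr0_cvgV0; last exact: cvg_id.
  exact: nbhs_pinfty_gt.
- move=> x x1; apply: derivableN; apply: derivableV => //.
  by rewrite gt_eqF// (lt_trans _ x1).
- apply: cvg_at_right_filter; apply: cvgN; apply: cvgV; first by rewrite oner_eq0.
  exact: cvg_id.
- move=> x; rewrite in_itv/= andbT => x1; rewrite derive1E.
  have x0 : x != 0%R by rewrite gt_eqF// (lt_trans _ x1).
  have h := is_deriveN (is_deriveV x0 (is_derive_id x (1%R : R))).
  have [_ ->] : is_derive x (1%R : R) (fun p => - p^-1)%R (x ^- 2)%R; last by [].
  by apply: is_derive_eq h _; rewrite scaleNr opprK /GRing.scale/= mulr1.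
Qed.

(** Below 1 the kernel is at most [1/2], above 1 it is at most [2 / p^2]. *)
Lemma cos_kernel_cst_lty : cos_kernel_cst < +oo.
Proof.
have mk (D : set (measurableTypeR R)) : measurable_fun D (fun p : measurableTypeR R => (cos_kernel p)%:E).
  by apply/measurable_EFinP/measurable_funTS; exact: measurable_cos_kernel.
have k0 (p : R) : 0 <= (cos_kernel p)%:E by rewrite lee_fin cos_kernel_ge0.
rewrite /cos_kernel_cst.
have -> : `]0%R, +oo[%classic = (`]0%R, 1%R[ `|` `[1%R, +oo[)%classic :> set R.
  by rewrite -(@itv_bndbnd_setU _ _ _ (BLeft 1%R)) // bnd_simp.
rewrite ge0_integral_setU//; last first.
  apply/disj_setPLR => x /=; rewrite !in_itv/= => /andP[_ x1]; rewrite andbT => x1'.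
  by rewrite ltNge x1' in x1.
rewrite lte_add_pinfty//.
  apply: (@le_lt_trans _ _ (\int[leb]_(p in `]0%R, 1%R[) (cst (2^-1)%:E p))).
    apply: ge0_le_integral => //.
    move=> p /=; rewrite in_itv/= => /andP[p0 _]; rewrite lee_fin /cos_kernel.
    by rewrite ler_pdivrMr ?exprn_gt0// mulrC cos_le_sqr.
  apply: (@le_lt_trans _ _ ((2^-1)%:E * leb [set` `]0%R, 1%R[])).
    by rewrite integral_cst.
  by rewrite lebesgue_measure_itv/= lte_fin ltr01 -EFinB -EFinM ltry.
apply: (@le_lt_trans _ _ (\int[leb]_(p in `[1%R, +oo[) (2%:E * (p ^- 2)%:E))).
  apply: ge0_le_integral => //.
  - apply: emeasurable_funM => //; apply/measurable_EFinP/measurable_funTS.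
    exact: measurable_inv_sqr.
  - move=> p _; rewrite -EFinM lee_fin /cos_kernel ler_wpM2r ?invr_ge0 ?sqr_ge0//.
    by rewrite lerBlDr -lerBlDl; have := cos_geN1 p; lra.
rewrite ge0_integralZl_EFin//; last 2 first.
- by move=> p _; rewrite lee_fin invr_ge0 sqr_ge0.
- by apply/measurable_EFinP/measurable_funTS; exact: measurable_inv_sqr.
by rewrite integral_inv_sqr mule1 ltry.
Qed.

Lemma cos_kernel_cst_gt0 : 0 < cos_kernel_cst.
Proof.
have c1 : (cos 1 < 1 :> R)%R.
  have pi2 : (2 <= pi :> R)%R by have := @pihalf_ge1 R; lra.
  rewrite -[ltRHS]cos0 ltr_cos// in_itv/=; lra.
(* On [[1, 2]], where the cosine decreases since [2 <= pi], the numerator is at least [1 - cos 1]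
   and the denominator at most 4. *)
apply: (@lt_le_trans _ _ (\int[leb]_(p in `[1%R, 2%R]) (cst ((1 - cos 1) / 4)%:E p))).
  apply: (@lt_le_trans _ _ (((1 - cos 1) / 4)%:E * leb [set` `[1%R, 2%R]])).
    rewrite lebesgue_measure_itv/= lte_fin ifT; last by lra.
    by rewrite -EFinB -EFinM lte_fin; nra.
  by rewrite integral_cst.
apply: (@le_trans _ _ (\int[leb]_(p in `[1%R, 2%R]) (cos_kernel p)%:E)).
  apply: ge0_le_integral => //.
  - by move=> p _; rewrite lee_fin; lra.
  - by apply/measurable_EFinP/measurable_funTS; exact: measurable_cos_kernel.
  - move=> p /=; rewrite in_itv/= => /andP[p1 p2]; rewrite lee_fin /cos_kernel.
    have pi2 : (2 <= pi :> R)%R by have := @pihalf_ge1 R; lra.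
    apply: ler_pM.
    + by rewrite subr_ge0 cos_le1.
    + lra.
    + rewrite lerD2l lerN2; move: p1; rewrite le_eqVlt => /predU1P[->//|p1].
      by apply/ltW; rewrite ltr_cos// in_itv/=; lra.
    + rewrite lef_pV2 ?posrE; [nra|lra|nra].
apply: ge0_subset_integral => //.
- by apply/measurable_EFinP/measurable_funTS; exact: measurable_cos_kernel.
- by move=> p _; rewrite lee_fin cos_kernel_ge0.
- by move=> p /=; rewrite !in_itv/= andbT; lra.
Qed.

(** Since [(1 - cos (p y)) / p^2] is [y^2] times the kernel at [p y], scaling leaves one factor
    [|y|]. The absolute value is thereby a superposition of cosines. *)
Lemma integral_cos_kernel (y : R) :
  \int[leb]_(p in `]0%R, +oo[) ((1 - cos (p * y)) / p ^+ 2)%:E = cos_kernel_cst * `|y|%:E.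
Proof.
wlog y0 : y / (0 <= y)%R => [H|].
  have [/H//|/ltW] := leP 0%R y; rewrite -oppr_ge0 => /H; rewrite normrN => <-.
  by apply: eq_integral => p _; rewrite mulrN cosN.
move: y0; rewrite le_eqVlt => /predU1P[<-|y0].
  rewrite normr0 mule0; apply: integral0_eq => p _; by rewrite mulr0 cos0 subrr mul0r.
rewrite gtr0_norm// /cos_kernel_cst.
pose f (p : R) : \bar R := (cos_kernel p * (0 < p)%R%:R)%:E.
have mf : measurable_fun [set: measurableTypeR R] f.
  apply/measurable_EFinP; apply: measurable_funM; first exact: measurable_cos_kernel.
  by apply: measurable_ind_lt => //; exact: measurable_cst.
have f0 p : 0 <= f p by rewrite lee_fin mulr_ge0// cos_kernel_ge0.
have fE : \int[leb]_(p in `]0%R, +oo[) (cos_kernel p)%:E = \int[leb]_p f p.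
  rewrite integral_mkcond; apply: eq_integral => p _.
  by rewrite patchE mem_setE in_itv/= andbT /f; case: ifP; rewrite ?mulr1 ?mulr0.
have := integral_lebesgue_scale y0 mf f0; rewrite -fE.
move=> /(congr1 (fun z => (y ^+ 2)%:E * z)); rewrite muleA -EFinM.
rewrite (_ : (y ^+ 2 * y^-1 = y)%R); last by rewrite expr2 mulfK// gt_eqF.
rewrite [RHS]muleC => <-.
rewrite -ge0_integralZl_EFin ?sqr_ge0//; last first.
  apply: (measurableT_comp mf).
  by apply: measurable_funM => //; exact: measurable_cst.
rewrite [LHS]integral_mkcond; apply: eq_integral => p _.
rewrite patchE mem_setE in_itv/= andbT /f -EFinM pmulr_rgt0//.
case: ifP => p0; last by rewrite !mulr0.
rewrite mulr1 /cos_kernel [(y * p)%R]mulrC; congr EFin.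
by field; rewrite !gt_eqF.
Qed.

End cosine_kernel.

Lemma integral_probability_cst d (T : measurableType d) (R : realType) (P : probability T R) (c : R) :
  (\int[P]_w c%:E = c%:E)%E.
Proof. by rewrite integral_cst//= probability_setT mule1. Qed.

Section density.
Context d (T : measurableType d) (R : realType) (mu : {measure set T -> \bar R}).
Variable g : T -> R.
Hypotheses (mg : measurable_fun setT g) (g0 : forall x, 0 <= g x).
Local Open Scope ereal_scope.

Let mgE : measurable_fun setT (fun x => (g x)%:E).
Proof. exact/measurable_EFinP. Qed.

Let g0E x : 0 <= (g x)%:E.
Proof. by rewrite lee_fin. Qed.

(** The two proofs are arguments so that the measure structure, which rests on them, can be attached
    to the function. *)
Definition density_measure of measurable_fun setT g & (forall x, (0 <= g x)%R) :=
  fun A : set T => \int[mu]_(x in A) (g x)%:E.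

Local Notation nu := (density_measure mg g0).

Let density0 : nu set0 = 0.
Proof. by rewrite /density_measure integral_set0. Qed.

Let density_ge0 A : 0 <= nu A.
Proof. by apply: integral_ge0 => x _; rewrite lee_fin. Qed.

Let density_sigma_additive : semi_sigma_additive nu.
Proof.
move=> /= F mF tF mUF; rewrite /density_measure; apply: cvg_toP.
  apply: ereal_nondecreasing_is_cvgn => m n mn.
  by apply: lee_sum_nneg_natr => // k _ _; apply: integral_ge0 => x _; rewrite lee_fin.
by rewrite ge0_integral_bigcup//=; exact: measurable_funTS.
Qed.

HB.instance Definition _ := isMeasure.Build _ _ _ nu
  density0 density_ge0 density_sigma_additive.

Let integral_density_indic E : measurable E ->
  \int[nu]_x (\1_E x)%:E = \int[mu]_x ((\1_E x)%:E * (g x)%:E).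
Proof.
move=> mE; rewrite integral_indic//= /density_measure setIT integral_mkcond.
apply: eq_integral => x _; rewrite patchE indicE.
by case: ifP => xE; rewrite ?xE ?mul1e// mul0e.
Qed.

Import HBNNSimple.

Let integral_density_nnsfun (f : {nnsfun T >-> R}) :
  \int[nu]_x (f x)%:E = \int[mu]_x ((f x)%:E * (g x)%:E).
Proof.
have f0 (y : R) x : (0 <= (y * \1_(f @^-1` [set y]) x)%:E)%E.
  by rewrite EFinM nnfun_muleindic_ge0.
under [LHS]eq_integral do rewrite fimfunE -fsumEFin//.
rewrite [LHS]ge0_integral_fsum//; last first.
  by move=> r; exact/measurable_EFinP/measurableT_comp.
under [RHS]eq_integral do rewrite fimfunE -fsumEFin// ge0_mule_fsuml//.
rewrite [RHS]ge0_integral_fsum//; last 2 first.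
  - move=> r; apply: emeasurable_funM => //.
    by apply/measurable_EFinP; do 2 apply/measurableT_comp => //.
  - by move=> n x _; rewrite mule_ge0.
apply: eq_fsbigr => r _.
have [r0|r0] := leP 0%R r.
  under eq_integral do rewrite EFinM.
  rewrite ge0_integralZl//; last first.
  - by apply/measurable_EFinP; exact: measurable_indic.
  rewrite integral_density_indic// -ge0_integralZl//.
  - by apply: eq_integral => x _; rewrite EFinM muleA.
  - apply: emeasurable_funM => //; apply/measurable_EFinP; exact: measurable_indic.
  - by move=> x _; rewrite mule_ge0.
have e : f @^-1` [set r] = set0.
  apply/seteqP; split => // x /= fx; have := @fun_ge0 _ _ f x.
  by move=> h; move: r0; rewrite -fx ltNge => /negP; apply; exact: h.
by rewrite e !integral0_eq// => x _; rewrite indic0 mulr0 ?mul0e.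
Qed.

Lemma integral_density_measure (f : T -> \bar R) :
  measurable_fun setT f -> (forall x, 0 <= f x) ->
  \int[nu]_x f x = \int[mu]_x (f x * (g x)%:E).
Proof.
move=> mf f0.
pose f_ := nnsfun_approx measurableT mf.
transitivity (lim (\int[nu]_x (f_ n x)%:E @[n --> \oo])%E).
  rewrite -monotone_convergence//=.
  - apply: eq_integral => ? /[!inE] xD; apply/esym/cvg_lim => //=.
    exact: cvg_nnsfun_approx.
  - by move=> n; exact/measurable_EFinP/measurable_funTS.
  - by move=> n ? _; rewrite lee_fin.
  - by move=> ? _ ? ? mn; rewrite lee_fin; exact/lefP/nd_nnsfun_approx.
rewrite [RHS](_ : _ = lim (\int[mu]_x ((f_ n x)%:E * (g x)%:E) @[n --> \oo])%E).
  by apply: congr_lim; apply/funext => n /=; exact: integral_density_nnsfun.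
rewrite -monotone_convergence//=.
- apply: eq_integral => x _; apply/esym/cvg_lim => //.
  by apply: cvgeZr => //; exact: cvg_nnsfun_approx.
- move=> n; apply: emeasurable_funM => //.
  exact/measurable_EFinP/measurable_funTS.
- by move=> n x _; rewrite mule_ge0// lee_fin.
- move=> x _ a b ab; apply: lee_wpmul2r => //.
  by rewrite lee_fin; exact/lefP/nd_nnsfun_approx.
Qed.

End density.

(** * Uniqueness for cosine transforms *)

Section cosine_transform.
Context d (T : measurableType d) (R : realType) (P : probability T R).
Variable X : T -> R.
Hypothesis mX : measurable_fun setT X.
Local Notation leb := (@lebesgue_measure R).
Local Open Scope ereal_scope.

(** The phase [pi - p * a] writes [1 - cos (p (X - a))] in the form [1 + cos (p X + th)] in which
    the transforms are given. Adding 1 to the cosine keeps all integrands nonnegative, as Tonelli's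
    theorem requires. *)
Lemma abs_transformE (g : T -> R) (a : R) : measurable_fun setT g -> (forall w, (0 <= g w)%R) ->
  cos_kernel_cst R * \int[P]_w (`|X w - a| * g w)%:E =
  \int[leb]_(p in `]0%R, +oo[) ((p ^- 2)%:E *
    \int[P]_w ((1 + cos (p * X w + (pi - p * a))) * g w)%:E).
Proof.
move=> mg g0.
pose F (w : T) (p : R) : \bar R := (p ^- 2 * ((1 + cos (p * X w + (pi - p * a))) * g w) * (0 < p)%R%:R)%:E.
have mp : measurable_fun setT (fun z : T * measurableTypeR R => z.2) by exact: measurable_snd.
have mc : measurable_fun setT (fun z : T * measurableTypeR R =>
    (1 + cos (z.2 * X z.1 + (pi - z.2 * a))) * g z.1)%R.
  apply: measurable_funM; last exact: measurableT_comp mg measurable_fst.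
  apply: measurable_funD; first exact: measurable_cst.
  apply: (measurableT_comp (continuous_measurable_fun (@continuous_cos R))).
  apply: measurable_funD; first by apply: measurable_funM => //; exact: measurableT_comp mX measurable_fst.
  apply: measurable_funB; first exact: measurable_cst.
  by apply: measurable_funM => //; exact: measurable_cst.
have c0 p w : (0 <= (1 + cos (p * X w + (pi - p * a))) * g w)%R.
  by rewrite mulr_ge0// -lerBlDl sub0r cos_geN1.
have mF : measurable_fun setT (fun z : T * measurableTypeR R => F z.1 z.2).
  apply/measurable_EFinP; apply: measurable_funM; last first.
    by apply: measurable_ind_lt => //; exact: measurable_cst.
  apply: measurable_funM => //; exact: (measurableT_comp (@measurable_inv_sqr R) mp).
have F0 w p : 0 <= F w p by rewrite lee_fin !mulr_ge0// ?invr_ge0 ?sqr_ge0//; apply: c0.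
have cE p w : (1 + cos (p * X w + (pi - p * a)) = 1 - cos (p * (X w - a)))%R.
  by rewrite addrA addrAC cosDpi mulrBr.
transitivity (\int[P]_w \int[leb]_p F w p).
  rewrite -ge0_integralZl//; last 3 first.
  - apply/measurable_EFinP; apply: measurable_funM => //.
    by apply: measurableT_comp => //; apply: measurable_funB => //; exact: measurable_cst.
  - by move=> w _; rewrite lee_fin mulr_ge0.
  - by rewrite ltW// cos_kernel_cst_gt0.
  apply: eq_integral => w _; rewrite EFinM muleA -integral_cos_kernel muleC.
  rewrite -ge0_integralZl_EFin//; last 2 first.
  - by move=> p _; rewrite lee_fin divr_ge0 ?sqr_ge0// subr_ge0 cos_le1.
  - apply/measurable_EFinP/measurable_funTS; apply: measurable_funM.
      apply: measurable_funB; first exact: measurable_cst.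
      apply: (measurableT_comp (continuous_measurable_fun (@continuous_cos R))).
      by apply: measurable_funM => //; exact: measurable_cst.
    exact: measurable_inv_sqr.
  rewrite integral_mkcond; apply: eq_integral => p _.
  rewrite patchE mem_setE in_itv/= andbT /F cE.
  by case: ifP => p0; rewrite ?mulr1 ?mulr0// -EFinM; congr EFin; ring.
rewrite (fubini_tonelli (fun z : T * measurableTypeR R => F z.1 z.2))//=.
rewrite [RHS]integral_mkcond; apply: eq_integral => p _.
rewrite patchE mem_setE in_itv/= andbT /F.
case: ifP => p0; last by apply: integral0_eq => w _; rewrite mulr0.
rewrite -ge0_integralZl_EFin//.
- by apply: eq_integral => w _; rewrite mulr1.
- by move=> w _; rewrite lee_fin; exact: c0.
- apply/measurable_EFinP; exact: (measurableT_comp mc (@measurable_pair2 _ _ _ _ (p : measurableTypeR R))).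
- by rewrite invr_ge0 sqr_ge0.
Qed.

Variables (g1 g2 : T -> R) (M : R).
Hypotheses (mg1 : measurable_fun setT g1) (mg2 : measurable_fun setT g2).
Hypotheses (g1M : forall w, (0 <= g1 w <= M)%R) (g2M : forall w, (0 <= g2 w <= M)%R).
Hypothesis iX : P.-integrable setT (EFin \o X).
Hypothesis cos_eq : forall p th : R,
  \int[P]_w ((1 + cos (p * X w + th)) * g1 w)%:E =
  \int[P]_w ((1 + cos (p * X w + th)) * g2 w)%:E.

Let ig1 w : (0 <= g1 w)%R. Proof. by case/andP: (g1M w). Qed.
Let ig2 w : (0 <= g2 w)%R. Proof. by case/andP: (g2M w). Qed.

(* [\int (1 - cos (p y)) / p^2 dp] is a multiple of [|y|], so the cosine
   transforms determine [E |X - a| g], whose slopes in [a] are the weights of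
   half-lines. *)
Lemma abs_transform_eq (a : R) :
  \int[P]_w (`|X w - a| * g1 w)%:E = \int[P]_w (`|X w - a| * g2 w)%:E.
Proof.
have C0 := cos_kernel_cst_gt0 R; have Cy := cos_kernel_cst_lty R.
have Cf : cos_kernel_cst R \is a fin_num by rewrite ge0_fin_numE// ltW.
have : cos_kernel_cst R * \int[P]_w (`|X w - a| * g1 w)%:E =
    cos_kernel_cst R * \int[P]_w (`|X w - a| * g2 w)%:E.
  by rewrite !abs_transformE//; apply: eq_integral => p _; rewrite cos_eq.
rewrite -(fineK Cf).
have c0 : (fine (cos_kernel_cst R) != 0)%R by rewrite gt_eqF// fine_gt0// C0 Cy.
move=> /(congr1 (fun z => (fine (cos_kernel_cst R))^-1%:E * z)).
by rewrite !muleA -!EFinM mulVf// !mul1e.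
Qed.

Lemma mass_transform_eq : \int[P]_w (g1 w)%:E = \int[P]_w (g2 w)%:E.
Proof.
have := cos_eq 0 0.
rewrite (eq_integral (fun w => 2%:E * (g1 w)%:E)); last first.
  by move=> w _; rewrite mul0r addr0 cos0 -EFinM.
rewrite [in RHS](eq_integral (fun w => 2%:E * (g2 w)%:E)); last first.
  by move=> w _; rewrite mul0r addr0 cos0 -EFinM.
rewrite !ge0_integralZl_EFin//; try exact/measurable_EFinP; try by move=> w _; rewrite lee_fin.
move=> /(congr1 (fun z => (2^-1)%:E * z)).
by rewrite !muleA -!EFinM mulVf// !mul1e.
Qed.

Lemma integrable_linear_weight (f g : T -> R) (A B : R) :
  measurable_fun setT f -> measurable_fun setT g -> (forall w, 0 <= g w <= M)%R ->
  (forall w, `|f w| <= A + B * `|X w|)%R ->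
  P.-integrable setT (EFin \o (fun w => f w * g w)%R).
Proof.
move=> mf mg gM fX.
apply: (@le_integrable _ _ _ P setT measurableT _ (fun w => (M * (A + B * `|X w|))%:E)).
- by apply/measurable_EFinP; exact: measurable_funM.
- move=> w _ /=; rewrite lee_fin normrM mulrC.
  have /andP[gw0 gwM] := gM w.
  rewrite [leRHS]ger0_norm; last first.
    by rewrite mulr_ge0 ?(le_trans gw0 gwM)// (le_trans (normr_ge0 (f w)) (fX w)).
  by rewrite ler_pM// ger0_norm.
- have -> : (fun w => (M * (A + B * `|X w|))%:E) =
      (fun w => M%:E * (A%:E + B%:E * (EFin \o (fun w => `|X w|)%R) w)).
    by apply/funext => w; rewrite EFinM EFinD EFinM.
  apply: integrableZl => //; apply: integrableD => //.
    exact: finite_measure_integrable_cst.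
  by apply: integrableZl => //; exact: integrable_norm.
Qed.

(** As a function of [X], [D k] is the ramp that is 0 up to [a], 1 from [a + 1/(k+1)] on, and affine
    between. It is a combination of 1 and of two functions [|X - b|], for which the weights agree,
    and it tends to the indicator of [a < X]. *)
Lemma ray_transform_eq (a : R) :
  \int[P]_w ((a < X w)%R%:R * g1 w)%:E = \int[P]_w ((a < X w)%R%:R * g2 w)%:E.
Proof.
pose D k w : R := ((1 + k.+1%:R * (`|X w - a| - `|X w - (a + k.+1%:R^-1)|)) / 2)%R.
have mabs b : measurable_fun setT (fun w => `|X w - b|)%R.
  by apply: measurableT_comp => //; apply: measurable_funB => //; exact: measurable_cst.
have mD k : measurable_fun setT (D k).
  apply: measurable_funM; last exact: measurable_cst.
  apply: measurable_funD; first exact: measurable_cst.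
  by apply: measurable_funM; [exact: measurable_cst|exact: measurable_funB].
have D01 k w : (0 <= D k w <= 1)%R.
  have k0 : (0 < k.+1%:R :> R)%R by [].
  have e : (`| `|X w - a| - `|X w - (a + k.+1%:R^-1)| | <= k.+1%:R^-1)%R.
    apply: le_trans (ler_dist_dist _ _) _; rewrite opprD addrACA subrr add0r opprK.
    by rewrite addKr ger0_norm.
  have : (k.+1%:R * `| `|X w - a| - `|X w - (a + k.+1%:R^-1)| | <= 1)%R.
    by rewrite -ler_pdivlMl// mulr1.
  rewrite -[X in (X * _)%R](ger0_norm (ltW k0)) -normrM ler_norml => /andP[e1 e2].
  by rewrite /D; lra.
have cD (g : T -> R) : measurable_fun setT g -> (forall w, 0 <= g w <= M)%R ->
    (fun k => \int[P]_w (D k w * g w)%:E) @ \oo --> \int[P]_w ((a < X w)%R%:R * g w)%:E.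
  move=> mg gM.
  have [] := @dominated_convergence _ _ _ P setT measurableT
    (fun k w => (D k w * g w)%:E) (fun w => ((a < X w)%R%:R * g w)%:E) (cst M%:E).
  - by move=> k; apply/measurable_EFinP; exact: measurable_funM.
  - apply/measurable_EFinP; apply: measurable_funM => //.
    by apply: measurable_ind_lt => //; exact: measurable_cst.
  - apply: aeW => w _; apply: cvg_EFin; first exact: nearW.
    apply: cvgMl; have [Xa|Xa] := ltP a (X w).
      have e0 : (0 < X w - a)%R by rewrite subr_gt0.
      apply: cvg_near_cst; near=> k.
      have ke : (k.+1%:R^-1 < X w - a)%R by near: k; exact: (near_infty_natSinv_lt (PosNum e0)).
      rewrite /D gtr0_norm// gtr0_norm; last by rewrite subr_gt0 -ltrBrDl.
      by rewrite /=; field.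
    apply: cvg_near_cst; apply: nearW => k; rewrite /D ler0_norm ?subr_le0// ler0_norm; last first.
      by rewrite subr_le0 (le_trans Xa)// lerDl.
    by rewrite /=; field.
  - exact: finite_measure_integrable_cst.
  - apply: aeW => w k _; rewrite lee_fin.
    have /andP[D0 D1] := D01 k w; have /andP[gw0 gwM] := gM w.
    have Dg : (0 <= D k w * g w)%R by exact: mulr_ge0.
    rewrite (ger0_norm Dg); apply: (@le_trans _ _ (1 * M)%R); first exact: ler_pM.
    by rewrite mul1r.
  by move=> _ _ H; exact: H.
have iabs (b : R) (g : T -> R) : measurable_fun setT g -> (forall w, 0 <= g w <= M)%R ->
    P.-integrable setT (EFin \o (fun w => `|X w - b| * g w)%R).
  move=> mg gM; apply: (@integrable_linear_weight _ _ `|b| 1) => // w.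
  by rewrite mul1r normr_id [leRHS]addrC ler_normB.
have ig (g : T -> R) : measurable_fun setT g -> (forall w, 0 <= g w <= M)%R ->
    P.-integrable setT (EFin \o g).
  move=> mg gM; have := @integrable_linear_weight (cst 1%R) g 1 0.
  rewrite (_ : (fun w => _) = g); last by apply/funext => w; rewrite mul1r.
  by apply => // w; rewrite mul0r addr0 normr1.
have RD k (g : T -> R) : measurable_fun setT g -> (forall w, 0 <= g w <= M)%R ->
    \int[P]_w (D k w * g w)%:E = (2^-1)%:E * (\int[P]_w (g w)%:E +
      k.+1%:R%:E * (\int[P]_w (`|X w - a| * g w)%:E - \int[P]_w (`|X w - (a + k.+1%:R^-1)| * g w)%:E)).
  move=> mg gM.
  rewrite -integralB_EFin//; [|exact: iabs|exact: iabs].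
  rewrite -integralZl//; last by apply: integrableB => //; exact: iabs.
  rewrite -integralD//; [|exact: ig|]; last first.
    by apply: integrableZl => //; apply: integrableB => //; exact: iabs.
  rewrite -integralZl//; last first.
    apply: integrableD => //; first exact: ig.
    by apply: integrableZl => //; apply: integrableB => //; exact: iabs.
  apply: eq_integral => w _; rewrite -!(EFinB, EFinM, EFinD) /D; congr EFin; ring.
have := cD _ mg1 g1M; have := cD _ mg2 g2M.
rewrite (_ : (fun k => \int[P]_w (D k w * g2 w)%:E) = (fun k => \int[P]_w (D k w * g1 w)%:E)).
  by move=> h2 h1; apply: (cvg_unique _ h1 h2).
by apply/funext => k; rewrite !RD// mass_transform_eq !abs_transform_eq.
Unshelve. all: by end_near. Qed.

(** The open right half-lines are stable under intersection and generate the Borel sets, and the two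
    weighted laws are finite since the weights are at most [M]. *)
Lemma cosine_transform_unique (A : set R) : measurable A ->
  \int[P]_(w in X @^-1` A) (g1 w)%:E = \int[P]_(w in X @^-1` A) (g2 w)%:E.
Proof.
move=> mA.
pose m1 : {measure set R -> \bar R} := measure_function_pushforward__canonical__measure_function_Measure
  (density_measure P mg1 ig1) mX.
pose m2 : {measure set R -> \bar R} := measure_function_pushforward__canonical__measure_function_Measure
  (density_measure P mg2 ig2) mX.
have ray (g : T -> R) k : \int[P]_(w in X @^-1` `]k, +oo[) (g w)%:E = \int[P]_w ((k < X w)%R%:R * g w)%:E.
  rewrite integral_mkcond; apply: eq_integral => w _.
  rewrite patchE; have -> : (w \in X @^-1` `]k, +oo[) = (k < X w)%R.
    by apply/idP/idP; rewrite inE /= in_itv/= andbT.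
  by case: ifP => _; rewrite ?mul1r ?mul0r.
have := @measure_unique _ R _ (@RGenOInfty.G R) (fun k => `](- k%:R)%R, +oo[%classic)
  _ _ _ _ m1 m2 _ _ A mA; apply.
- exact: RGenOInfty.measurableE.
- move=> _ _ [x ->] [y ->]; exists (Num.max x y)%R.
  by apply/seteqP; split => z /=; rewrite !in_itv/= !andbT gt_max => /andP.
- by move=> k; exists (- k%:R)%R.
- apply/seteqP; split => // z _; exists (Num.truncn `|z|).+1 => //=.
  rewrite in_itv/= andbT ltrNl; apply: le_lt_trans (truncnS_gt _).
  by rewrite -normrN ler_norm.
- by move=> _ [x ->]; rewrite /m1 /m2 /= /pushforward /density_measure !ray ray_transform_eq.
- move=> k; rewrite /m1 /= /pushforward /density_measure.
  apply: (@le_lt_trans _ _ (\int[P]_w (cst M%:E w))); last first.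
    by rewrite integral_probability_cst ltry.
  rewrite integral_mkcond; apply: ge0_le_integral => //.
  - by move=> w _; apply: erestrict_ge0 => z _; rewrite lee_fin.
  - apply/(measurable_restrictT _ _).1.
      by rewrite -[X in measurable X]setTI; apply: mX => //; exact: measurable_itv.
    by apply/measurable_EFinP; exact: measurable_funTS.
  - move=> w _; rewrite patchE /=; case: ifP => _; rewrite lee_fin.
      by case/andP: (g1M w).
    by case/andP: (g1M w); exact: le_trans.
Qed.

End cosine_transform.

(** * The standard normal law *)

Section standard_normal.
Context (R : realType).
Local Notation leb := (@lebesgue_measure R).
Local Notation gam := (normal_prob (0 : R) 1).
Local Open Scope ereal_scope.

Definition std_pdf (z : R) : R := ((Num.sqrt (2 * pi))^-1 * expR (- (z ^+ 2 / 2)))%R.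

Lemma std_pdf_ge0 z : (0 <= std_pdf z)%R.
Proof. by rewrite mulr_ge0 ?expR_ge0// invr_ge0 sqrtr_ge0. Qed.

Lemma normal_pdf_std (m s z : R) : (0 < s)%R -> normal_pdf m s z = (s^-1 * std_pdf ((z - m) / s))%R.
Proof.
move=> s0; rewrite /normal_pdf gt_eqF// /std_pdf /normal_peak /normal_fun.
rewrite mulrA -invfM; congr (_^-1 * expR _)%R.
  rewrite -mulr_natl [(s ^+ 2 * pi)%R]mulrC mulrA sqrtrM ?mulr_ge0 ?pi_ge0// sqrtr_sqr.
  by rewrite gtr0_norm// mulrC.
by rewrite expr_div_n -mulr_natl; field; rewrite gt_eqF.
Qed.

Lemma normal_pdf01 : normal_pdf 0 1 = std_pdf.
Proof. by apply/funext => z; rewrite normal_pdf_std// subr0 invr1 mul1r mulr1. Qed.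

Lemma continuous_std_pdf : continuous std_pdf.
Proof. by rewrite -normal_pdf01; exact: continuous_normal_pdf. Qed.

Lemma measurable_std_pdf : measurable_fun [set: measurableTypeR R] std_pdf.
Proof. exact: continuous_measurable_fun continuous_std_pdf. Qed.

Lemma std_pdfN z : std_pdf (- z) = std_pdf z.
Proof. by rewrite /std_pdf sqrrN. Qed.

Lemma std_pdf_le_half z : (std_pdf z <= 2^-1)%R.
Proof.
rewrite -[leRHS]mulr1 ler_pM ?expR_ge0 ?invr_ge0 ?sqrtr_ge0//.
  rewrite lef_pV2 ?posrE ?sqrtr_gt0 ?mulr_gt0 ?pi_gt0//.
  rewrite -(@ler_pXn2r _ 2) ?nnegrE ?sqrtr_ge0// sqr_sqrtr ?mulr_ge0 ?pi_ge0//.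
  by have := @pihalf_ge1 R; lra.
by rewrite -expR0 ler_expR oppr_le0 divr_ge0 ?sqr_ge0.
Qed.

Lemma integral_normal_prob (m s : R) (f : R -> \bar R) : (0 < s)%R ->
  measurable_fun [set: measurableTypeR R] f -> (forall z, 0 <= f z) ->
  \int[normal_prob m s]_z f z = \int[leb]_z (f z * (normal_pdf m s z)%:E).
Proof.
move=> s0 mf f0.
exact: (integral_density_measure leb (measurable_normal_pdf m s) (normal_pdf_ge0 m s)).
Qed.

Lemma integral_std (f : R -> \bar R) :
  measurable_fun [set: measurableTypeR R] f -> (forall z, 0 <= f z) ->
  \int[gam]_z f z = \int[leb]_z (f z * (std_pdf z)%:E).
Proof.
move=> mf f0; rewrite integral_normal_prob//; apply: eq_integral => z _.
by rewrite normal_pdf01.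
Qed.

Lemma integral_normal_std (m s : R) (f : R -> \bar R) : (0 < s)%R ->
  measurable_fun [set: measurableTypeR R] f -> (forall z, 0 <= f z) ->
  \int[normal_prob m s]_z f z = \int[gam]_z f (m + s * z)%R.
Proof.
move=> s0 mf f0; rewrite integral_normal_prob// integral_std//; last first.
  apply: (measurableT_comp mf); apply: measurable_funD; first exact: measurable_cst.
  by apply: measurable_funM => //; exact: measurable_cst.
pose F (z : R) := f z * (normal_pdf m s z)%:E.
have mF : measurable_fun [set: measurableTypeR R] F.
  apply: emeasurable_funM => //; apply/measurable_EFinP; exact: measurable_normal_pdf.
have F0 z : 0 <= F z by rewrite mule_ge0// lee_fin normal_pdf_ge0.
have mFm : measurable_fun [set: measurableTypeR R] (fun z => F (z + m)%R).
  by apply: (measurableT_comp mF); apply: measurable_funD => //; exact: measurable_cst.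
rewrite -[LHS](integral_lebesgue_shift m mF F0).
have := integral_lebesgue_scale s0 mFm (fun z => F0 _).
move=> /(congr1 (fun x => s%:E * x)); rewrite muleVK ?gt_eqF// => <-.
rewrite -ge0_integralZl_EFin ?ltW//; last first.
  apply: (measurableT_comp mFm); apply: measurable_funM => //; exact: measurable_cst.
apply: eq_integral => z _; rewrite /F normal_pdf_std// muleCA addrC; congr (f _ * _).
have -> : ((m + s * z - m) / s = z)%R by field; rewrite gt_eqF.
by rewrite -EFinM mulrA divff ?gt_eqF// mul1r.
Qed.

Lemma is_derive_std_pdf (x : R) : is_derive x 1%R (fun z => - std_pdf z)%R (x * std_pdf x)%R.
Proof.
have h := is_deriveZ (- (Num.sqrt (2 * pi))^-1)%R (@is_derive1_comp _ expR (fun t : R => - (2^-1 * (t * t)))%R x _ _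
    (is_derive_expR _) (is_deriveN (is_deriveZ 2^-1%R (is_deriveM (is_derive_id x (1%R : R)) (is_derive_id x (1%R : R)))))).
have -> : (fun z => - std_pdf z)%R = (- (Num.sqrt (2 * pi))^-1)%R \*: (expR \o (fun t : R => - (2^-1 * (t * t)))%R).
  by apply/funext => z; rewrite /std_pdf /= /GRing.scale /= mulNr; congr (- (_ * expR (- _)))%R; rewrite mulrC expr2.
apply: is_derive_eq h _; rewrite /GRing.scale/= /std_pdf.
rewrite (_ : x ^+ 2 / 2 = 2^-1 * (x * x))%R; last by rewrite mulrC expr2.
by set c := (Num.sqrt _)^-1%R; field.
Qed.

Lemma cvg_std_pdf : (std_pdf z @[z --> +oo] --> (0 : R))%R.
Proof.
rewrite -(mulr0 (Num.sqrt (2 * pi : R))^-1%R); apply: cvgM; first exact: cvg_cst.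
apply: (cvg_comp (fun z : R => z ^+ 2 / 2)%R (fun u : R => expR (- u))); last exact: cvgr_expR.
by apply: gt0_cvgMly => //; exact: cvgr_expr2.
Qed.

Lemma integral_std_tail (v : R) : (0 <= v)%R ->
  \int[leb]_u ((u * std_pdf u)%:E * (v <= u)%R%:R%:E) = (std_pdf v)%:E.
Proof.
move=> v0; have dF := is_derive_std_pdf; have cg := continuous_std_pdf.
rewrite integral_ind -set_itvcy.
rewrite (@ge0_continuous_FTC2y _ _ (fun u => - std_pdf u)%R _ 0%R).
- by rewrite EFinN oppeK add0e.
- by move=> x vx; rewrite mulr_ge0 ?std_pdf_ge0// (le_trans v0).
- by apply: continuous_subspaceT => x; apply: cvgM; [exact: cvg_id|exact: cg].
- by rewrite -oppr0; apply: cvgN; exact: cvg_std_pdf.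
- by move=> x _; apply: ex_derive.
- by apply: cvgN; apply: cvg_at_right_filter; exact: cg.
- by move=> x _; rewrite derive1E; exact: derive_val.
Qed.

Lemma integral_std_pdf : \int[leb]_z (std_pdf z)%:E = 1.
Proof.
rewrite -[RHS](integral_normal_pdf (0 : R) 1); apply: eq_integral => z _.
by rewrite normal_pdf01.
Qed.

(** The density at [z] is the integral of [u std_pdf u] over [u >= |z|]; integrating over [z] first
    gives the length [2 u] of [[-u, u]], so the total mass 1 is also the second moment. *)
Lemma integral_std_sqr : \int[gam]_z (z ^+ 2)%:E = 1.
Proof.
have mid : measurable_fun [set: measurableTypeR R] (fun z : R => z) by [].
have mphi := measurable_std_pdf.
have m2 : measurable_fun [set: measurableTypeR R] (fun z : R => (z ^+ 2)%:E).
  by apply/measurable_EFinP; exact: measurable_funX.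
rewrite integral_std//; last by move=> z; rewrite lee_fin sqr_ge0.
rewrite -integral_std_pdf; symmetry.
pose F (z u : R) : \bar R := ((u * std_pdf u) * (`|z| <= u)%R%:R)%:E.
have mF : measurable_fun setT (fun z : measurableTypeR R * measurableTypeR R => F z.1 z.2).
  have m1 : measurable_fun setT (fun z : measurableTypeR R * measurableTypeR R => z.1) by exact: measurable_fst.
  have m2' : measurable_fun setT (fun z : measurableTypeR R * measurableTypeR R => z.2) by exact: measurable_snd.
  apply/measurable_EFinP; apply: measurable_funM.
    by apply: measurable_funM => //; exact: measurableT_comp m2'.
  by apply: measurable_ind_le => //; exact: measurableT_comp.
have F0 z u : 0 <= F z u.
  rewrite lee_fin; have [zu|] := leP `|z|%R u; last by rewrite mulr0.
  by rewrite mulr1 mulr_ge0 ?std_pdf_ge0// (le_trans _ zu).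
transitivity (\int[leb]_z \int[leb]_u F z u).
  apply: eq_integral => z _; rewrite -[LHS](_ : (std_pdf `|z|)%:E = _); last first.
    by case: (ger0P z); rewrite ?std_pdfN.
  by rewrite -integral_std_tail.
rewrite (fubini_tonelli (fun z : measurableTypeR R * measurableTypeR R => F z.1 z.2))//=.
under [RHS]eq_integral do rewrite -EFinM.
rewrite [RHS]ge0_symfun_integralT//; last 3 first.
- by move=> z; rewrite mulr_ge0 ?sqr_ge0 ?std_pdf_ge0.
- by move=> z; apply: cvgM; [exact: exprn_continuous|exact: continuous_std_pdf].
- by move=> z /=; rewrite sqrrN std_pdfN.
rewrite -ge0_integralZl_EFin//; last 3 first.
- by rewrite -set_itvcy; exact: measurable_itv.
- by move=> z _; rewrite lee_fin mulr_ge0 ?sqr_ge0 ?std_pdf_ge0.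
- apply/measurable_EFinP; apply: measurable_funTS; exact: measurable_funM.
rewrite [RHS]integral_mkcond; apply: eq_integral => u _.
rewrite patchE; case: ifPn.
  rewrite inE /= => u0.
  transitivity ((u * std_pdf u)%:E * leb [set` `[(- u)%R, u]%R]).
    rewrite -integral_cst// [RHS]integral_mkcond; apply: eq_integral => z _.
    rewrite patchE mem_setE in_itv/= /F ler_norml.
    by case: ifP => _; rewrite ?mulr1 ?mulr0.
  rewrite lebesgue_measure_itv/= lte_fin; case: ifPn => uu.
    by rewrite -EFinB -EFinM; congr EFin; ring.
  have -> : u = 0%R by lra.
  by rewrite mule0 expr0n/= mul0r mule0.
rewrite notin_setE /= => u0; apply: integral0_eq => z _; rewrite /F.
have [zu|] := leP `|z|%R u; last by rewrite mulr0.
by exfalso; apply: u0; exact: le_trans zu.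
Qed.

(** As for orthogonal maps, the double integral of [f (- x) std_pdf (y + x)] is computed in both
    orders, with translations only. *)
Lemma integral_lebesgue_opp (f : R -> \bar R) :
  measurable_fun [set: measurableTypeR R] f -> (forall z, 0 <= f z) ->
  \int[leb]_z f (- z)%R = \int[leb]_z f z.
Proof.
move=> mf f0.
pose g z := (std_pdf z)%:E.
have mg : measurable_fun [set: measurableTypeR R] g by apply/measurable_EFinP; exact: measurable_std_pdf.
have g0 z : 0 <= g z by rewrite lee_fin std_pdf_ge0.
have mN : measurable_fun [set: measurableTypeR R] (fun z => f (- z)%R).
  by apply: (measurableT_comp mf); exact: measurable_funN.
have m1 : measurable_fun setT (fun z : measurableTypeR R * measurableTypeR R => z.1) by exact: measurable_fst.
have m2 : measurable_fun setT (fun z : measurableTypeR R * measurableTypeR R => z.2) by exact: measurable_snd.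
have mD (a : R) : measurable_fun [set: measurableTypeR R] (fun y : R => y + a)%R.
  by apply: measurable_funD => //; exact: measurable_cst.
transitivity (\int[leb]_x \int[leb]_y (f (- x)%R * g (y + x)%R)).
  apply: eq_integral => x _; rewrite ge0_integralZl//; last 1 first.
  - by apply: (measurableT_comp mg); exact: mD.
  by rewrite integral_lebesgue_shift// integral_std_pdf mule1.
rewrite (fubini_tonelli (fun z : measurableTypeR R * measurableTypeR R => f (- z.1)%R * g (z.2 + z.1)%R))//=; last 2 first.
- apply: emeasurable_funM; first by apply: measurableT_comp mN m1.
  by apply: (measurableT_comp mg); exact: measurable_funD.
- by move=> z; rewrite mule_ge0.
transitivity (\int[leb]_y \int[leb]_x (f (y - x)%R * g x)).
  apply: eq_integral => y _.
  pose h x := f (- x)%R * g (y + x)%R.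
  transitivity (\int[leb]_x h (x - y)%R); last first.
    by apply: eq_integral => x _; rewrite /h opprB [(y + (x - y))%R]addrC subrK.
  apply/esym/integral_lebesgue_shift => [|x]; last by rewrite mule_ge0.
  apply: emeasurable_funM => //; apply: (measurableT_comp mg).
  by apply: measurable_funD => //; exact: measurable_cst.
rewrite (fubini_tonelli (fun z : measurableTypeR R * measurableTypeR R => f (z.1 - z.2)%R * g z.2))//=; last 2 first.
- apply: emeasurable_funM; last exact: measurableT_comp mg m2.
  by apply: (measurableT_comp mf); exact: measurable_funB.
- by move=> z; rewrite mule_ge0.
transitivity (\int[leb]_x (g x * \int[leb]_y f y)).
  apply: eq_integral => x _; rewrite -(integral_lebesgue_shift (- x)%R mf f0) -ge0_integralZl//.
  - by apply: eq_integral => y _; rewrite muleC.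
  - by apply: (measurableT_comp mf); exact: mD.
by rewrite ge0_integralZr// ?integral_std_pdf ?mul1e//; exact: integral_ge0.
Qed.

Lemma integral_std_opp (f : R -> \bar R) :
  measurable_fun [set: measurableTypeR R] f -> (forall z, 0 <= f z) ->
  \int[gam]_z f (- z)%R = \int[gam]_z f z.
Proof.
move=> mf f0; rewrite !integral_std//; last by apply: (measurableT_comp mf); exact: measurable_funN.
rewrite -integral_lebesgue_opp; last 2 first.
- apply: emeasurable_funM; first by apply: (measurableT_comp mf); exact: measurable_funN.
  by apply/measurable_EFinP; exact: measurable_std_pdf.
- by move=> z; rewrite mule_ge0// lee_fin std_pdf_ge0.
by apply: eq_integral => z _; rewrite opprK std_pdfN.
Qed.

Let measurable_affine (a b : R) : measurable_fun [set: measurableTypeR R] (fun z : R => a * z + b)%R.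
Proof.
apply: measurable_funD; last exact: measurable_cst.
by apply: measurable_funM => //; exact: measurable_cst.
Qed.

Let measurable_lin2 (a b : R) : measurable_fun setT
  (fun z : measurableTypeR R * measurableTypeR R => a * z.1 + b * z.2)%R.
Proof.
apply: measurable_funD; apply: measurable_funM; try exact: measurable_cst.
  exact: measurable_fst.
exact: measurable_snd.
Qed.

(** For fixed [y], the substitution [u = a z + b y] is affine since [a > 0]. After exchanging the
    integrals, the one over [y] is that of a normal density, hence 1. *)
Let integral_std_rot_gt0 (f : R -> \bar R) (a b : R) : (0 < a)%R -> (a ^+ 2 + b ^+ 2 = 1)%R ->
  measurable_fun [set: measurableTypeR R] f -> (forall z, 0 <= f z) ->
  \int[gam]_z \int[gam]_y f (a * z + b * y)%R = \int[gam]_z f z.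
Proof.
move=> a0 ab mf f0.
have mphi := measurable_std_pdf.
have mphiE : measurable_fun [set: measurableTypeR R] (fun z => (std_pdf z)%:E) by exact/measurable_EFinP.
have phi0 z : 0 <= (std_pdf z)%:E by rewrite lee_fin std_pdf_ge0.
rewrite (fubini_tonelli (fun z : measurableTypeR R * measurableTypeR R => f (a * z.1 + b * z.2)%R))//=; last first.
  by apply: (measurableT_comp mf); exact: measurable_lin2.
have mf1 y : measurable_fun [set: measurableTypeR R] (fun z => f (a * z + b * y)%R).
  by apply: (measurableT_comp mf); exact: measurable_affine.
pose K (y u : R) := (a^-1 * std_pdf ((u - b * y) / a))%R.
have mK2 : measurable_fun setT (fun z : measurableTypeR R * measurableTypeR R => K z.1 z.2).
  apply: measurable_funM; first exact: measurable_cst.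
  apply: (measurableT_comp mphi); apply: measurable_funM; last exact: measurable_cst.
  rewrite (_ : (fun _ => _) = (fun z : measurableTypeR R * measurableTypeR R => (- b) * z.1 + 1 * z.2)%R).
    exact: measurable_lin2.
  by apply/funext => z; ring.
have K0 y u : (0 <= K y u)%R by rewrite mulr_ge0 ?std_pdf_ge0// invr_ge0 ltW.
have mK y : measurable_fun [set: measurableTypeR R] (K y).
  exact: (measurableT_comp mK2 (@measurable_pair1 _ _ _ _ (y : measurableTypeR R))).
have inner y : \int[gam]_z f (a * z + b * y)%R = \int[leb]_u (f u * (K y u)%:E).
  rewrite integral_std//.
  pose G u := f u * (std_pdf ((u - b * y) / a))%:E.
  have mG : measurable_fun [set: measurableTypeR R] G.
    apply: emeasurable_funM => //; apply/measurable_EFinP; apply: (measurableT_comp mphi).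
    apply: measurable_funM; last exact: measurable_cst.
    by apply: measurable_funB => //; exact: measurable_cst.
  have G0 u : 0 <= G u by rewrite mule_ge0// lee_fin std_pdf_ge0.
  have mGs : measurable_fun [set: measurableTypeR R] (fun u => G (u + b * y)%R).
    by apply: (measurableT_comp mG); apply: measurable_funD => //; exact: measurable_cst.
  transitivity (\int[leb]_z G (a * z + b * y)%R).
    by apply: eq_integral => z _; rewrite /G; congr (_ * (std_pdf _)%:E); field; rewrite gt_eqF.
  rewrite (integral_lebesgue_scale a0 mGs)// integral_lebesgue_shift//.
  rewrite -ge0_integralZl_EFin ?invr_ge0 ?ltW//.
  by apply: eq_integral => u _; rewrite /G muleCA -EFinM.
transitivity (\int[gam]_y \int[leb]_u (f u * (K y u)%:E)).
  by apply: eq_integral => y _; exact: inner.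
have mfK : measurable_fun setT (fun z : measurableTypeR R * measurableTypeR R => f z.2 * (K z.1 z.2)%:E).
  by apply: emeasurable_funM; [exact: measurableT_comp mf measurable_snd|exact/measurable_EFinP].
have fK0 y u : 0 <= f u * (K y u)%:E by rewrite mule_ge0// lee_fin K0.
rewrite (fubini_tonelli (fun z : measurableTypeR R * measurableTypeR R => f z.2 * (K z.1 z.2)%:E))//=.
rewrite integral_std//; apply: eq_integral => u _.
rewrite integral_std//; last first.
  exact: (measurableT_comp mfK (@measurable_pair2 _ _ _ _ (u : measurableTypeR R))).
(* Completing the square: the joint density of [u] and [y] is that of [u], standard normal, times
   the conditional one of [y], normal with mean [b u] and standard deviation [a]. *)
have E y : (K y u * std_pdf y = std_pdf u * normal_pdf (b * u) a y)%R.
  rewrite normal_pdf_std// /K /std_pdf; set c := (Num.sqrt _)^-1%R.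
  have e : (- (((u - b * y) / a) ^+ 2 / 2) + - (y ^+ 2 / 2) =
      - (u ^+ 2 / 2) + - (((y - b * u) / a) ^+ 2 / 2))%R.
    have b2 : (b ^+ 2 = 1 - a ^+ 2)%R by rewrite -ab addrC addKr.
    have -> : (((u - b * y) / a) ^+ 2 = (u ^+ 2 - 2 * u * b * y + (1 - a ^+ 2) * y ^+ 2) / a ^+ 2)%R.
      by rewrite -b2; field; rewrite gt_eqF.
    have -> : (((y - b * u) / a) ^+ 2 = (y ^+ 2 - 2 * u * b * y + (1 - a ^+ 2) * u ^+ 2) / a ^+ 2)%R.
      by rewrite -b2; field; rewrite gt_eqF.
    by field; rewrite gt_eqF.
  transitivity (a^-1 * c * c * expR (- (u ^+ 2 / 2) + - (((y - b * u) / a) ^+ 2 / 2)))%R.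
    by rewrite -e expRD; ring.
  by rewrite expRD; ring.
transitivity (\int[leb]_y (f u * (std_pdf u)%:E * (normal_pdf (b * u) a y)%:E)).
  by apply: eq_integral => y _; rewrite -!muleA -!EFinM E.
rewrite ge0_integralZl//.
- by rewrite integral_normal_pdf mule1.
- by apply/measurable_EFinP; exact: measurable_normal_pdf.
- by move=> y _; rewrite lee_fin normal_pdf_ge0.
- by rewrite mule_ge0.
Qed.

(** Dividing by [r] reduces to [a^2 + b^2 = 1]; the symmetry of the standard normal law handles
    [a < 0], and [a = 0] is separate because one divides by [a]. *)
Lemma integral_std_rot (f : R -> \bar R) (a b : R) :
  measurable_fun [set: measurableTypeR R] f -> (forall z, 0 <= f z) ->
  \int[gam]_z \int[gam]_y f (a * z + b * y)%R = \int[gam]_z f (Num.sqrt (a ^+ 2 + b ^+ 2) * z)%R.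
Proof.
move=> mf f0; pose r := Num.sqrt (a ^+ 2 + b ^+ 2)%R; rewrite -/r.
have mfc c e : measurable_fun [set: measurableTypeR R] (fun z => f (c * z + e)%R).
  by apply: (measurableT_comp mf); exact: measurable_affine.
have mfc0 c : measurable_fun [set: measurableTypeR R] (fun z => f (c * z)%R).
  by have := mfc c 0%R; under eq_fun do rewrite addr0.
have [a0|a0] := eqVneq a 0%R.
  transitivity (\int[gam]_y f (b * y)%R).
    rewrite -[RHS]mul1e -(integral_probability_cst gam 1) -[in RHS]ge0_integralZr//.
    - by apply: eq_integral => z _; rewrite a0 mul1e; apply: eq_integral => y _; rewrite mul0r add0r.
    - exact: integral_ge0.
  rewrite /r a0 expr0n add0r sqrtr_sqr; case: (ger0P b) => // b0.
  rewrite -[RHS]integral_std_opp//; apply: eq_integral => y _; by rewrite mulNr mulrN opprK.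
have r0 : (0 < r)%R by rewrite sqrtr_gt0 ltr_wpDr ?sqr_ge0// exprn_even_gt0.
have H (c : R) : (0 < c)%R -> (c ^+ 2 = a ^+ 2)%R -> \int[gam]_z \int[gam]_y f (c * z + b * y)%R = \int[gam]_z f (r * z)%R.
  move=> c0 ca; transitivity (\int[gam]_z \int[gam]_y f (r * (c / r * z + b / r * y))%R); last first.
    apply: (@integral_std_rot_gt0 (fun z => f (r * z)%R)) => //.
    + by rewrite divr_gt0.
    + rewrite !expr_div_n ca -mulrDl /r sqr_sqrtr ?addr_ge0 ?sqr_ge0// divff//.
      by move: r0; rewrite sqrtr_gt0 => /gt_eqF ->.
  by apply: eq_integral => z _; apply: eq_integral => y _; congr f; field; rewrite gt_eqF.
have [a0'|a0'] := ltP 0%R a; first exact: H.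
rewrite -[RHS](H (- a)%R) ?sqrrN//; last by rewrite oppr_gt0 lt_neqAle a0.
rewrite -integral_std_opp.
- by apply: eq_integral => z _; apply: eq_integral => y _; rewrite mulrN mulNr.
- apply: (measurable_fun_fubini_tonelli_F (fun z : measurableTypeR R * measurableTypeR R => f (a * z.1 + b * z.2)%R)) => //.
  by apply: (measurableT_comp mf); exact: measurable_lin2.
- by move=> z; exact: integral_ge0.
Qed.

End standard_normal.

Section square_integrable.
Context d (T : measurableType d) (R : realType) (P : probability T R).
Local Open Scope ereal_scope.

Lemma Lfun2P (X : T -> R) : measurable_fun setT X -> \int[P]_w (X w ^+ 2)%:E < +oo ->
  X \in Lfun P 2%:E.
Proof.
move=> mX X2; rewrite inE; apply/andP; split; rewrite inE//=.
rewrite /finite_norm unlock poweR_lty//; apply: le_lt_trans X2.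
apply: ge0_le_integral => //.
- by move=> w _; rewrite poweR_ge0.
- apply/measurable_EFinP; apply: (@measurableT_comp _ _ _ _ _ _ (fun x : R => x `^ 2)%R) => //.
  exact: measurableT_comp.
- by apply/measurable_EFinP; exact: measurable_funX.
- by move=> w _ /=; rewrite lee_fin powR_mulrn// -normrX ger0_norm ?sqr_ge0.
Qed.

Lemma Lfun2_measurable (X : T -> R) : X \in Lfun P 2%:E -> measurable_fun setT X.
Proof. by rewrite inE => /andP[]; rewrite inE. Qed.

Lemma Lfun2_sqr_lty (X : T -> R) : X \in Lfun P 2%:E -> \int[P]_w (X w ^+ 2)%:E < +oo.
Proof.
move=> /Lfun2_integrable_sqr/integrableP[_]; apply: le_lt_trans.
by under [leRHS]eq_integral do rewrite /= ger0_norm ?sqr_ge0//.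
Qed.

End square_integrable.

Section normal_law.
Context (R : realType).
Local Notation gam := (normal_prob (0 : R) 1).
Local Open Scope ereal_scope.

Lemma integral_std_odd (f : R -> R) : measurable_fun [set: measurableTypeR R] f ->
  (forall z, f (- z) = - f z)%R -> gam.-integrable setT (EFin \o f) -> \int[gam]_z (f z)%:E = 0.
Proof.
move=> mf fN fi; rewrite integralE.
have -> : \int[gam]_x (EFin \o f)^\- x = \int[gam]_x (EFin \o f)^\+ (- x)%R.
  by apply: eq_integral => z _; rewrite funeposE funenegE /= fN.
rewrite integral_std_opp//.
- rewrite subee// ge0_fin_numE; last exact: integral_ge0.
  exact: integral_funepos_lt_pinfty.
- by apply: measurable_funepos; exact/measurable_EFinP.
Qed.

Lemma integrable_std_quad (a b c : R) : gam.-integrable setT (fun z => (a * z ^+ 2 + b * z + c)%:E).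
Proof.
have mid : measurable_fun [set: measurableTypeR R] (fun z : R => z) by [].
have m2 : measurable_fun [set: measurableTypeR R] (fun z : R => (z ^+ 2)%R) by exact: measurable_funX.
have i2 : gam.-integrable setT (fun z => (z ^+ 2)%:E).
  apply/integrableP; split; first exact/measurable_EFinP.
  under eq_integral do rewrite /= ger0_norm ?sqr_ge0//.
  by rewrite integral_std_sqr ltry.
have ic e : gam.-integrable setT (fun=> e%:E) by exact: finite_measure_integrable_cst.
have i1 : gam.-integrable setT (fun z => z%:E).
  apply: (@le_integrable _ _ _ gam setT measurableT _ (fun z => (z ^+ 2)%:E + 1)) => //.
  - exact/measurable_EFinP.
  - move=> z _ /=; rewrite lee_fin [leRHS]ger0_norm ?addr_ge0 ?sqr_ge0//.
    by rewrite -(real_normK (num_real z)); have := normr_ge0 z; nra.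
  - exact: integrableD.
have -> : (fun z => (a * z ^+ 2 + b * z + c)%:E) = (fun z => (a%:E * (z ^+ 2)%:E + b%:E * z%:E) + c%:E).
  by apply/funext => z; rewrite !(EFinD, EFinM).
by apply: integrableD => //; apply: integrableD => //; exact: integrableZl.
Qed.

Lemma integral_std_quad (a b c : R) :
  \int[gam]_z (a * z ^+ 2 + b * z + c)%:E = (a + c)%:E.
Proof.
have iq := integrable_std_quad.
have i2 : gam.-integrable setT (fun z => (a * z ^+ 2)%:E).
  by have := iq a 0%R 0%R; under eq_fun do rewrite mul0r !addr0.
have i1 : gam.-integrable setT (fun z => (b * z)%:E).
  by have := iq 0%R b 0%R; under eq_fun do rewrite mul0r add0r addr0.
have ic : gam.-integrable setT (fun=> c%:E) by exact: finite_measure_integrable_cst.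
under eq_integral do rewrite !EFinD.
rewrite integralD//; last exact: integrableD.
rewrite integralD// integral_probability_cst.
rewrite (@integral_std_odd (fun z => b * z)%R)//; last 2 first.
- by apply: measurable_funM => //; exact: measurable_cst.
- by move=> z; rewrite mulrN.
rewrite adde0 EFinD; congr (_ + _).
under eq_integral do rewrite EFinM.
rewrite integralZl//; first by rewrite integral_std_sqr mule1.
by have := iq 1%R 0%R 0%R; under eq_fun do rewrite mul1r mul0r !addr0.
Qed.

Context d (T : measurableType d) (P : probability T R).

(** Stated as the law of [m + s Z] with [Z] standard normal, which includes the degenerate case
    [s = 0]; from here on the two clauses of [gaussian_rv] are treated at once. *)
Definition normal_law (X : T -> R) (m s : R) := forall f : R -> \bar R,
  measurable_fun [set: measurableTypeR R] f -> (forall x, 0 <= f x) ->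
  \int[P]_w f (X w) = \int[gam]_z f (m + s * z)%R.

Lemma gaussian_rv_law (X : T -> R) : gaussian_rv P X ->
  exists m s, (0 <= s)%R /\ normal_law X m s.
Proof.
move=> [mX [m [s [s0 XE]]]]; exists m, s; split => // f mf f0.
have -> : \int[P]_w f (X w) = \int[pushforward P (X : T -> measurableTypeR R)]_x f x.
  by rewrite ge0_integral_pushforward.
have [se|sn] := eqVneq s 0%R.
  transitivity (\int[\d_(m : measurableTypeR R)]_x f x).
    apply: eq_measure_integral => A mA _.
    by have := XE A mA; rewrite se eqxx.
  rewrite integral_dirac// diracT mul1e.
  rewrite -[LHS]mule1 -(integral_probability_cst gam 1) -ge0_integralZl//.
  by apply: eq_integral => z _; rewrite mule1 se mul0r addr0.
rewrite -integral_normal_std//; last by rewrite lt_neqAle eq_sym sn.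
apply: eq_measure_integral => A mA _.
by have := XE A mA; rewrite (negbTE sn).
Qed.

Section moments.
Variables (X : T -> R) (m s : R).
Hypotheses (mX : measurable_fun setT X) (XE : normal_law X m s).

Lemma normal_law_integral (f : R -> R) : measurable_fun [set: measurableTypeR R] f ->
  \int[P]_w (f (X w))%:E = \int[gam]_z (f (m + s * z))%:E.
Proof.
move=> mf; rewrite integralE [RHS]integralE.
have mE : measurable_fun [set: measurableTypeR R] (EFin \o f) by exact/measurable_EFinP.
have fp U (u : U -> R) : (fun x => (f (u x))%:E)^\+ = fun x => (EFin \o f)^\+ (u x).
  by apply/funext => x; rewrite !funeposE.
have fn U (u : U -> R) : (fun x => (f (u x))%:E)^\- = fun x => (EFin \o f)^\- (u x).
  by apply/funext => x; rewrite !funenegE.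
by rewrite !fp !fn (XE (measurable_funepos mE) (funepos_ge0 _)) (XE (measurable_funeneg mE) (funeneg_ge0 _)).
Qed.

Lemma normal_law_integrable (f : R -> R) : measurable_fun [set: measurableTypeR R] f ->
  gam.-integrable setT (fun z => (f (m + s * z))%:E) -> P.-integrable setT (fun w => (f (X w))%:E).
Proof.
move=> mf /integrableP[_ fi]; apply/integrableP; split.
  by apply/measurable_EFinP; exact: measurableT_comp.
have mE : measurable_fun [set: measurableTypeR R] (fun z => `|(f z)%:E|).
  by apply: measurableT_comp => //; exact/measurable_EFinP.
by rewrite (XE mE).
Qed.

Let quadE (a b c : R) : (fun z => (a * (m + s * z) ^+ 2 + b * (m + s * z) + c)%:E) =
  (fun z => ((a * s ^+ 2) * z ^+ 2 + (2 * a * m * s + b * s) * z + (a * m ^+ 2 + b * m + c))%:E).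
Proof. by apply/funext => z; congr EFin; ring. Qed.

Let mquad (a b c : R) : measurable_fun [set: measurableTypeR R] (fun x : R => a * x ^+ 2 + b * x + c)%R.
Proof.
have mid : measurable_fun [set: measurableTypeR R] (fun z : R => z) by [].
by repeat (apply: measurable_funD || apply: measurable_funM || apply: measurable_funX || exact: measurable_cst || exact: mid).
Qed.

Lemma normal_law_quad (a b c : R) :
  P.-integrable setT (fun w => (a * X w ^+ 2 + b * X w + c)%:E) /\
  \int[P]_w (a * X w ^+ 2 + b * X w + c)%:E = (a * (m ^+ 2 + s ^+ 2) + b * m + c)%:E.
Proof.
split.
  by apply: (normal_law_integrable (mquad a b c)); rewrite quadE; exact: integrable_std_quad.
rewrite (normal_law_integral (mquad a b c)) quadE integral_std_quad; congr EFin; ring.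
Qed.

Lemma normal_law_Lfun2 : X \in Lfun P 2%:E.
Proof.
apply: Lfun2P => //; have [_] := normal_law_quad 1 0 0.
by under eq_integral do rewrite mul1r mul0r !addr0; move=> ->; rewrite ltry.
Qed.

Lemma normal_law_mean : 'E_P[X] = m%:E.
Proof.
rewrite unlock; have [_] := normal_law_quad 0 1 0.
by under eq_integral do rewrite mul0r add0r mul1r addr0; rewrite mul0r add0r mul1r addr0.
Qed.

Lemma normal_law_sqr : \int[P]_w (X w ^+ 2)%:E = (m ^+ 2 + s ^+ 2)%:E.
Proof.
have [_] := normal_law_quad 1 0 0.
by under eq_integral do rewrite mul1r mul0r !addr0; rewrite mul1r mul0r !addr0.
Qed.

Lemma normal_law_variance : 'V_P[X] = (s ^+ 2)%:E.
Proof.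
rewrite varianceE ?normal_law_Lfun2// normal_law_mean unlock.
have -> : \int[P]_w ((X ^+ 2)%R w)%:E = \int[P]_w (X w ^+ 2)%:E by [].
by rewrite normal_law_sqr -EFin_expe -EFinB; congr EFin; ring.
Qed.

End moments.

Definition mean (X : T -> R) : R := fine 'E_P[X].
Definition sd (X : T -> R) : R := Num.sqrt (fine 'V_P[X]).

Lemma gaussian_rvP (X : T -> R) : gaussian_rv P X -> normal_law X (mean X) (sd X).
Proof.
move=> gX; have [m [s [s0 XE]]] := gaussian_rv_law gX; have [mX _] := gX.
by rewrite /mean /sd (normal_law_mean mX XE) (normal_law_variance mX XE)/= sqrtr_sqr ger0_norm.
Qed.

Lemma gaussian_Lfun2 (X : T -> R) : gaussian_rv P X -> X \in Lfun P 2%:E.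
Proof. by move=> gX; have [mX _] := gX; exact: (normal_law_Lfun2 mX (gaussian_rvP gX)). Qed.

End normal_law.

(** * Uncorrelated Gaussian pairs *)

Section gaussian_pair.
Context d (T : measurableType d) (R : realType) (P : probability T R).
Local Notation gam := (normal_prob (0 : R) 1).
Local Open Scope ereal_scope.

Lemma sqr_sd (X : T -> R) : X \in Lfun P 2%:E -> 'V_P[X] = (sd P X ^+ 2)%:E.
Proof.
move=> X2; rewrite /sd sqr_sqrtr; last by rewrite fine_ge0// variance_ge0.
by rewrite fineK// variance_fin_num.
Qed.

Lemma Lfun21 (X : T -> R) : X \in Lfun P 2%:E -> X \in Lfun P 1.
Proof. by apply: Lfun_subset12; exact: fin_num_measure. Qed.

Lemma mean_lin (Y W : T -> R) (p q : R) : Y \in Lfun P 2%:E -> W \in Lfun P 2%:E ->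
  mean P (fun w => p * Y w + q * W w)%R = (p * mean P Y + q * mean P W)%R.
Proof.
move=> Y2 W2.
have Y1 := Lfun21 Y2; have W1 := Lfun21 W2.
have -> : (fun w => p * Y w + q * W w)%R = ((p \o* Y) \+ (q \o* W))%R.
  by apply/funext => w /=; rewrite mulrC [(q * _)%R]mulrC.
rewrite /mean expectationD ?Lfun_scale// !expectationZl//.
rewrite fineD ?fin_numM ?expectation_fin_num//.
by rewrite !fineM ?expectation_fin_num.
Qed.

Lemma variance_lin (Y W : T -> R) (p q : R) : Y \in Lfun P 2%:E -> W \in Lfun P 2%:E ->
  'V_P[fun w => p * Y w + q * W w]%R =
  (p ^+ 2)%:E * 'V_P[Y] + (q ^+ 2)%:E * 'V_P[W] + (2 * p * q)%:E * covariance P Y W.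
Proof.
move=> Y2 W2.
have Y1 := Lfun21 Y2; have W1 := Lfun21 W2.
have -> : (fun w => p * Y w + q * W w)%R = ((p \o* Y) \+ (q \o* W))%R.
  by apply/funext => w /=; rewrite mulrC [(q * _)%R]mulrC.
have ZL (k : R) (X : T -> R) : X \in Lfun P 2%:E -> (k \o* X)%R \in Lfun P 2%:E by move=> X2; apply: Lfun_scale => //; rewrite ler1n.
rewrite varianceD ?ZL// !varianceZ//; congr (_ + _).
rewrite covarianceZl//; last 2 first.
- by apply: Lfun_scale.
- exact: Lfun2_mul_Lfun1 (ZL _ _ _).
rewrite covarianceZr//; last exact: Lfun2_mul_Lfun1.
by rewrite !muleA -!EFinM.
Qed.

Variables (Y W : T -> R).
Hypothesis gYW : forall p q : R, gaussian_rv P (fun w => p * Y w + q * W w)%R.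
Hypothesis cov0 : covariance P Y W = 0.

Let gY : gaussian_rv P Y.
Proof. by have := gYW 1%R 0%R; under eq_fun do rewrite mul1r mul0r addr0. Qed.

Let gW : gaussian_rv P W.
Proof. by have := gYW 0%R 1%R; under eq_fun do rewrite mul1r mul0r add0r. Qed.

Let mY : measurable_fun setT Y. Proof. by case: gY. Qed.
Let mW : measurable_fun setT W. Proof. by case: gW. Qed.

Local Notation a := (mean P Y).
Local Notation b := (mean P W).
Local Notation s := (sd P Y).
Local Notation u := (sd P W).

(** A normal law is determined by its mean and variance, and with zero covariance those of
    [p Y + q W] are the ones of the same combination of independent variables. *)
Lemma uncorrelated_lin_law (p q : R) (f : R -> \bar R) :
  measurable_fun [set: measurableTypeR R] f -> (forall x, 0 <= f x) ->
  \int[P]_w f (p * Y w + q * W w)%R =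
  \int[gam]_z \int[gam]_y f (p * (a + s * z) + q * (b + u * y))%R.
Proof.
move=> mf f0; rewrite (gaussian_rvP (gYW p q))//.
have Y2 := gaussian_Lfun2 gY; have W2 := gaussian_Lfun2 gW.
rewrite mean_lin//.
have -> : sd P (fun w => p * Y w + q * W w)%R = Num.sqrt ((p * s) ^+ 2 + (q * u) ^+ 2).
  rewrite [in LHS]/sd variance_lin// cov0 mule0 adde0 !sqr_sd//= !exprMn.
  by [].
have := @integral_std_rot _ (fun x => f (p * a + q * b + x)%R) (p * s) (q * u).
move=> <-//; last first.
  by apply: (measurableT_comp mf); apply: measurable_funD => //; exact: measurable_cst.
by apply: eq_integral => z _; apply: eq_integral => y _; congr f; ring.
Qed.

Let measurable_affine (m r : R) : measurable_fun [set: measurableTypeR R] (fun z : R => m + r * z)%R.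
Proof.
apply: measurable_funD; first exact: measurable_cst.
by apply: measurable_funM => //; exact: measurable_cst.
Qed.

Let mcos (p th : R) : measurable_fun [set: measurableTypeR R] (fun x : R => 1 + cos (p * x + th))%R.
Proof.
apply: measurable_funD; first exact: measurable_cst.
apply: (measurableT_comp (continuous_measurable_fun (@continuous_cos R))).
apply: measurable_funD; last exact: measurable_cst.
by apply: measurable_funM => //; exact: measurable_cst.
Qed.

Let cos1_ge0 (x : R) : (0 <= 1 + cos x)%R.
Proof. by rewrite -lerBlDl sub0r cos_geN1. Qed.

Let cos1_le2 (x : R) : (0 <= 1 + cos x <= 2)%R.
Proof. by rewrite cos1_ge0/= -[leRHS]/(1 + 1)%R lerD2l cos_le1. Qed.

(** The product-to-sum formula, completed by constants so that only nonnegative terms occur on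
    either side. *)
Let cosE (x y : R) : ((1 + cos x) * (1 + cos y) + 2 =
  2^-1 * (1 + cos (x + y)) + (2^-1 * (1 + cos (x - y)) + ((1 + cos x) + (1 + cos y))))%R.
Proof. by rewrite cosD cosB; field. Qed.

Let C (p q th x y : R) : R := (1 + cos (p * x + q * y + th))%R.

Let C_ge0 p q th x y : 0 <= (C p q th x y)%:E.
Proof. by rewrite lee_fin; exact: cos1_ge0. Qed.

Let measurable_C e (U : measurableType e) (x y : U -> R) (p q th : R) :
  measurable_fun setT x -> measurable_fun setT y -> measurable_fun setT (fun w => C p q th (x w) (y w)).
Proof.
move=> mx my; apply: measurable_funD; first exact: measurable_cst.
apply: (measurableT_comp (continuous_measurable_fun (@continuous_cos R))).
apply: measurable_funD; last exact: measurable_cst.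
by apply: measurable_funD; apply: measurable_funM => //; exact: measurable_cst.
Qed.

Let measurable_z1 : measurable_fun setT (fun z : measurableTypeR R * measurableTypeR R => a + s * z.1)%R.
Proof. exact: measurableT_comp (measurable_affine a s) measurable_fst. Qed.

Let measurable_z2 : measurable_fun setT (fun z : measurableTypeR R * measurableTypeR R => b + u * z.2)%R.
Proof. exact: measurableT_comp (measurable_affine b u) measurable_snd. Qed.

(** [C 0 0 0] is the constant 2 of [cosE]. The formula holds for any measure and any pair of
    functions, so it can be read both under [P] and under the product of two standard normal
    laws. *)
Let C_split e (U : measurableType e) (mu : {measure set U -> \bar R}) (x y : U -> R) (p th q et : R) :
  measurable_fun setT x -> measurable_fun setT y ->
  \int[mu]_w (C p 0 th (x w) (y w) * C 0 q et (x w) (y w))%:E + \int[mu]_w (C 0 0 0 (x w) (y w))%:E =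
  (2^-1)%:E * \int[mu]_w (C p q (th + et) (x w) (y w))%:E +
  ((2^-1)%:E * \int[mu]_w (C p (- q) (th - et) (x w) (y w))%:E +
   (\int[mu]_w (C p 0 th (x w) (y w))%:E + \int[mu]_w (C 0 q et (x w) (y w))%:E)).
Proof.
move=> mx my.
have mC p' q' th' := measurable_C p' q' th' mx my.
have mCE p' q' th' : measurable_fun setT (fun w => (C p' q' th' (x w) (y w))%:E) by exact/measurable_EFinP.
have C0 p' q' th' w : 0 <= (C p' q' th' (x w) (y w))%:E by exact: C_ge0.
have hC0 p' q' th' w : 0 <= (2^-1)%:E * (C p' q' th' (x w) (y w))%:E by rewrite mule_ge0// lee_fin.
have mhC p' q' th' : measurable_fun setT (fun w => (2^-1)%:E * (C p' q' th' (x w) (y w))%:E).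
  by apply: emeasurable_funM => //; exact: measurable_cst.
rewrite -!ge0_integralZl_EFin//.
rewrite -!ge0_integralD//; last 6 first.
- by move=> w _; rewrite !adde_ge0.
- by do 2 (apply: emeasurable_funD => //).
- by move=> w _; rewrite adde_ge0.
- exact: emeasurable_funD.
- by move=> w _; rewrite lee_fin mulr_ge0 -?lee_fin.
- by apply/measurable_EFinP; exact: measurable_funM.
apply: eq_integral => w _; rewrite -!EFinM -!EFinD /C; congr EFin.
rewrite !mul0r !add0r !addr0 cos0 -[(1 + 1)%R]/(2%:R)%R cosE.
by congr (_ * (1 + cos _) + (_ * (1 + cos _) + _))%R; ring.
Qed.

Let C_law (p q th : R) : \int[P]_w (C p q th (Y w) (W w))%:E =
  \int[gam \x gam]_z (C p q th (a + s * z.1) (b + u * z.2))%:E.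
Proof.
have mC1 : measurable_fun [set: measurableTypeR R] (fun x => (1 + cos (1 * x + th))%:E).
  by apply/measurable_EFinP; exact: mcos.
have e x : (1 + cos (x + th))%:E = (1 + cos (1 * x + th))%:E by rewrite mul1r.
rewrite fubini_tonelli1//=; last by apply/measurable_EFinP; exact: measurable_C.
transitivity (\int[P]_w (1 + cos (1 * (p * Y w + q * W w) + th))%:E).
  by apply: eq_integral => w _; rewrite mul1r.
rewrite (@uncorrelated_lin_law p q (fun x => (1 + cos (1 * x + th))%:E))//.
by apply: eq_integral => z _; apply: eq_integral => y _; rewrite mul1r.
Qed.

(** Each term on the right of [C_split] involves a single linear combination of [Y] and [W], whose
    law is known; so the product has the same expectation as for independent variables. *)
Lemma cos_product_mean (p th q et : R) :
  \int[P]_w ((1 + cos (p * Y w + th)) * (1 + cos (q * W w + et)))%:E =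
  \int[P]_w (1 + cos (p * Y w + th))%:E * \int[P]_w (1 + cos (q * W w + et))%:E.
Proof.
have h1 := C_split P p th q et mY mW; have h2 := C_split (gam \x gam) p th q et measurable_z1 measurable_z2.
move: h1; rewrite !C_law -h2 => {h2} h.
have f0 : \int[gam \x gam]_z (C 0 0 0 (a + s * z.1) (b + u * z.2))%:E \is a fin_num.
  rewrite -C_law /C; under eq_integral do rewrite !mul0r !add0r cos0.
  by rewrite integral_probability_cst.
have {h} E := congr1 (fun x => x - \int[gam \x gam]_z (C 0 0 0 (a + s * z.1) (b + u * z.2))%:E) h.
rewrite !addeK// in E.
transitivity (\int[P]_w (C p 0 th (Y w) (W w) * C 0 q et (Y w) (W w))%:E).
  by apply: eq_integral => w _; rewrite /C !mul0r addr0 add0r.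
have mcE p' th' : measurable_fun [set: measurableTypeR R] (fun x => (1 + cos (p' * x + th'))%:E).
  by apply/measurable_EFinP; exact: mcos.
have cE0 (x : R) : 0 <= (1 + cos x)%:E by rewrite lee_fin; exact: cos1_ge0.
have mcA p' th' m r : measurable_fun [set: measurableTypeR R] (fun x => (1 + cos (p' * (m + r * x) + th'))%:E).
  exact: (measurableT_comp (mcE p' th') (measurable_affine m r)).
rewrite E fubini_tonelli1//=; last 2 first.
- by apply/measurable_EFinP; apply: measurable_funM; exact: measurable_C.
- by move=> z; rewrite lee_fin mulr_ge0//; exact: cos1_ge0.
rewrite (gaussian_rvP gY (mcE p th))// (gaussian_rvP gW (mcE q et))//.
rewrite -ge0_integralZr//; last exact: integral_ge0.
apply: eq_integral => z _; rewrite -ge0_integralZl//.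
by apply: eq_integral => y _; rewrite /C/= !mul0r addr0 add0r.
Qed.

(** [cosine_transform_unique] is applied twice. For [Y], the weights [1 + cos (q W + et)] and their
    mean have the same transform, by [cos_product_mean]. This in turn says that for [W] the weights
    [\1_(Y @^-1] A)[and]P (Y @^-1[A)] have the same transform. *)
Lemma uncorrelated_events (A B : set R) : measurable A -> measurable B ->
  P (Y @^-1` A `&` W @^-1` B) = P (Y @^-1` A) * P (W @^-1` B).
Proof.
move=> mA mB.
have iX (X : T -> R) : gaussian_rv P X -> P.-integrable setT (EFin \o X).
  by move=> gX; apply/Lfun1_integrable; apply: Lfun21; exact: gaussian_Lfun2.
have mcX (X : T -> R) p th : measurable_fun setT X -> measurable_fun setT (fun w => 1 + cos (p * X w + th))%R.
  by move=> mX; exact: (measurableT_comp (mcos p th) mX).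
have c1_fin q et : \int[P]_w (1 + cos (q * W w + et))%:E \is a fin_num.
  rewrite ge0_fin_numE; last by apply: integral_ge0 => w _; rewrite lee_fin.
  apply: (@le_lt_trans _ _ (\int[P]_w 2%:E)); last by rewrite integral_probability_cst ltry.
  apply: ge0_le_integral => //.
  - by apply/measurable_EFinP; exact: mcX.
  - by move=> w _; rewrite lee_fin; case/andP: (cos1_le2 (q * W w + et)).
have step1 q et : \int[P]_(w in Y @^-1` A) (1 + cos (q * W w + et))%:E =
    \int[P]_(w in Y @^-1` A) (cst (fine (\int[P]_w (1 + cos (q * W w + et))%:E)) w)%:E.
  apply: (@cosine_transform_unique _ _ _ P Y mY _ _ 2) => //.
  - exact: mcX.
  - move=> w; rewrite -!lee_fin /= fineK//; apply/andP; split.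
      by apply: integral_ge0 => v _; rewrite lee_fin.
    rewrite -(integral_probability_cst P 2); apply: ge0_le_integral => //.
    + by apply/measurable_EFinP; exact: mcX.
    + by move=> v _; rewrite lee_fin; case/andP: (cos1_le2 (q * W v + et)).
  - exact: iX.
  - move=> p th; rewrite cos_product_mean.
    rewrite -[X in _ * X](fineK (c1_fin q et)) -ge0_integralZr//.
    + by apply/measurable_EFinP; exact: mcX.
    + by rewrite lee_fin fine_ge0// integral_ge0// => v _; rewrite lee_fin.
have mYA : measurable (Y @^-1` A) by rewrite -[X in measurable X]setTI; exact: mY.
have mWB : measurable (W @^-1` B) by rewrite -[X in measurable X]setTI; exact: mW.
have PYf : P (Y @^-1` A) \is a fin_num by exact: fin_num_measure.
have := @cosine_transform_unique _ _ _ P W mW (\1_(Y @^-1` A)) (cst (fine (P (Y @^-1` A)))) 1 _ _ _ _ _ _ B mB.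
rewrite integral_indic// setIC => ->.
- by rewrite /= integral_cst//= fineK.
- exact: measurable_indic.
- exact: measurable_cst.
- by move=> w; rewrite indicE; case: (w \in _); rewrite ?ler01 ?lexx.
- by move=> w; rewrite -!lee_fin /= fineK// measure_ge0 probability_le1.
- exact: iX.
- move=> q et.
  transitivity (\int[P]_(w in Y @^-1` A) (1 + cos (q * W w + et))%:E).
    rewrite [RHS]integral_mkcond; apply: eq_integral => w _.
    by rewrite patchE indicE; case: ifP => _; rewrite ?mulr1 ?mulr0.
  rewrite step1 /= integral_cst//= fineK// -[X in _ * X]fineK// -ge0_integralZr//.
  + by apply/measurable_EFinP; exact: mcX.
  + by rewrite lee_fin fine_ge0.
Qed.

Lemma uncorrelated_law (F : R * R -> \bar R) :
  measurable_fun [set: measurableTypeR R * measurableTypeR R] F -> (forall x, 0 <= F x) ->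
  \int[P]_w F (Y w, W w) = \int[gam]_z \int[gam]_y F (a + s * z, b + u * y)%R.
Proof.
move=> mF F0.
pose Y' : {mfun T >-> measurableTypeR R} := @mfun_Sub _ _ T (measurableTypeR R) Y (mem_set mY).
pose W' : {mfun T >-> measurableTypeR R} := @mfun_Sub _ _ T (measurableTypeR R) W (mem_set mW).
have mYW : measurable_fun setT (fun w => (Y w : measurableTypeR R, W w : measurableTypeR R)).
  exact: measurable_fun_pair.
transitivity (\int[pushforward P (fun w => (Y w : measurableTypeR R, W w : measurableTypeR R))]_z F z).
  by rewrite ge0_integral_pushforward.
transitivity (\int[distribution P Y' \x distribution P W']_z F z).
  apply: eq_measure_integral => A mA _; symmetry.
  apply: (@product_measure_unique _ _ _ _ _ (distribution P Y') (distribution P W')) => // B D mB mD.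
  by rewrite /= /distribution /pushforward /= -uncorrelated_events.
pose G x := \int[gam]_y F (x, b + u * y)%R.
have mFx x : measurable_fun [set: measurableTypeR R] (fun y => F (x, y)).
  exact: (measurableT_comp mF (@measurable_pair1 _ _ _ _ (x : measurableTypeR R))).
have mG : measurable_fun [set: measurableTypeR R] G.
  apply: (measurable_fun_fubini_tonelli_F (fun z : measurableTypeR R * measurableTypeR R => F (z.1, b + u * z.2)%R)) => //.
  apply: (measurableT_comp mF); apply: measurable_fun_pair => //; exact: measurable_z2.
have G0 x : 0 <= G x by exact: integral_ge0.
rewrite fubini_tonelli1//.
transitivity (\int[distribution P Y']_x G x).
  apply: eq_integral => x _; rewrite /fubini_F ge0_integral_distribution//.
  by rewrite (gaussian_rvP gW (mFx x)).
by rewrite ge0_integral_distribution// (gaussian_rvP gY mG).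
Qed.

End gaussian_pair.

(** * Pointwise limits of Gaussian variables *)

Section measurable_level_sets.
Context d (T : measurableType d) (R : realType).

Lemma measurable_leset (f g : T -> R) : measurable_fun setT f -> measurable_fun setT g ->
  measurable [set x | f x <= g x].
Proof.
move=> mf mg; have := measurable_fun_ler mf mg.
by move=> /(_ measurableT [set true]); rewrite setTI; exact.
Qed.

Lemma measurable_ltset (f g : T -> R) : measurable_fun setT f -> measurable_fun setT g ->
  measurable [set x | f x < g x].
Proof.
move=> mf mg; have := measurable_fun_ltr mf mg.
by move=> /(_ measurableT [set true]); rewrite setTI; exact.
Qed.

Lemma measurable_norm_leset (f : T -> R) (c : R) : measurable_fun setT f ->
  measurable [set x | `|f x| <= c].
Proof.
by move=> mf; apply: measurable_leset; [exact: measurableT_comp|exact: measurable_cst].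
Qed.

End measurable_level_sets.

Section tightness.
Context (R : realType).
Local Notation leb := (@lebesgue_measure R).
Local Notation gam := (normal_prob (0 : R) 1).
Local Open Scope ereal_scope.

Lemma integral_bool d (T : measurableType d) (mu : {measure set T -> \bar R}) (b : T -> bool) :
  measurable [set x | b x] -> \int[mu]_x (b x)%:R%:E = mu [set x | b x].
Proof.
move=> mb; have := integral_ind mu (cst 1) b.
by rewrite integral_cst// mul1e => <-; apply: eq_integral => x _; rewrite mul1e.
Qed.

Lemma std_itv_le (x y : R) : (x <= y)%R -> gam [set` `[x, y]%R] <= ((y - x) / 2)%:E.
Proof.
move=> xy; rewrite /normal_prob normal_pdf01.
apply: (@le_trans _ _ (\int[leb]_(z in [set` `[x, y]%R]) (cst (2^-1)%:E z))).
  apply: ge0_le_integral => //.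
  - by move=> z _; rewrite lee_fin std_pdf_ge0.
  - by apply/measurable_EFinP; apply: measurable_funTS; exact: measurable_std_pdf.
  - by move=> z _; rewrite lee_fin std_pdf_le_half.
rewrite integral_cst//= lebesgue_measure_itv/= lte_fin; case: ifPn => _.
  by rewrite -EFinB -EFinM lee_fin mulrC.
by rewrite mule0 lee_fin; lra.
Qed.

Lemma std_tail_le : gam [set z | (2 <= `|z|)%R] <= (4^-1)%:E.
Proof.
have mid : measurable_fun [set: measurableTypeR R] (fun z : R => z) by [].
have mnorm : measurable_fun [set: measurableTypeR R] (fun z : R => `|z|)%R.
  exact: (continuous_measurable_fun (@norm_continuous _ R^o)).
have m1 : measurable [set z : measurableTypeR R | (2 <= `|z|)%R].
  by apply: (measurable_leset (T := measurableTypeR R)); [exact: measurable_cst|exact: mnorm].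
rewrite -(integral_bool gam (b := fun z : R => (2 <= `|z|)%R) m1).
rewrite -[leRHS]mule1 -[X in _ <= _ * X](integral_std_sqr R) -ge0_integralZl_EFin//; last 2 first.
- by move=> z _; rewrite lee_fin sqr_ge0.
- by apply/measurable_EFinP; exact: measurable_funX.
apply: ge0_le_integral => //.
- apply/measurable_EFinP; apply: measurable_ind_le; first exact: measurable_cst.
  exact: mnorm.
- apply/measurable_EFinP; apply: measurable_funM; first exact: measurable_cst.
  exact: measurable_funX.
- move=> z _; rewrite -EFinM lee_fin -(real_normK (num_real z)).
  have [z2|_] := leP 2%R `|z|%R; last by rewrite mulr_ge0 ?invr_ge0 ?sqr_ge0.
  by rewrite /=; nra.
Qed.

Context d (T : measurableType d) (P : probability T R).

(** If [|m| > c + 2 s], then [|V| <= c] forces the standardized variable beyond 2, an event of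
    probability at most 1/4 by Chebyshev. Besides, [[-c, c]] has length [2 c / s] in standard units,
    hence mass at most [c / s], so [s <= 4 c / 3]. Then [m^2 + s^2 <= (121 + 16) / 9 * c^2], which
    is below [20 c^2]. *)
Lemma gaussian_tight (V : T -> R) (c : R) : gaussian_rv P V -> (0 <= c)%R ->
  (3 / 4)%:E <= P [set w | (`|V w| <= c)%R] -> \int[P]_w (V w ^+ 2)%:E <= (20 * c ^+ 2)%:E.
Proof.
move=> gV c0; have [mV _] := gV; have LV := gaussian_rvP gV.
rewrite (normal_law_sqr mV LV) lee_fin.
have s0 : (0 <= sd P V)%R by exact: sqrtr_ge0.
set m := mean P V; set s := sd P V; rewrite -/s in s0.
have mid : measurable_fun [set: measurableTypeR R] (fun z : R => z) by [].
have mnorm : measurable_fun [set: measurableTypeR R] (fun z : R => `|z|)%R.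
  exact: (continuous_measurable_fun (@norm_continuous _ R^o)).
have mI : measurable [set w | (`|V w| <= c)%R] by exact: measurable_norm_leset.
have mA : measurable_fun [set: measurableTypeR R] (fun z : R => m + s * z)%R.
  apply: measurable_funD; first exact: measurable_cst.
  by apply: measurable_funM => //; exact: measurable_cst.
have mJ : measurable [set z : measurableTypeR R | (`|m + s * z| <= c)%R].
  exact: (measurable_norm_leset (T := measurableTypeR R)).
have -> : P [set w | (`|V w| <= c)%R] = gam [set z : R | (`|m + s * z| <= c)%R].
  rewrite -(integral_bool P (b := fun w => (`|V w| <= c)%R) mI).
  rewrite -(integral_bool gam (b := fun z : R => (`|m + s * z| <= c)%R) mJ).
  rewrite (LV (fun x => ((`|x| <= c)%R%:R)%:E))//.
  - apply/measurable_EFinP; apply: measurable_ind_le; last exact: measurable_cst.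
    exact: mnorm.
move=> h.
have mle : (`|m| <= c + 2 * s)%R.
  rewrite leNgt; apply/negP => mlt.
  have : gam [set z : R | (`|m + s * z| <= c)%R] <= (4^-1)%:E.
    apply: le_trans std_tail_le; apply: le_measure; rewrite ?inE//.
      by apply: (measurable_leset (T := measurableTypeR R)); [exact: measurable_cst|exact: mnorm].
    move=> z /= mz; rewrite leNgt; apply/negP => z2.
    have : (`|m| <= `|m + s * z| + s * `|z|)%R.
      rewrite -[X in (X * `|z|)%R]ger0_norm// -normrM.
      by rewrite -{1}(addrK (s * z)%R m) (le_trans (ler_normB _ _)).
    by nra.
  by move/(le_trans h); rewrite lee_fin; lra.
have sle : (s <= 4 / 3 * c)%R.
  move: s0; rewrite le_eqVlt => /predU1P[<-|s0]; first by lra.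
  have e : [set z : R | (`|m + s * z| <= c)%R] = [set` `[((- c - m) / s)%R, ((c - m) / s)%R]].
    apply/seteqP; split => z /=; rewrite in_itv/= ler_norml ler_pdivrMr// ler_pdivlMr// mulrC.
      by move=> /andP[? ?]; apply/andP; split; lra.
    by move=> /andP[? ?]; apply/andP; split; lra.
  have : (3 / 4)%:E <= (c / s)%:E.
    apply: (le_trans h); rewrite e; apply: le_trans (std_itv_le _) _.
      by rewrite ler_pM2r ?invr_gt0//; lra.
    by rewrite lee_fin le_eqVlt; apply/orP; left; apply/eqP; field; rewrite gt_eqF.
  by rewrite lee_fin ler_pdivlMr//; lra.
have := normr_ge0 m; rewrite -(real_normK (num_real m)); nra.
Qed.

(** Continuity from below. This is how a property that holds eventually along each path, at a rank
    depending on the path, comes to hold at a fixed rank with probability close to 1. *)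
Lemma prob_exhaust (A : nat -> set T) (p : R) : (forall k, measurable (A k)) ->
  (forall k, A k `<=` A k.+1) -> (forall w, exists k, A k w) -> (p < 1)%R ->
  exists k, p%:E <= P (A k).
Proof.
move=> mA ndA AT p1.
have : P (A k) @[k --> \oo] --> P (\bigcup_k A k).
  apply: nondecreasing_cvg_mu => //; first exact: bigcupT_measurable.
  by apply/nondecreasing_seqP => k; apply/subsetPset; exact: ndA.
have -> : \bigcup_k A k = setT.
  by apply/seteqP; split => // w _; have [k Ak] := AT w; exists k.
rewrite probability_setT => cP; apply: contrapT => /forallNP H.
suff : limn (fun k => P (A k)) <= p%:E by rewrite (cvg_lim _ cP)// lee_fin leNgt p1.
apply: lime_le; first by apply/cvg_ex; exists 1.
apply: nearW => k; rewrite leNgt; apply/negP => /ltW; exact: H.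
Qed.

End tightness.

Section gaussian_limits.
Context d (T : measurableType d) (R : realType) (P : probability T R).
Local Open Scope ereal_scope.

Lemma prob_setI_ge (A B : set T) (p q : R) : measurable A -> measurable B ->
  p%:E <= P A -> q%:E <= P B -> (p + q - 1)%:E <= P (A `&` B).
Proof.
move=> mA mB; have f X : measurable X -> P X \is a fin_num by move=> mX; exact: fin_num_measure.
have : P A = P (A `\` B) + P (A `&` B) by exact: measureDI.
have : P (A `\` B) <= 1 - P B.
  by rewrite -probability_setC//; apply: le_measure; rewrite ?inE//; [exact: measurableD|exact: measurableC].
rewrite -(fineK (f _ mA)) -(fineK (f _ mB)) -(fineK (f _ (measurableD mA mB))).
rewrite -(fineK (f _ (measurableI _ _ mA mB))) -EFinD !lee_fin => h [->].
lra.
Qed.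

Variable H : set (T -> R).
Hypothesis gH : forall X, H X -> gaussian_rv P X.
Hypothesis linH : forall a b X Y, H X -> H Y -> H (fun w => a * X w + b * Y w)%R.

(* The sequence is tight, which for Gaussian variables bounds the second
   moments; so pointwise limits are limits in [L^2]. *)
Definition glim (X : T -> R) := exists V : nat -> T -> R,
  (forall k, H (V k)) /\ forall w, (V k w @[k --> \oo] --> X w)%R.

Lemma glimW (X : T -> R) : H X -> glim X.
Proof. by move=> HX; exists (fun=> X); split => // w; exact: cvg_cst. Qed.

Lemma glim_lin a b (X Y : T -> R) : glim X -> glim Y -> glim (fun w => a * X w + b * Y w)%R.
Proof.
move=> [V [HV VX]] [W [HW WY]]; exists (fun k w => a * V k w + b * W k w)%R; split.
  by move=> k; exact: linH.
by move=> w; apply: cvgD; apply: cvgM; (exact: cvg_cst || exact: VX || exact: WY).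
Qed.

Lemma glimB (X Y : T -> R) : glim X -> glim Y -> glim (fun w => X w - Y w)%R.
Proof.
move=> gX gY; have := glim_lin 1 (-1) gX gY.
by under eq_fun do rewrite mul1r mulN1r.
Qed.

Lemma glim_measurable (X : T -> R) : glim X -> measurable_fun setT X.
Proof.
move=> [V [HV VX]]; apply: (@measurable_fun_cvg _ _ _ _ V) => //.
by move=> k; case: (gH (HV k)).
Qed.

(** Two events of probability at least 7/8 meet with probability at least 3/4, so [gaussian_tight]
    applies to the approximants with [2 c] in place of [c]; this gives [20 (2 c)^2 = 80 c^2], and
    Fatou's lemma passes to the limit. *)
Lemma glim_tight (X : T -> R) (c : R) : glim X -> (0 < c)%R ->
  (7 / 8)%:E <= P [set w | (`|X w| <= c)%R] -> \int[P]_w (X w ^+ 2)%:E <= (80 * c ^+ 2)%:E.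
Proof.
move=> gX c0 h; have mX := glim_measurable gX; case: gX => V [HV VX].
have mV k : measurable_fun setT (V k) by case: (gH (HV k)).
have mI : measurable [set w | (`|X w| <= c)%R] by exact: measurable_norm_leset.
have mJ k : measurable [set w | (`|V k w| <= 2 * c)%R] by exact: measurable_norm_leset.
(* The bound [2 c] on the approximants is asked only where [|X| <= c], so that the sets [A K]
   exhaust the whole space. *)
pose A K := ~` [set w | (`|X w| <= c)%R] `|` \bigcap_(k in [set k | (K <= k)%N]) [set w | (`|V k w| <= 2 * c)%R].
have mA K : measurable (A K).
  by apply: measurableU; [exact: measurableC|exact: bigcap_measurableType].
have [K PK] : exists K, (7 / 8)%:E <= P (A K).
  apply: prob_exhaust => //; [move=> K w|move=> w|lra].
- by move=> [Xw|Vw]; [left|right] => // k /= Kk; apply: Vw => /=; exact: leq_trans Kk.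
- have [Xc|Xc] := leP `|X w|%R c; last by exists 0%N; left => /=; rewrite leNgt Xc.
  have : \forall k \near \oo, (`|V k w| < 2 * c)%R.
    apply: (@cvgr_lt _ _ _ _ (fun k => `|V k w|)%R `|X w|%R); last by lra.
    by apply: cvg_norm; exact: VX.
  by move=> [K _ HK]; exists K; right => k /= Kk; apply/ltW; exact: HK.
have P34 k : (K <= k)%N -> \int[P]_w (V k w ^+ 2)%:E <= (80 * c ^+ 2)%:E.
  move=> Kk; have -> : (80 * c ^+ 2 = 20 * (2 * c) ^+ 2)%R by ring.
  apply: gaussian_tight => //; [exact: gH|lra|].
  apply: (@le_trans _ _ (7 / 8 + 7 / 8 - 1)%:E); first by rewrite lee_fin; lra.
  apply: le_trans (prob_setI_ge mI (mA K) h PK) _.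
  apply: le_measure; rewrite ?inE//; first exact: measurableI.
  by move=> w [/= Xc [//|]]; apply.
pose f k w : \bar R := (V k w ^+ 2)%:E.
have mf k : measurable_fun setT (f k) by apply/measurable_EFinP; exact: measurable_funX.
have f0 k w : setT w -> 0 <= f k w by rewrite lee_fin sqr_ge0.
have -> : \int[P]_w (X w ^+ 2)%:E = \int[P]_w limn_einf (f ^~ w).
  apply: eq_integral => w _; symmetry.
  suff /cvg_limn_einf_sup[] : f k w @[k --> \oo] --> (X w ^+ 2)%:E by [].
  apply: cvg_EFin; first exact: nearW.
  by apply: cvgM; exact: VX.
apply: le_trans (fatou P measurableT mf f0) _.
rewrite limn_einf_lim; apply: lime_le; first exact: is_cvg_einfs.
apply: nearW => k; apply: le_trans (P34 (maxn K k) (leq_maxl _ _)).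
by apply: ereal_inf_lbound; exists (maxn K k) => //=; exact: leq_maxr.
Qed.

Lemma glim_Lfun2 (X : T -> R) : glim X -> X \in Lfun P 2%:E.
Proof.
move=> gX; have mX := glim_measurable gX; apply: Lfun2P => //.
have [k Pk] : exists k, (7 / 8)%:E <= P [set w | (`|X w| <= k.+1%:R)%R].
  apply: (@prob_exhaust _ _ _ P (fun k => [set w | (`|X w| <= k.+1%:R)%R])); [| | |lra].
  - by move=> k; exact: measurable_norm_leset.
  - by move=> k w /= /le_trans; apply; rewrite ler_nat.
  - by move=> w; exists (Num.truncn `|X w|)%R => /=; apply/ltW; exact: truncnS_gt.
by apply: le_lt_trans (glim_tight gX _ Pk) _ => //; rewrite ltry.
Qed.

(** The index type may be uncountable, and a supremum over it need not be measurable. Were the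
    conclusion false, a sequence of indices with unbounded second moments would exist; along a
    sequence the supremum is measurable, and tightness applies. *)
Lemma glim_bounded (J : Type) (X : J -> T -> R) : (forall i, glim (X i)) ->
  (forall w, exists M : R, forall i, (`|X i w| <= M)%R) ->
  exists B : R, forall i, \int[P]_w (X i w ^+ 2)%:E <= B%:E.
Proof.
move=> gX bX; apply: contrapT => /forallNP NB.
have /choice[i iB] : forall k : nat, exists i, (k%:R)%:E < \int[P]_w (X i w ^+ 2)%:E.
  move=> k; apply: contrapT => /forallNP H'; apply: (NB k%:R) => i.
  by rewrite leNgt; apply/negP; exact: H'.
have mX k : measurable_fun setT (X (i k)) by exact: glim_measurable.
pose A (K : nat) := \bigcap_k [set w | (`|X (i k) w| <= K.+1%:R)%R].
have mA K : measurable (A K) by apply: bigcapT_measurable => k; exact: measurable_norm_leset.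
have [K PK] : exists K, (7 / 8)%:E <= P (A K).
  apply: prob_exhaust => //; [move=> K w|move=> w|lra].
- by move=> Aw k _ /=; apply: le_trans (Aw k I) _; rewrite ler_nat.
- have [M HM] := bX w; exists (Num.truncn M) => k _ /=.
  by apply: le_trans (HM _) _; apply/ltW; exact: truncnS_gt.
have := iB (Num.truncn (80 * K.+1%:R ^+ 2 : R)%R).+1.
apply/negP; rewrite -leNgt.
apply: (@le_trans _ _ (80 * K.+1%:R ^+ 2)%:E); last by rewrite lee_fin; apply/ltW; exact: truncnS_gt.
apply: glim_tight => //; apply: le_trans PK _; apply: le_measure; rewrite ?inE//.
  exact: measurable_norm_leset.
by move=> w /= Aw; exact: (Aw _ I).
Qed.

Lemma glim_cvg0 (X : nat -> T -> R) : (forall k, glim (X k)) ->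
  (forall w, (X k w @[k --> \oo] --> 0)%R) -> \int[P]_w (X k w ^+ 2)%:E @[k --> \oo] --> 0.
Proof.
move=> gX X0; have mX k := glim_measurable (gX k).
have I0 k : 0 <= \int[P]_w (X k w ^+ 2)%:E by apply: integral_ge0 => w _; rewrite lee_fin sqr_ge0.
apply: cvg_EFin.
  by apply: nearW => k; rewrite ge0_fin_numE// Lfun2_sqr_lty// glim_Lfun2.
apply/cvgrPdist_le => e e0.
(* With [c <= 1] and [c <= e / 80], the bound [80 c^2] is at most [e]. *)
pose c := Num.min 1%R (e / 80)%R.
have c0 : (0 < c)%R by rewrite lt_min ltr01 divr_gt0.
pose A K := \bigcap_(k in [set k | (K <= k)%N]) [set w | (`|X k w| <= c)%R].
have mA K : measurable (A K).
  by apply: bigcap_measurableType => // k _; exact: measurable_norm_leset.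
have [K PK] : exists K, (7 / 8)%:E <= P (A K).
  apply: prob_exhaust => //; [move=> K w|move=> w|lra].
    by move=> Aw k /= Kk; apply: Aw => /=; exact: leq_trans Kk.
  have /cvgrPdist_le/(_ _ c0)[K _ HK] := X0 w.
  by exists K => k /= Kk; have := HK k Kk; rewrite sub0r normrN.
exists K => // k /= Kk; rewrite sub0r normrN ger0_norm ?fine_ge0//.
rewrite -lee_fin fineK; last by rewrite ge0_fin_numE// Lfun2_sqr_lty// glim_Lfun2.
apply: (@le_trans _ _ (80 * c ^+ 2)%:E).
  apply: glim_tight => //; apply: le_trans PK _; apply: le_measure; rewrite ?inE//.
    exact: measurable_norm_leset.
  by move=> w Aw; exact: Aw.
have c1 : (c <= 1)%R by rewrite ge_min lexx.
have ce : (c <= e / 80)%R by rewrite ge_min lexx orbT.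
by rewrite lee_fin; nra.
Qed.

Lemma sqr_integral_le (X Y Z : T -> R) (a b : R) : (0 <= a)%R -> (0 <= b)%R ->
  X \in Lfun P 2%:E -> Y \in Lfun P 2%:E -> Z \in Lfun P 2%:E ->
  (forall w, X w ^+ 2 <= a * Y w ^+ 2 + b * Z w ^+ 2)%R ->
  (fine (\int[P]_w (X w ^+ 2)%:E) <=
   a * fine (\int[P]_w (Y w ^+ 2)%:E) + b * fine (\int[P]_w (Z w ^+ 2)%:E))%R.
Proof.
move=> a0 b0 X2 Y2 Z2 XYZ.
have fin (U : T -> R) : U \in Lfun P 2%:E -> \int[P]_w (U w ^+ 2)%:E \is a fin_num.
  move=> U2; rewrite ge0_fin_numE ?Lfun2_sqr_lty//.
  by apply: integral_ge0 => w _; rewrite lee_fin sqr_ge0.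
have m2 (U : T -> R) : U \in Lfun P 2%:E -> measurable_fun setT (fun w => (U w ^+ 2)%:E).
  by move=> U2; apply/measurable_EFinP; apply: measurable_funX; exact: Lfun2_measurable U2.
rewrite -lee_fin EFinD !EFinM !fineK ?fin//.
have Zl (U : T -> R) (k : R) : U \in Lfun P 2%:E -> (0 <= k)%R ->
    k%:E * \int[P]_w (U w ^+ 2)%:E = \int[P]_w (k%:E * (U w ^+ 2)%:E).
  move=> U2 k0; rewrite ge0_integralZl_EFin//; last exact: m2.
  by move=> w _; rewrite lee_fin sqr_ge0.
rewrite !Zl//.
rewrite -ge0_integralD//; last 4 first.
- by move=> w _; rewrite -EFinM lee_fin mulr_ge0 ?sqr_ge0.
- by apply: emeasurable_funM; [exact: measurable_cst|exact: m2].
- by move=> w _; rewrite -EFinM lee_fin mulr_ge0 ?sqr_ge0.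
- by apply: emeasurable_funM; [exact: measurable_cst|exact: m2].
apply: ge0_le_integral => //; first by move=> w _; rewrite lee_fin sqr_ge0.
- exact: m2.
- apply: emeasurable_funD; (apply: emeasurable_funM; [exact: measurable_cst|exact: m2]).
- by move=> w _; rewrite -!EFinM -EFinD lee_fin.
Qed.

(** From [x^2 <= (1 + r) y^2 + (1 + 1/r) (x - y)^2], used in both directions, the second moments are
    close once that of the difference is small. *)
Lemma glim_sqr_cvg (X : nat -> T -> R) (Y : T -> R) : (forall k, glim (X k)) -> glim Y ->
  (forall w, (X k w @[k --> \oo] --> Y w)%R) ->
  (fine (\int[P]_w (X k w ^+ 2)%:E) @[k --> \oo] --> fine (\int[P]_w (Y w ^+ 2)%:E))%R.
Proof.
move=> gX gY XY.
pose q (U : T -> R) : R := fine (\int[P]_w (U w ^+ 2)%:E).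
have q0 U : (0 <= q U)%R by apply: fine_ge0; apply: integral_ge0 => w _; rewrite lee_fin sqr_ge0.
pose D k w := (X k w - Y w)%R.
have gD k : glim (D k) by exact: glimB.
have D0 : (q (D k) @[k --> \oo] --> 0)%R.
  apply: fine_cvg; apply: glim_cvg0 => // w.
  by rewrite -(subrr (Y w)); apply: cvgB; [exact: XY|exact: cvg_cst].
have le1 k (r : R) : (0 < r)%R -> (q (X k) <= (1 + r) * q Y + (1 + r^-1) * q (D k))%R.
  move=> r0; apply: sqr_integral_le; try exact: glim_Lfun2.
  - by rewrite addr_ge0// ltW.
  - by rewrite addr_ge0// invr_ge0 ltW.
  - move=> w; rewrite -subr_ge0 /D.
    have -> : ((1 + r) * Y w ^+ 2 + (1 + r^-1) * (X k w - Y w) ^+ 2 - X k w ^+ 2 =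
      (r * Y w - (X k w - Y w)) ^+ 2 / r)%R by field; rewrite gt_eqF.
    by rewrite divr_ge0 ?sqr_ge0// ltW.
have le2 k (r : R) : (0 < r)%R -> (q Y <= (1 + r) * q (X k) + (1 + r^-1) * q (D k))%R.
  move=> r0; apply: sqr_integral_le; try exact: glim_Lfun2.
  - by rewrite addr_ge0// ltW.
  - by rewrite addr_ge0// invr_ge0 ltW.
  - move=> w; rewrite -subr_ge0 /D.
    have -> : ((1 + r) * X k w ^+ 2 + (1 + r^-1) * (X k w - Y w) ^+ 2 - Y w ^+ 2 =
      (r * X k w + (X k w - Y w)) ^+ 2 / r)%R by field; rewrite gt_eqF.
    by rewrite divr_ge0 ?sqr_ge0// ltW.
apply/cvgrPdist_le => e e0; rewrite -/(q Y).
(* [M] bounds the second moments of [Y] and, by the inequality with [r = 1], of [X k] as soon as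
   that of the difference is at most 1. With [r M = e / 2], each of the two error terms is at most
   [e / 2]. *)
pose M := (2 * q Y + 2)%R; pose r := (e / (2 * M))%R.
have M0 : (0 < M)%R by have := q0 Y; rewrite /M; lra.
have r0 : (0 < r)%R by rewrite divr_gt0// mulr_gt0.
have rM : (r * M = e / 2)%R by rewrite /r; field; rewrite gt_eqF.
have r1 : (0 < 1 + r^-1)%R by rewrite addr_gt0// invr_gt0.
near=> k; rewrite -/(q (X k)).
have d1 : (q (D k) <= 1)%R.
  near: k; have /cvgrPdist_le/(_ 1%R ltr01) := D0.
  by apply: filterS => k; rewrite sub0r normrN ger0_norm.
have d2 : ((1 + r^-1) * q (D k) <= e / 2)%R.
  near: k; have e1 : (0 < e / 2 / (1 + r^-1))%R by rewrite !divr_gt0.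
  have /cvgrPdist_le/(_ _ e1) := D0.
  by apply: filterS => k; rewrite sub0r normrN ger0_norm// ler_pdivlMr// mulrC.
have := le1 k 1%R ltr01; rewrite invr1 => h1.
have qXM : (q (X k) <= M)%R by rewrite /M; lra.
have := le1 k r r0; have := le2 k r r0; have := q0 Y; have := q0 (X k) => ? ? ? ?.
have : (r * q Y <= e / 2)%R by rewrite -rM ler_pM2l// /M; lra.
have : (r * q (X k) <= e / 2)%R by rewrite -rM ler_pM2l.
by rewrite ler_norml; lra.
Unshelve. all: by end_near. Qed.

End gaussian_limits.

(** * Zeros of a Gaussian process on the line *)

Section small_ball.
Context (R : realType).
Local Notation leb := (@lebesgue_measure R).
Local Notation gam := (normal_prob (0 : R) 1).
Local Open Scope ereal_scope.

Lemma std_pdf_lip (x y : R) : (std_pdf x <= std_pdf y + `|x - y| / 2)%R.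
Proof.
wlog xy : x y / (x <= y)%R => [H|].
  have [/H//|/ltW yx] := leP x y.
  have := H (- x)%R (- y)%R; rewrite !std_pdfN lerN2.
  by have -> : (`|- x - - y| = `|x - y|)%R; [rewrite -opprD normrN|apply].
have dF (t : R) := is_derive_std_pdf t.
have [] := @MVT_segment R (fun z => - std_pdf z)%R (fun t => t * std_pdf t)%R x y xy.
- by apply: continuous_subspaceT => t; apply: cvgN; exact: continuous_std_pdf.
move=> c _ e.
(* [std_pdf 0 <= 1/2] and [c <= 1 + c^2 / 2 <= e^(c^2 / 2)]. An upper bound of the slope suffices:
   reflection has reduced the statement to [x <= y], where it only asserts that the density drops
   slowly. *)
have b : (c * std_pdf c <= 2^-1)%R.
  have [c0|c0] := leP c 0%R.
    by apply: (@le_trans _ _ 0%R); rewrite ?invr_ge0// mulr_le0_ge0 ?std_pdf_ge0.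
  rewrite /std_pdf mulrCA -[leRHS]mulr1; apply: ler_pM.
  - by rewrite invr_ge0 sqrtr_ge0.
  - by rewrite mulr_ge0 ?expR_ge0// ltW.
  - by have := std_pdf_le_half (0 : R); rewrite /std_pdf expr0n/= mul0r oppr0 expR0 mulr1.
  - rewrite expRN ler_pdivrMr ?expR_gt0// mul1r; apply: le_trans (expR_ge1Dx _); nra.
move: e; rewrite opprK => e.
have : ((c * std_pdf c) * (y - x) <= 2^-1 * (y - x))%R by rewrite ler_wpM2r// subr_ge0.
by rewrite distrC ger0_norm ?subr_ge0//; lra.
Qed.

Let measurable_ball (a s r : R) :
  measurable_fun [set: measurableTypeR R] (fun y : R => ((`|a + s * y| < r)%R%:R)%:E : \bar R).
Proof.
apply/measurable_EFinP; apply: measurable_ind_lt; last exact: measurable_cst.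
apply: (measurableT_comp (continuous_measurable_fun (@norm_continuous _ R^o))).
apply: measurable_funD; first exact: measurable_cst.
by apply: measurable_funM => //; exact: measurable_cst.
Qed.

Lemma integral_ball (r : R) : (0 <= r)%R -> \int[leb]_v ((`|v| < r)%R%:R)%:E = (2 * r)%:E.
Proof.
move=> r0; rewrite -[RHS]mule1.
transitivity (leb [set` `](- r)%R, r[%R]).
  rewrite -[RHS]mul1e -integral_cst// [RHS]integral_mkcond; apply: eq_integral => v _.
  by rewrite patchE mem_setE in_itv/= ltr_norml; case: ifP.
rewrite lebesgue_measure_itv/= lte_fin mule1; case: ifPn => h.
  by rewrite -EFinB; congr EFin; ring.
have -> : r = 0%R by lra.
by rewrite mulr0.
Qed.

(** The ball has length [2 r]. The density is at most 1/2, and differs from its central value by at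
    most [r / 2], its slope being at most 1/2; this is the origin of the error
    [2 r * (r / 2) = r^2]. *)
Let small_ball1 (a r : R) : (0 <= r)%R ->
  let p := \int[gam]_y ((`|a + 1 * y| < r)%R%:R)%:E in
  [/\ p <= r%:E, p <= (2 * r * std_pdf a + r ^+ 2)%:E & (2 * r * std_pdf a)%:E <= p + (r ^+ 2)%:E].
Proof.
move=> r0 p.
have mb : measurable_fun [set: measurableTypeR R] (fun v : R => ((`|v| < r)%R%:R)%:E : \bar R).
  by have := measurable_ball 0 1 r; under eq_fun do rewrite add0r mul1r.
have b0 (v : R) : 0 <= ((`|v| < r)%R%:R)%:E :> \bar R by rewrite lee_fin ler0n.
have mphi : measurable_fun [set: measurableTypeR R] (fun v : R => (std_pdf (v - a))%:E).
  apply/measurable_EFinP; apply: (measurableT_comp (@measurable_std_pdf R)).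
  by apply: measurable_funB => //; exact: measurable_cst.
have phi0 (v : R) : 0 <= (std_pdf (v - a))%:E by rewrite lee_fin std_pdf_ge0.
have mbphi : measurable_fun [set: measurableTypeR R] (fun v : R => ((`|v| < r)%R%:R)%:E * (std_pdf (v - a))%:E).
  exact: emeasurable_funM.
have pE : p = \int[leb]_v (((`|v| < r)%R%:R)%:E * (std_pdf (v - a))%:E).
  rewrite /p integral_std//.
  rewrite -[RHS](integral_lebesgue_shift a mbphi); last by move=> v; rewrite mule_ge0.
  by apply: eq_integral => v _; rewrite mul1r addrK [(a + v)%R]addrC.
have key (c : R) : (0 <= c)%R -> (forall v, `|v| < r -> std_pdf (v - a) <= c)%R -> p <= (2 * r * c)%:E.
  move=> c0 H; rewrite pE EFinM -integral_ball// -ge0_integralZr//.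
  apply: ge0_le_integral => //.
  - by move=> v _; rewrite mule_ge0.
  - by apply: emeasurable_funM => //; exact: measurable_cst.
  - move=> v _; have [vr|_] := ltP `|v|%R r; last by rewrite !mul0e.
    by rewrite !mul1e lee_fin; exact: H.
have lip v : (`|v| < r -> `|v| / 2 <= r / 2)%R by move=> vr; lra.
split.
- have -> : r = (2 * r * 2^-1)%R by field.
  by apply: key => // v _; exact: std_pdf_le_half.
- have -> : (2 * r * std_pdf a + r ^+ 2 = 2 * r * (std_pdf a + r / 2))%R by field.
  apply: key; first by rewrite addr_ge0 ?std_pdf_ge0 ?divr_ge0.
  move=> v vr; apply: le_trans (std_pdf_lip _ (- a)) _.
  by rewrite std_pdfN opprK subrK lerD2l; exact: lip.
- have -> : (r ^+ 2)%:E = \int[leb]_v (((`|v| < r)%R%:R)%:E * (r / 2)%:E).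
    rewrite ge0_integralZr//; last by rewrite lee_fin divr_ge0.
    by rewrite integral_ball// -EFinM; congr EFin; field.
  rewrite pE EFinM -integral_ball// -ge0_integralZr//; last by rewrite lee_fin std_pdf_ge0.
  rewrite -ge0_integralD//; last 3 first.
  + by move=> v _; rewrite mule_ge0.
  + by move=> v _; rewrite mule_ge0// lee_fin divr_ge0.
  + by apply: emeasurable_funM => //; exact: measurable_cst.
  apply: ge0_le_integral => //.
  + by move=> v _; rewrite mule_ge0// lee_fin std_pdf_ge0.
  + by apply: emeasurable_funM => //; exact: measurable_cst.
  + by apply: emeasurable_funD => //; apply: emeasurable_funM => //; exact: measurable_cst.
  + move=> v _; have [vr|_] := ltP `|v|%R r; last by rewrite !mul0e adde0.
    rewrite !mul1e -EFinD lee_fin -std_pdfN; apply: le_trans (std_pdf_lip _ (v - a)) _.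
    by rewrite lerD2l opprB addrA addNr add0r normrN; exact: lip.
Qed.

Lemma small_ball (a s r : R) : (0 < s)%R -> (0 <= r)%R ->
  let p := \int[gam]_y ((`|a + s * y| < r)%R%:R)%:E in
  [/\ p <= (r / s)%:E, p <= (2 * (r / s) * std_pdf (a / s) + (r / s) ^+ 2)%:E &
      (2 * (r / s) * std_pdf (a / s))%:E <= p + ((r / s) ^+ 2)%:E].
Proof.
move=> s0 r0 /=.
have -> : \int[gam]_y ((`|a + s * y| < r)%R%:R)%:E = \int[gam]_y ((`|a / s + 1 * y| < r / s)%R%:R)%:E.
  apply: eq_integral => y _; rewrite ltr_pdivlMr//.
  have -> : (a + s * y = (a / s + 1 * y) * s)%R by field; rewrite gt_eqF.
  by rewrite normrM (gtr0_norm s0).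
by apply: small_ball1; rewrite divr_ge0// ltW.
Qed.

Context d (T : measurableType d) (P : probability T R).

(** Given [W], which is independent of [Y], the event says that [Y] falls in a ball of radius
    [c |W|]; the three bounds of [small_ball] are then integrated over the law of [W]. The error is
    quadratic in [W], hence controlled by its second moment. *)
Lemma crossing_prob (Y W : T -> R) (c : R) :
  (forall p q : R, gaussian_rv P (fun w => p * Y w + q * W w)%R) ->
  covariance P Y W = 0 -> (0 < sd P Y)%R -> (0 <= c)%R ->
  let p := \int[P]_w ((`|Y w| < c * `|W w|)%R%:R)%:E in
  let k := (c / sd P Y)%R in
  let L := std_pdf (mean P Y / sd P Y) in
  let m1 := \int[P]_w (`|W w|)%:E in
  let m2 := \int[P]_w (W w ^+ 2)%:E in
  [/\ p <= k%:E * m1, p <= (2 * k * L)%:E * m1 + (k ^+ 2)%:E * m2 &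
      (2 * k * L)%:E * m1 <= p + (k ^+ 2)%:E * m2].
Proof.
move=> gYW cov0 s0 c0.
have gWY p q : gaussian_rv P (fun w => p * W w + q * Y w)%R.
  by have := gYW q p; under eq_fun do rewrite addrC.
have cov0' : covariance P W Y = 0 by rewrite covarianceC.
have gW : gaussian_rv P W by have := gWY 1%R 0%R; under eq_fun do rewrite mul1r mul0r addr0.
have mnorm : measurable_fun [set: measurableTypeR R] (fun x : R => `|x|%R).
  exact: (continuous_measurable_fun (@norm_continuous _ R^o)).
have maff (m r : R) : measurable_fun [set: measurableTypeR R] (fun x : R => m + r * x)%R.
  by apply: measurable_funD; [exact: measurable_cst|apply: measurable_funM => //; exact: measurable_cst].
set s := sd P Y in s0 *; set a := mean P Y => p k L m1 m2.
have k0 : (0 <= k)%R by rewrite divr_ge0// ltW.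
have L0 : (0 <= L)%R by exact: std_pdf_ge0.
pose b := mean P W; pose u := sd P W.
have mF : measurable_fun [set: measurableTypeR R * measurableTypeR R]
    (fun z : R * R => ((`|z.2| < c * `|z.1|)%R%:R)%:E : \bar R).
  apply/measurable_EFinP; apply: measurable_ind_lt.
    exact: (measurableT_comp mnorm measurable_snd).
  apply: measurable_funM; first exact: measurable_cst.
  exact: (measurableT_comp mnorm measurable_fst).
pose q (z : R) := \int[gam]_y ((`|a + s * y| < c * `|b + u * z|)%R%:R)%:E : \bar R.
have q0 z : 0 <= q z by apply: integral_ge0 => y _; rewrite lee_fin ler0n.
have mq : measurable_fun [set: measurableTypeR R] q.
  apply: (measurable_fun_fubini_tonelli_F (fun z : measurableTypeR R * measurableTypeR R =>
    ((`|a + s * z.2| < c * `|b + u * z.1|)%R%:R)%:E : \bar R)).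
    apply/measurable_EFinP; apply: measurable_ind_lt.
      exact: (measurableT_comp mnorm (measurableT_comp (maff a s) measurable_snd)).
    apply: measurable_funM; first exact: measurable_cst.
    exact: (measurableT_comp mnorm (measurableT_comp (maff b u) measurable_fst)).
  by move=> z; rewrite lee_fin ler0n.
have pE : p = \int[gam]_z q z.
  have := uncorrelated_law gWY cov0' mF; rewrite /p => <- // x; by rewrite lee_fin ler0n.
have mA : measurable_fun [set: measurableTypeR R] (fun z => (`|b + u * z|%R)%:E).
  by apply/measurable_EFinP; exact: (measurableT_comp mnorm (maff b u)).
have mS : measurable_fun [set: measurableTypeR R] (fun z => ((b + u * z) ^+ 2)%:E).
  by apply/measurable_EFinP; apply: measurable_funX; exact: maff.
have m1E : m1 = \int[gam]_z (`|b + u * z|)%:E.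
  by rewrite /m1 (gaussian_rvP gW (f := fun x => (`|x|%R)%:E))//; apply/measurable_EFinP.
have m2E : m2 = \int[gam]_z ((b + u * z) ^+ 2)%:E.
  rewrite /m2 (gaussian_rvP gW (f := fun x => (x ^+ 2)%:E))//; last by move=> x; rewrite lee_fin sqr_ge0.
  by apply/measurable_EFinP; exact: measurable_funX.
have Zl (f : R -> \bar R) (e : R) : measurable_fun [set: measurableTypeR R] f -> (forall z, 0 <= f z) -> (0 <= e)%R ->
    e%:E * \int[gam]_z f z = \int[gam]_z (e%:E * f z) by move=> *; rewrite ge0_integralZl_EFin.
have A0 z : 0 <= (`|b + u * z|%R)%:E by rewrite lee_fin.
have S0 z : 0 <= ((b + u * z) ^+ 2)%:E by rewrite lee_fin sqr_ge0.
have kL0 : (0 <= 2 * k * L)%R by apply: mulr_ge0 => //; apply: mulr_ge0.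
have k20 : (0 <= k ^+ 2)%R by rewrite sqr_ge0.
have mZ (f : R -> \bar R) (e : R) : measurable_fun [set: measurableTypeR R] f ->
    measurable_fun [set: measurableTypeR R] (fun z => e%:E * f z).
  by move=> mf; apply: emeasurable_funM => //; exact: measurable_cst.
have Z0 (e : R) (x : \bar R) : (0 <= e)%R -> 0 <= x -> 0 <= e%:E * x by move=> *; rewrite mule_ge0.
have Q z := @small_ball a s (c * `|b + u * z|)%R s0 (mulr_ge0 c0 (normr_ge0 _)).
have rE z : (c * `|b + u * z| / s = k * `|b + u * z|)%R by rewrite /k mulrAC.
have sqE z : ((k * `|b + u * z|) ^+ 2 = k ^+ 2 * (b + u * z) ^+ 2)%R by rewrite exprMn real_normK ?num_real.
rewrite pE m1E m2E !Zl//; split.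
- apply: ge0_le_integral => //; first exact: mZ.
  by move=> z _; have [h _ _] := Q z; rewrite -EFinM -rE.
- rewrite -ge0_integralD//; try by [move=> z _; exact: Z0|exact: mZ].
  apply: ge0_le_integral => //; first by apply: emeasurable_funD; exact: mZ.
  move=> z _; have [_ h _] := Q z; rewrite -!EFinM -EFinD -sqE -rE; apply: le_trans h _.
  rewrite lee_fin lerD2r rE -/L.
  by have -> : (2 * (k * `|b + u * z|) * L = 2 * k * L * `|b + u * z|)%R by ring.
- rewrite -ge0_integralD//; try by [move=> z _; exact: Z0|exact: mZ].
  apply: ge0_le_integral => //; [by move=> z _; exact: Z0|exact: mZ|by apply: emeasurable_funD => //; exact: mZ|].
  move=> z _; have [_ _ h] := Q z; rewrite -!EFinM -sqE -rE; apply: le_trans _ h.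
  rewrite lee_fin rE -/L.
  by have -> : (2 * (k * `|b + u * z|) * L = 2 * k * L * `|b + u * z|)%R by ring.
Qed.

End small_ball.

Section first_order.
Context (R : realType).
Implicit Types (f : R -> R) (z l : R).

Lemma is_derive_first_order f z l : is_derive z 1 f l -> forall e, 0 < e ->
  exists2 r, 0 < r & forall u, `|u| < r -> `|f (z + u) - f z - l * u| <= e * `|u|.
Proof.
move=> [df dl] e e0.
have : h^-1 *: ((f \o shift z) (h *: 1) - f z) @[h --> 0^'] --> l by rewrite -dl; exact: df.
move=> /cvgrPdist_le/(_ _ e0)[r /= r0 H]; exists r => // u ur.
have [->|u0] := eqVneq u 0; first by rewrite addr0 subrr mulr0 subr0 normr0 mulr0.
have := H u; rewrite /= sub0r normrN => /(_ ur u0).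
have -> : l - u^-1 *: (f (u *: 1 + z) - f z) = - ((f (z + u) - f z - l * u) / u).
  by rewrite /GRing.scale/= mulr1 [u + z]addrC; field.
by rewrite normrN normrM normfV ler_pdivrMr ?normr_gt0.
Qed.

Lemma is_derive_seq f z l : is_derive z 1 f l ->
  k.+1%:R * (f (z + k.+1%:R^-1) - f z) @[k --> \oo] --> l.
Proof.
move=> df; apply/cvgrPdist_le => e e0.
have [r r0 H] := is_derive_first_order df e0.
near=> k.
have kr : `|k.+1%:R^-1 : R| < r.
  by rewrite ger0_norm//; near: k; exact: (near_infty_natSinv_lt (PosNum r0)).
have := H _ kr; rewrite [X in e * X]ger0_norm// ler_pdivlMr// => {}H.
have k0 : 0 < k.+1%:R :> R by [].
have -> : l - k.+1%:R * (f (z + k.+1%:R^-1) - f z) =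
   - (k.+1%:R * (f (z + k.+1%:R^-1) - f z - l * k.+1%:R^-1)).
  by rewrite [X in _ = - X]mulrBr [X in _ = - (_ - X)]mulrC divfK ?gt_eqF// opprB.
by rewrite normrN normrM ger0_norm// mulrC.
Unshelve. all: by end_near. Qed.

Lemma is_derive_slope_le f (df : R -> R) (a b M : R) : a < b ->
  (forall t, a <= t <= b -> is_derive t 1 f (df t)) -> (forall t, a <= t <= b -> `|df t| <= M) ->
  `|(f b - f a) / (b - a)| <= M.
Proof.
move=> ab d1 dM.
have [||c] := @MVT_segment R f df a b (ltW ab).
- by move=> x; rewrite in_itv/= => /andP[/ltW ax /ltW xb]; apply: d1; rewrite ax xb.
- apply: derivable_within_continuous => x; rewrite in_itv/= => xab.
  by case: (d1 x xab).
rewrite in_itv/= => cab ->; rewrite mulfK ?gt_eqF ?subr_gt0//; exact: dM.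
Qed.

Lemma sign_change_zero f (df : R -> R) (a b : R) : a <= b ->
  (forall t, a <= t <= b -> is_derive t 1 f (df t)) -> f a * f b < 0 ->
  exists2 c, a <= c <= b & f c = 0.
Proof.
move=> ab d1 fab.
have [||c] := @IVT R f a b 0 ab.
- apply: derivable_within_continuous => x; rewrite in_itv/= => xab.
  by case: (d1 x xab).
- by rewrite ge_min le_max; case: (ltP (f a) 0) => fa; case: (ltP (f b) 0) => fb; nra.
by rewrite in_itv/= => cab fc; exists c.
Qed.

(** With a first order error of at most [|l| / 2] times the increment, [f] has the sign of [l u] at
    [z + u]. *)
Lemma sign_change_near f z l : is_derive z 1 f l -> f z = 0 -> l != 0 ->
  exists2 r, 0 < r & forall u v, - r < u < 0 -> 0 < v < r -> f (z + u) * f (z + v) < 0.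
Proof.
move=> df fz l0; have l20 : 0 < `|l| / 2 by rewrite divr_gt0// normr_gt0.
have [r r0 H] := is_derive_first_order df l20; exists r => // u v /andP[ru u0] /andP[v0 vr].
have := H u; have := H v; rewrite fz !subr0 (gtr0_norm v0) (ltr0_norm u0) => /(_ vr) + /(_ ltac:(lra)).
rewrite !ler_norml.
case: (ltrgt0P l) l0 => // l0 _.
  move=> /andP[a1 a2] /andP[b1 b2].
  have fu : f (z + u) < 0 by nra.
  have fv : 0 < f (z + v) by nra.
  by nra.
move=> /andP[a1 a2] /andP[b1 b2].
have fu : 0 < f (z + u) by nra.
have fv : f (z + v) < 0 by nra.
by nra.
Qed.

(** The mean value and intermediate value theorems are used on [[t, t + h]], so the whole window,
    and not only its end points, has to stay in [S]. *)
Definition window_in (S : set R) (h : R) : set R := [set t | forall u, t <= u <= t + h -> S u].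

Lemma open_ball_sub (S : set R) z : open S -> S z ->
  exists2 r, 0 < r & forall t, `|t - z| < r -> S t.
Proof.
move=> oS Sz; have /nbhs_ballP[r /= r0 H] := open_nbhs_nbhs (conj oS Sz).
by exists r => // t tz; apply: H; rewrite /ball/= distrC.
Qed.

Lemma open_window_in (S : set R) (h : R) : open S -> 0 <= h -> open (window_in S h).
Proof.
move=> oS h0; rewrite openE => t Jt.
have [r1 r10 H1] := open_ball_sub oS (Jt t ltac:(by rewrite lexx/= lerDl)).
have [r2 r20 H2] := open_ball_sub oS (Jt (t + h) ltac:(by rewrite lexx andbT lerDl)).
exists (Num.min r1 r2) => /=; first by rewrite lt_min r10.
move=> s; rewrite /ball/= lt_min => /andP[]; rewrite !ltr_norml => /andP[a1 a2] /andP[b1 b2] u /andP[su ush].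
have [ut|tu] := ltP u t; first by apply: H1; rewrite ltr_norml; lra.
have [uth|thu] := leP u (t + h); first by apply: Jt; rewrite tu.
by apply: H2; rewrite ltr_norml; lra.
Qed.

Lemma window_in_near (S : set R) z : open S -> S z -> \forall k \near \oo, window_in S k.+1%:R^-1 z.
Proof.
move=> oS Sz; have [r r0 H] := open_ball_sub oS Sz.
near=> k => u /andP[zu uk].
have kr : k.+1%:R^-1 < r :> R by near: k; exact: (near_infty_natSinv_lt (PosNum r0)).
by apply: H; rewrite ger0_norm ?subr_ge0// ltrBlDl (le_lt_trans uk)// ltrD2l.
Unshelve. all: by end_near. Qed.

Lemma measurable_window_in (S : set R) (h : R) : open S -> 0 <= h ->
  measurable (window_in S h : set (measurableTypeR R)).
Proof. by move=> oS h0; apply: open_measurable; exact: open_window_in. Qed.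

End first_order.

(** * Zeros at which the derivative vanishes *)

Section tangency.
Context d (T : measurableType d) (R : realType) (P : probability T R).
Local Notation gam := (normal_prob (0 : R) 1).
Local Open Scope ereal_scope.

Lemma gaussian_small_ball (V : T -> R) (c : R) : gaussian_rv P V -> (0 < sd P V)%R -> (0 <= c)%R ->
  P [set w | (`|V w| < c)%R] <= (c / sd P V)%:E.
Proof.
move=> gV s0 c0; have [mV _] := gV.
have mB : measurable [set w | (`|V w| < c)%R].
  by apply: measurable_ltset; [exact: measurableT_comp|exact: measurable_cst].
rewrite -(integral_bool P (b := fun w => (`|V w| < c)%R) mB).
rewrite (gaussian_rvP gV (f := fun x => ((`|x| < c)%R%:R)%:E)); last 2 first.
- apply/measurable_EFinP; apply: measurable_ind_lt; last exact: measurable_cst.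
  exact: (continuous_measurable_fun (@norm_continuous _ R^o)).
- by move=> x; rewrite lee_fin ler0n.
by have [h _ _] := @small_ball R (mean P V) _ c s0 c0.
Qed.

Variables (X Xd : T -> R -> R).

(** Bulinskaya's argument. At a zero with zero derivative the path is [o(h)] at distance [h], so for
    every fine enough grid of step [h] it is below a small multiple of [h] at some grid point. Each
    such event has probability at most that multiple of [h], and there are about [1 / h] grid
    points; the sum stays below a constant that can be made arbitrarily small. *)
Lemma null_tangency_segment (a b : R) : (a < b)%R ->
  (forall t, (a <= t <= b)%R -> gaussian_rv P (X^~ t)) ->
  (forall t, (a <= t <= b)%R -> sd P (X^~ t) = 1%R) ->
  (forall w t, (a <= t <= b)%R -> is_derive t 1%R (X w) (Xd w t)) ->
  P.-negligible [set w | exists t, [/\ (a <= t <= b)%R, X w t = 0%R & Xd w t = 0%R]].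
Proof.
move=> ab gX sX dX; pose l := (b - a)%R.
have l0 : (0 < l)%R by rewrite subr_gt0.
pose tau (k j : nat) : R := (a + l * (j%:R / k.+1%:R))%R.
have tauE k j : (j <= k.+1)%N -> (a <= tau k j <= b)%R.
  move=> jk; have j1 : (0 <= (j%:R / k.+1%:R : R) <= 1)%R.
    by rewrite divr_ge0//= ler_pdivrMr// mul1r ler_nat.
  move: j1; rewrite /tau; move: (j%:R / k.+1%:R)%R => x /andP[x0 x1].
  apply/andP; split; first by rewrite lerDl; apply: mulr_ge0 => //; exact: ltW.
  by rewrite -lerBrDl -/l -[leRHS]mulr1 ler_pM2l.
(* The threshold is the grid step [l / (k+1)] times [1 / (n+1)]. Over the [k + 2] grid points the
   probabilities add up to at most [2 l / (n+1)], uniformly in [k]. *)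
pose c (n k : nat) : R := (n.+1%:R^-1 * l / k.+1%:R)%R.
have c0 n k : (0 < c n k)%R by rewrite !mulr_gt0 ?invr_gt0.
pose U n k := \big[setU/set0]_(j < k.+2) [set w | (`|X w (tau k j)| < c n k)%R].
have mU n k : measurable (U n k).
  apply: bigsetU_measurable => j _; apply: measurable_ltset; last exact: measurable_cst.
  by apply: measurableT_comp => //; have [] := gX (tau k j) (tauE k j (ltn_ord j)).
have PU n k : P (U n k) <= (2 * (n.+1%:R^-1 * l))%:E.
  apply: (@le_trans _ _ (\sum_(j < k.+2) (c n k)%:E)).
    pose B (j : nat) := [set w | (`|X w (tau k j)| < c n k)%R].
    have mB j : (j < k.+2)%N -> measurable (B j).
      move=> jk; apply: measurable_ltset; last exact: measurable_cst.
      by apply: measurableT_comp => //; have [] := gX (tau k j) (tauE k j jk).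
    apply: (@le_trans _ _ (\sum_(j < k.+2) P (B j))).
      exact: (@content_subadditive _ _ _ P (U n k) B k.+2 mB (mU n k)).
    apply: lee_sum => j _; have tj := tauE k j (ltn_ord j).
    have sX1 := sX _ tj.
    have s0 : (0 < sd P (X^~ (tau k j)))%R by rewrite sX1.
    by have := gaussian_small_ball (gX _ tj) s0 (ltW (c0 n k)); rewrite sX1 divr1.
  rewrite sumEFin lee_fin sumr_const card_ord -[X in (X <= _)%R]mulr_natl /c.
  rewrite [X in (X <= _)%R]mulrA ler_pdivrMr// [X in (_ <= X)%R]mulrAC ler_pM2r ?mulr_gt0 ?invr_gt0//.
  by rewrite -natrM ler_nat mul2n -addnn addSn ltnS leq_addl.
(* The inferior limit of the events [U n k] in [k], whose probability inherits the bound; a path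
   with such a zero lies in [A n] for every [n]. *)
pose A n := \bigcup_K \bigcap_(k in [set k | (K <= k)%N]) U n k.
have mI n K : measurable (\bigcap_(k in [set k | (K <= k)%N]) U n k).
  by apply: bigcap_measurableType => // k _; exact: mU.
have mA n : measurable (A n) by apply: bigcupT_measurable.
have PA n : P (A n) <= (2 * (n.+1%:R^-1 * l))%:E.
  have cA : P (\bigcap_(k in [set k | (K <= k)%N]) U n k) @[K --> \oo] --> P (A n).
    apply: nondecreasing_cvg_mu => //; first exact: bigcupT_measurable.
    apply/nondecreasing_seqP => K; apply/subsetPset => w Uw k /= Kk.
    by apply: Uw => /=; exact: leq_trans Kk.
  rewrite -(cvg_lim _ cA)//; apply: lime_le; first by apply/cvg_ex; exists (P (A n)).
  apply: nearW => K; apply: le_trans _ (PU n K); apply: le_measure; rewrite ?inE//.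
  by move=> w Uw; apply: Uw => /=.
exists (\bigcap_n A n); split; first exact: bigcapT_measurable.
  apply/eqP; rewrite eq_le measure_ge0 andbT; apply/lee_addgt0Pr => e e0; rewrite add0e.
  have e1 : (0 < e / (2 * l))%R by rewrite divr_gt0// mulr_gt0.
  have [n _ /(_ n (leqnn n)) ne] := near_infty_natSinv_lt (PosNum e1).
  apply: (@le_trans _ _ (P (A n))).
    by apply: le_measure; rewrite ?inE//; [exact: bigcapT_measurable|move=> w; exact].
  apply: le_trans (PA n) _; rewrite lee_fin mulrCA.
  by move: ne; rewrite /= ltr_pdivlMr ?mulr_gt0// => /ltW.
move=> w [t [tab Xt Xdt]] n _.
have d20 : (0 < n.+1%:R^-1 / 2 :> R)%R by rewrite divr_gt0.
have [r r0 H] := is_derive_first_order (dX w t tab) d20.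
have : \forall K \near \oo, (l / K.+1%:R < r)%R.
  have r1 : (0 < r / l)%R by rewrite divr_gt0.
  have := near_infty_natSinv_lt (PosNum r1); apply: filterS => K /=.
  by rewrite ltr_pdivlMr// mulrC.
move=> [K _ HK]; exists K => // k /= Kk.
have {HK} lr := HK k Kk.
have k0 : (0 < k.+1%:R :> R)%R by [].
(* [tau k j] is the last grid point up to [t], at distance at most one step. The derivative estimate
   has constant [1 / (2 (n+1))], so that the strict inequality below [c n k] holds. *)
pose x := ((t - a) * k.+1%:R / l)%R; pose j := Num.truncn x.
have x0 : (0 <= x)%R by apply: divr_ge0; [apply: mulr_ge0 => //; lra|exact: ltW].
have xk : (x <= k.+1%:R)%R by rewrite ler_pdivrMr// [X in (_ <= X)%R]mulrC ler_pM2r// /l; lra.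
have /andP[jx xj] : (j%:R <= x < j.+1%:R)%R by exact: truncn_itv.
have jk : (j < k.+2)%N by rewrite ltnS -(ler_nat R); exact: le_trans xk.
have ut : (tau k j - t = - (l / k.+1%:R) * (x - j%:R))%R.
  by rewrite /tau /x; field; rewrite !gt_eqF.
have lk0 : (0 < l / k.+1%:R)%R by rewrite divr_gt0.
have ul : (`|tau k j - t| <= l / k.+1%:R)%R.
  rewrite ut normrM normrN (gtr0_norm lk0) -[leRHS]mulr1 ler_pM2l// ger0_norm ?subr_ge0//.
  by move: xj; rewrite -natr1; lra.
have := H _ (le_lt_trans ul lr); rewrite [(t + _)%R]addrC subrK Xt Xdt mul0r !subr0 => Xtau.
rewrite /U -(bigcup_mkord k.+2 (fun j => [set w | (`|X w (tau k j)| < c n k)%R])); exists j => //=.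
apply: le_lt_trans Xtau _; apply: (@le_lt_trans _ _ (n.+1%:R^-1 / 2 * (l / k.+1%:R)))%R.
  by rewrite ler_pM2l.
have y0 : (0 < n.+1%:R^-1 :> R)%R by [].
have -> : c n k = (n.+1%:R^-1 * (l / k.+1%:R))%R by rewrite /c mulrA.
by rewrite ltr_pM2r// ltr_pdivrMr// ltr_pMr// ltr1n.
Qed.

(** Every point of an open set lies in a segment with rational end points contained in it, and there
    are countably many of these. *)
Lemma null_tangency (S : set R) : open S ->
  (forall t, S t -> gaussian_rv P (X^~ t)) -> (forall t, S t -> sd P (X^~ t) = 1%R) ->
  (forall w t, S t -> is_derive t 1%R (X w) (Xd w t)) ->
  P.-negligible [set w | exists t, [/\ S t, X w t = 0%R & Xd w t = 0%R]].
Proof.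
move=> oS gX sX dX.
pose G (a b : R) := [set w | exists t, [/\ (a <= t <= b)%R, X w t = 0%R & Xd w t = 0%R]].
pose C (pq : rat * rat) := ((ratr pq.1 : R) < ratr pq.2)%R /\ forall t : R, (ratr pq.1 <= t <= ratr pq.2)%R -> S t.
pose F k := if choice.unpickle k is Some pq then [set w | C pq /\ G (ratr pq.1) (ratr pq.2) w] else set0.
apply: (@negligibleS _ _ _ _ (\bigcup_k F k)); last first.
  apply: negligible_bigcup => k; rewrite /F; case: (choice.unpickle k) => [pq|]; last exact: negligible_set0.
  have [[pq1 pq2]|nC] := pselect (C pq); last first.
    by apply: (@negligibleS _ _ _ _ set0); [move=> w [/nC]|exact: negligible_set0].
  apply: (@negligibleS _ _ _ _ (G (ratr pq.1) (ratr pq.2))); first by move=> w [].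
  by apply: null_tangency_segment => // [t tpq|t tpq|w t tpq]; [apply: gX|apply: sX|apply: dX]; exact: pq2.
move=> w [t [St Xt Xdt]].
have [r r0 Hr] := open_ball_sub oS St.
have [p] := @rat_in_itvoo R (t - r)%R t ltac:(by rewrite ltrBlDr ltrDl).
have [q] := @rat_in_itvoo R t (t + r)%R ltac:(by rewrite ltrDl).
rewrite !in_itv/= => /andP[tq qr] /andP[rp pt].
have [k kE] : exists k, @choice.unpickle (rat * rat)%type k = Some (p, q).
  by exists (choice.pickle (p, q)); exact: choice.pickleK.
exists k; first by [].
rewrite /F kE; split; last by exists t; split; rewrite ?ltW.
split => /=; first exact: lt_trans tq.
by move=> u /andP[pu uq]; apply: Hr; rewrite ltr_norml; lra.
Qed.

End tangency.

(** * Sign changes of a pair of unit variance *)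

Section unit_pair.
Context d (T : measurableType d) (R : realType) (P : probability T R).
Local Open Scope ereal_scope.

Lemma Lfun2_lin (p q : R) (U V : T -> R) : U \in Lfun P 2%:E -> V \in Lfun P 2%:E ->
  (fun w => p * U w + q * V w)%R \in Lfun P 2%:E.
Proof.
move=> U2 V2; have mU := Lfun2_measurable U2; have mV := Lfun2_measurable V2.
apply: Lfun2P.
  by apply: measurable_funD; apply: measurable_funM => //; exact: measurable_cst.
have mE (W : T -> R) : measurable_fun setT W -> measurable_fun setT (fun w => (W w ^+ 2)%:E).
  by move=> mW; apply/measurable_EFinP; exact: measurable_funX.
have W0 (W : T -> R) w : 0 <= (W w ^+ 2)%:E by rewrite lee_fin sqr_ge0.
have c0 (c : R) : (0 <= 2 * c ^+ 2)%R by rewrite mulr_ge0// sqr_ge0.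
have mcE (c : R) (W : T -> R) : measurable_fun setT W -> measurable_fun setT (fun w => (2 * c ^+ 2)%:E * (W w ^+ 2)%:E).
  by move=> mW; apply: emeasurable_funM; [exact: measurable_cst|exact: mE].
apply: (@le_lt_trans _ _ (\int[P]_w ((2 * p ^+ 2)%:E * (U w ^+ 2)%:E + (2 * q ^+ 2)%:E * (V w ^+ 2)%:E))).
  apply: ge0_le_integral => //.
  - by move=> w _; rewrite lee_fin sqr_ge0.
  - apply: mE; by apply: measurable_funD; apply: measurable_funM => //; exact: measurable_cst.
  - by apply: emeasurable_funD; exact: mcE.
  - move=> w _; rewrite -!EFinM -EFinD lee_fin; have := sqr_ge0 (p * U w - q * V w)%R; nra.
rewrite ge0_integralD//; [|by move=> w _; rewrite mule_ge0// lee_fin|exact: mcE|by move=> w _; rewrite mule_ge0// lee_fin|exact: mcE].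
by rewrite !ge0_integralZl_EFin//; [|exact: mE|exact: mE]; rewrite lte_add_pinfty// lte_mul_pinfty// ?lee_fin// Lfun2_sqr_lty.
Qed.

(** The covariance of [(A + B) / 2] and [n (B - A)] is [n / 2] times the difference of the variances
    of [B] and [A], which are equal; and the variances of [(A + B) / 2] and [(B - A) / 2] add up to
    1. *)
Lemma unit_pair (A B : T -> R) (n : R) : A \in Lfun P 2%:E -> B \in Lfun P 2%:E ->
  sd P A = 1%R -> sd P B = 1%R -> (0 < n)%R ->
  let Y w := (2^-1 * A w + 2^-1 * B w)%R in
  let W w := ((- n) * A w + n * B w)%R in
  covariance P Y W = 0 /\ (sd P Y ^+ 2 = 1 - sd P W ^+ 2 / (4 * n ^+ 2))%R.
Proof.
move=> A2 B2 A1 B1 n0 Y W.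
have lin2 (p q : R) (U V : T -> R) : U \in Lfun P 2%:E -> V \in Lfun P 2%:E ->
    (fun w => p * U w + q * V w)%R \in Lfun P 2%:E.
  exact: Lfun2_lin.
have Y2 : Y \in Lfun P 2%:E by exact: lin2.
have W2 : W \in Lfun P 2%:E by exact: lin2.
have cf (U V : T -> R) : U \in Lfun P 2%:E -> V \in Lfun P 2%:E -> covariance P U V \is a fin_num.
  by move=> U2 V2; apply: covariance_fin_num; [exact: Lfun21|exact: Lfun21|exact: Lfun2_mul_Lfun1].
have vl p q := @variance_lin _ _ _ P A B p q A2 B2.
pose rho := fine (covariance P A B).
have vE (p q : R) : 'V_P[fun w => p * A w + q * B w]%R = (p ^+ 2 + q ^+ 2 + 2 * p * q * rho)%:E.
  by rewrite vl !sqr_sd// A1 B1 expr1n !mule1 -(fineK (cf _ _ A2 B2)) -EFinM -!EFinD.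
have VY := vE 2^-1%R 2^-1%R; have VW := vE (- n)%R n.
rewrite -/Y sqr_sd// in VY; rewrite -/W sqr_sd// in VW.
move: VY VW => [VY] [VW]; split; last first.
  by rewrite VY VW; field; rewrite gt_eqF.
(* The covariance is read off the variance of [Y + W], itself a combination of [A] and [B]. *)
have := @variance_lin _ _ _ P Y W 1 1 Y2 W2.
have -> : (fun w => 1 * Y w + 1 * W w)%R = (fun w => (2^-1 - n) * A w + (2^-1 + n) * B w)%R.
  by apply/funext => w; rewrite /Y /W; ring.
rewrite vE !sqr_sd// VY VW -(fineK (cf _ _ Y2 W2)) -!EFinM -!EFinD => -[h].
by congr EFin; move: h; set c := fine _ => h; nra.
Qed.

End unit_pair.

Section crossing_pair.
Context d (T : measurableType d) (R : realType) (P : probability T R).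
Local Open Scope ereal_scope.

(** [a b] is the difference of the squares of [(a + b) / 2] and [(b - a) / 2]. *)
Lemma sign_change_half (a b : R) :
  (a * b < 0)%R = (`|2^-1 * a + 2^-1 * b| < `|2^-1 * (b - a)|)%R.
Proof.
have -> (x y : R) : (`|x| < `|y|)%R = (`|x| ^+ 2 < `|y| ^+ 2)%R.
  by rewrite ltr_pXn2r// ?nnegrE ?normr_ge0.
by rewrite -!normrX !ger0_norm ?sqr_ge0//; apply/idP/idP => h; nra.
Qed.

Lemma gaussian_sqr (X : T -> R) : gaussian_rv P X ->
  \int[P]_w (X w ^+ 2)%:E = (mean P X ^+ 2 + sd P X ^+ 2)%:E.
Proof. by move=> gX; have [mX _] := gX; apply: normal_law_sqr => //; exact: gaussian_rvP. Qed.

(** The parameter [r] is free in [|x| <= r / 2 + x^2 / (2 r)]: the value 1 gives finiteness and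
    explicit bounds, a small value gives convergence of first moments from that of second
    moments. *)
Lemma integral_norm_le (X : T -> R) (r : R) : (0 < r)%R -> X \in Lfun P 2%:E ->
  \int[P]_w (`|X w|%R)%:E <= (r / 2 + fine (\int[P]_w (X w ^+ 2)%:E) / (2 * r))%:E.
Proof.
move=> r0 X2; have mX := Lfun2_measurable X2.
have m2 : measurable_fun setT (fun w => (X w ^+ 2)%:E).
  by apply/measurable_EFinP; exact: measurable_funX.
have f2 : \int[P]_w (X w ^+ 2)%:E \is a fin_num.
  rewrite ge0_fin_numE ?Lfun2_sqr_lty//.
  by apply: integral_ge0 => w _; rewrite lee_fin sqr_ge0.
have r20 : (0 <= (2 * r)^-1)%R by rewrite invr_ge0 mulr_ge0// ltW.
apply: (@le_trans _ _ (\int[P]_w ((r / 2)%:E + ((2 * r)^-1)%:E * (X w ^+ 2)%:E))).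
  apply: ge0_le_integral => //.
  - by apply/measurable_EFinP; exact: measurableT_comp.
  - by apply: emeasurable_funD => //; apply: emeasurable_funM.
  - move=> w _; rewrite -EFinM -EFinD lee_fin.
    have -> : (r / 2 + (2 * r)^-1 * X w ^+ 2 = (r ^+ 2 + `|X w| ^+ 2) / (2 * r))%R.
      by rewrite real_normK ?num_real//; field; rewrite gt_eqF.
    by rewrite ler_pdivlMr ?mulr_gt0//; have := sqr_ge0 (r - `|X w|)%R; lra.
rewrite ge0_integralD//.
- rewrite ge0_integralZl_EFin//; last by move=> w _; rewrite lee_fin sqr_ge0.
  rewrite integral_probability_cst EFinD [X in _ <= _ + X]EFinM fineK//.
  by rewrite muleC.
- by move=> w _; rewrite lee_fin divr_ge0// ltW.
- by move=> w _; rewrite -EFinM lee_fin mulr_ge0// sqr_ge0.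
- by apply: emeasurable_funM.
Qed.

(** A sign change is the event [|Y| < |W| / (2 n)]. This is [crossing_prob] with [c = 1 / (2 n)],
    multiplied by [n]; [W] is the slope of the path when [1 / n] is the distance between the two
    times. *)
Lemma crossing_pair (A B : T -> R) (n : R) :
  (forall p q, gaussian_rv P (fun w => p * A w + q * B w)%R) ->
  sd P A = 1%R -> sd P B = 1%R -> (0 < n)%R ->
  let Y w := (2^-1 * A w + 2^-1 * B w)%R in
  let W w := ((- n) * A w + n * B w)%R in
  let s := sd P Y in
  let p := fine (\int[P]_w ((A w * B w < 0)%R%:R)%:E) in
  let m1 := fine (\int[P]_w (`|W w|%R)%:E) in
  let m2 := fine (\int[P]_w (W w ^+ 2)%:E) in
  (0 < s)%R ->
  (n * p <= m1 / (2 * s) /\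
   `|n * p - std_pdf (mean P Y / s) * m1 / s| <= m2 / (4 * n * s ^+ 2))%R.
Proof.
move=> gAB sA sB n0 Y W s p m1 m2 s0.
have gA : gaussian_rv P A.
  by have := gAB 1%R 0%R; under eq_fun do rewrite mul1r mul0r addr0.
have gB : gaussian_rv P B.
  by have := gAB 0%R 1%R; under eq_fun do rewrite mul1r mul0r add0r.
have [mA _] := gA; have [mB _] := gB.
have [cYW _] := unit_pair (gaussian_Lfun2 gA) (gaussian_Lfun2 gB) sA sB n0.
have gYW (u v : R) : gaussian_rv P (fun w => u * Y w + v * W w)%R.
  have := gAB (u * 2^-1 - v * n)%R (u * 2^-1 + v * n)%R.
  by congr gaussian_rv; apply/funext => w; rewrite /Y /W; ring.
have gW : gaussian_rv P W by exact: gAB.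
have W2 := gaussian_Lfun2 gW.
have k0 : (0 <= (2 * n)^-1)%R by rewrite invr_ge0 mulr_ge0// ltW.
have := crossing_prob gYW cYW s0 k0.
set q := \int[P]_w _; set M1 := \int[P]_w (`|_|)%:E; set M2 := \int[P]_w (_ ^+ 2)%:E.
have M20 : 0 <= M2 by apply: integral_ge0 => w _; rewrite lee_fin sqr_ge0.
have M10 : 0 <= M1 by apply: integral_ge0 => w _; rewrite lee_fin.
have F2 : M2 = m2%:E by rewrite fineK// ge0_fin_numE// Lfun2_sqr_lty.
have F1 : M1 = m1%:E.
  rewrite fineK// ge0_fin_numE//; apply: le_lt_trans (integral_norm_le ltr01 W2) _.
  by rewrite ltry.
have qE : q = \int[P]_w ((A w * B w < 0)%R%:R)%:E.
  apply: eq_integral => w _; congr (_%:R%:E).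
  rewrite sign_change_half; congr (nat_of_bool _).
  have -> : ((2 * n)^-1 * `|W w| = `|2^-1 * (B w - A w)|)%R.
    rewrite -{1}(ger0_norm k0) -normrM /W; congr `|_|%R.
    by field; rewrite gt_eqF.
  by [].
have Fq : q = p%:E.
  rewrite qE fineK// ge0_fin_numE; last by apply: integral_ge0 => w _; rewrite lee_fin ler0n.
  have mC : measurable [set w | (A w * B w < 0)%R].
    by apply: measurable_ltset; [exact: measurable_funM|exact: measurable_cst].
  by rewrite (integral_bool P (b := fun w => (A w * B w < 0)%R) mC) (le_lt_trans (probability_le1 P mC))// ltry.
move=> [h1 h2 h3]; move: h1 h2 h3; rewrite Fq F1 F2 -!EFinM -!EFinD !lee_fin -/s => h1 h2 h3; split.
  have -> : (m1 / (2 * s) = (2 * n)^-1 / s * m1 * n)%R by field; rewrite !gt_eqF.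
  by rewrite [leLHS]mulrC ler_pM2r.
have E1 : ((((2 * n)^-1 / s) ^+ 2) * m2 * n = m2 / (4 * n * s ^+ 2))%R.
  by field; rewrite !gt_eqF.
have E2 : ((2 * ((2 * n)^-1 / s) * std_pdf (mean P Y / s)) * m1 * n = std_pdf (mean P Y / s) * m1 / s)%R.
  by field; rewrite !gt_eqF.
rewrite -E1 -E2 ler_norml; apply/andP; split.
  by have := ler_wpM2r (ltW n0) h3; lra.
by have := ler_wpM2r (ltW n0) h2; lra.
Qed.

End crossing_pair.

(** * Zeros of a process of unit variance *)

Section rice_limit.
Context d (T : measurableType d) (R : realType) (P : probability T R).
Local Notation leb := (@lebesgue_measure R).
Local Open Scope ereal_scope.

Variable H : set (T -> R).
Hypothesis gH : forall X, H X -> gaussian_rv P X.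
Hypothesis linH : forall a b X Y, H X -> H Y -> H (fun w => a * X w + b * Y w)%R.

Lemma fine_norm_cvg (X : nat -> T -> R) (Y : T -> R) :
  (forall k, glim H (X k)) -> glim H Y -> (forall w, (X k w @[k --> \oo] --> Y w)%R) ->
  (fine (\int[P]_w (`|X k w|%R)%:E) @[k --> \oo] --> fine (\int[P]_w (`|Y w|%R)%:E))%R.
Proof.
move=> gX gY XY.
have L2 (Z : T -> R) : glim H Z -> Z \in Lfun P 2%:E by exact: glim_Lfun2.
have mn (Z : T -> R) : glim H Z -> measurable_fun setT (fun w => (`|Z w|%R)%:E).
  by move=> gZ; apply/measurable_EFinP; apply: measurableT_comp => //; exact: Lfun2_measurable (L2 _ gZ).
have fin (Z : T -> R) : glim H Z -> \int[P]_w (`|Z w|%R)%:E \is a fin_num.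
  move=> gZ; rewrite ge0_fin_numE; last by apply: integral_ge0 => w _; rewrite lee_fin.
  by apply: le_lt_trans (integral_norm_le ltr01 (L2 _ gZ)) _; rewrite ltry.
have tri (U V D : T -> R) : glim H U -> glim H V -> glim H D -> (forall w, `|U w| <= `|V w| + `|D w|)%R ->
    (fine (\int[P]_w (`|U w|%R)%:E) <= fine (\int[P]_w (`|V w|%R)%:E) + fine (\int[P]_w (`|D w|%R)%:E))%R.
  move=> gU gV gD UVD; rewrite -lee_fin EFinD !fineK ?fin// -ge0_integralD//; [|exact: mn|exact: mn].
  apply: ge0_le_integral => //; [exact: mn|by apply: emeasurable_funD; exact: mn|].
  by move=> w _; rewrite -EFinD lee_fin.
pose D k w := (X k w - Y w)%R.
have gD k : glim H (D k) by exact: glimB.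
have D0 : (fine (\int[P]_w (D k w ^+ 2)%:E) @[k --> \oo] --> 0)%R.
  apply: fine_cvg; apply: (glim_cvg0 gH) => // w.
  by rewrite -(subrr (Y w)); apply: cvgB; [exact: XY|exact: cvg_cst].
apply/cvgrPdist_le => e e0.
have e2 : (0 < e ^+ 2)%R by rewrite exprn_gt0.
move/cvgrPdist_le : D0 => /(_ _ e2); apply: filterS => k.
rewrite sub0r normrN ger0_norm; last by rewrite fine_ge0//; apply: integral_ge0 => w _; rewrite lee_fin sqr_ge0.
move=> De.
(* [integral_norm_le] with [r = e]: a second moment below [e^2] bounds the first moment by
   [e / 2 + e / 2]. *)
have De1 : (fine (\int[P]_w (`|D k w|%R)%:E) <= e)%R.
  rewrite -lee_fin fineK ?fin//; apply: le_trans (integral_norm_le e0 (L2 _ (gD k))) _.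
  rewrite lee_fin.
  have : (fine (\int[P]_w (D k w ^+ 2)%:E) / (2 * e) <= e / 2)%R.
    by rewrite ler_pdivrMr ?mulr_gt0//; apply: le_trans De _; rewrite expr2; lra.
  lra.
rewrite ler_norml; apply/andP; split.
  have := tri (X k) Y (D k) (gX k) gY (gD k) _.
  by move=> /(_ ltac:(by move=> w; rewrite -{1}(subrK (Y w) (X k w)) addrC ler_normD)); lra.
have := tri Y (X k) (D k) gY (gX k) (gD k) _.
move=> /(_ ltac:(by move=> w; rewrite /D distrC -{1}(subrK (X k w) (Y w)) addrC ler_normD)); lra.
Qed.

Variables (S : set R) (X Xd : T -> R -> R).
Hypothesis oS : open S.
Hypothesis HX : forall t, S t -> H (X^~ t).
Hypothesis sX : forall t, S t -> sd P (X^~ t) = 1%R.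
Hypothesis dX : forall w t, S t -> is_derive t 1%R (X w) (Xd w t).
Hypothesis bX : forall w, exists M : R, forall t, S t -> (`|Xd w t| <= M)%R.

Definition crossing_prob_at (k : nat) (t : R) : R :=
  fine (\int[P]_w ((X w t * X w (t + k.+1%:R^-1) < 0)%R%:R)%:E).

Let Y k t w := (2^-1 * X w t + 2^-1 * X w (t + k.+1%:R^-1))%R.
Let W k t w := ((- k.+1%:R) * X w t + k.+1%:R * X w (t + k.+1%:R^-1))%R.
Let q (U : T -> R) := fine (\int[P]_w (U w ^+ 2)%:E).
Let m1 (U : T -> R) := fine (\int[P]_w (`|U w|%R)%:E).

Let win_l k t : window_in S k.+1%:R^-1 t -> S t.
Proof. by apply; rewrite lexx/= lerDl invr_ge0. Qed.

Let win_r k t : window_in S k.+1%:R^-1 t -> S (t + k.+1%:R^-1)%R.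
Proof. by apply; rewrite lexx andbT lerDl invr_ge0. Qed.

Let WE k t w : (W k t w = (X w (t + k.+1%:R^-1) - X w t) / k.+1%:R^-1)%R.
Proof. by rewrite /W invrK; ring. Qed.

Let HW k t : window_in S k.+1%:R^-1 t -> H (W k t).
Proof. by move=> J; apply: linH; apply: HX; [exact: win_l J|exact: win_r J]. Qed.

(** The derivative is a pointwise limit of slopes, which are linear combinations of values of the
    process. The first [K] slopes are dropped because their windows may leave [S]. *)
Lemma glim_derive t : S t -> glim H (Xd^~ t).
Proof.
move=> St; have [K _ HK] := window_in_near oS St.
have j k : window_in S (k + K).+1%:R^-1 t by apply: HK => /=; exact: leq_addl.
exists (fun k => W (k + K) t); split => [k|w]; first exact: HW.
have := is_derive_seq (dX w St); rewrite -(cvg_shiftn K) /=.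
by under eq_fun do rewrite mulrC; under [X in _ -> X @ _ --> _]eq_fun do rewrite WE invrK.
Qed.

(** By the mean value theorem each path has its slopes bounded over all windows at once;
    [glim_bounded], indexed by the pairs of a scale and a time, makes this a mean square bound. *)
Lemma slope_sqr_bounded : exists2 B : R, (0 <= B)%R &
  forall k t, window_in S k.+1%:R^-1 t -> \int[P]_w (W k t w ^+ 2)%:E <= B%:E.
Proof.
pose J := {kt : nat * R | window_in S kt.1.+1%:R^-1 kt.2}.
have [||B HB] := @glim_bounded _ _ _ P H gH J (fun j => W (sval j).1 (sval j).2).
- by move=> [[k t] j]; apply: glimW => //; exact: HW.
- move=> w; have [M HM] := bX w; exists M => -[[k t] /= j].
  have tt : (t < t + k.+1%:R^-1)%R by rewrite ltrDl.
  have := @is_derive_slope_le R (X w) (Xd w) _ _ M tt.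
  have -> : (t + k.+1%:R^-1 - t = k.+1%:R^-1 :> R)%R by rewrite addrAC subrr add0r.
  rewrite -WE; apply.
  + by move=> u ut; apply: dX; exact: j.
  + by move=> u ut; apply: HM; exact: j.
exists `|B|%R => // k t j; apply: le_trans (HB (exist _ (k, t) j)) _.
by rewrite lee_fin ler_norm.
Qed.

Let sdY k t : window_in S k.+1%:R^-1 t -> (sd P (Y k t) ^+ 2 = 1 - sd P (W k t) ^+ 2 / (4 * k.+1%:R ^+ 2))%R.
Proof.
move=> j; have Sl := win_l j; have Sr := win_r j.
have A2 := gaussian_Lfun2 (gH (HX Sl)); have B2 := gaussian_Lfun2 (gH (HX Sr)).
by have [_ h] := unit_pair A2 B2 (sX Sl) (sX Sr) (ltr0Sn R k).
Qed.

Let qE (U : T -> R) : H U -> q U = (mean P U ^+ 2 + sd P U ^+ 2)%R.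
Proof. by move=> HU; rewrite /q gaussian_sqr//; exact: gH. Qed.

Let pairW k t : window_in S k.+1%:R^-1 t -> (0 < sd P (Y k t))%R ->
  (k.+1%:R * crossing_prob_at k t <= m1 (W k t) / (2 * sd P (Y k t)) /\
   `|k.+1%:R * crossing_prob_at k t - std_pdf (mean P (Y k t) / sd P (Y k t)) * m1 (W k t) / sd P (Y k t)|
     <= q (W k t) / (4 * k.+1%:R * sd P (Y k t) ^+ 2))%R.
Proof.
move=> j s0; apply: crossing_pair => //.
- by move=> a b; apply/gH/linH; apply: HX; [exact: win_l j|exact: win_r j].
- by apply: sX; exact: win_l j.
- by apply: sX; exact: win_r j.
Qed.

Let cp_ge0 k t : (0 <= crossing_prob_at k t)%R.
Proof. by apply: fine_ge0; apply: integral_ge0 => w _; rewrite lee_fin ler0n. Qed.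

Let cp_le1 k t : window_in S k.+1%:R^-1 t -> (crossing_prob_at k t <= 1)%R.
Proof.
move=> j.
have mX1 u : S u -> measurable_fun setT (X^~ u) by move=> Su; have [] := gH (HX Su).
have mC : measurable [set w | (X w t * X w (t + k.+1%:R^-1) < 0)%R].
  apply: measurable_ltset; last exact: measurable_cst.
  by apply: measurable_funM; apply: mX1; [exact: win_l j|exact: win_r j].
rewrite -lee_fin /crossing_prob_at (integral_bool P (b := fun w => (X w t * X w (t + k.+1%:R^-1) < 0)%R) mC).
by rewrite fineK ?fin_num_measure// probability_le1.
Qed.

(** The bound of [crossing_pair] degenerates with the standard deviation of the half-sum. If the
    latter is at least 1/2, that bound is uniform. *)
Lemma crossing_prob_dominated : exists C : R,
  forall k t, window_in S k.+1%:R^-1 t -> (k.+1%:R * crossing_prob_at k t <= C)%R.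
Proof.
have [B B0 HB] := slope_sqr_bounded; exists (1 + B)%R => k t j.
have n1 : (1 <= k.+1%:R :> R)%R by rewrite ler1n.
have qB : (q (W k t) <= B)%R.
  rewrite -lee_fin fineK; first exact: HB.
  by rewrite ge0_fin_numE ?Lfun2_sqr_lty ?gaussian_Lfun2//; [exact: gH (HW j)|apply: integral_ge0 => w _; rewrite lee_fin sqr_ge0].
have [s1|s1] := leP (4^-1)%R (sd P (Y k t) ^+ 2)%R.
  have s2 : (2^-1 <= sd P (Y k t))%R.
    rewrite -(@ler_pXn2r _ 2)// ?nnegrE ?sqrtr_ge0// ?invr_ge0//; apply: le_trans s1.
    by rewrite exprVn -natrX.
  have s0 : (0 < sd P (Y k t))%R by apply: lt_le_trans s2.
  have [h _] := pairW j s0; apply: le_trans h _.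
  have m1B : (m1 (W k t) <= 2^-1 + B / 2)%R.
    have L2 := gaussian_Lfun2 (gH (HW j)).
    have h := integral_norm_le ltr01 L2.
    rewrite -lee_fin fineK; last first.
      rewrite ge0_fin_numE; last by apply: integral_ge0 => w _; rewrite lee_fin.
      by apply: le_lt_trans h _; rewrite ltry.
    apply: le_trans h _; rewrite lee_fin mulr1 mul1r -/(q _); lra.
  rewrite ler_pdivrMr ?mulr_gt0//; apply: le_trans m1B _; nra.
(* Otherwise the slope has variance at least [3 (k+1)^2], while its second moment is at most [B].
   Only finitely many [k] are concerned, and for these the probability is bounded by 1. *)
have := sdY j; have := qE (HW j); set v := sd P (W k t).
move=> qv sv; have v0 : (v ^+ 2 <= B)%R by have := sqr_ge0 (mean P (W k t)); lra.
have : (3 * k.+1%:R ^+ 2 <= v ^+ 2)%R.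
  have : (3 / 4 <= v ^+ 2 / (4 * k.+1%:R ^+ 2))%R.
    by move: s1; rewrite sv; set z := (v ^+ 2 / _)%R; lra.
  rewrite ler_pdivlMr ?mulr_gt0 ?exprn_gt0//; lra.
have := cp_le1 j; have := cp_ge0 k t; nra.
Qed.

(** By [crossing_pair], the rescaled probability differs from a main term [a k] by a multiple of
    [1/(k+1)]; the ingredients of [a k] converge by the [L^2] convergence of the slopes. *)
Lemma crossing_prob_cvg t : S t ->
  (k.+1%:R * crossing_prob_at k t @[k --> \oo] -->
   std_pdf (mean P (X^~ t)) * fine (\int[P]_w (`|Xd w t|%R)%:E))%R.
Proof.
move=> St; have [K _ HK] := window_in_near oS St.
have j k : window_in S (k + K).+1%:R^-1 t by apply: HK => /=; exact: leq_addl.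
rewrite -(cvg_shiftn K) /=.
have [B B0 HB] := slope_sqr_bounded.
pose h k : R := (k + K).+1%:R^-1%R.
have h0 : (h k @[k --> \oo] --> 0)%R.
  by have := @cvg_harmonic R; rewrite -(cvg_shiftn K).
have h01 k : (0 < h k <= 1)%R by rewrite invr_gt0 ltr0n/= invf_le1// ler1n.
have V_Xd w : (W (k + K) t w @[k --> \oo] --> Xd w t)%R.
  have := is_derive_seq (dX w St); rewrite -(cvg_shiftn K) /=.
  by under eq_fun do rewrite mulrC; under [X in _ -> X @ _ --> _]eq_fun do rewrite WE invrK.
have gV k : glim H (W (k + K) t) by apply: glimW; exact: HW.
have gXd : glim H (Xd^~ t) by exists (fun k => W (k + K) t); split => // k; exact: HW.
have qV := glim_sqr_cvg gH linH gV gXd V_Xd.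
have mV := fine_norm_cvg gV gXd V_Xd.
have qB k : (q (W (k + K) t) <= B)%R.
  rewrite -lee_fin fineK; first exact: HB.
  rewrite ge0_fin_numE; last by apply: integral_ge0 => w _; rewrite lee_fin sqr_ge0.
  by rewrite Lfun2_sqr_lty// gaussian_Lfun2//; exact/gH/HW.
have small (u : nat -> R) (C : R) : (forall k, `|u k| <= C * h k)%R -> (u k @[k --> \oo] --> 0)%R.
  move=> uC; apply/norm_cvg0P; apply: (@squeeze_cvgr _ _ _ _ (fun=> 0%R) (fun k => C * h k)%R).
  - by apply: nearW => k; rewrite normr_ge0 uC.
  - exact: cvg_cst.
  - by rewrite -(mulr0 C); apply: cvgM => //; exact: cvg_cst.
(* The variance of the half-sum falls short of 1 by that of the slope times [h^2 / 4]. *)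
have s2 : (sd P (Y (k + K) t) ^+ 2 @[k --> \oo] --> (1 : R))%R.
  have -> : (fun k => sd P (Y (k + K) t) ^+ 2)%R = (fun k => 1 - sd P (W (k + K) t) ^+ 2 / (4 * (k + K).+1%:R ^+ 2))%R.
    by apply/funext => k; exact: sdY.
  rewrite -[X in _ --> X]subr0; apply: cvgB; first exact: cvg_cst.
  apply: (small _ B) => k; have /andP[hp h1] := h01 k.
  have -> : (sd P (W (k + K) t) ^+ 2 / (4 * (k + K).+1%:R ^+ 2) = sd P (W (k + K) t) ^+ 2 * (h k ^+ 2) / 4)%R.
    by rewrite /h; field; rewrite gt_eqF.
  have := qE (HW (j k)); have := qB k; have := sqr_ge0 (mean P (W (k + K) t)).
  move=> a1 a2 a3; have v2 : (0 <= sd P (W (k + K) t) ^+ 2 <= B)%R by rewrite sqr_ge0/=; lra.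
  move: v2; set v := (sd P _ ^+ 2)%R => /andP[v0 vB].
  rewrite ger0_norm; last by rewrite divr_ge0// mulr_ge0// sqr_ge0.
  have : (v * h k ^+ 2 <= B * h k)%R.
    by apply: ler_pM => //; rewrite ?sqr_ge0// expr2 ler_piMl// ltW.
  have : (0 <= B * h k)%R by rewrite mulr_ge0// ltW.
  lra.
have s1 : (sd P (Y (k + K) t) @[k --> \oo] --> (1 : R))%R.
  have -> : (fun k => sd P (Y (k + K) t)) = (fun k => Num.sqrt (sd P (Y (k + K) t) ^+ 2))%R.
    by apply/funext => k; rewrite sqrtr_sqr ger0_norm// sqrtr_ge0.
  by rewrite -(@sqrtr1 R); apply: continuous_cvg => //; exact: sqrt_continuous.
(* The half-sum is the value at [t] plus [h / 2] times the slope, whose mean is bounded. *)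
have mY : (mean P (Y (k + K) t) @[k --> \oo] --> mean P (X^~ t))%R.
  have -> : (fun k => mean P (Y (k + K) t)) = (fun k => mean P (X^~ t) + h k / 2 * mean P (W (k + K) t))%R.
    apply/funext => k.
    rewrite -[X in (X + _)%R]mul1r -mean_lin; [|exact/gaussian_Lfun2/gH/HX|exact/gaussian_Lfun2/gH/HW].
    by congr (mean P); apply/funext => w; rewrite /Y /W /h; field; rewrite gt_eqF.
  rewrite -[X in _ --> X]addr0; apply: cvgD; first exact: cvg_cst.
  apply: (small _ (1 + B)%R) => k; have /andP[hp h1] := h01 k.
  have := qE (HW (j k)); have := qB k; have := sqr_ge0 (sd P (W (k + K) t)).
  set mu := mean P _ => a1 a2 a3.
  rewrite normrM gtr0_norm ?divr_gt0// mulrC.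
  have mu1 : (`|mu| <= 1 + B)%R.
    have : (`|mu| ^+ 2 <= B)%R by rewrite real_normK ?num_real//; lra.
    have := sqr_ge0 (`|mu| - 1)%R; have := normr_ge0 mu; nra.
  apply: ler_pM => //; lra.
pose a k := (std_pdf (mean P (Y (k + K) t) / sd P (Y (k + K) t)) * m1 (W (k + K) t) / sd P (Y (k + K) t))%R.
have a_lim : (a k @[k --> \oo] --> std_pdf (mean P (X^~ t)) * m1 (Xd^~ t))%R.
  have i1 : ((sd P (Y (k + K) t))^-1 @[k --> \oo] --> (1 : R))%R by rewrite -(@invr1 R); exact: cvgV.
  rewrite -[X in _ --> X]mulr1; apply: cvgM => //; apply: cvgM => //.
  have h2 : (mean P (Y (k + K) t) / sd P (Y (k + K) t) @[k --> \oo] --> mean P (X^~ t))%R.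
    by rewrite -[X in _ --> X]mulr1; apply: cvgM.
  exact: (cvg_comp _ _ h2 (@continuous_std_pdf R (mean P (X^~ t)))).
have e_lim : ((k + K).+1%:R * crossing_prob_at (k + K) t - a k @[k --> \oo] --> 0)%R.
  apply/norm_cvg0P; apply: (@squeeze_cvgr _ _ _ _ (fun=> 0%R) (fun k => q (W (k + K) t) / 4 / sd P (Y (k + K) t) ^+ 2 * h k)%R).
  - near=> k; rewrite normr_ge0/=.
    have s0 : (0 < sd P (Y (k + K) t))%R by near: k; apply: (cvgr_gt 1%R).
    have [_ le] := pairW (j k) s0; apply: le_trans le _.
    rewrite le_eqVlt; apply/orP; left; apply/eqP; rewrite /h.
    by field; rewrite !gt_eqF.
  - exact: cvg_cst.
  - rewrite -(mulr0 (q (Xd^~ t) / 4 / 1)%R); apply: cvgM => //; apply: cvgM.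
      by apply: cvgM => //; exact: cvg_cst.
    exact: cvgV.
have -> : (fun k => (k + K).+1%:R * crossing_prob_at (k + K) t)%R = (fun k => a k + ((k + K).+1%:R * crossing_prob_at (k + K) t - a k))%R.
  by apply/funext => k; rewrite addrC subrK.
by have h3 := cvgD a_lim e_lim; rewrite addr0 in h3; exact: h3.
Unshelve. all: by end_near. Qed.

Hypothesis Sfin : leb S < +oo.
Hypothesis mX : measurable_fun [set: T * measurableTypeR R] (fun z => X z.1 z.2).

Let cross (k : nat) (z : T * measurableTypeR R) : bool :=
  `[< window_in S k.+1%:R^-1 z.2 >] && (X z.1 z.2 * X z.1 (z.2 + k.+1%:R^-1) < 0)%R.

Let mS : measurable (S : set (measurableTypeR R)).
Proof. exact: open_measurable. Qed.

Let m_cross k : measurable [set z | cross k z].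
Proof.
have -> : [set z | cross k z] = (snd @^-1` window_in S k.+1%:R^-1) `&`
    [set z | (X z.1 z.2 * X z.1 (z.2 + k.+1%:R^-1) < 0)%R].
  apply/seteqP; split => z; rewrite /cross/=; first by move=> /andP[/asboolP].
  by move=> [/asboolP -> ->].
apply: measurableI.
  rewrite -[X in measurable X]setTI; apply: (measurable_snd measurableT).
  by apply: measurable_window_in.
apply: measurable_ltset; last exact: measurable_cst.
apply: measurable_funM => //.
have sh : measurable_fun [set: T * measurableTypeR R] (fun z => (z.1, (z.2 + k.+1%:R^-1)%R) : T * measurableTypeR R).
  apply: measurable_fun_pair; first exact: measurable_fst.
  have sh2 : measurable_fun [set: T * measurableTypeR R] (fun z => (z.2 + k.+1%:R^-1)%R : R).
    by apply: measurable_funD; [exact: measurable_snd|exact: measurable_cst].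
  exact: sh2.
exact: (measurableT_comp mX sh).
Qed.

Let E k w := xsection [set z | cross k z] w.

Let EP k w t : E k w t <-> window_in S k.+1%:R^-1 t /\ (X w t * X w (t + k.+1%:R^-1) < 0)%R.
Proof.
by rewrite /E /xsection/= inE/=; split; [move=> /andP[/asboolP]|move=> [/asboolP h1 h2]; rewrite /cross h1 h2].
Qed.

Let mE k w : measurable (E k w : set (measurableTypeR R)).
Proof. exact: (measurable_xsection w (m_cross k)). Qed.

Let cross_prob_eq k t : \int[P]_w ((cross k (w, t))%:R)%:E =
  if `[< window_in S k.+1%:R^-1 t >] then (crossing_prob_at k t)%:E else 0.
Proof.
rewrite /cross /=; case: asboolP => j /=; last by rewrite integral0_eq.
have mX1 u : S u -> measurable_fun setT (X^~ u) by move=> Su; have [] := gH (HX Su).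
have mC : measurable [set w | (X w t * X w (t + k.+1%:R^-1) < 0)%R].
  apply: measurable_ltset; last exact: measurable_cst.
  by apply: measurable_funM; apply: mX1; [exact: win_l j|exact: win_r j].
rewrite /crossing_prob_at (integral_bool P (b := fun w => (X w t * X w (t + k.+1%:R^-1) < 0)%R) mC).
by rewrite fineK// fin_num_measure.
Qed.

Let rate k t := k.+1%:R%:E * \int[P]_w ((cross k (w, t))%:R)%:E.

Let rateE k t : rate k t =
  if `[< window_in S k.+1%:R^-1 t >] then (k.+1%:R * crossing_prob_at k t)%:E else 0.
Proof. by rewrite /rate cross_prob_eq; case: ifP => // _; rewrite mule0. Qed.

Let m_cross_fun k : measurable_fun [set: T * measurableTypeR R] (fun z => ((cross k z)%:R)%:E : \bar R).
Proof. apply/measurable_EFinP; apply: measurable_natr_bool.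
by apply: (measurable_fun_bool true); rewrite setTI; exact: m_cross. Qed.

Let m_section k : measurable_fun [set: measurableTypeR R] (fun t => \int[P]_w ((cross k (w, t))%:R)%:E).
Proof.
have h := @measurable_fun_fubini_tonelli_G _ _ T (measurableTypeR R) R P _ (m_cross_fun k).
by apply: h => z; rewrite lee_fin ler0n.
Qed.

Let m_rate k : measurable_fun [set: measurableTypeR R] (rate k).
Proof.
by apply: emeasurable_funM; [exact: measurable_cst|exact: m_section].
Qed.

Let integral_window k : \int[P]_w (k.+1%:R%:E * leb (E k w)) = \int[leb]_(t in S) rate k t.
Proof.
have mN : measurable_fun setT (fun w => leb (E k w)) by exact: (measurable_fun_xsection leb (m_cross k)).
rewrite ge0_integralZl_EFin//.
have -> : \int[P]_w leb (E k w) = \int[P]_w \int[leb]_t ((cross k (w, t))%:R)%:E.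
  apply: eq_integral => w _; rewrite (@integral_bool _ _ _ leb (fun t => cross k (w, t))).
    by congr (leb _); apply/seteqP; split => t; rewrite /E /xsection/= inE.
  by have := mE k w; congr measurable; apply/seteqP; split => t; rewrite /E /xsection/= inE.
rewrite (@fubini_tonelli _ _ T (measurableTypeR R) R P leb (fun z => ((cross k z)%:R)%:E) (m_cross_fun k)); last first.
  by move=> z; rewrite lee_fin ler0n.
rewrite -ge0_integralZl_EFin//; last first.
  by move=> t _; apply: integral_ge0 => w _; rewrite lee_fin ler0n.
rewrite [RHS]integral_mkcond; apply: eq_integral => t _; rewrite /patch.
case: ifPn => //; rewrite notin_setE => nS.
rewrite -/(rate k t) rateE; case: asboolP => // j; exfalso; apply: nS; exact: win_l j.
Qed.

Let zeros w := [set t | S t /\ X w t = 0%R].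

Let window_le w k : k.+1%:R%:E * leb (E k w) <= counting (zeros w).
Proof.
apply: (@window_le_counting R (zeros w) (E^~ w)); first by move=> i; exact: mE.
move=> {}k t /EP[j tX].
have h0 : (0 <= k.+1%:R^-1 :> R)%R by rewrite invr_ge0.
have th : (t <= t + k.+1%:R^-1)%R by rewrite lerDl.
have [z tz Xz] := sign_change_zero th (fun u tu => dX w (j u tu)) tX.
by exists z => //; split => //; exact: j.
Qed.

(** At a zero with nonzero derivative, the path has opposite signs just before and just after, so
    every [t] in the window to the left of the zero is counted once the window is short. *)
Let window_cvg w : ~ (exists t, [/\ S t, X w t = 0%R & Xd w t = 0%R]) ->
  k.+1%:R%:E * leb (E k w) @[k --> \oo] --> counting (zeros w).
Proof.
move=> nt; apply: (@window_cvg_counting R (zeros w) (E^~ w)).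
  by move=> i; exact: mE.
  move=> k t /EP[j tX].
  have th : (t <= t + k.+1%:R^-1)%R by rewrite lerDl invr_ge0.
  have [z tz Xz] := sign_change_zero th (fun u tu => dX w (j u tu)) tX.
  by exists z => //; split => //; exact: j.
move=> z [Sz Xz].
have l0 : (Xd w z != 0)%R by apply/eqP => l0; apply: nt; exists z.
have [r1 r10 H1] := sign_change_near (dX w Sz) Xz l0.
have [r2 r20 H2] := open_ball_sub oS Sz.
have key (t e : R) : (z - e < t)%R -> (t < z)%R -> (e < r1)%R -> (e < r2)%R ->
    window_in S e t /\ (X w t * X w (t + e) < 0)%R.
  move=> zt tz e1 e2; split.
    by move=> u /andP[tu ut]; apply: H2; rewrite ltr_norml; lra.
  have := H1 (t - z)%R (t + e - z)%R.
  have -> : (z + (t - z) = t)%R by rewrite addrC subrK.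
  have -> : (z + (t + e - z) = t + e)%R by rewrite addrC subrK.
  apply; lra.
near=> k => t; rewrite /= in_itv/= => /andP[zt tz].
have kr1 : (k.+1%:R^-1 < r1)%R by near: k; exact: (near_infty_natSinv_lt (PosNum r10)).
have kr2 : (k.+1%:R^-1 < r2)%R by near: k; exact: (near_infty_natSinv_lt (PosNum r20)).
by apply/EP; exact: key.
Unshelve. all: by end_near. Qed.

(** Dominated convergence is used in the time variable only, with the constant bound [C] on the set
    [S] of finite length. In [w] there is no integrable majorant at hand, so the limit is compared
    with the expected count by two inequalities. *)
Lemma rice_standard : \int[P]_w counting (zeros w) =
  \int[leb]_(t in S) ((std_pdf (mean P (X^~ t)))%:E * \int[P]_w (`|Xd w t|%R)%:E).
Proof.
pose g t := (std_pdf (mean P (X^~ t)) * fine (\int[P]_w (`|Xd w t|%R)%:E))%R.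
have -> : \int[leb]_(t in S) ((std_pdf (mean P (X^~ t)))%:E * \int[P]_w (`|Xd w t|%R)%:E) = \int[leb]_(t in S) (g t)%:E.
  apply: eq_integral => t; rewrite inE => St; rewrite /g [RHS]EFinM fineK//.
  rewrite ge0_fin_numE; last by apply: integral_ge0 => w _; rewrite lee_fin.
  apply: le_lt_trans (integral_norm_le ltr01 (glim_Lfun2 gH (glim_derive St))) _.
  by rewrite ltry.
have [C HC] := crossing_prob_dominated.
have rate_cvg t : S t -> rate k t @[k --> \oo] --> (g t)%:E.
  move=> St; have [K _ HK] := window_in_near oS St.
  apply: (@cvg_trans _ ((k.+1%:R * crossing_prob_at k t)%:E @[k --> \oo])).
    apply: near_eq_cvg; exists K => // k /HK j; rewrite rateE.
    by case: asboolP.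
  by apply: cvg_EFin; [exact: nearW|exact: crossing_prob_cvg].
have g_meas : measurable_fun (S : set (measurableTypeR R)) (fun t => (g t)%:E).
  apply: (@emeasurable_fun_cvg _ _ _ _ rate) => // k.
  exact: measurable_funTS.
have [_ _ lim_rate] := @dominated_convergence _ (measurableTypeR R) R leb S mS rate (fun t => (g t)%:E) (fun=> `|C|%:E)
  (fun k => measurable_funTS (m_rate k)) g_meas
  ltac:(by apply: aeW => t St; exact: rate_cvg)
  ltac:(by apply/integrableP; split; [exact: measurable_cst|rewrite /= integral_cst// lte_mul_pinfty//])
  ltac:(apply: aeW => t k St; rewrite rateE; case: asboolP => j; [rewrite /= lee_fin ger0_norm ?mulr_ge0//; apply: le_trans (HC k t j) (ler_norm _)|by rewrite abse0 lee_fin]).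
have lim_win : \int[P]_w (k.+1%:R%:E * leb (E k w)) @[k --> \oo] --> \int[leb]_(t in S) (g t)%:E.
  by under eq_fun do rewrite integral_window.
apply/eqP; rewrite eq_le; apply/andP; split.
  (* Off a null set the count is the limit of the window sums, and Fatou's lemma bounds its
     expectation. *)
  have [N [mN N0 sN]] := null_tangency oS (fun t St => gH (HX St)) sX dX.
  rewrite (@eq_integral_off_null _ _ _ P N _ (fun w => limn_einf (fun k => k.+1%:R%:E * leb (E k w)))) //; last 2 first.
  - move=> w; rewrite limn_einf_lim; apply: lime_ge; first exact: is_cvg_einfs.
    by apply: nearW => i; rewrite /einfs/=; apply: le_ereal_inf_tmp => _ [k _ <-]; rewrite mule_ge0.
  - move=> w Nw; have /window_cvg/cvg_limn_einf_sup[-> _] : ~ (exists t, [/\ S t, X w t = 0%R & Xd w t = 0%R]) by move=> e; apply: Nw; exact: sN.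
    by [].
  have mN2 k : measurable_fun setT (fun w => k.+1%:R%:E * leb (E k w)).
    apply: emeasurable_funM; first exact: measurable_cst.
    exact: (measurable_fun_xsection leb (m_cross k)).
  apply: le_trans (fatou P measurableT mN2 _) _; first by move=> k w _; rewrite mule_ge0.
  by have [-> _] := cvg_limn_einf_sup lim_win.
(* Conversely, for each [k] and on every path, the window sum is at most the count. *)
rewrite -(cvg_lim _ lim_win)//; apply: lime_le; first by apply/cvg_ex; eexists; exact: lim_win.
apply: nearW => k; apply: (@le_integral_off_null _ _ _ P set0) => //.
by move=> w; rewrite mule_ge0.
Qed.

End rice_limit.

Section derive_sequential.
Context (R : realType).

(** The limit theorems for Gaussian variables concern sequences, hence this sequential criterion. *)
Lemma is_derive_seqP (f : R -> R) (z l : R) :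
  (forall u : nat -> R, (forall k, u k != 0) -> u @ \oo --> (0 : R) ->
     (f (z + u k) - f z) / u k @[k --> \oo] --> l) ->
  is_derive z 1 f l.
Proof.
move=> H; have cv : h^-1 *: ((f \o shift z) (h *: 1) - f z) @[h --> 0^'] --> l.
  apply/cvgrPdist_le => e e0; apply: contrapT => nN.
  have /choice[u Hu] : forall k : nat, exists h : R, [/\ `|h| < k.+1%:R^-1, h != 0 &
      ~ `|l - h^-1 *: ((f \o shift z) (h *: 1) - f z)| <= e].
    move=> k; apply: contrapT => /forallNP nk; apply: nN.
    have k0 : 0 < k.+1%:R^-1 :> R by [].
    exists k.+1%:R^-1 => //= h /=; rewrite sub0r normrN => hk h0.
    by apply: contrapT => nle; apply: (nk h).
  have u0 : u @ \oo --> (0 : R).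
    apply/cvgrPdist_lt => r r0; near=> k; rewrite sub0r normrN.
    have [uk _ _] := Hu k; apply: lt_trans uk _.
    by near: k; exact: (near_infty_natSinv_lt (PosNum r0)).
  have := H u (fun k => let: And3 _ h _ := Hu k in h) u0.
  move=> /cvgrPdist_le/(_ _ e0)[K _ /(_ K (leqnn K))] /=.
  have [_ un0 +] := Hu K; apply: contra_not => h; apply: le_trans h.
  by rewrite /GRing.scale/= mulr1 [u K + z]addrC [X in _ - X]mulrC.
have dv : derivable f z 1 by apply/cvg_ex; exists l.
by apply: DeriveDef => //; apply/cvg_lim.
Unshelve. all: by end_near. Qed.

Lemma is_derive_quotient (f g : R -> R) (t a b : R) : is_derive t 1 f a -> is_derive t 1 g b ->
  g t != 0 -> is_derive t 1 (fun u => f u / g u) (a / g t - f t * b / g t ^+ 2).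
Proof.
move=> df dg g0; have h := is_deriveM df (is_deriveV g0 dg).
by apply: (is_derive_eq h); rewrite /GRing.scale/=; field.
Qed.

End derive_sequential.

(** * Differentiability of the standard deviation *)

Section covariance_derivative.
Context d (T : measurableType d) (R : realType) (P : probability T R).
Local Open Scope ereal_scope.

Definition fcov (U V : T -> R) : R := fine (covariance P U V).

Lemma sd_ge0 (U : T -> R) : (0 <= sd P U)%R.
Proof. exact: sqrtr_ge0. Qed.

Lemma sd_lin (p q : R) (U V : T -> R) : U \in Lfun P 2%:E -> V \in Lfun P 2%:E ->
  (sd P (fun w => p * U w + q * V w) ^+ 2 =
   p ^+ 2 * sd P U ^+ 2 + q ^+ 2 * sd P V ^+ 2 + 2 * p * q * fcov U V)%R.
Proof.
move=> U2 V2; have := variance_lin p q U2 V2.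
have cf : covariance P U V \is a fin_num.
  by apply: covariance_fin_num; [exact: Lfun21|exact: Lfun21|exact: Lfun2_mul_Lfun1].
rewrite !sqr_sd//; last exact: Lfun2_lin.
by rewrite -(fineK cf) -!EFinM -!EFinD => -[].
Qed.

Lemma Lfun2_sqrE (U : T -> R) : U \in Lfun P 2%:E ->
  fine (\int[P]_w (U w ^+ 2)%:E) = (mean P U ^+ 2 + sd P U ^+ 2)%R.
Proof.
move=> U2; have := varianceE U2; rewrite sqr_sd//.
have Ef : 'E_P[U] \is a fin_num by exact: (expectation_fin_num (Lfun21 U2)).
have If : \int[P]_w (U w ^+ 2)%:E \is a fin_num.
  by rewrite ge0_fin_numE ?Lfun2_sqr_lty//; apply: integral_ge0 => w _; rewrite lee_fin sqr_ge0.
have -> : 'E_P[(U ^+ 2)%R] = \int[P]_w (U w ^+ 2)%:E by rewrite unlock.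
rewrite -(fineK Ef) -/(mean P U).
by rewrite -(fineK If) -EFin_expe -EFinB => -[->]; rewrite addrC subrK.
Qed.

Lemma fcov_le (U V : T -> R) : U \in Lfun P 2%:E -> V \in Lfun P 2%:E ->
  (`|fcov U V| <= (sd P U ^+ 2 + sd P V ^+ 2) / 2)%R.
Proof.
move=> U2 V2; have h1 := sd_lin 1 1 U2 V2; have h2 := sd_lin 1 (-1) U2 V2.
have p1 := sqr_ge0 (sd P (fun w => 1 * U w + 1 * V w)%R).
have p2 := sqr_ge0 (sd P (fun w => 1 * U w + -1 * V w)%R).
rewrite ler_norml; lra.
Qed.

Variable H : set (T -> R).
Hypothesis gH : forall X, H X -> gaussian_rv P X.
Hypothesis linH : forall a b X Y, H X -> H Y -> H (fun w => a * X w + b * Y w)%R.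

Lemma mean_cvg (X : nat -> T -> R) (Y : T -> R) : (forall k, glim H (X k)) -> glim H Y ->
  (forall w, (X k w @[k --> \oo] --> Y w)%R) -> (mean P (X k) @[k --> \oo] --> mean P Y)%R.
Proof.
move=> gX gY XY.
have L2 (Z : T -> R) : glim H Z -> Z \in Lfun P 2%:E by exact: glim_Lfun2.
pose D k w := (1 * X k w + -1 * Y w)%R.
have gD k : glim H (D k) by exact: glim_lin.
have D0 : (fine (\int[P]_w (D k w ^+ 2)%:E) @[k --> \oo] --> 0)%R.
  apply: fine_cvg; apply: (glim_cvg0 gH) => // w.
  have -> : 0%R = (1 * Y w + -1 * Y w)%R :> R by ring.
  by apply: cvgD; apply: cvgM; (exact: cvg_cst || exact: XY).
apply/cvgrPdist_le => e e0.
have e2 : (0 < e ^+ 2)%R by rewrite exprn_gt0.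
move/cvgrPdist_le : D0 => /(_ _ e2); apply: filterS => k.
rewrite sub0r normrN Lfun2_sqrE; last exact: L2.
rewrite mean_lin; [|exact: L2|exact: L2].
have := sqr_ge0 (sd P (D k)); have := sqr_ge0 (1 * mean P (X k) + -1 * mean P Y)%R.
move=> s1 s2; rewrite ger0_norm; last lra.
move=> h; rewrite -(@ler_pXn2r _ 2)// ?nnegrE ?(ltW e0)// real_normK ?num_real//.
have -> : ((mean P Y - mean P (X k)) ^+ 2 = (1 * mean P (X k) + -1 * mean P Y) ^+ 2)%R by ring.
lra.
Qed.

Lemma sd_sqr_cvg (X : nat -> T -> R) (Y : T -> R) : (forall k, glim H (X k)) -> glim H Y ->
  (forall w, (X k w @[k --> \oo] --> Y w)%R) -> (sd P (X k) ^+ 2 @[k --> \oo] --> sd P Y ^+ 2)%R.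
Proof.
move=> gX gY XY.
have E (Z : T -> R) : glim H Z -> (sd P Z ^+ 2 = fine (\int[P]_w (Z w ^+ 2)%:E) - mean P Z ^+ 2)%R.
  by move=> gZ; rewrite (Lfun2_sqrE (glim_Lfun2 gH gZ)) addrAC subrr add0r.
rewrite E//; under eq_fun do rewrite E//.
apply: cvgB; first exact: (glim_sqr_cvg gH linH).
by rewrite expr2; under eq_fun do rewrite expr2; apply: cvgM; exact: mean_cvg.
Qed.

(** By polarization, the covariance is half the variance of the sum minus the two variances. *)
Lemma fcov_cvg (B : T -> R) (X : nat -> T -> R) (Y : T -> R) : glim H B ->
  (forall k, glim H (X k)) -> glim H Y ->
  (forall w, (X k w @[k --> \oo] --> Y w)%R) -> (fcov B (X k) @[k --> \oo] --> fcov B Y)%R.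
Proof.
move=> gB gX gY XY.
have L2 (Z : T -> R) : glim H Z -> Z \in Lfun P 2%:E by exact: glim_Lfun2.
have E (Z : T -> R) : glim H Z ->
    (fcov B Z = (sd P (fun w => 1 * B w + 1 * Z w) ^+ 2 - sd P B ^+ 2 - sd P Z ^+ 2) / 2)%R.
  by move=> gZ; rewrite sd_lin; [field|exact: L2|exact: L2].
rewrite E//; under eq_fun do rewrite E//.
apply: cvgM; last exact: cvg_cst.
apply: cvgB; last exact: sd_sqr_cvg.
apply: cvgB; last exact: cvg_cst.
apply: sd_sqr_cvg => [k||w]; [exact: glim_lin|exact: glim_lin|].
by apply: cvgD; apply: cvgM; (exact: cvg_cst || exact: XY).
Qed.

Variables (S : set R) (g gd : T -> R -> R).
Hypothesis oS : open S.
Hypothesis Hg : forall t, S t -> H (g^~ t).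
Hypothesis dg : forall w t, S t -> is_derive t 1%R (g w) (gd w t).
Hypothesis sd_gt0 : forall t, S t -> (0 < sd P (g^~ t))%R.

(** Writing the value at [t + u] as [g t + u D] with [D] the slope, the slope of the variance is
    [2 cov (g t, D) + u Var D], which tends to [2 cov (g t, g' t)]. Differentiability of paths alone
    thus yields that of the standard deviation. *)
Lemma is_derive_sd t : S t ->
  is_derive t 1%R (fun u => sd P (g^~ u)) (fcov (g^~ t) (gd^~ t) / sd P (g^~ t))%R.
Proof.
move=> St; have s0 := sd_gt0 St.
have gd_t : glim H (gd^~ t) := glim_derive linH oS Hg dg St.
have dv : is_derive t 1%R (fun u => (sd P (g^~ u) ^+ 2)%R) (2 * fcov (g^~ t) (gd^~ t))%R.
  apply: is_derive_seqP => u u0 u_lim.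
  have [r r0 Hr] := open_ball_sub oS St.
  have [K _ HK] : \forall k \near \oo, S (t + u k)%R.
    move/cvgrPdist_lt : u_lim => /(_ _ r0); apply: filterS => k.
    rewrite sub0r normrN => ukr; apply: Hr.
    by rewrite addrC addKr.
  have j k : S (t + u (k + K)%N)%R by apply: HK => /=; exact: leq_addl.
  rewrite -(cvg_shiftn K) /=.
  pose D k w := ((u (k + K)%N)^-1 * g w (t + u (k + K)%N) + - (u (k + K)%N)^-1 * g w t)%R.
  have HD k : H (D k) by apply: linH; exact: Hg.
  have gB : glim H (g^~ t) by apply: glimW; exact: Hg.
  have gD k : glim H (D k) by exact: glimW.
  have D_lim w : (D k w @[k --> \oo] --> gd w t)%R.
    apply/cvgrPdist_le => e e0; have [r' r'0 H'] := is_derive_first_order (dg w St) e0.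
    move: (u_lim); rewrite -(cvg_shiftn K) => /cvgrPdist_lt/(_ _ r'0); apply: filterS => k.
    rewrite sub0r normrN => /H' => h.
    have un0 := u0 (k + K)%N.
    have -> : (gd w t - D k w = - ((g w (t + u (k + K)%N) - g w t - gd w t * u (k + K)%N) / u (k + K)%N))%R.
      by rewrite /D; field.
    by rewrite normrN normrM normfV ler_pdivrMr ?normr_gt0.
  have c_lim := fcov_cvg gB gD gd_t D_lim.
  have s_lim := sd_sqr_cvg gD gd_t D_lim.
  have -> : (fun k => (sd P (g^~ (t + u (k + K)%N)) ^+ 2 - sd P (g^~ t) ^+ 2) / u (k + K)%N)%R =
      (fun k => 2 * fcov (g^~ t) (D k) + u (k + K)%N * sd P (D k) ^+ 2)%R.
    apply/funext => k; have un0 := u0 (k + K)%N.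
    have -> : g^~ (t + u (k + K)%N)%R = (fun w => 1 * g w t + u (k + K)%N * D k w)%R.
      by apply/funext => w; rewrite /D; field.
    by rewrite sd_lin; [field|exact: (glim_Lfun2 gH gB)|exact: (glim_Lfun2 gH (gD k))].
  have u_limK : (u (k + K)%N @[k --> \oo] --> (0 : R))%R.
    by move: u_lim; rewrite -(cvg_shiftn K).
  have h1 : (2 * fcov (g^~ t) (D k) @[k --> \oo] --> 2 * fcov (g^~ t) (gd^~ t))%R.
    by apply: cvgM => //; exact: cvg_cst.
  by have := cvgD h1 (cvgM u_limK s_lim); rewrite mul0r addr0; apply.
have s20 : (0 < sd P (g^~ t) ^+ 2)%R by rewrite exprn_gt0.
have ds := is_derive1_sqrt s20.
have -> : (fun u => sd P (g^~ u)) = (Num.sqrt \o (fun u => sd P (g^~ u) ^+ 2)%R).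
  by apply/funext => u /=; rewrite sqrtr_sqr ger0_norm// sd_ge0.
have := @is_derive1_comp R Num.sqrt (fun u => (sd P (g^~ u) ^+ 2)%R) t _ _ ds dv.
move=> h; apply: (is_derive_eq h).
by rewrite sqrtr_sqr ger0_norm ?sd_ge0// /GRing.scale/=; field; rewrite gt_eqF.
Qed.

End covariance_derivative.

Section rice.
Context d (T : measurableType d) (R : realType) (P : probability T R).
Local Notation leb := (@lebesgue_measure R).
Local Open Scope ereal_scope.

Variable H : set (T -> R).
Hypothesis gH : forall X, H X -> gaussian_rv P X.
Hypothesis linH : forall a b X Y, H X -> H Y -> H (fun w => a * X w + b * Y w)%R.
Variables (S : set R) (g gd : T -> R -> R) (e : R).
Hypothesis oS : open S.
Hypothesis Sfin : leb S < +oo.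
Hypothesis mg : measurable_fun [set: T * measurableTypeR R] (fun z => g z.1 z.2).
Hypothesis Hg : forall t, S t -> H (g^~ t).
Hypothesis dg : forall w t, S t -> is_derive t 1%R (g w) (gd w t).
Hypothesis bg : forall w, exists M : R, forall t, S t -> (`|g w t| <= M)%R.
Hypothesis bgd : forall w, exists M : R, forall t, S t -> (`|gd w t| <= M)%R.
Hypothesis e_gt0 : (0 < e)%R.
Hypothesis sd_ge_e : forall t, S t -> (e <= sd P (g^~ t))%R.

(** The process is divided by its standard deviation [s], which does not move its zeros. The lower
    bound [e] on [s], together with mean square bounds on the process and its derivative, keeps the
    derivative of the quotient bounded along each path. *)
Lemma rice : \int[P]_w counting [set t | S t /\ g w t = 0%R] =
  \int[leb]_(t in S) ((std_pdf (mean P (g^~ t) / sd P (g^~ t)))%:E *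
    \int[P]_w (`|gd w t / sd P (g^~ t) -
      g w t * (fcov P (g^~ t) (gd^~ t) / sd P (g^~ t)) / sd P (g^~ t) ^+ 2|%R)%:E).
Proof.
pose s t := sd P (g^~ t).
pose s' t := (fcov P (g^~ t) (gd^~ t) / s t)%R.
have s0 t : S t -> (0 < s t)%R by move=> St; apply: lt_le_trans (sd_ge_e St).
have ds t : S t -> is_derive t 1%R s (s' t) by move=> St; exact: (is_derive_sd gH linH oS Hg dg s0 St).
have gL2 t : S t -> g^~ t \in Lfun P 2%:E by move=> St; apply: gaussian_Lfun2; exact/gH/Hg.
have ggd t : S t -> glim H (gd^~ t) by exact: (glim_derive linH oS Hg dg).
have gdL2 t : S t -> gd^~ t \in Lfun P 2%:E by move=> St; exact: (glim_Lfun2 gH (ggd t St)).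
have bound (f : T -> R -> R) : (forall t, S t -> glim H (f^~ t)) ->
    (forall w, exists M : R, forall t, S t -> (`|f w t| <= M)%R) ->
    exists B : R, forall t, S t -> (sd P (f^~ t) ^+ 2 <= B)%R.
  move=> gf bf.
  have [||B HB] := @glim_bounded _ _ _ P H gH {t | S t} (fun t => f^~ (sval t)).
  - by move=> [t St]; exact: gf.
  - by move=> w; have [M HM] := bf w; exists M => -[t St]; exact: HM.
  exists B => t St; have := HB (exist _ t St).
  have f2 := glim_Lfun2 gH (gf t St).
  rewrite /= -(fineK (x := \int[P]_w _)); last first.
    by rewrite ge0_fin_numE ?Lfun2_sqr_lty//; apply: integral_ge0 => w _; rewrite lee_fin sqr_ge0.
  by rewrite lee_fin Lfun2_sqrE//; have := sqr_ge0 (mean P (f^~ t)); lra.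
have [B1 HB1] := bound g (fun t St => glimW (Hg St)) bg.
have [B2 HB2] := bound gd ggd bgd.
have s'B t : S t -> (`|s' t| <= (B1 + B2) / 2 / e)%R.
  move=> St; rewrite normrM normfV ler_pdivrMr; last by rewrite normr_gt0 gt_eqF// s0.
  have := fcov_le (gL2 t St) (gdL2 t St); have := HB1 t St; have := HB2 t St => b2 b1 c.
  apply: (@le_trans _ _ ((B1 + B2) / 2)%R); first lra.
  have B0 : (0 <= (B1 + B2) / 2)%R by have := normr_ge0 (fcov P (g^~ t) (gd^~ t)); lra.
  by rewrite (gtr0_norm (s0 t St)) -[leRHS]mulrA ler_peMr// ler_pdivlMl// mulr1; exact: sd_ge_e.
pose X w t := (g w t * ((fun u => (s u)^-1) \_ S) t)%R.
pose Xd w t := (gd w t / s t - g w t * s' t / s t ^+ 2)%R.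
have XE w t : S t -> X w t = (g w t / s t)%R by move=> St; rewrite /X patchE mem_set.
have XF t : S t -> X^~ t = (fun w => (s t)^-1 * g w t + 0 * g w t)%R.
  by move=> St; apply/funext => w; rewrite XE// mul0r addr0 mulrC.
have HX t : S t -> H (X^~ t) by move=> St; rewrite XF//; apply: linH; exact: Hg.
have sX t : S t -> sd P (X^~ t) = 1%R.
  move=> St; have st := s0 t St.
  have h : (sd P (X^~ t) ^+ 2 = 1)%R by rewrite XF// sd_lin; [rewrite -/(s t); field; rewrite gt_eqF|exact: gL2|exact: gL2].
  by apply/eqP; rewrite -(@eqrXn2 _ 2)// ?sd_ge0// h expr1n.
have dX w t : S t -> is_derive t 1%R (X w) (Xd w t).
  move=> St; have st := s0 t St.
  have dq : is_derive t 1%R (fun u => g w u / s u)%R (Xd w t).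
    by apply: is_derive_quotient; [exact: dg|exact: ds|rewrite gt_eqF].
  apply: near_eq_is_derive dq.
  have [r r0 Hr] := open_ball_sub oS St; exists r => // u /=; rewrite distrC => /Hr Su.
  by rewrite XE.
have bX w : exists M : R, forall t, S t -> (`|Xd w t| <= M)%R.
  have [M1 HM1] := bg w; have [M2 HM2] := bgd w.
  exists (M2 / e + M1 * ((B1 + B2) / 2 / e) / e ^+ 2)%R => t St.
  have st := s0 t St; have es := sd_ge_e St.
  have iv : ((s t)^-1 <= e^-1)%R by rewrite lef_pV2// posrE.
  apply: le_trans (ler_normB _ _) _; apply: lerD.
    by rewrite normrM normfV (gtr0_norm st); apply: ler_pM => //; [rewrite invr_ge0 ltW|exact: HM2].
  rewrite normrM normfV normrX (gtr0_norm st); apply: ler_pM => //.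
  - by rewrite invr_ge0 sqr_ge0.
  - by rewrite normrM; apply: ler_pM => //; [exact: HM1|exact: s'B].
  - by rewrite -!exprVn lerXn2r// nnegrE invr_ge0 ltW.
have mS : measurable (S : set (measurableTypeR R)) by exact: open_measurable.
have mX : measurable_fun [set: T * measurableTypeR R] (fun z => X z.1 z.2).
  apply: measurable_funM => //.
  have m1 : measurable_fun [set: measurableTypeR R] (((fun u => (s u)^-1) \_ S)%R : measurableTypeR R -> R).
    have m2 : measurable_fun (S : set (measurableTypeR R)) (fun u => (s u)^-1%R).
      apply: open_continuous_measurable_fun => // t; rewrite inE => St.
      apply: cvgV; first by rewrite gt_eqF// s0.
      apply: differentiable_continuous; apply/derivable1_diffP.
      by case: (ds t St).
    exact: (measurable_restrictT _ mS).1 m2.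
  exact: (measurableT_comp m1 measurable_snd).
have h := rice_standard gH linH oS HX sX dX bX Sfin mX.
transitivity (\int[P]_w counting [set t | S t /\ X w t = 0%R]).
  apply: eq_integral => w _; congr counting; apply/seteqP; split => t /= [St].
    by move=> g0; split => //; rewrite /X g0 mul0r.
  rewrite XE// => /eqP; rewrite mulf_eq0 invr_eq0 (gt_eqF (s0 t St)) orbF => /eqP g0.
  by split.
rewrite h; apply: eq_integral => t; rewrite inE => St; congr (_ * _).
by rewrite XF// mean_lin; [rewrite mul0r addr0 mulrC|exact: gL2|exact: gL2].
Qed.

End rice.

(** * Integration over all lines *)

Section caratheodory.
Context (R : realType) (n : nat).
Local Notation V := 'rV[R]_n.+1.

Lemma within_continuous_dist (W : normedModType R) (F : set V) (f : V -> W) x e :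
  {within F, continuous f} -> F x -> 0 < e ->
  exists2 r, 0 < r & forall y, F y -> `|x - y| < r -> `|f x - f y| < e.
Proof.
move=> /subspace_continuousP fc Fx e0; have := fc x Fx.
move=> /cvgrPdist_lt/(_ _ e0); rewrite /prop_near1 /= => /nbhs_ballP[r /= r0 H].
exists r => // y Fy xy; apply: H => //.
by rewrite -ball_normE.
Qed.

Lemma within_continuous_real (F : set V) (f : V -> R) x e :
  {within F, continuous f} -> F x -> 0 < e ->
  exists2 r, 0 < r & forall y, F y -> `|x - y| < r -> `|f x - f y| < e.
Proof. exact: (@within_continuous_dist R^o). Qed.

Lemma measurable_itvoy_fun d (U : measurableType d) (f : U -> R) :
  (forall a : R, measurable [set u | a < f u]) -> measurable_fun setT f.
Proof.
move=> H mD; apply: (measurability _ (RGenOInfty.measurableE R)) => //.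
by move=> /= _ [_ [x ->] <-]; rewrite preimage_itvoy setTI; exact: H.
Qed.

Variables (d : measure_display) (U : measurableType d) (f : U -> V -> R) (F : set V).
Hypothesis cF : closed F.
Hypothesis mf : forall x, F x -> measurable_fun setT (f^~ x).
Hypothesis cf : forall u, {within F, continuous (f u)}.

(** On [F], [f u x > a] holds iff for some [m] there are points [q j] of a dense sequence
    arbitrarily close to [x] with [f u (q j) > a + 1/(m+1)]; only countably many sections of [f] are
    involved. *)
Lemma measurable_caratheodory : (forall u x, ~ F x -> f u x = 0) ->
  measurable_fun [set: U * V] (fun z => f z.1 z.2).
Proof.
move=> f0; have [F0|/set0P/dense_seq[q [Fq dq]]] := eqVneq F set0.
  rewrite (_ : (fun z => _) = cst 0); first exact: measurable_cst.
  by apply/funext => z; apply: f0; rewrite F0.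
have mF : measurable F by exact: closed_measurable_rV.
have mG (a : R) : measurable [set z : U * V | F z.2 /\ a < f z.1 z.2].
  have -> : [set z : U * V | F z.2 /\ a < f z.1 z.2] =
     (snd @^-1` F) `&` \bigcup_m \bigcap_k \bigcup_j
       ((fun z => `|z.2 - q j|) @^-1` [set y | y < k.+1%:R^-1] `&` (fun z => f z.1 (q j)) @^-1` [set y | a + m.+1%:R^-1 < y]).
    apply/seteqP; split => -[u x] /=.
      move=> [Fx afx]; split => //.
      have e0 : 0 < (f u x - a) / 2 by lra.
      have [m _ /(_ m (leqnn m)) /= me] := near_infty_natSinv_lt (PosNum e0).
      exists m => // k _.
      have [r r0 Hr] := within_continuous_real (@cf u) Fx e0.
      have rk : 0 < Num.min r k.+1%:R^-1 by rewrite lt_min r0/=.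
      have [j] := dq x _ Fx rk; rewrite lt_min => /andP[xr xk].
      exists j => //; split => //=.
      have := Hr (q j) (Fq j) xr; rewrite ltr_norml => /andP[h1 h2].
      have me' : m.+1%:R^-1 < (f u x - a) / 2 := me.
      by move: me' h2; move: m.+1%:R^-1 => i; lra.
    move=> [Fx [m _ H]]; split => //.
    have m0 : 0 < m.+1%:R^-1 :> R by [].
    have m2 : 0 < m.+1%:R^-1 / 2 :> R by rewrite divr_gt0.
    have [r r0 Hr] := within_continuous_real (@cf u) Fx m2.
    have [k _ /(_ k (leqnn k)) /= kr] := near_infty_natSinv_lt (PosNum r0).
    have [j _ [/= xj aj]] := H k Logic.I.
    have := Hr (q j) (Fq j) (lt_trans xj kr); rewrite ltr_norml => /andP[h1 h2].
    move: m0 aj h1; move: m.+1%:R^-1 => i; lra.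
  apply: measurableI.
    by rewrite -[X in measurable X]setTI; exact: measurable_snd.
  apply: bigcupT_measurable => m; apply: bigcapT_measurable => k; apply: bigcupT_measurable => j.
  apply: measurableI.
    have h : measurable_fun [set: U * V] (fun z => `|z.2 - q j|).
      exact: (measurableT_comp (measurable_distrV (q j)) measurable_snd).
    exact: (measurable_ltset h (measurable_cst _)).
  have h : measurable_fun [set: U * V] (fun z => f z.1 (q j)).
    exact: (measurableT_comp (mf (Fq j)) measurable_fst).
  exact: (measurable_ltset (measurable_cst _) h).
apply: measurable_itvoy_fun => a.
have -> : [set z : U * V | a < f z.1 z.2] = [set z | F z.2 /\ a < f z.1 z.2] `|` [set z | ~ F z.2 /\ a < 0].
  apply/seteqP; split => -[u x] /=.
    by have [Fx|nFx] := pselect (F x); [left|right; rewrite -(f0 u x nFx)].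
  by move=> [[]//|[nFx]]; rewrite f0.
apply: measurableU => //; have [a0|a0] := boolP (a < 0).
  rewrite (_ : [set z : U * V | _] = snd @^-1` (~` F)); last by apply/seteqP; split => z /= => [[]|].
  by rewrite -[X in measurable X]setTI; apply: measurable_snd => //; exact: measurableC.
rewrite (_ : [set z : U * V | _] = set0)//; by apply/seteqP; split => z //= -[].
Qed.

(* By compactness, a segment contains a zero iff [|f u q| + |x - q|] has infimum
   0 for [x] over the rational points of the segment and [q] over a countable
   dense subset of [F]. *)
Lemma measurable_line_count : measurable_fun [set: U * (V * V)]
  (fun y => line_count [set x | F x /\ f y.1 x = 0] y.2.1 y.2.2 : \bar R).
Proof.
have [F0|/set0P/dense_seq[q [Fq dq]]] := eqVneq F set0.
  rewrite (_ : (fun y => _) = cst 0%E); first exact: measurable_cst.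
  apply/funext => y; rewrite /line_count (_ : [set t | _] = set0).
    by rewrite /counting asboolT// fset_set0.
  by apply/seteqP; split => t //= -[]; rewrite F0.
pose Y := (U * (V * V))%type.
pose Z (y : Y) := [set t | F (y.2.1 + t *: y.2.2) /\ f y.1 (y.2.1 + t *: y.2.2) = 0].
pose E k (y : Y) := [set t | exists z, Z y z /\ t <= z <= t + k.+1%:R^-1].
pose A k := [set yt : Y * measurableTypeR R | E k yt.1 yt.2].
pose psi (yt : Y * measurableTypeR R) u j :=
  `|f yt.1.1 (q j)| + `|yt.1.2.1 + (yt.2 + u) *: yt.1.2.2 - q j|.
have AE k : A k = \bigcap_m \bigcup_(p in [set p : rat | (0 <= p <= 1)%R]) \bigcup_j
    [set yt | psi yt (k.+1%:R^-1 * ratr p) j < m.+1%:R^-1].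
  have k0 : 0 < k.+1%:R^-1 :> R by [].
  apply/seteqP; split => -[[u [x s]] t0] /=; move: (t0 : R) => t {t0}.
    move=> [z [[/= Fz fz] /andP[tz zt]]] m _.
    have m0 : 0 < m.+1%:R^-1 :> R by [].
    pose pz := (z - t) / k.+1%:R^-1.
    have pz01 : 0 <= pz <= 1.
      apply/andP; split; first by rewrite divr_ge0 ?subr_ge0// ltW.
      by rewrite ler_pdivrMr// mul1r lerBlDl.
    (* One third each for the value of [f u] at [q j], for the distance from the zero to [q j], and
       for moving along the line to a rational fraction of the window; the added 1 covers
       [s = 0]. *)
    have e0 : 0 < m.+1%:R^-1 / 3 / (`|s| + 1) :> R by rewrite !divr_gt0// ltr_wpDl.
    have [p p01 pp] : exists2 p : rat, (0 <= p <= 1)%R & `|ratr p - pz| < m.+1%:R^-1 / 3 / (`|s| + 1).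
      case/andP: pz01 => pz0; rewrite le_eqVlt => /orP[/eqP ->|pz1].
        by exists 1%R; rewrite ?ler01 ?lexx// rmorph1 subrr normr0.
      have [|p] := @rat_in_itvoo R pz (Num.min 1 (pz + m.+1%:R^-1 / 3 / (`|s| + 1))).
        by rewrite lt_min pz1 ltrDl.
      rewrite in_itv/= lt_min => /andP[pzp /andP[p1 pe]].
      exists p; last by rewrite gtr0_norm ?subr_gt0// ltrBlDl.
      rewrite -(@ler0q R) -(@ler_rat R) rmorph1; apply/andP; split; lra.
    exists p => //.
    have e30 : 0 < m.+1%:R^-1 / 3 :> R by rewrite divr_gt0.
    have [r r0 Hr] := within_continuous_real (@cf u) Fz e30.
    have re : 0 < Num.min r (m.+1%:R^-1 / 3) by rewrite lt_min r0.
    have [j] := dq _ _ Fz re; rewrite lt_min => /andP[jr je].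
    exists j => //; rewrite /psi /=.
    have := Hr _ (Fq j) jr; rewrite fz sub0r normrN => h1.
    have h2 : `|x + (t + k.+1%:R^-1 * ratr p) *: s - q j| <= `|x + z *: s - q j| + `|ratr p - pz| * `|s|.
      have -> : x + (t + k.+1%:R^-1 * ratr p) *: s - q j = (x + z *: s - q j) + (k.+1%:R^-1 * (ratr p - pz)) *: s.
        have -> : k.+1%:R^-1 * (ratr p - pz) = t + k.+1%:R^-1 * ratr p - z.
          by rewrite /pz mulrBr [X in _ - X = _]mulrC divfK ?gt_eqF//; ring.
        by apply/rowP => i; rewrite !mxE; ring.
      apply: le_trans (ler_normD _ _) _; rewrite lerD2l normrZ ler_wpM2r// normrM ler_piMl//.
      by rewrite gtr0_norm// invf_le1// ler1n.
    have h3 : `|ratr p - pz| * `|s| <= m.+1%:R^-1 / 3.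
      have s1 : 0 < `|s| + 1 by rewrite ltr_wpDl.
      apply: (@le_trans _ _ (m.+1%:R^-1 / 3 / (`|s| + 1) * (`|s| + 1))); last by rewrite divfK// gt_eqF.
      by apply: ler_pM => //; [exact: ltW|rewrite lerDl].
    move: jr je h1 h2 h3; move: m.+1%:R^-1 => i; lra.
  move=> H.
  have /choice[u_ Hu] : forall m, exists pj : rat * nat, (0 <= pj.1 <= 1)%R /\
      psi (u, (x, s), t) (k.+1%:R^-1 * ratr pj.1) pj.2 < m.+1%:R^-1.
    by move=> m; have [p p01 [j _ pj]] := H m Logic.I; exists (p, j).
  pose v m : R := ratr (u_ m).1.
  have v01 m : 0 <= v m <= 1.
    by have [/andP[p0 p1] _] := Hu m; rewrite /v ler0q p0/= -(rmorph1 (@ratr R)) ler_rat.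
  (* A cluster point of the rational fractions gives a point of the segment. It lies in [F] because
     [F] is closed, and is a zero by continuity. *)
  have [c [c01 cl]] : exists c, `[0, 1]%classic c /\ cluster (v @ \oo) c.
    have := @segment_compact R 0 1 (v @ \oo) _.
    apply; exists 0%N => // m _ /=; rewrite in_itv/=; exact: v01.
  have clc e M : 0 < e -> exists2 m, (M <= m)%N & `|c - v m| < e.
    move=> e0; have /= := cl [set y | exists2 m, (M <= m)%N & y = v m] (ball c e) _ (nbhsx_ballx c e e0).
    case; first by exists M => // m Mm; exists m.
    by move=> _ [[m Mm ->] cm]; exists m => //; rewrite -ball_normE in cm.
  pose z := t + k.+1%:R^-1 * c.
  have key e : 0 < e -> exists j, `|f u (q j)| < e /\ `|x + z *: s - q j| < e.
    move=> e0; have e2 : 0 < e / 2 by rewrite divr_gt0.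
    have s1 : 0 < `|s| + 1 by rewrite ltr_wpDl.
    have [M _ HM] := near_infty_natSinv_lt (PosNum e2).
    have [m Mm cm] := clc (e / 2 / (`|s| + 1)) M (divr_gt0 e2 s1).
    have /= me := HM m Mm.
    have [_] := Hu m; rewrite /psi /= -/(v m) => h.
    exists (u_ m).2; split.
      by apply: le_lt_trans (lt_trans h (lt_trans me _)); [rewrite lerDl|lra].
    have -> : x + z *: s - q (u_ m).2 = (x + (t + k.+1%:R^-1 * v m) *: s - q (u_ m).2) + (k.+1%:R^-1 * (c - v m)) *: s.
      have -> : k.+1%:R^-1 * (c - v m) = z - (t + k.+1%:R^-1 * v m) by rewrite /z; ring.
      by apply/rowP => i; rewrite !mxE; ring.
    apply: le_lt_trans (ler_normD _ _) _.
    have h2 : `|(k.+1%:R^-1 * (c - v m)) *: s| <= e / 2.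
      rewrite normrZ normrM (gtr0_norm k0).
      apply: (@le_trans _ _ (e / 2 / (`|s| + 1) * (`|s| + 1))); last by rewrite divfK// gt_eqF.
      apply: ler_pM => //; rewrite ?mulr_ge0 ?lerDl//.
      apply: le_trans (ltW cm); rewrite ler_piMl// invf_le1// ler1n//.
    have := normr_ge0 (f u (q (u_ m).2)); move: h me h2; move: m.+1%:R^-1 => i; lra.
  have Fz : F (x + z *: s).
    apply: cF => B /nbhs_ballP[e /= e0 He].
    by have [j [_ jq]] := key e e0; exists (q j); split => //; apply: He; rewrite -ball_normE.
  exists z; split; last first.
    move: c01; rewrite /= in_itv/= /z lerDl => /andP[c0 c1].
    by rewrite mulr_ge0// lerD2l ler_piMr.
  split => //=; apply/eqP; rewrite -normr_eq0 eq_le normr_ge0 andbT; apply/ler_addgt0Pr => e e0; rewrite add0r.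
  have e2 : 0 < e / 2 by rewrite divr_gt0.
  have [r r0 Hr] := within_continuous_real (@cf u) Fz e2.
  have re : 0 < Num.min r (e / 2) by rewrite lt_min r0.
  have [j []] := key _ re; rewrite !lt_min => /andP[_ j1] /andP[j2 _].
  have := Hr _ (Fq j) j2; have := ler_normB (f u (x + z *: s)) (f u (x + z *: s) - f u (q j)).
  have -> : f u (x + z *: s) - (f u (x + z *: s) - f u (q j)) = f u (q j) by ring.
  have := ler_normD (f u (x + z *: s) - f u (q j)) (f u (q j)).
  by rewrite subrK; lra.
have mA k : measurable (A k).
  rewrite AE; apply: bigcapT_measurable => m; rewrite bigcup_mkcond.
  apply: bigcupT_measurable_rat => p; case: ifPn => // _.
  apply: bigcupT_measurable => j; apply: measurable_ltset; last exact: measurable_cst.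
  apply: measurable_funD.
    apply: measurableT_comp => //.
    apply: (measurableT_comp (mf (Fq j))).
    by apply: (measurableT_comp measurable_fst); exact: measurable_fst.
  apply: (measurableT_comp (measurable_distrV (q j))).
  apply: measurable_fun_rV => i; under eq_fun do rewrite !mxE.
  have m2 : measurable_fun [set: Y * measurableTypeR R] (fun yt => yt.1.2).
    exact: (measurableT_comp measurable_snd measurable_fst).
  apply: measurable_funD.
    exact: (measurableT_comp (measurable_coord i) (measurableT_comp measurable_fst m2)).
  apply: measurable_funM.
    by apply: measurable_funD; [exact: measurable_snd|exact: measurable_cst].
  exact: (measurableT_comp (measurable_coord i) (measurableT_comp measurable_snd m2)).
(* Here [E k y] consists of all [t] whose window contains a zero, so the window sums tend to the
   count without exception, and each is a measurable function of [y] as the length of a section. *)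
apply: (@emeasurable_fun_cvg _ _ _ _ (fun k y => (k.+1%:R%:E * lebesgue_measure (xsection (A k) y))%E)).
  move=> k; apply: emeasurable_funM; first exact: measurable_cst.
  exact: (measurable_fun_xsection lebesgue_measure (mA k)).
move=> y _.
have xE k : xsection (A k) y = E k y.
  by apply/seteqP; split => t; rewrite /xsection/= inE.
under eq_fun do rewrite xE.
apply: window_cvg_counting.
- by move=> k; rewrite -xE; exact: measurable_xsection.
- by move=> k t [z [Zz tz]]; exists z.
- move=> z Zz; near=> k => t; rewrite /= in_itv/= => /andP[zt tz]; exists z; split => //.
  by rewrite (ltW tz)/= -lerBlDr ltW.
Unshelve. all: by end_near. Qed.

End caratheodory.

Section finite_ae.
Local Open Scope ereal_scope.

Lemma integral_lty_ae d (T : measurableType d) (R : realType) (mu : {measure set T -> \bar R})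
    (f : T -> \bar R) : measurable_fun setT f -> (forall x, 0 <= f x) ->
  \int[mu]_x f x < +oo ->
  exists N, [/\ measurable N, mu N = 0 & forall x, ~ N x -> f x < +oo].
Proof.
move=> mf f0 fi.
have fint : mu.-integrable setT f.
  by apply/integrableP; split => //; under eq_integral do rewrite gee0_abs//.
have [N [mN N0 sN]] := integrable_ae measurableT fint.
exists N; split => // x Nx; rewrite -ge0_fin_numE//; apply: contrapT => nf; apply: Nx; apply: sN => /= h.
by apply: nf; exact: h.
Qed.

End finite_ae.

(** * Tonelli's theorem over the space of lines *)

Section sphere_fubini.
Context (R : realType) (n : nat).
Local Notation V := 'rV[R]_n.+1.
Local Notation lebV := (lebesgue_rV R n.+1).
Local Notation surf := (surface_measure R n.+1).
Local Open Scope ereal_scope.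

Lemma sphere_enorm : exists v : V, enorm v = 1%R.
Proof.
exists (enormalize (const_mx 1%R : 'rV[R]_n.+1)); apply: enormalize_sphere.
by apply/eqP => /rowP/(_ ord0); rewrite !mxE => /eqP; rewrite oner_eq0.
Qed.

(** The sign comes from [favard_cst_sphere] at a unit vector: the constant times a nonnegative
    integral is 1. *)
Lemma favard_cst_gt0 : (0 < favard_cst R n)%R.
Proof.
have [v v1] := sphere_enorm; have := favard_cst_sphere v; rewrite v1.
set I := \int[_]_(_ in _) _ => h.
have I0 : 0 <= I by apply: integral_ge0 => s _; rewrite lee_fin.
rewrite ltNge; apply/negP => c0; have : (favard_cst R n)%:E * I <= 0 by rewrite mule_le0_ge0// lee_fin.
by rewrite h lee_fin ler10.
Qed.

(** The surface measure is an image of Lebesgue measure on the ball, so [integral_sphere] moves the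
    exchange to two sigma-finite measures. *)
Lemma fubini_sphere d (U : measurableType d) (mu : {sigma_finite_measure set U -> \bar R})
    (F : U * V -> \bar R) : measurable_fun setT F -> (forall z, 0 <= F z) ->
  \int[mu]_u \int[surf]_(s in sphere) F (u, s) =
  \int[surf]_(s in sphere) \int[mu]_u F (u, s).
Proof.
move=> mF F0.
have mF1 u : measurable_fun setT (fun s => F (u, s)) by exact: measurableT_comp mF (@measurable_pair1 _ _ _ _ u).
have mF2 s : measurable_fun setT (fun u => F (u, s)) by exact: measurableT_comp mF (@measurable_pair2 _ _ _ _ s).
pose b (x : V) : R := (((0 < enorm x) && (enorm x <= 1))%R%:R)%R.
have b0 x : 0 <= (b x)%:E by rewrite lee_fin ler0n.
have mb : measurable_fun [set: V] (fun x => (b x)%:E).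
  apply/measurable_EFinP; apply: measurable_natr_bool; apply: measurable_and.
    by apply: measurable_fun_ltr; [exact: measurable_cst|exact: measurable_enorm].
  by apply: measurable_fun_ler; [exact: measurable_enorm|exact: measurable_cst].
pose G (z : U * V) := F (z.1, enormalize z.2) * (b z.2)%:E.
have mG : measurable_fun setT G.
  apply: emeasurable_funM; last exact: (measurableT_comp mb measurable_snd).
  apply: measurableT_comp => //; apply: measurable_fun_pair; first exact: measurable_fst.
  exact: (measurableT_comp (@measurable_enormalize R n.+1) measurable_snd).
have G0 z : 0 <= G z by rewrite mule_ge0.
transitivity (\int[mu]_u (n.+1%:R%:E * \int[lebV]_x G (u, x))).
  by apply: eq_integral => u _; rewrite integral_sphere.
rewrite ge0_integralZl_EFin//; last 2 first.
- by move=> u _; apply: integral_ge0.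
- exact: (@measurable_fun_fubini_tonelli_F _ _ _ _ R lebV _ mG G0).
rewrite (@fubini_tonelli _ _ _ _ R mu lebV _ mG G0) integral_sphere; last 2 first.
- exact: (@measurable_fun_fubini_tonelli_G _ _ _ _ R mu _ mF F0).
- by move=> s; apply: integral_ge0.
congr (_ * _); apply: eq_integral => x _; rewrite /G /= ge0_integralZr//.
Qed.

(** When [Phi x s] is the number of points of a set on the line through [x], times the indicator of
    the slab, this is the Favard measure of the set. *)
Definition crofton (Phi : V -> V -> \bar R) : \bar R :=
  (favard_cst R n)%:E * \int[surf]_(s in sphere) \int[lebV]_x Phi x s.

Lemma crofton_fubini d (U : measurableType d) (mu : {sigma_finite_measure set U -> \bar R})
    (Phi : U -> V -> V -> \bar R) :
  measurable_fun setT (fun z : U * (V * V) => Phi z.1 z.2.1 z.2.2) ->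
  (forall u x s, 0 <= Phi u x s) ->
  \int[mu]_u crofton (Phi u) = crofton (fun x s => \int[mu]_u Phi u x s).
Proof.
move=> mP P0.
have mP' : measurable_fun setT (fun z : (U * V) * V => Phi z.1.1 z.2 z.1.2).
  have sw : measurable_fun setT (fun z : (U * V) * V => (z.1.1, (z.2, z.1.2)) : U * (V * V)).
    apply: measurable_fun_pair; first by apply: measurableT_comp => //; exact: measurable_fst.
    apply: measurable_fun_pair; first exact: measurable_snd.
    by apply: (measurableT_comp measurable_snd); exact: measurable_fst.
  exact: (measurableT_comp mP sw).
pose F (z : U * V) := \int[lebV]_x Phi z.1 x z.2.
have mF : measurable_fun setT F.
  by apply: (@measurable_fun_fubini_tonelli_F _ _ _ _ R lebV _ mP') => z.
have F0 z : 0 <= F z by exact: integral_ge0.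
rewrite /crofton ge0_integralZl_EFin//; last 3 first.
- by move=> u _; apply: integral_ge0 => s _; exact: (F0 (u, s)).
- have mF1 u : measurable_fun setT (fun s => F (u, s)) by exact: measurableT_comp mF (@measurable_pair1 _ _ _ _ u).
  rewrite (_ : (fun u => _) = fun u => n.+1%:R%:E * \int[lebV]_x
      (F (u, enormalize x) * ((0 < enorm x) && (enorm x <= 1))%R%:R%:E)); last first.
    by apply/funext => u; rewrite -(@integral_sphere R n.+1 (fun s => F (u, s)))// => s; exact: (F0 (u, s)).
  apply: emeasurable_funM; first exact: measurable_cst.
  apply: (@measurable_fun_fubini_tonelli_F _ _ _ _ R lebV (fun z : U * V => F (z.1, enormalize z.2) * ((0 < enorm z.2) && (enorm z.2 <= 1))%R%:R%:E)).
    apply: emeasurable_funM.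
      apply: (measurableT_comp mF); apply: measurable_fun_pair; first exact: measurable_fst.
      exact: (measurableT_comp (@measurable_enormalize R n.+1) measurable_snd).
    have mb : measurable_fun [set: V] (fun x => (((0 < enorm x) && (enorm x <= 1))%R%:R)%:E : \bar R).
      apply/measurable_EFinP; apply: measurable_natr_bool; apply: measurable_and.
        by apply: measurable_fun_ltr; [exact: measurable_cst|exact: measurable_enorm].
      by apply: measurable_fun_ler; [exact: measurable_enorm|exact: measurable_cst].
    exact: (measurableT_comp mb measurable_snd).
  by move=> z; rewrite mule_ge0// lee_fin ler0n.
- exact: (ltW favard_cst_gt0).
congr (_ * _); rewrite (@fubini_sphere _ U mu F mF F0); apply: eq_integral => s _.
rewrite /F /= (@fubini_tonelli _ _ U V R mu lebV (fun z => Phi z.1 z.2 s))//.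
have sw : measurable_fun setT (fun z : U * V => (z.1, (z.2, s)) : U * (V * V)).
  apply: measurable_fun_pair; first exact: measurable_fst.
  by apply: measurable_fun_pair; [exact: measurable_snd|exact: measurable_cst].
exact: (measurableT_comp mP sw).
Qed.

(** A finite average makes [L] finite for almost all directions and then almost all base points, so
    [Phi] and [Psi] need agree only there. With [L] the number of boundary points on the line, this
    is how finiteness of the Favard measure of the boundary is exploited. *)
Lemma eq_crofton_finite (L Phi Psi : V -> V -> \bar R) :
  measurable_fun setT (fun z : V * V => L z.1 z.2) -> (forall x s, 0 <= L x s) ->
  crofton L < +oo ->
  (forall x s, 0 <= Phi x s) -> (forall x s, 0 <= Psi x s) ->
  (forall x s, sphere s -> L x s < +oo -> Phi x s = Psi x s) ->
  crofton Phi = crofton Psi.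
Proof.
move=> mL L0 Lfin Phi0 Psi0 H.
have mL2 : measurable_fun setT (fun s => \int[lebV]_x L x s).
  exact: (@measurable_fun_fubini_tonelli_G _ _ _ _ R lebV _ mL (fun z => L0 z.1 z.2)).
have Is0 s : 0 <= \int[lebV]_x L x s by exact: integral_ge0.
have fin : \int[surf]_(s in sphere) \int[lebV]_x L x s < +oo.
  rewrite ltey; apply/eqP => E; move: Lfin.
  by rewrite /crofton E mulry gtr0_sg ?favard_cst_gt0// mul1e ltxx.
congr (_ * _); rewrite integral_mkcond [RHS]integral_mkcond.
rewrite integral_mkcond in fin.
have mLs : measurable_fun setT ((fun s => \int[lebV]_x L x s) \_ sphere).
  by apply/(measurable_restrictT _ (@measurable_sphere R n.+1)); exact: measurable_funTS.
have [s|N [mN N0 HN]] := integral_lty_ae mLs _ fin.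
  by rewrite patchE; case: ifPn.
apply: (eq_integral_off_null mN N0) => [s|s|s Ns].
- by rewrite patchE; case: ifPn => // _; exact: integral_ge0.
- by rewrite patchE; case: ifPn => // _; exact: integral_ge0.
have := HN s Ns; rewrite !patchE; case: ifPn => //; rewrite inE => Ss Lx.
have mLx : measurable_fun setT (fun x => L x s) by exact: measurableT_comp mL (@measurable_pair2 _ _ _ _ s).
have [M [mM M0 HM]] := integral_lty_ae mLx (fun x => L0 x s) Lx.
by apply: (eq_integral_off_null mM M0) => // x Mx; apply: H => //; exact: HM.
Qed.

Lemma crofton_shift (rho : V -> V -> \bar R) :
  measurable_fun setT (fun z : V * V => rho z.1 z.2) -> (forall x s, 0 <= rho x s) ->
  crofton (fun x s => (slab s x)%:R%:E * \int[@lebesgue_measure R]_t rho (x + t *: s)%R s) = crofton rho.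
Proof.
move=> mr r0; congr (_ * _); apply: eq_integral => s; rewrite inE /sphere/= => s1.
have ss : (dotp s s = 1)%R by rewrite -sqr_enorm s1 expr1n.
have mrs : measurable_fun setT (fun x => rho x s) by exact: measurableT_comp mr (@measurable_pair2 _ _ _ _ s).
have msl : measurable_fun setT (fun x : V => (slab s x)%:R%:E : \bar R).
  by apply: measurable_slab; [exact: measurable_cst|exact: measurable_id].
have sl0 (x : V) : 0 <= (slab s x)%:R%:E :> \bar R by rewrite lee_fin ler0n.
have mts : measurable_fun setT (fun z : V * measurableTypeR R => (z.1 + z.2 *: s)%R).
  apply: measurable_fun_rV => i; under eq_fun do rewrite !mxE.
  apply: measurable_funD; first exact: (measurableT_comp (measurable_coord i) measurable_fst).
  by apply: measurable_funM; [exact: measurable_snd|exact: measurable_cst].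
have mf1 : measurable_fun setT (fun z : V * measurableTypeR R => (slab s z.1)%:R%:E * rho (z.1 + z.2 *: s)%R s).
  apply: emeasurable_funM; first exact: (measurableT_comp msl measurable_fst).
  exact: (measurableT_comp mrs mts).
transitivity (\int[lebV]_x \int[@lebesgue_measure R]_t ((slab s x)%:R%:E * rho (x + t *: s)%R s)).
  apply: eq_integral => x _; rewrite ge0_integralZl//.
  have h : measurable_fun setT (fun t : measurableTypeR R => (x, t) : V * measurableTypeR R) by exact: measurable_pair1.
  exact: (measurableT_comp mrs (measurableT_comp mts h)).
rewrite (@fubini_tonelli _ _ V (measurableTypeR R) R lebV (@lebesgue_measure R)
  (fun z => (slab s z.1)%:R%:E * rho (z.1 + z.2 *: s)%R s) mf1); last by move=> z; rewrite mule_ge0.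
transitivity (\int[@lebesgue_measure R]_t \int[lebV]_x ((slab s (x - t *: s)%R)%:R%:E * rho x s)).
  apply: eq_integral => t _.
  rewrite -(@integral_rV_shift _ _ (fun x => (slab s (x - t *: s)%R)%:R%:E * rho x s) (t *: s)%R).
  - by apply: eq_integral => x _; rewrite addrK.
  - apply: emeasurable_funM => //; exact: (measurableT_comp msl (measurable_addrV (- (t *: s))%R)).
  - by move=> x; rewrite mule_ge0.
have mf2 : measurable_fun setT (fun z : V * measurableTypeR R => (slab s (z.1 - z.2 *: s)%R)%:R%:E * rho z.1 s).
  apply: emeasurable_funM; last exact: (measurableT_comp mrs measurable_fst).
  apply: (measurableT_comp msl); apply: measurable_fun_rV => i; under eq_fun do rewrite !mxE.
  apply: measurable_funB; first exact: (measurableT_comp (measurable_coord i) measurable_fst).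
  by apply: measurable_funM; [exact: measurable_snd|exact: measurable_cst].
rewrite -(@fubini_tonelli _ _ V (measurableTypeR R) R lebV (@lebesgue_measure R)
  (fun z => (slab s (z.1 - z.2 *: s)%R)%:R%:E * rho z.1 s) mf2); last by move=> z; rewrite mule_ge0.
apply: eq_integral => x _ /=.
(* For fixed [x], the parameters [t] for which the base point [x - t s] lies in the slab form an
   interval of length 1, since [s] is a unit vector. *)
have sE t : slab s (x - t *: s)%R = (dotp x s - 1 < t <= dotp x s)%R.
  rewrite /slab dotpDl dotpNl dotpZl ss mulr1; apply/idP/idP => /andP[a b]; apply/andP; lra.
rewrite ge0_integralZr//; last first.
  by apply: (measurableT_comp msl); apply: measurable_fun_rV => i; under eq_fun do rewrite !mxE;
    apply: measurable_funB; [exact: measurable_cst|apply: measurable_funM; [exact: measurable_id|exact: measurable_cst]].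
under eq_integral do rewrite sE.
rewrite (@integral_bool _ _ _ (@lebesgue_measure R) (fun t => (dotp x s - 1 < t <= dotp x s)%R)); last first.
  have := @measurable_itv R `]dotp x s - 1, dotp x s]%R.
  by congr measurable; apply/seteqP; split => t; rewrite /= in_itv.
have -> : [set t : R | (dotp x s - 1 < t <= dotp x s)%R] = [set` `]dotp x s - 1, dotp x s]%R].
  by apply/seteqP; split => t; rewrite /= in_itv.
have lE : @lebesgue_measure R [set` `]dotp x s - 1, dotp x s]%R] = 1.
  rewrite lebesgue_measure_itv/= lte_fin ifT; last lra.
  by rewrite -EFinB; congr EFin; ring.
transitivity (1 * rho x s); last by rewrite mul1e.
by congr (_ * _); exact: lE.
Qed.

Lemma favard_cst_sphere_integral d (U : measurableType d) (mu : {sigma_finite_measure set U -> \bar R})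
    (v : U -> V) (psi : U -> \bar R) : measurable_fun setT v -> measurable_fun setT psi ->
  (forall u, 0 <= psi u) ->
  (favard_cst R n)%:E * \int[surf]_(s in sphere) \int[mu]_u (psi u * (`|dotp (v u) s|)%:E) =
  \int[mu]_u (psi u * (enorm (v u))%:E).
Proof.
move=> mv mpsi psi0.
pose F (z : U * V) := psi z.1 * (`|dotp (v z.1) z.2|)%:E.
have mF : measurable_fun setT F.
  apply: emeasurable_funM; first exact: (measurableT_comp mpsi measurable_fst).
  apply/measurable_EFinP; apply: measurableT_comp => //; apply: measurable_dotp; last exact: measurable_snd.
  exact: (measurableT_comp mv measurable_fst).
have F0 z : 0 <= F z by rewrite mule_ge0// lee_fin.
rewrite -(@fubini_sphere _ U mu F mF F0) -ge0_integralZl//; last 3 first.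
- have mF1 u : measurable_fun setT (fun s => F (u, s)) by exact: measurableT_comp mF (@measurable_pair1 _ _ _ _ u).
  rewrite (_ : (fun u => _) = fun u => psi u * (((favard_cst R n)^-1)%:E * (enorm (v u))%:E)).
    apply: emeasurable_funM => //; apply: emeasurable_funM; first exact: measurable_cst.
    by apply/measurable_EFinP; exact: (measurableT_comp (@measurable_enorm R n.+1) mv).
  apply/funext => u; rewrite -favard_cst_sphere [X in _ * X]muleA -EFinM mulVf ?mul1e; last by rewrite gt_eqF// favard_cst_gt0.
  rewrite /F /= ge0_integralZl//.
  + exact: measurable_sphere.
  + apply/measurable_EFinP; apply: measurable_funTS; apply: measurableT_comp => //.
    by apply: measurable_dotp; [exact: measurable_cst|exact: measurable_id].
- by move=> u _; apply: integral_ge0 => s _; exact: F0.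
- by rewrite lee_fin ltW// favard_cst_gt0.
apply: eq_integral => u _; rewrite -favard_cst_sphere /F /= ge0_integralZl//; last 2 first.
- exact: measurable_sphere.
- apply/measurable_EFinP; apply: measurable_funTS; apply: measurableT_comp => //.
  by apply: measurable_dotp; [exact: measurable_cst|exact: measurable_id].
by rewrite muleCA.
Qed.

(** Almost every line meets [A] in finitely many points, hence in a set of length 0. The weight
    [|<v, s>|] with a unit vector [v] is there because the Favard constant normalizes exactly this
    average, so the volume of [A] becomes an integral over lines. *)
Lemma favard_lty_null (A : set V) : measurable A ->
  measurable_fun setT (fun z : V * V => line_count A z.1 z.2 : \bar R) ->
  crofton (fun x s => line_count A x s * (slab s x)%:R%:E) < +oo -> lebV A = 0.
Proof.
move=> mA mLA fin; have [v v1] := sphere_enorm.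
have mpsi : measurable_fun [set: V] (fun x => (\1_A x)%:E : \bar R).
  by apply/measurable_EFinP; exact: measurable_indic.
have psi0 (x : V) : 0 <= (\1_A x)%:E :> \bar R by rewrite lee_fin indicE ler0n.
have := favard_cst_sphere_integral lebV (measurable_cst v) mpsi psi0.
under [RHS]eq_integral do rewrite /= v1 mule1.
rewrite integral_indic// setIT => <-.
pose rho (x s : V) : \bar R := (\1_A x)%:E * (`|dotp v s|)%:E.
have mr : measurable_fun setT (fun z : V * V => rho z.1 z.2).
  apply: emeasurable_funM; first exact: (measurableT_comp mpsi measurable_fst).
  apply/measurable_EFinP; apply: measurableT_comp => //; apply: measurable_dotp; last exact: measurable_snd.
  exact: measurable_cst.
have r0 x s : 0 <= rho x s by rewrite mule_ge0// lee_fin.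
rewrite -/(crofton rho) -crofton_shift//.
rewrite (@eq_crofton_finite (fun x s => line_count A x s * (slab s x)%:R%:E) _ (fun _ _ => 0)) //.
- by rewrite /crofton integral0_eq ?mule0// => s _; exact: integral0_eq.
- apply: emeasurable_funM => //; exact: measurable_slab.
- by move=> x s; rewrite mule_ge0 ?line_count_ge0// lee_fin ler0n.
- by move=> x s; rewrite mule_ge0 ?lee_fin ?ler0n//; apply: integral_ge0.
move=> x s s1; case: (slab s x); last by rewrite mul0e.
rewrite mule1 mul1e /line_count /counting; case: ifPn => [/asboolP fA _|]; last by rewrite ltxx.
have fA0 : lebesgue_measure [set t : R | A (x + t *: s)%R] = 0.
  by apply: countable_lebesgue_measure0; exact: finite_set_countable.
have mfA : measurable ([set t : R | A (x + t *: s)%R] : set (measurableTypeR R)).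
  exact: countable_measurable (finite_set_countable fA).
transitivity (\int[@lebesgue_measure R]_(t in setT) (cst 0 t : \bar R)); last by rewrite integral0.
apply: (eq_integral_off_null mfA fA0) => // t At.
by rewrite /rho indicE memNset ?mul0e.
Qed.

End sphere_fubini.

(** * Zeros of a smooth Gaussian field *)

Section lines.
Context (R : realType) (n : nat).
Local Notation V := 'rV[R]_n.+1.
Implicit Types (f : V -> R) (F : set V).

Lemma is_derive_line f (x s : V) (t l : R) : is_derive (x + t *: s) s (f : V -> R^o) l ->
  is_derive t 1 (fun u => f (x + u *: s)) l.
Proof.
have E : (fun h : R => h^-1 *: (((fun u => f (x + u *: s)) \o shift t) (h *: 1) - f (x + t *: s)) : R^o) =
    (fun h : R => h^-1 *: (((f : V -> R^o) \o shift (x + t *: s)) (h *: s) - f (x + t *: s))).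
  apply/funext => h /=; congr (_ *: (f _ - _)).
  by apply/rowP => i; rewrite /GRing.scale/= !mxE; ring.
move=> [df dl]; apply: DeriveDef.
  by rewrite /derivable E.
by rewrite -dl /derive E.
Qed.

Lemma is_derive_of_line f (y v : V) (l : R) : is_derive (0 : R) (1 : R) (fun u => f (y + u *: v)) l ->
  is_derive y v (f : V -> R^o) l.
Proof.
have E : (fun h : R => h^-1 *: (((fun u => f (y + u *: v)) \o shift 0) (h *: 1) - f (y + 0 *: v)) : R^o) =
    (fun h : R => h^-1 *: (((f : V -> R^o) \o shift y) (h *: v) - f y)).
  apply/funext => h /=; congr (_ *: (f _ - f _)); apply/rowP => i; rewrite /GRing.scale/= !mxE; ring.
move=> [df dl]; apply: DeriveDef.
  by rewrite /derivable -E.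
by rewrite -dl /derive -E.
Qed.

Lemma derive_dotp f (y v : V) : differentiable (f : V -> R^o) y ->
  'D_v (f : V -> R^o) y = dotp (grad f y) v.
Proof.
move=> df; rewrite deriveE// {1}[v]row_sum_delta linear_sum /dotp.
by apply: eq_bigr => i _; rewrite linearZ mxE deriveE// /GRing.scale/= mulrC.
Qed.

Lemma line_interior_open F (x s : V) : open [set t : R | F° (x + t *: s)].
Proof.
apply: (@open_comp _ _ (fun t : R => x + t *: s) F°); last exact: open_interior.
move=> t _; apply: cvgD; first exact: cvg_cst.
exact: scalel_continuous.
Qed.

Lemma compact_norm_le F : compact F -> exists B : R, forall x, F x -> `|x| <= B.
Proof.
move=> /compact_bounded [M [_ HM]]; exists (M + 1) => x Fx.
by apply: (HM (M + 1)) => //; rewrite ltrDl.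
Qed.

Lemma line_interior_lty F (x s : V) : compact F -> s != 0 ->
  (@lebesgue_measure R [set t : R | F° (x + t *: s)%R] < +oo)%E.
Proof.
move=> /compact_norm_le[B HB] s0; have sp : 0 < `|s| by rewrite normr_gt0.
pose C := (B + `|x|) / `|s|.
apply: (@le_lt_trans _ _ (@lebesgue_measure R [set` `[- C, C]])); last first.
  by rewrite lebesgue_measure_itv/=; case: ifP => // _; rewrite -EFinB ltry.
apply: le_outer_measure => t /interior_subset/HB h; rewrite /= in_itv/= -ler_norml.
rewrite ler_pdivlMr// -normrZ.
have -> : t *: s = (x + t *: s) - x by rewrite addrC addKr.
by apply: le_trans (ler_normB _ _) _; rewrite lerD2r.
Qed.

Lemma dotp_delta (u : V) i : dotp u (delta_mx ord0 i) = u ord0 i.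
Proof.
rewrite /dotp (bigD1 i)//= big1 => [|j ji]; first by rewrite mxE !eqxx mulr1 addr0.
by rewrite mxE (negbTE ji) andbF mulr0.
Qed.

Lemma dotp_sum_delta (u v : V) : dotp u v = \sum_i v ord0 i * u ord0 i.
Proof. by apply: eq_bigr => i _; rewrite mulrC. Qed.

End lines.

Section closed_line_count.
Context (R : realType) (n : nat).
Local Notation V := 'rV[R]_n.+1.

(** The points of [F] are the zeros on [F] of the null function. *)
Lemma measurable_line_count_closed (F : set V) : closed F ->
  measurable_fun setT (fun z : V * V => line_count F z.1 z.2 : \bar R).
Proof.
move=> cF; pose z0 (u x : V) : R := 0.
have mz x : F x -> measurable_fun setT (z0^~ x) by move=> _; exact: measurable_cst.
have cz u : {within F, continuous (z0 u)}.
  by apply: continuous_subspaceT => x; exact: cst_continuous.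
have h := measurable_line_count cF mz cz.
have E u : [set x | F x /\ z0 u x = 0] = F by apply/seteqP; split => x /=; [case|].
rewrite (_ : (fun z => _) = (fun z => line_count [set x | F x /\ z0 (0 : V) x = 0] z.1 z.2)); last by rewrite E.
exact: (measurableT_comp h (@measurable_pair1 _ _ _ _ (0 : V))).
Qed.

End closed_line_count.

Section negligible_finite.
Context d (T : measurableType d) (R : realType) (mu : {measure set T -> \bar R}).

Lemma negligible_finite_bigcup (I : choiceType) (Z : set I) (A : I -> set T) : finite_set Z ->
  (forall t, Z t -> mu.-negligible (A t)) -> mu.-negligible (\bigcup_(t in Z) A t).
Proof.
move=> fZ nA; pose s := enum_fset (fset_set Z).
have sZ t : t \in s -> Z t by move=> ts; move: (ts : t \in fset_set Z); rewrite in_fset_set// inE.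
pose B k := if s is t0 :: _ then (if (k < size s)%N then A (nth t0 s k) else set0) else set0.
apply: (@negligibleS _ _ _ _ (\bigcup_k B k)).
  move=> w [t Zt Aw].
  have ts : t \in s by have : t \in fset_set Z by rewrite in_fset_set// inE.
  exists (index t s) => //; rewrite /B.
  case Es : s => [|t0 s']; first by rewrite Es in ts.
  by rewrite -Es index_mem ts nth_index.
apply: negligible_bigcup => k; rewrite /B.
case Es : s => [|t0 s']; first exact: negligible_set0.
rewrite -Es; case: ifPn => [ks|_]; last exact: negligible_set0.
by apply/nA/sZ/mem_nth.
Qed.

End negligible_finite.

Section gaussian_no_atom.
Context d (T : measurableType d) (R : realType) (P : probability T R).
Local Open Scope ereal_scope.

Lemma gaussian_eq0_null (X : T -> R) : gaussian_rv P X -> (0 < sd P X)%R ->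
  P.-negligible [set w | X w = 0%R].
Proof.
move=> gX s0; have [mX _] := gX.
have m0 : measurable [set w | X w = 0%R].
  by have := mX measurableT [set 0%R] (measurable_set1 _); rewrite setTI.
exists [set w | X w = 0%R]; split => //.
apply/eqP; rewrite eq_le measure_ge0 andbT; apply/lee_addgt0Pr => c c0; rewrite add0e.
have cs : (0 <= c * sd P X)%R by rewrite mulr_ge0// ltW.
have := gaussian_small_ball gX s0 cs; rewrite mulfK ?gt_eqF// => h.
apply: le_trans h; apply: le_measure; rewrite ?inE//.
  by apply: measurable_ltset; [exact: measurableT_comp|exact: measurable_cst].
by move=> w /= ->; rewrite normr0 mulr_gt0.
Qed.

End gaussian_no_atom.

Section fcov_linear.
Context d (T : measurableType d) (R : realType) (P : probability T R).
Local Open Scope ereal_scope.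

Lemma fcov_lin (p q : R) (U X Y : T -> R) : U \in Lfun P 2%:E -> X \in Lfun P 2%:E -> Y \in Lfun P 2%:E ->
  fcov P U (fun w => p * X w + q * Y w)%R = (p * fcov P U X + q * fcov P U Y)%R.
Proof.
move=> U2 X2 Y2.
have Z2 (c : R) (Z : T -> R) : Z \in Lfun P 2%:E -> (c \o* Z)%R \in Lfun P 2%:E.
  move=> hZ; rewrite (_ : (c \o* Z)%R = fun w => c * Z w + 0 * Z w)%R; first exact: Lfun2_lin.
  by apply/funext => w /=; ring.
have cf (Z : T -> R) : Z \in Lfun P 2%:E -> covariance P U Z \is a fin_num.
  by move=> hZ; apply: covariance_fin_num; [exact: Lfun21|exact: Lfun21|exact: Lfun2_mul_Lfun1].
have -> : (fun w => p * X w + q * Y w)%R = ((p \o* X) \+ (q \o* Y))%R.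
  by apply/funext => w /=; rewrite mulrC [(q * _)%R]mulrC.
rewrite /fcov covarianceDr//; [|exact: Z2|exact: Z2].
rewrite !covarianceZr//; try exact: Lfun21; try exact: Lfun2_mul_Lfun1.
by rewrite -(fineK (cf X X2)) -(fineK (cf Y Y2)) -!EFinM -EFinD.
Qed.

Lemma fcov_sum (I : Type) (r : seq I) (c : I -> R) (U : T -> R) (X : I -> T -> R) :
  U \in Lfun P 2%:E -> (forall i, X i \in Lfun P 2%:E) ->
  (fun w => \sum_(i <- r) c i * X i w)%R \in Lfun P 2%:E /\
  fcov P U (fun w => \sum_(i <- r) c i * X i w)%R = (\sum_(i <- r) c i * fcov P U (X i))%R.
Proof.
move=> U2 X2; elim: r => [|i r [IH1 IH2]].
  have E : (fun w => \sum_(i <- [::]) c i * X i w)%R = (fun w => 0 * U w + 0 * U w)%R.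
    by apply/funext => w; rewrite big_nil !mul0r addr0.
  by rewrite E big_nil; split; [exact: Lfun2_lin|rewrite fcov_lin// !mul0r addr0].
have E : (fun w => \sum_(j <- i :: r) c j * X j w)%R =
    (fun w => c i * X i w + 1 * \sum_(j <- r) c j * X j w)%R.
  by apply/funext => w; rewrite big_cons mul1r.
by rewrite E big_cons; split; [exact: Lfun2_lin|rewrite fcov_lin// IH2 mul1r].
Qed.

End fcov_linear.

Section smooth_field.
Context d (T : measurableType d) (R : realType) (P : probability T R) (n : nat).
Local Notation V := 'rV[R]_n.+1.
Local Notation lebV := (lebesgue_rV R n.+1).
Local Open Scope ereal_scope.

Variables (H : set (T -> R)) (F : set V) (g : T -> V -> R).
Hypothesis gH : forall X, H X -> gaussian_rv P X.
Hypothesis linH : forall a b X Y, H X -> H Y -> H (fun w => a * X w + b * Y w)%R.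
Hypothesis cptF : compact F.
Hypothesis Hg : forall x, F x -> H (g^~ x).
Hypothesis cg : forall w, {within F, continuous (g w)}.
Hypothesis dg : forall w x v, F° x -> is_derive x v (g w : V -> R^o) (dotp (grad (g w) x) v).
Hypothesis bD : forall w, exists M : R, forall x i, F° x -> (`|grad (g w) x ord0 i| <= M)%R.
Hypothesis g_off : forall w x, ~ F x -> g w x = 0%R.
Hypothesis sd_pos : forall x, F x -> (0 < sd P (g^~ x))%R.

Let sg x := sd P (g^~ x).
Let mg x := mean P (g^~ x).

Let closedF : closed F.
Proof. by apply: compact_closed => //; exact: norm_hausdorff. Qed.

Let bg w : exists M : R, forall x, F x -> (`|g w x| <= M)%R.
Proof.
have /compact_bounded[M [_ HM]] := continuous_compact (@cg w) cptF.
by exists (M + 1)%R => x Fx; apply: (HM (M + 1)%R); [rewrite ltrDl|exists x].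
Qed.

(** By contradiction along a sequence, since convergence of variances is sequential. Continuity
    provides a positive lower bound of the standard deviation on the compact [F]. *)
Let sg_cont : {within F, continuous sg}.
Proof.
apply/subspace_continuousP => x Fx; apply/cvgrPdist_le => e e0; apply: contrapT => nN.
have /choice[y Hy] : forall k : nat, exists y, [/\ F y, (`|x - y| < k.+1%:R^-1)%R & ~ (`|sg x - sg y| <= e)%R].
  move=> k; apply: contrapT => /forallNP nk; apply: nN.
  have k0 : (0 < k.+1%:R^-1 :> R)%R by [].
  rewrite /prop_near1 /within/= -nbhs_ballE; exists k.+1%:R^-1%R => //= z xz Fz.
  apply: contrapT => nle; apply: (nk z); split => //.
  by rewrite -ball_normE in xz.
have gy w : (g w (y k) @[k --> \oo] --> g w x)%R.
  apply/cvgrPdist_lt => r r0; have [q q0 Hq] := within_continuous_real (@cg w) Fx r0.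
  near=> k; have [Fy xy _] := Hy k; apply: Hq => //; apply: lt_trans xy _.
  by near: k; exact: (near_infty_natSinv_lt (PosNum q0)).
have gl z : F z -> glim H (g^~ z) by move=> Fz; apply: glimW; exact: Hg.
have s2 := sd_sqr_cvg gH linH (fun k => let: And3 Fy _ _ := Hy k in gl _ Fy) (gl x Fx) gy.
have s1 : (sg (y k) @[k --> \oo] --> sg x)%R.
  have sE z : sg z = Num.sqrt (sd P (g^~ z) ^+ 2)%R by rewrite sqrtr_sqr ger0_norm// sd_ge0.
  rewrite sE; under eq_fun do rewrite sE.
  by apply: continuous_cvg => //; exact: sqrt_continuous.
move/cvgrPdist_le : s1 => /(_ _ e0)[K _ /(_ K (leqnn K)) /= hK].
by have [_ _] := Hy K; apply.
Unshelve. all: by end_near. Qed.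

Let sg_min : exists2 e : R, (0 < e)%R & forall x, F x -> (e <= sg x)%R.
Proof.
have [F0|/set0P Fn0] := eqVneq F set0.
  by exists 1%R => // x; rewrite F0.
have [c] := compact_EVT_min Fn0 cptF sg_cont; rewrite inE => Fc Hc.
exists (sg c); first exact: sd_pos.
by move=> x Fx; apply: Hc; rewrite inE.
Qed.

Let mgj : measurable_fun [set: T * V] (fun z => g z.1 z.2).
Proof.
apply: measurable_caratheodory closedF _ (@cg) g_off.
by move=> x Fx; have [] := gH (Hg Fx).
Qed.

Let interior_line_g w y v t : F° (y + t *: v)%R ->
  is_derive t 1%R (fun u => g w (y + u *: v)%R) (dotp (grad (g w) (y + t *: v)%R) v).
Proof.
by move=> Ft; apply: is_derive_line; exact: dg.
Qed.

Let inF x : F° x -> F x. Proof. exact: interior_subset. Qed.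

Let glim_dir y v : F° y -> glim H (fun w => dotp (grad (g w) y) v).
Proof.
move=> Fy; have E : (y + 0 *: v = y)%R by rewrite scale0r addr0.
have := @glim_derive _ _ _ H linH _ (fun w t => g w (y + t *: v)%R)
  (fun w t => dotp (grad (g w) (y + t *: v)%R) v) (@line_interior_open R n F y v)
  (fun t Ft => Hg (inF Ft)) (fun w t Ft => @interior_line_g w y v t Ft) 0%R.
have S0 : [set t : R | F° (y + t *: v)%R] 0%R by rewrite /= E.
by move=> /(_ S0); rewrite E.
Qed.

Definition norm_field w x : R := (g w x / sd P (g^~ x))%R.

(** The quotient rule for [g / sg], the derivative of [sg] in the direction [v] being the covariance
    of [g] and its directional derivative, divided by [sg]. *)
Definition dir_deriv w y v : R :=
  (dotp (grad (g w) y) v / sg y -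
   g w y * (fcov P (g^~ y) (fun w => dotp (grad (g w) y) v) / sg y) / sg y ^+ 2)%R.

Let is_derive_norm_field w y v : F° y ->
  is_derive y v (norm_field w : V -> R^o) (dir_deriv w y v).
Proof.
move=> Fy; have E : (y + 0 *: v = y)%R by rewrite scale0r addr0.
apply: is_derive_of_line.
have S0 : [set t : R | F° (y + t *: v)%R] 0%R by rewrite /= E.
have ds := @is_derive_sd _ _ _ P H gH linH _ (fun w t => g w (y + t *: v)%R)
  (fun w t => dotp (grad (g w) (y + t *: v)%R) v) (@line_interior_open R n F y v)
  (fun t Ft => Hg (inF Ft)) (fun w t Ft => @interior_line_g w y v t Ft) (fun t Ft => sd_pos (inF Ft)) 0%R S0.
have dgl := @interior_line_g w y v 0%R S0.
have n0 : sd P (g^~ (y + 0 *: v)%R) != 0%R by rewrite gt_eqF// E; exact/sd_pos/inF.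
have := is_derive_quotient dgl ds n0; rewrite /dir_deriv /sg !E; exact.
Qed.

Let gL2 x : F x -> g^~ x \in Lfun P 2%:E.
Proof. by move=> Fx; exact/gaussian_Lfun2/gH/Hg. Qed.

(** Only directional derivatives of the normalized field are available. That they are given by the
    gradient follows from the linearity of the covariance in the derivative of [g]. *)
Let dir_deriv_dotp w y v : F° y -> dir_deriv w y v = dotp (grad (norm_field w) y) v.
Proof.
move=> Fy; rewrite dotp_sum_delta.
have gE i : grad (norm_field w) y ord0 i = dir_deriv w y (delta_mx ord0 i).
  by rewrite mxE; have [_ ->] := is_derive_norm_field w (delta_mx ord0 i) Fy.
under eq_bigr do rewrite gE.
have L2 i : (fun w => grad (g w) y ord0 i) \in Lfun P 2%:E.
  have := glim_Lfun2 gH (glim_dir (delta_mx ord0 i) Fy).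
  by under eq_fun do rewrite dotp_delta.
have [_ fs] := fcov_sum (index_enum _) (fun i => v ord0 i) (gL2 (inF Fy)) L2.
rewrite /dir_deriv.
have -> : (fun w => dotp (grad (g w) y) v) = (fun w => \sum_i v ord0 i * grad (g w) y ord0 i)%R.
  by apply/funext => u; rewrite dotp_sum_delta.
rewrite fs dotp_sum_delta !(mulr_suml, mulr_sumr) -sumrB; apply: eq_bigr => i _.
have -> : (fun w => dotp (grad (g w) y) (delta_mx ord0 i)) = (fun w => grad (g w) y ord0 i).
  by apply/funext => u; rewrite dotp_delta.
rewrite dotp_delta; ring.
Qed.

Let g_off0 x : ~ F x -> g^~ x = cst 0%R.
Proof. by move=> nF; apply/funext => w; exact: g_off. Qed.

Let gL2all x : g^~ x \in Lfun P 2%:E.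
Proof.
have [/gL2//|nF] := pselect (F x); rewrite (g_off0 nF); apply: Lfun2P; first exact: measurable_cst.
by rewrite integral0_eq// => w _; rewrite /= expr0n.
Qed.

Let m_mg : measurable_fun setT mg.
Proof.
pose f z : \bar R := (g z.1 z.2)%:E.
have mf : measurable_fun [set: T * V] f by exact/measurable_EFinP.
have -> : mg = (fun x => fine ((\int[P]_w f^\+ (w, x)) - (\int[P]_w f^\- (w, x)))).
  apply/funext => x; rewrite /mg /mean unlock integralE; congr (fine (_ - _)).
  - by apply: eq_integral => w _; rewrite !funeposE.
  - by apply: eq_integral => w _; rewrite !funenegE.
apply: measurableT_comp => //; apply: emeasurable_funB.
  by apply: (@measurable_fun_fubini_tonelli_G _ _ _ _ R P _ (measurable_funepos mf)) => z.
by apply: (@measurable_fun_fubini_tonelli_G _ _ _ _ R P _ (measurable_funeneg mf)) => z.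
Qed.

Let m_sg : measurable_fun setT sg.
Proof.
have -> : sg = (fun x => Num.sqrt (fine (\int[P]_w (g w x ^+ 2)%:E) - mg x ^+ 2))%R.
  apply/funext => x; rewrite (Lfun2_sqrE (gL2all x)) addrAC subrr add0r.
  by rewrite sqrtr_sqr ger0_norm// sd_ge0.
apply: (measurableT_comp (f := @Num.sqrt R)).
  exact: (continuous_measurable_fun (@sqrt_continuous R)).
apply: measurable_funB; last exact: measurable_funX.
apply: measurableT_comp => //.
have mf : measurable_fun [set: T * V] (fun z => (g z.1 z.2 ^+ 2)%:E).
  by apply/measurable_EFinP; exact: measurable_funX.
by apply: (@measurable_fun_fubini_tonelli_G _ _ _ _ R P _ mf) => z; rewrite lee_fin sqr_ge0.
Qed.

Let m_sgV : measurable_fun setT (fun x => (sg x)^-1%R).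
Proof.
rewrite (_ : (fun _ => _) = (@powR R ^~ (-1)%R) \o sg).
  by apply: measurableT_comp => //; exact: measurable_powR.
by apply/funext => v /=; rewrite powR_inv1// sd_ge0.
Qed.

Let m_norm_field : measurable_fun [set: T * V] (fun z => norm_field z.1 z.2).
Proof. by apply: measurable_funM => //; exact: (measurableT_comp m_sgV measurable_snd). Qed.

Definition norm_grad w x : V := if `[< F° x >] then grad (norm_field w) x else 0%R.

Let m_intF : measurable F°.
Proof. by apply: open_measurable_rV; exact: open_interior. Qed.

(** Each coordinate is a limit of difference quotients. They are jointly measurable because
    [norm_field] is so on the whole space, being 0 off [F]; the factor [b] cuts down to the interior
    before the limit is taken. *)
Let m_norm_grad : measurable_fun [set: T * V] (fun z => norm_grad z.1 z.2).
Proof.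
apply: measurable_fun_rV => i.
pose e : V := delta_mx ord0 i.
pose b (x : V) : R := `[< F° x >]%:R%R.
have mb : measurable_fun setT b.
  apply: measurable_natr_bool; apply: (measurable_fun_bool true); rewrite setTI.
  by have := m_intF; congr measurable; apply/seteqP; split => x /=; [move=> h; apply/asboolP|move=> /asboolP].
pose q k (z : T * V) := (b z.2 * (k.+1%:R * (norm_field z.1 (z.2 + k.+1%:R^-1 *: e) - norm_field z.1 z.2)))%R.
apply: (@measurable_fun_cvg _ _ _ _ q) => [k|[w x] _].
  apply: measurable_funM; first exact: (measurableT_comp mb measurable_snd).
  apply: measurable_funM; first exact: measurable_cst.
  apply: measurable_funB => //.
  have sh : measurable_fun [set: T * V] (fun z => (z.1, (z.2 + k.+1%:R^-1 *: e)%R)).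
    apply: measurable_fun_pair; first exact: measurable_fst.
    exact: (measurableT_comp (measurable_addrV _) measurable_snd).
  exact: (measurableT_comp m_norm_field sh).
rewrite /q /b /norm_grad /=; case: asboolP => [Fx|nF]; last first.
  by rewrite mxE; under eq_fun do rewrite mul0r; exact: cvg_cst.
have E : (x + 0 *: e = x)%R by rewrite scale0r addr0.
have := is_derive_norm_field w e Fx; rewrite dir_deriv_dotp// dotp_delta -{1}E => /is_derive_line/is_derive_seq.
by rewrite E; under eq_fun do rewrite add0r; under [X in _ -> X @ _ --> _]eq_fun do rewrite mul1r.
Qed.

(** In the interior of [F], the density at 0 of the law of [g x] divided by its standard
    deviation. *)
Definition zero_density x : \bar R :=
  if `[< F° x >] then (std_pdf (mean P (g^~ x) / sd P (g^~ x)))%:E else 0.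

Let m_zero_density : measurable_fun setT zero_density.
Proof.
pose b (x : V) : R := `[< F° x >]%:R%R.
have mb : measurable_fun setT b.
  apply: measurable_natr_bool; apply: (measurable_fun_bool true); rewrite setTI.
  by have := m_intF; congr measurable; apply/seteqP; split => x /=; [move=> h; apply/asboolP|move=> /asboolP].
have -> : zero_density = (fun x => (b x * std_pdf (mg x * (sg x)^-1))%:E).
  by apply/funext => x; rewrite /zero_density /b; case: asboolP => _; rewrite ?mul1r ?mul0r.
apply/measurable_EFinP; apply: measurable_funM => //.
by apply: measurableT_comp; [exact: measurable_std_pdf|exact: measurable_funM].
Qed.

Let zero_density_ge0 x : 0 <= zero_density x.
Proof. by rewrite /zero_density; case: ifP => // _; rewrite lee_fin std_pdf_ge0. Qed.

Let rho x s := zero_density x * \int[P]_w (`|dotp (norm_grad w x) s|%R)%:E.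

(** [rice] is applied on the trace of the interior of [F], an open set of finite length because [F]
    is bounded and [s] is not 0. *)
Let rice_line x s : enorm s = 1%R -> finite_set [set t : R | boundary F (x + t *: s)%R] ->
  \int[P]_w line_count [set y | F y /\ g w y = 0%R] x s =
  \int[@lebesgue_measure R]_t rho (x + t *: s)%R s.
Proof.
move=> s1 fB; have s0 := sphere_neq0 s1.
pose S := [set t : R | F° (x + t *: s)%R].
have [e e0 He] := sg_min.
have FS t : S t -> F (x + t *: s)%R by move=> /inF.
have Sbd t : F (x + t *: s)%R -> ~ S t -> boundary F (x + t *: s)%R.
  by move=> Ft nS; split => //; exact: subset_closure.
have ml : measurable_fun [set: T * measurableTypeR R] (fun z => g z.1 (x + z.2 *: s)%R).
  have sh : measurable_fun [set: T * measurableTypeR R] (fun z => (z.1, (x + z.2 *: s)%R) : T * V).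
    apply: measurable_fun_pair; first exact: measurable_fst.
    apply: measurable_fun_rV => i; under eq_fun do rewrite !mxE.
    apply: measurable_funD; first exact: measurable_cst.
    by apply: measurable_funM; [exact: measurable_snd|exact: measurable_cst].
  exact: (measurableT_comp mgj sh).
have h := @rice _ _ _ P H gH linH S (fun w t => g w (x + t *: s)%R)
  (fun w t => dotp (grad (g w) (x + t *: s)%R) s) e (@line_interior_open R n F x s)
  (@line_interior_lty R n F x s cptF s0) ml (fun t St => Hg (FS t St)) (fun w t St => @interior_line_g w x s t St) _ _ e0
  (fun t St => He _ (FS t St)).
transitivity (\int[P]_w counting [set t | S t /\ g w (x + t *: s)%R = 0%R]).
  (* The remaining points of the line in [F] are boundary points, finite in number, and at each the
     value is a nondegenerate Gaussian variable, hence almost surely nonzero. *)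
  have nN : P.-negligible (\bigcup_(t in [set t : R | boundary F (x + t *: s)%R /\ F (x + t *: s)%R]) [set w | g w (x + t *: s)%R = 0%R]).
    apply: negligible_finite_bigcup; first by apply: sub_finite_set fB => t [].
    by move=> t [_ Ft]; apply: gaussian_eq0_null; [exact/gH/Hg|exact: sd_pos].
  have [N [mN N0 sN]] := nN.
  apply: (eq_integral_off_null mN N0) => [w|w|w Nw].
  - exact: line_count_ge0.
  - by have := @line_count_ge0 R n.+1 [set y | F° y /\ g w y = 0%R] x s.
  congr counting; apply/seteqP; split => t /= [Ft gt0]; split => //; last exact: FS.
  by apply: contrapT => nS; apply: Nw; apply: sN; exists t => //; split => //; exact: Sbd.
rewrite h; last 2 first.
- by move=> w; have [M HM] := bg w; exists M => t /FS/HM.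
- move=> w; have [M HM] := bD w; exists (\sum_(i < n.+1) `|M| * `|s ord0 i|)%R => t St.
  apply: le_trans (ler_norm_sum _ _ _) _; apply: ler_sum => i _; rewrite normrM ler_wpM2r//.
  by apply: le_trans (HM _ i St) (ler_norm _).
rewrite integral_mkcond; apply: eq_integral => t _; rewrite patchE /rho /zero_density.
have [St|nS] := pselect (S t).
  rewrite mem_set// asboolT//; congr (_ * _); apply: eq_integral => w _.
  by rewrite /norm_grad asboolT// -dir_deriv_dotp.
by rewrite memNset// asboolF// mul0e.
Qed.

Lemma measurable_zero_integrand :
  measurable_fun setT (fun x => zero_density x * \int[P]_w (enorm (norm_grad w x))%:E).
Proof.
have mne : measurable_fun [set: T * V] (fun z => (enorm (norm_grad z.1 z.2))%:E).
  by apply/measurable_EFinP; exact: (measurableT_comp (@measurable_enorm R n.+1) m_norm_grad).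
apply: emeasurable_funM => //.
by apply: (@measurable_fun_fubini_tonelli_G _ _ _ _ R P _ mne) => z; rewrite lee_fin enorm_ge0.
Qed.

Lemma integral_favard_zeros : favard (boundary F) < +oo ->
  \int[P]_w favard [set x | F x /\ g w x = 0%R] =
  \int[lebV]_x (zero_density x * \int[P]_w (enorm (norm_grad w x))%:E).
Proof.
move=> bfin.
have clB : closed (boundary F).
  by apply: closedI; [exact: closed_closure|apply: open_closedC; exact: open_interior].
have mLB := measurable_line_count_closed clB.
have mLA : measurable_fun [set: T * (V * V)] (fun y => line_count [set x | F x /\ g y.1 x = 0%R] y.2.1 y.2.2 : \bar R).
  by apply: (measurable_line_count closedF _ (@cg)) => x Fx; have [] := gH (Hg Fx).
have mslab : measurable_fun [set: V * V] (fun z => (slab z.2 z.1)%:R%:E : \bar R).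
  exact: measurable_slab.
have slab0 (s x : V) : 0 <= (slab s x)%:R%:E :> \bar R by rewrite lee_fin ler0n.
have mdot : measurable_fun [set: T * (V * V)] (fun z => (`|dotp (norm_grad z.1 z.2.1) z.2.2|%R)%:E).
  apply/measurable_EFinP; apply: measurableT_comp => //; apply: measurable_dotp.
    have sh : measurable_fun [set: T * (V * V)] (fun z => (z.1, z.2.1) : T * V).
      by apply: measurable_fun_pair; [exact: measurable_fst|exact: (measurableT_comp measurable_fst measurable_snd)].
    exact: (measurableT_comp m_norm_grad sh).
  exact: (measurableT_comp measurable_snd measurable_snd).
have mpsi3 : measurable_fun [set: T * (V * V)] (fun z => zero_density z.2.1).
  exact: (measurableT_comp m_zero_density (measurableT_comp measurable_fst measurable_snd)).
have rhoE x s : rho x s = \int[P]_w (zero_density x * (`|dotp (norm_grad w x) s|%R)%:E).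
  rewrite ge0_integralZl//.
  have sh : measurable_fun [set: T] (fun w => (w, (x, s)) : T * (V * V)) by exact: measurable_pair2.
  exact: (measurableT_comp mdot sh).
have mrho : measurable_fun [set: V * V] (fun z => rho z.1 z.2).
  apply: emeasurable_funM; first exact: (measurableT_comp m_zero_density measurable_fst).
  by apply: (@measurable_fun_fubini_tonelli_G _ _ _ _ R P _ mdot) => z; rewrite lee_fin.
have rho0 x s : 0 <= rho x s by rewrite mule_ge0//; apply: integral_ge0 => w _; rewrite lee_fin.
transitivity (\int[P]_w crofton (fun x s => line_count [set y | F y /\ g w y = 0%R] x s * (slab s x)%:R%:E)).
  apply: eq_integral => w _; rewrite favardE//.
  exact: (measurableT_comp mLA (@measurable_pair1 _ _ _ _ w)).
rewrite crofton_fubini; last 2 first.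
- apply: emeasurable_funM => //; exact: (measurableT_comp mslab measurable_snd).
- by move=> w x s; rewrite mule_ge0// line_count_ge0.
transitivity (crofton rho).
  rewrite -(crofton_shift mrho rho0).
  (* The comparison is confined to lines with finitely many boundary points, where [rice_line]
     holds. *)
  apply: (@eq_crofton_finite _ _ (fun x s => line_count (boundary F) x s * (slab s x)%:R%:E)).
  - exact: emeasurable_funM.
  - by move=> x s; rewrite mule_ge0// line_count_ge0.
  - by rewrite /crofton -favardE.
  - by move=> x s; apply: integral_ge0 => w _; rewrite mule_ge0// line_count_ge0.
  - by move=> x s; rewrite mule_ge0//; apply: integral_ge0.
  move=> x s s1; rewrite ge0_integralZr//; last first.
    have sh : measurable_fun [set: T] (fun w => (w, (x, s)) : T * (V * V)) by exact: measurable_pair2.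
    exact: (measurableT_comp mLA sh).
  case: (slab s x); last by rewrite !mule0 mul0e.
  rewrite !mule1 mul1e => fB; apply: rice_line => //.
  by move: fB; rewrite /line_count /counting; case: asboolP => // _; rewrite ltxx.
(* The expectation is moved outside again: for fixed [w] the gradient is a vector field, and the
   average over directions turns [|<v, s>|] into its norm. *)
transitivity (\int[P]_w crofton (fun x s => zero_density x * (`|dotp (norm_grad w x) s|%R)%:E)).
  rewrite crofton_fubini.
  - by congr crofton; apply/funext => x; apply/funext => s; exact: rhoE.
  - exact: emeasurable_funM.
  - by move=> w x s; rewrite mule_ge0// lee_fin.
have mng w : measurable_fun setT (norm_grad w).
  exact: (measurableT_comp m_norm_grad (@measurable_pair1 _ _ _ _ w)).
transitivity (\int[P]_w \int[lebV]_x (zero_density x * (enorm (norm_grad w x))%:E)).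
  by apply: eq_integral => w _; rewrite /crofton favard_cst_sphere_integral.
have mne : measurable_fun [set: T * V] (fun z => (enorm (norm_grad z.1 z.2))%:E).
  by apply/measurable_EFinP; exact: (measurableT_comp (@measurable_enorm R n.+1) m_norm_grad).
rewrite (@fubini_tonelli _ _ T V R P lebV (fun z => zero_density z.2 * (enorm (norm_grad z.1 z.2))%:E)); last 2 first.
- by apply: emeasurable_funM => //; exact: (measurableT_comp m_zero_density measurable_snd).
- by move=> z; rewrite mule_ge0// lee_fin enorm_ge0.
apply: eq_integral => x _ /=; rewrite ge0_integralZl//.
- exact: (measurableT_comp mne (@measurable_pair2 _ _ _ _ x)).
- by move=> w _; rewrite lee_fin enorm_ge0.
Qed.

End smooth_field.

(** * Modification of the field on a null set *)

Section off_null.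
Context d (T : measurableType d) (R : realType) (P : probability T R).
Local Open Scope ereal_scope.
Variable N : set T.
Hypothesis mN : measurable N.
Hypothesis N0 : P N = 0.

Lemma eq_signed_integral_off_null (f g : T -> \bar R) : (forall w, ~ N w -> f w = g w) ->
  \int[P]_w f w = \int[P]_w g w.
Proof.
move=> fg; rewrite integralE [RHS]integralE.
by congr (_ - _); apply: (eq_integral_off_null mN N0) => // w Nw; rewrite ?funeposE ?funenegE fg.
Qed.

Lemma eq_mean_off_null (X Y : T -> R) : (forall w, ~ N w -> X w = Y w) -> mean P X = mean P Y.
Proof.
move=> XY; rewrite /mean unlock; congr fine; apply: eq_signed_integral_off_null => w Nw.
by rewrite XY.
Qed.

Lemma eq_sd_off_null (X Y : T -> R) : (forall w, ~ N w -> X w = Y w) -> sd P X = sd P Y.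
Proof.
move=> XY; have EXY := eq_mean_off_null XY; rewrite /sd /variance; congr (Num.sqrt (fine _)).
rewrite unlock -/(mean P X) -/(mean P Y) EXY unlock.
by apply: eq_signed_integral_off_null => w Nw /=; rewrite !fctE /= XY.
Qed.

Lemma gaussian_rv_off_null (X Y : T -> R) : (forall w, ~ N w -> X w = Y w) ->
  measurable_fun setT X -> gaussian_rv P Y -> gaussian_rv P X.
Proof.
move=> XY mX [mY [m [s [s0 YE]]]]; split => //; exists m, s; split => // A mA.
rewrite -(YE A mA).
have mXA : measurable (X @^-1` A) by rewrite -[X in measurable X]setTI; exact: mX.
have mYA : measurable (Y @^-1` A) by rewrite -[X in measurable X]setTI; exact: mY.
rewrite -[X @^-1` A]setIT -[Y @^-1` A]setIT -!integral_indic//.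
apply: (eq_integral_off_null mN N0) => [w|w|w Nw].
- by rewrite lee_fin indicE ler0n.
- by rewrite lee_fin indicE ler0n.
- congr EFin; rewrite !indicE; congr (nat_of_bool _)%:R; apply/idP/idP; rewrite !inE /=; by rewrite XY.
Qed.

End off_null.

Lemma favard_ge0 (R : realType) n (A : set 'rV[R]_n.+1) : (0 <= favard A)%E.
Proof.
have c0 (S : choiceType) (B : set S) : (0 <= counting B :> \bar R)%E.
  by rewrite /counting; case: ifP => // _; rewrite lee_fin.
rewrite /favard; case: ifPn => // _; apply: mule_ge0; first by rewrite lee_fin ltW// favard_cst_gt0.
by apply: integral_ge0 => s _; apply: integral_ge0.
Qed.

Section modification.
Context d (T : measurableType d) (R : realType) (P : probability T R) (n : nat).
Local Notation V := 'rV[R]_n.+1.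
Local Open Scope ereal_scope.
Variables (F : set V) (G : T -> V -> R) (N : set T).
Hypothesis cptF : compact F.
Hypothesis gG : gaussian_field P F G.
Hypothesis mN : measurable N.
Hypothesis N0 : P N = 0.
Hypothesis C1G : forall w, ~ N w -> C1_on F (G w).

(** Zero on the exceptional null set, so that all paths are smooth, and zero off [F], so that joint
    measurability can be stated on the whole space. *)
Definition modified w x : R := if `[< ~ N w /\ F x >] then G w x else 0%R.
Local Notation g := modified.

Let gE w x : ~ N w -> F x -> g w x = G w x.
Proof. by move=> Nw Fx; rewrite /modified asboolT. Qed.

Let gN w x : N w -> g w x = 0%R.
Proof. by move=> Nw; rewrite /modified asboolF// => -[]. Qed.

Lemma modified_off w x : ~ F x -> g w x = 0%R.
Proof. by move=> nF; rewrite /modified asboolF// => -[]. Qed.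

Lemma near_modified w x : ~ N w -> F° x -> \forall y \near x, G w y = g w y.
Proof.
move=> Nw Fx; have : nbhs x F by exact: Fx.
by apply: filterS => y Fy; rewrite gE.
Qed.

Lemma modified_continuous w : {within F, continuous (g w)}.
Proof.
have [Nw|Nw] := pselect (N w).
  rewrite (_ : g w = fun=> 0%R); last by apply/funext => x; exact: gN.
  by apply: continuous_subspaceT => x; exact: cst_continuous.
have [cG _ _] := C1G Nw; apply: subspace_eq_continuous cG => x; rewrite inE => Fx.
by apply/esym; exact: gE.
Qed.

Let grad_modified w x : ~ N w -> F° x -> grad (g w) x = grad (G w) x.
Proof.
move=> Nw Fx; apply/rowP => i; rewrite !mxE; apply/esym; apply: near_eq_derive.
exact: near_modified.
Qed.

Let grad_modifiedN w x : N w -> grad (g w) x = 0%R.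
Proof.
move=> Nw; apply/rowP => i; rewrite !mxE.
by rewrite (_ : g w = cst 0%R) ?derive_cst//; apply/funext => y; exact: gN.
Qed.

Lemma modified_derive w x v : F° x -> is_derive x v (g w : V -> R^o) (dotp (grad (g w) x) v).
Proof.
move=> Fx; have [Nw|Nw] := pselect (N w).
  rewrite grad_modifiedN// (_ : g w = cst 0%R); last by apply/funext => y; exact: gN.
  rewrite (_ : dotp _ _ = 0%R); first exact: is_derive_cst.
  by rewrite /dotp big1// => i _; rewrite mxE mul0r.
rewrite grad_modified//; have [_ dG _] := C1G Nw.
apply: near_eq_is_derive (near_modified Nw Fx) _.
rewrite -derive_dotp; last exact: dG.
by apply: DeriveDef => //; apply: diff_derivable; exact: dG.
Qed.

Lemma modified_grad_bounded w : exists M : R, forall x i, F° x -> (`|grad (g w) x ord0 i| <= M)%R.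
Proof.
have [Nw|Nw] := pselect (N w).
  by exists 0%R => x i _; rewrite grad_modifiedN// mxE normr0.
have [_ _ [h [ch hE]]] := C1G Nw.
have /compact_bounded[M [_ HM]] := continuous_compact ch cptF.
exists (M + 1)%R => x i Fx; rewrite grad_modified// -hE//.
apply: le_trans (coord_le_norm _ _) _; apply: (HM (M + 1)%R); first by rewrite ltrDl.
by exists x => //; exact: interior_subset.
Qed.

(** The linear span of the values on [F]: it plays the part of the class [H], which must consist of
    Gaussian variables and be stable under linear combinations. *)
Definition modified_span : set (T -> R) := [set X | exists2 s : seq (R * V),
  (forall p, p \in s -> F p.2) & X = fun w => (\sum_(p <- s) p.1 * g w p.2)%R].

Lemma modified_in_span x : F x -> modified_span (g^~ x).
Proof.
move=> Fx; exists [:: (1%R, x)].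
  by move=> p; rewrite inE => /eqP ->.
by apply/funext => w; rewrite big_seq1 mul1r.
Qed.

Lemma modified_span_lin a b X Y : modified_span X -> modified_span Y ->
  modified_span (fun w => a * X w + b * Y w)%R.
Proof.
move=> [s sF ->] [t tF ->].
exists ([seq ((a * p.1)%R, p.2) | p <- s] ++ [seq ((b * p.1)%R, p.2) | p <- t]).
  by move=> p; rewrite mem_cat => /orP[] /mapP[q qs ->] /=; [exact: sF|exact: tF].
apply/funext => w; rewrite big_cat !big_map /= !mulr_sumr.
by congr (_ + _)%R; apply: eq_bigr => p _; rewrite mulrA.
Qed.

Lemma modified_span_gaussian X : modified_span X -> gaussian_rv P X.
Proof.
move=> [s sF ->].
pose x (i : 'I_(size s)) := (tnth (in_tuple s) i).2.
pose a (i : 'I_(size s)) := (tnth (in_tuple s) i).1.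
have Fx i : F (x i) by apply: sF; exact: mem_tnth.
have gY := gG a Fx; set Y := fun w => _ in gY.
have XY w : ~ N w -> (\sum_(p <- s) p.1 * g w p.2)%R = Y w.
  by move=> Nw; rewrite big_tnth; apply: eq_bigr => i _; rewrite -/(x i) gE.
have [mY _] := gY; apply: (gaussian_rv_off_null mN N0 XY) gY.
(* A modification on a null set preserves the law but has to be measurable; here it is the original
   combination times the indicator of a measurable set. *)
rewrite (_ : (fun w => _) = fun w => (\1_(~` N) w * Y w)%R); last first.
  apply/funext => w; rewrite indicE; have [Nw|Nw] := pselect (N w).
    by rewrite memNset ?mul0r; [rewrite big1// => p _; rewrite gN ?mulr0|exact].
  by rewrite mem_set// mul1r XY.
by apply: measurable_funM => //; apply: measurable_indic; exact: measurableC.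
Qed.

Lemma modified_mean x : F x -> mean P (g^~ x) = field_mean P G x.
Proof. by move=> Fx; apply: (eq_mean_off_null mN N0) => w Nw; rewrite gE. Qed.

Lemma modified_sd x : F x -> sd P (g^~ x) = field_sd P G x.
Proof. by move=> Fx; apply: (eq_sd_off_null mN N0) => w Nw; rewrite gE. Qed.

Lemma modified_norm_grad w x : ~ N w -> F° x ->
  norm_grad P F g w x = grad_on F (fun y => (G w y / field_sd P G y)%R) x.
Proof.
move=> Nw Fx; rewrite /norm_grad /grad_on !asboolT//.
apply/rowP => i; rewrite !mxE; apply: near_eq_derive.
have : nbhs x F by exact: Fx.
by apply: filterS => y Fy; rewrite /norm_field gE// modified_sd.
Qed.

End modification.

Local Open Scope ereal_scope.

Theorem theorem2 (R : realType) (n : nat) (d : measure_display)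
    (T : measurableType d) (P : probability T R)
    (F : set 'rV[R]_n.+1) (G : T -> 'rV[R]_n.+1 -> R) :
  let m := field_mean P G in
  let sigma := field_sd P G in
  let gradG (w : T) : 'rV[R]_n.+1 -> 'rV[R]_n.+1 :=
    grad_on F (fun y => (G w y / sigma y)%R) in
  compact F ->
  favard (boundary F) < +oo ->
  gaussian_field P F G ->
  {ae P, forall w, C1_on F (G w)} ->
  \int[P]_w favard [set x | F x /\ gradG w x = 0%R] < +oo ->
  (forall x, F x -> (0 < sigma x)%R) ->
  \int[P]_w favard [set x | F x /\ G w x = 0%R] =
  ((Num.sqrt (2 * pi))^-1)%:E *
    \int[lebesgue_rV R n.+1]_(x in F)
      ((expR (- (m x ^+ 2 / (2 * sigma x ^+ 2))))%:E *
       'E_P[fun w => enorm (gradG w x)]).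
Proof.
move=> m sigma gradG cptF bfin gG [N [mN N0 sN]] _ sigma0.
have C1G w : ~ N w -> C1_on F (G w) by move=> Nw; apply: contrapT => nC; apply: Nw; exact: sN.
pose g := modified F G N.
have cF : closed F by apply: compact_closed => //; exact: norm_hausdorff.
have sd0 x : F x -> (0 < sd P (g^~ x))%R by move=> Fx; rewrite modified_sd//; exact: sigma0.
have mz := measurable_zero_integrand (modified_span_gaussian gG mN N0) (@modified_span_lin _ _ _ _ F G N) cptF
  (@modified_in_span _ _ _ _ F G N) (modified_continuous C1G) (modified_derive C1G)
  (@modified_off _ _ _ _ F G N) sd0.
have main := integral_favard_zeros (modified_span_gaussian gG mN N0) (@modified_span_lin _ _ _ _ F G N) cptF
  (@modified_in_span _ _ _ _ F G N) (modified_continuous C1G) (modified_derive C1G)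
  (modified_grad_bounded cptF C1G) (@modified_off _ _ _ _ F G N) sd0 bfin.
have zdE x w : ~ N w -> F x -> g w x = G w x by move=> Nw Fx; rewrite /g /modified asboolT.
(* Off [N] the zero sets coincide, and this suffices even though the count for [G] may fail to be
   measurable. *)
transitivity (\int[P]_w favard [set x | F x /\ g w x = 0%R]).
  apply: (eq_integral_off_null mN N0) => [w|w|w Nw]; try exact: favard_ge0.
  congr favard; apply/seteqP; split => x [Fx]; rewrite ?zdE// => Gx; split => //.
  by rewrite zdE.
rewrite main.
pose K : R := ((Num.sqrt (2 * pi))^-1)%R.
have K0 : (0 < K)%R by rewrite invr_gt0 sqrtr_gt0 mulr_gt0// pi_gt0.
have z0 x : 0 <= zero_density P F g x * \int[P]_w (enorm (norm_grad P F g w x))%:E.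
  rewrite mule_ge0//; first by rewrite /zero_density; case: ifP => // _; rewrite lee_fin std_pdf_ge0.
  by apply: integral_ge0 => w _; rewrite lee_fin enorm_ge0.
(* [K] is the normalizing factor of [std_pdf]; inserting its inverse leaves the bare exponential in
   the integrand. *)
transitivity (K%:E * \int[lebesgue_rV R n.+1]_x ((K^-1)%:E *
    (zero_density P F g x * \int[P]_w (enorm (norm_grad P F g w x))%:E))).
  rewrite ge0_integralZl_EFin//; last by rewrite invr_ge0 ltW.
  by rewrite muleVK// gt_eqF.
congr (_ * _); rewrite [RHS]integral_mkcond.
have clB : closed (boundary F).
  by apply: closedI; [exact: closed_closure|apply: open_closedC; exact: open_interior].
have mB : measurable (boundary F) by exact: closed_measurable_rV.
have mLB := measurable_line_count_closed clB.
(* The two integrands are then compared only in the interior, where [grad_on] is the usual gradient,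
   and outside [F], where both vanish. *)
have B0 : lebesgue_rV R n.+1 (boundary F) = 0.
  by apply: favard_lty_null => //; rewrite /crofton -favardE.
apply: (eq_integral_off_null mB B0) => [x|x|x nB].
- by rewrite mule_ge0// lee_fin invr_ge0 ltW.
- rewrite patchE; case: ifP => // _; rewrite mule_ge0// ?lee_fin ?expR_ge0// unlock.
  by apply: integral_ge0 => w _; rewrite lee_fin enorm_ge0.
rewrite patchE /zero_density; have [Fx|nFx] := pselect (F x); last first.
  rewrite memNset// asboolF ?mul0e ?mule0//; by move=> /interior_subset.
have iFx : F° x by apply: contrapT => nF; apply: nB; split => //; exact: subset_closure.
rewrite mem_set// asboolT// modified_mean// modified_sd// -/(m x) -/(sigma x) muleA -EFinM.
congr (_%:E * _).
  rewrite /std_pdf -/K mulrA mulVf ?gt_eqF// mul1r; congr (expR (- _)).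
  by field; rewrite gt_eqF// sigma0.
rewrite unlock; apply: (eq_integral_off_null mN N0) => [w|w|w Nw].
- by rewrite lee_fin enorm_ge0.
- by rewrite lee_fin enorm_ge0.
- by rewrite modified_norm_grad.
Qed.
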